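(* Let $k\ge1$ and suppose $\beta\in\,]0,k\wedge2[$ or $k=1=\beta$. For $j=1,\dots,d$, let $\sigma_j:\mathbb{R}\times\mathbb{R}^k\to\mathbb{R}$ be continuous functions such that for all $T\in\mathbb{R}_+$ there are $0<c_T<C_T<\infty$ with $c_T\le\sigma_j(t,x)\le C_T$ for all $(t,x)\in[0,T]\times\mathbb{R}^k$. Let $\hat v=(\hat v(t,x),\,t\in\mathbb{R}_+,\,x\in\mathbb{R}^k)$ be the ($\mathbb{R}^d$-valued, continuous) mild solution of $$\frac{\partial}{\partial t}\hat v_j(t,x)=\Delta\hat v_j(t,x)+\sigma_j(t,x)\dot{\hat W}_j(t,x),\quad j=1,\dots,d,\qquad \hat v(0,x)=0,\ x\in\mathbb{R}^k.$$ Suppose that $d=(4+2k)/(2-\beta)$ and that, for each $j=1,\dots,d$, the following hold: (a) the Fourier transform $\mathcal{F}_{s,y}\sigma_j$ of $\sigma_j$ is a measure $\mu_j$ on $\mathbb{R}\times\mathbb{R}^k$ with finite total variation; (b) there is $c<\infty$ such that for all large $a$, $$\iint_{\mathbb{R}\times\mathbb{R}^k}|\mu_j|(dr,dz)\iint_{D_1(a)}d\tau\,d\xi\,|\xi|^{\beta-k}\,\frac{|\xi-z|^2}{|\xi-z|^4+|\tau-r|^2}\le c\,a^{2\gamma_2};$$ (c) there is $c<\infty$ such that for all large $b$, $$\iint_{\mathbb{R}\times\mathbb{R}^k}|\mu_j|(dr,dz)\iint_{D_2(b)}d\tau\,d\xi\,\frac{|\xi|^{\beta-k}}{|\xi-z|^4+|\tau-r|^2}\le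 c\,b^{-2}.$$ Here $\alpha_1=\frac{2-\beta}4$, $\alpha_2=\frac{2-\beta}2$, $\gamma_2=\alpha_2^{-1}-1=\frac{\beta}{2-\beta}$, $D_1(a)=\{(\tau,\xi)\in\mathbb{R}\times\mathbb{R}^k:\max(|\tau|^{\alpha_1},|\xi|^{\alpha_2})<a\}$ and $D_2(b)=\{(\tau,\xi):\max(|\tau|^{\alpha_1},|\xi|^{\alpha_2})>b\}$. Then points are polar for $\hat v$: for all $z\in\mathbb{R}^d$, $P\{\exists(t,x)\in\,]0,\infty[\,\times\mathbb{R}^k:\hat v(t,x)=z\}=0$.
   Context: Noise: $\hat W=(\hat W_1,\dots,\hat W_d)$ is a centered Gaussian family indexed by $C^\infty$ test functions with compact support on $\mathbb{R}\times\mathbb{R}^k$, with independent components, white in time. If $\beta\in\,]0,k\wedge2[$, it is spatially homogeneous with Riesz-kernel covariance: $E(\hat W_\ell(\varphi)\hat W_j(\psi))=\delta_{\ell,j}\int_{\mathbb{R}_+}dr\int_{\mathbb{R}^k}dy\int_{\mathbb{R}^k}dz\,\varphi(r,y)|y-z|^{-\beta}\psi(r,z)$. If $k=1=\beta$, it is space-time white noise: $E(\hat W_\ell(\varphi)\hat W_j(\psi))=\delta_{\ell,j}\int_{\mathbb{R}_+}dr\int_{\mathbb{R}}dy\,\varphi(r,y)\psi(r,y)$. Mild solution: $\hat v_j(t,x)=\int_0^t\int_{\mathbb{R}^k}G(t-s,x-y)\sigma_j(s,y)\,\hat W_j(ds,dy)$ (Wiener integral), with $G(t,x)=(4\pi t)^{-k/2}e^{-|x|^2/(4t)}$;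 so the components are independent centered Gaussian fields with covariance $$E[\hat v_j(t,x)\hat v_j(s,y)]=\int_0^{t\wedge s}dr\int_{\mathbb{R}^k}d\bar y\int_{\mathbb{R}^k}d\bar z\,G(t-r,x-\bar y)\sigma_j(r,\bar y)|\bar y-\bar z|^{-\beta}G(s-r,y-\bar z)\sigma_j(r,\bar z)$$ (if $k=1=\beta$: $\int_0^{t\wedge s}dr\int_{\mathbb{R}}d\bar y\,G(t-r,x-\bar y)G(s-r,y-\bar y)\sigma_j(r,\bar y)^2$). $\hat v$ denotes the version with continuous sample paths. $\mathcal{F}_{s,y}$ is the Fourier transform in the variables $(s,y)\in\mathbb{R}\times\mathbb{R}^k$, $\mathcal{F}_{s,y}\varphi(\tau,\xi)=\int\int e^{-i\tau s-i\xi\cdot y}\varphi(s,y)\,ds\,dy$, extended to tempered distributions; $|\mu_j|$ is the total variation measure of $\mu_j$. *)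

(* Defs.v *)
From HB Require Import structures.
From mathcomp Require Import all_boot all_order all_algebra.
From mathcomp Require Import all_classical all_reals all_analysis.
From mathcomp Require Import ring.

Set Implicit Arguments.
Unset Strict Implicit.
Unset Printing Implicit Defensive.

Import Order.TTheory GRing.Theory Num.Theory.
Import numFieldNormedType.Exports.

Local Open Scope classical_set_scope.
Local Open Scope ring_scope.

(* R^k is 'rV[R]_k. Its library topology comes from the sup norm, so the
   Euclidean norm enorm is defined separately below. Its sigma-algebra is the one
   generated by the coordinates, i.e. the Borel sigma-algebra; the library has
   this construction for tuples only. *)
Definition rV_display : measure_display.
Proof. exact. Qed.

Section measurable_rV.
Context {R : realType} (k : nat).

Let coors : 'I_k -> 'rV[R]_k -> R := fun i x => x ord0 i.

Let rV_set0 : g_sigma_preimage coors set0.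
Proof. exact: sigma_algebra0. Qed.

Let rV_setC A : g_sigma_preimage coors A -> g_sigma_preimage coors (~` A).
Proof. exact: sigma_algebraC. Qed.

Let rV_bigcup (F : (set 'rV[R]_k)^nat) :
  (forall i, g_sigma_preimage coors (F i)) ->
  g_sigma_preimage coors (\bigcup_i (F i)).
Proof. exact: sigma_algebra_bigcup. Qed.

HB.instance Definition _ := @isMeasurable.Build rV_display
  'rV[R]_k (g_sigma_preimage coors) rV_set0 rV_setC rV_bigcup.

End measurable_rV.

Lemma measurable_rV_coord {R : realType} k (i : 'I_k) :
  measurable_fun setT (fun x : 'rV[R]_k => x ord0 i).
Proof.
move=> _ Y mY; rewrite setTI; apply: sub_sigma_algebra => /=.
rewrite -bigcup_seq/=; exists i => /=; first by rewrite mem_index_enum.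
by exists Y => //; rewrite setTI.
Qed.

Lemma measurable_fun_rV {R : realType} d (T : measurableType d) k
    (f : T -> 'rV[R]_k) :
  (forall i, measurable_fun setT (fun x => f x ord0 i)) ->
  measurable_fun setT f.
Proof.
move=> mf.
suff prefS : g_sigma_preimage (fun i => (fun x : 'rV[R]_k => x ord0 i) \o f)
    `<=` measurable.
  move=> _ A mA; apply: prefS; rewrite g_sigma_preimage_comp.
  by exists A.
apply: smallest_sub; first exact: sigma_algebra_measurable.
case: k => [|k] in f mf *; first by rewrite big_ord0.
rewrite -bigcup_mkord_ord; apply: bigcup_sub => i Ii.
by move=> A [B mB <-]; exact: mf.
Qed.

Section lebesgue_rV.
Context {R : realType}.

Definition rV_cons k (p : measurableTypeR R * 'rV[R]_k) : 'rV[R]_k.+1 :=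
  \row_i oapp (p.2 ord0) p.1 (unlift ord0 i).

Let rV_uncons k (x : 'rV[R]_k.+1) : measurableTypeR R * 'rV[R]_k :=
  (x ord0 ord0, \row_j x ord0 (lift ord0 j)).

Let rV_consK k : cancel (@rV_cons k) (@rV_uncons k).
Proof.
move=> [t x]; rewrite /rV_uncons/= mxE unlift_none/=; congr pair.
by apply/rowP => j; rewrite !mxE liftK.
Qed.

Let measurable_rV_cons k : measurable_fun setT (@rV_cons k).
Proof.
apply: measurable_fun_rV => i.
under eq_fun do rewrite mxE.
case: (unliftP ord0 i) => [j|] _ /=; last exact: measurable_fst.
exact: (measurableT_comp (measurable_rV_coord j) measurable_snd).
Qed.

HB.instance Definition _ k := @isMeasurableFun.Build _ _ _ _ (@rV_cons k)
  (@measurable_rV_cons k).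

Let measurable_rV_uncons k : measurable_fun setT (@rV_uncons k).
Proof.
apply/measurable_fun_pairP; split; first exact: (measurable_rV_coord ord0).
apply: measurable_fun_rV => i /=.
under eq_fun do rewrite mxE.
exact: measurable_rV_coord.
Qed.

(* k-dimensional Lebesgue measure, as the k-fold product of lebesgue_measure
   transported to row vectors. *)
Fixpoint lebesgue_rV (k : nat) : set 'rV[R]_k -> \bar R :=
  match k return set 'rV[R]_k -> \bar R with
  | 0 => \d_(0 : 'rV[R]_0)
  | k'.+1 => pushforward (lebesgue_measure \x @lebesgue_rV k')%E (@rV_cons k')
  end.

Section step.
Variables (k : nat) (m : {sigma_finite_measure set 'rV[R]_k -> \bar R}).

Let nu : set 'rV[R]_k.+1 -> \bar R :=
  pushforward (lebesgue_measure \x m)%E (@rV_cons k).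

Let nu0 : nu set0 = 0%E. Proof. exact: measure0. Qed.

Let nu_ge0 A : (0 <= nu A)%E. Proof. exact: measure_ge0. Qed.

Let nu_sigma_additive : semi_sigma_additive nu.
Proof. exact: measure_semi_sigma_additive. Qed.

HB.instance Definition _ := isMeasure.Build _ _ _ nu nu0 nu_ge0 nu_sigma_additive.

Let nu_sigma_finite : sigma_finite setT nu.
Proof.
have /sigma_finiteP[F [FT ndF Foo]] := sigma_finiteT (@lebesgue_measure R).
have /sigma_finiteP[G [GT ndG Goo]] := sigma_finiteT m.
exists (fun n => @rV_uncons k @^-1` (F n `*` G n)).
  rewrite -preimage_bigcup (_ : \bigcup_n _ = setT) ?preimage_setT//.
  apply/seteqP; split=> // -[x y] _.
  have : [set: measurableTypeR R] x by [].
  have : [set: 'rV[R]_k] y by [].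
  rewrite GT FT => -[n _ Gny] [l _ Flx]; exists (maxn n l) => //; split.
  - by move: x Flx; exact/subsetPset/ndF/leq_maxr.
  - by move: y Gny; exact/subsetPset/ndG/leq_maxl.
move=> n; have [mF Fn] := Foo n; have [mG Gn] := Goo n; split.
  rewrite -[X in measurable X]setTI; apply: measurable_rV_uncons => //.
  exact: measurableX.
rewrite /nu /pushforward -comp_preimage.
rewrite (_ : _ \o _ = id) ?preimage_id; last first.
  by apply/funext => p; exact: rV_consK.
by rewrite product_measure1E// lte_mul_pinfty// ge0_fin_numE.
Qed.

HB.instance Definition _ := @Measure_isSigmaFinite.Build _ _ _ nu nu_sigma_finite.

Lemma lebesgue_rV_step : exists m' : {sigma_finite_measure set 'rV[R]_k.+1 -> \bar R},
  pushforward (lebesgue_measure \x m)%E (@rV_cons k) = m'.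
Proof. by exists nu. Qed.

End step.

Let lebesgue_rV_measure k :
  exists m : {sigma_finite_measure set 'rV[R]_k -> \bar R}, @lebesgue_rV k = m.
Proof.
elim: k => [|k [m IH]].
  by exists (\d_(0 : 'rV[R]_0) : {finite_measure set _ -> \bar R}).
by rewrite /= IH; exact: lebesgue_rV_step.
Qed.

Let lebesgue_rV0 k : @lebesgue_rV k set0 = 0%E.
Proof. by have [m ->] := lebesgue_rV_measure k; exact: measure0. Qed.

Let lebesgue_rV_ge0 k A : (0 <= @lebesgue_rV k A)%E.
Proof. by have [m ->] := lebesgue_rV_measure k; exact: measure_ge0. Qed.

Let lebesgue_rV_sigma_additive k : semi_sigma_additive (@lebesgue_rV k).
Proof.
by have [m ->] := lebesgue_rV_measure k; exact: measure_semi_sigma_additive.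
Qed.

HB.instance Definition _ k := isMeasure.Build _ _ _ (@lebesgue_rV k)
  (@lebesgue_rV0 k) (@lebesgue_rV_ge0 k) (@lebesgue_rV_sigma_additive k).

Let lebesgue_rV_sigma_finite k : sigma_finite setT (@lebesgue_rV k).
Proof. by have [m ->] := lebesgue_rV_measure k; exact: sigma_finiteT. Qed.

HB.instance Definition _ k := @Measure_isSigmaFinite.Build _ _ _
  (@lebesgue_rV k) (@lebesgue_rV_sigma_finite k).

End lebesgue_rV.
Arguments lebesgue_rV {R} k.

Section complex_variation.
Context d (T : measurableType d) (R : realType).
Local Open Scope ereal_scope.

(* The Fourier transform of a real function is in general a complex measure:
   real and imaginary parts are finite signed measures (charges). *)
Record complex_measure := ComplexMeasure {
  Re_measure : {charge set T -> \bar R} ;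
  Im_measure : {charge set T -> \bar R} }.

Implicit Type mu : complex_measure.

Definition modulus mu (A : set T) : R :=
  Num.sqrt (fine (Re_measure mu A) ^+ 2 + fine (Im_measure mu A) ^+ 2)%R.

(* |mu|(A): supremum over finite disjoint families of measurable subsets of A.
   Families need not cover A, which gives the same value as partitions for
   measurable A. *)
Definition complex_variation mu (A : set T) : \bar R :=
  ereal_sup [set s | exists n (F : (set T)^nat),
    [/\ forall i, measurable (F i), trivIset `I_n F,
        forall i, F i `<=` A &
        s = \sum_(i < n) (modulus mu (F i))%:E]].

Lemma modulus_dir mu A (c s : R) : (c ^+ 2 + s ^+ 2 = 1)%R ->
  (c * fine (Re_measure mu A) + s * fine (Im_measure mu A) <= modulus mu A)%R.
Proof.
move=> cs; set a := fine _; set b := fine _.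
rewrite (le_trans (ler_norm _))// -sqrtr_sqr ler_wsqrtr// -/a -/b.
rewrite -[leRHS]mul1r -cs -subr_ge0.
rewrite (_ : (_ - _)%R = ((c * b - s * a) ^+ 2)%R) ?sqr_ge0//.
by ring.
Qed.

Lemma modulus_exdir mu A : exists c s : R, (c ^+ 2 + s ^+ 2 = 1)%R /\
  (c * fine (Re_measure mu A) + s * fine (Im_measure mu A) = modulus mu A)%R.
Proof.
rewrite /modulus; set a := fine _; set b := fine _.
have [r0|r0] := eqVneq (a ^+ 2 + b ^+ 2)%R 0%R.
  move: (r0) => /eqP; rewrite paddr_eq0 ?sqr_ge0// !sqrf_eq0 => /andP[/eqP a0 /eqP b0].
  by exists 1%R, 0%R; rewrite r0 sqrtr0 a0 b0 expr1n expr0n/= addr0 !mulr0 addr0.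
set r := Num.sqrt _.
have rE : (r ^+ 2 = a ^+ 2 + b ^+ 2)%R by rewrite sqr_sqrtr// addr_ge0 ?sqr_ge0.
have rn0 : r != 0%R by apply: contra_neq r0 => r0; rewrite -rE r0 expr0n.
exists (a / r)%R, (b / r)%R; split.
  by rewrite !exprMn -mulrDl -rE -exprMn divff// expr1n.
rewrite mulrAC [X in (_ + X)%R]mulrAC -mulrDl -!expr2 -rE expr2 mulfK//.
Qed.

Lemma modulus_sigma mu (A : (set T)^nat) : (forall i, measurable (A i)) ->
  trivIset setT A ->
  (modulus mu (\bigcup_i A i))%:E <= \sum_(i <oo) (modulus mu (A i))%:E.
Proof.
move=> mA tA; have mU : measurable (\bigcup_i A i) by exact: bigcup_measurable.
have [c [s [cs <-]]] := modulus_exdir mu (\bigcup_i A i).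
rewrite EFinD !EFinM !fineK ?fin_num_measure//.
have /= cRe := @charge_semi_sigma_additive _ _ _ (Re_measure mu) A mA tA mU.
have /= cIm := @charge_semi_sigma_additive _ _ _ (Im_measure mu) A mA tA mU.
have cvg : c%:E * (\sum_(0 <= i < n) Re_measure mu (A i)) +
    s%:E * (\sum_(0 <= i < n) Im_measure mu (A i)) @[n --> \oo] -->
    c%:E * Re_measure mu (\bigcup_i A i) + s%:E * Im_measure mu (\bigcup_i A i).
  apply: cvgeD.
  - by rewrite fin_num_adde_defl// fin_numM// fin_num_measure.
  - by apply: cvgeZl.
  - by apply: cvgeZl.
rewrite -(cvg_lim _ cvg)//; apply: lime_le; first by apply/cvg_ex; eexists; exact: cvg.
apply: nearW => n.
apply: le_trans (nneseries_lim_ge n _); last by move=> i _ _; rewrite lee_fin sqrtr_ge0.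
rewrite (eq_bigr (fun i => (fine (Re_measure mu (A i)))%:E)); last first.
  by move=> i _; rewrite fineK// fin_num_measure.
rewrite [X in _ + _ * X](eq_bigr (fun i => (fine (Im_measure mu (A i)))%:E)); last first.
  by move=> i _; rewrite fineK// fin_num_measure.
rewrite !sumEFin -!EFinM -EFinD lee_fin !mulr_sumr -big_split/=.
by apply: ler_sum => i _; exact: modulus_dir.
Qed.

Lemma modulus_set0 mu : modulus mu set0 = 0%R.
Proof. by rewrite /modulus !charge0 /= expr0n addr0 sqrtr0. Qed.

Lemma complex_variation0 mu : complex_variation mu set0 = 0.
Proof.
apply/eqP; rewrite eq_le; apply/andP; split.
  apply: ge_ereal_sup => _ [n [F [mF tF F0 ->]]].
  rewrite big1// => i _; move: (F0 i); rewrite subset0 => ->.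
  by rewrite modulus_set0.
apply: ereal_sup_ubound; exists 0%N, (fun=> set0); split => //.
  by move=> _; exact: subset_refl.
by rewrite big_ord0.
Qed.

Lemma complex_variation_ge0 mu A : 0 <= complex_variation mu A.
Proof.
apply: ereal_sup_ubound; exists 0%N, (fun=> set0); split => //.
  by move=> _; exact: sub0set.
by rewrite big_ord0.
Qed.

Lemma complex_variation_le mu A B : A `<=` B -> complex_variation mu A <= complex_variation mu B.
Proof.
move=> AB; apply: ereal_sup_le => _ [n [F [mF tF FA ->]]].
by exists n, F; split => // i; exact: subset_trans AB.
Qed.

Lemma modulus_le_complex_variation mu A B : measurable A -> A `<=` B ->
  (modulus mu A)%:E <= complex_variation mu B.
Proof.
move=> mA AB; apply: ereal_sup_ubound; exists 1%N, (fun=> A); split => //.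
- by move=> i j /=; rewrite !ltnS !leqn0 => /eqP -> /eqP ->.
by rewrite big_ord_recl big_ord0 adde0.
Qed.

Lemma complex_variation_super mu A B : A `&` B = set0 ->
  complex_variation mu A + complex_variation mu B <= complex_variation mu (A `|` B).
Proof.
move=> AB0.
have [->|Boo] := eqVneq (complex_variation mu (A `|` B)) +oo; first by rewrite leey.
have fAB : complex_variation mu (A `|` B) \is a fin_num.
  by rewrite ge0_fin_numE ?complex_variation_ge0// ltey.
have fB : complex_variation mu B \is a fin_num.
  by rewrite ge0_fin_numE ?complex_variation_ge0// (le_lt_trans (complex_variation_le mu (@subsetUr _ A B)))// ltey.
rewrite -leeBrDr//; apply: ge_ereal_sup => _ [n [F [mF tF FA ->]]].
rewrite leeBrDr// addeC -leeBrDr ?sumEFin//.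
apply: ge_ereal_sup => _ [m [G [mG tG GB ->]]].
rewrite leeBrDr// sumEFin -EFinD.
apply: ereal_sup_ubound.
exists (m + n)%N, (fun i => if (i < m)%N then G i else F (i - m)%N); split.
- by move=> i; case: ifP.
- move=> i j /= im jm; case: ifPn => im'; case: ifPn => jm'.
  + exact: tG.
  + by move=> [x [/GB Bx /FA Ax]]; have : (A `&` B) x by []; rewrite AB0.
  + by move=> [x [/FA Ax /GB Bx]]; have : (A `&` B) x by []; rewrite AB0.
  + rewrite -leqNgt in im'; rewrite -leqNgt in jm'.
    move=> /tF; rewrite /= !ltn_subLR// => /(_ im jm) ij.
    by rewrite -(subnK im') ij subnK.
- by move=> i; case: ifP => _; [apply: subset_trans (GB i) _; exact: subsetUr
    |apply: subset_trans (FA _) _; exact: subsetUl].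
rewrite sumEFin big_split_ord/=; congr (_ + _)%:E.
  by apply: eq_bigr => i _; rewrite ltn_ord.
by apply: eq_bigr => i _; rewrite ltnNge leq_addr/= addKn.
Qed.

Lemma complex_variation_sigma_additive mu : semi_sigma_additive (complex_variation mu).
Proof.
move=> A mA tA mU.
have : \sum_(0 <= i < n) complex_variation mu (A i) @[n --> \oo] --> \sum_(i <oo) complex_variation mu (A i).
  by apply: is_cvg_nneseries => i _ _; exact: complex_variation_ge0.
suff -> : complex_variation mu (\bigcup_i A i) = \sum_(i <oo) complex_variation mu (A i) by [].
apply/eqP; rewrite eq_le; apply/andP; split; last first.
  apply: lime_le; first by apply: is_cvg_nneseries => i _ _; exact: complex_variation_ge0.
  apply: nearW => n.
  apply: (@le_trans _ _ (complex_variation mu (\big[setU/set0]_(i < n) A i))); last first.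
    by apply: complex_variation_le; exact: bigsetU_bigcup.
  elim: n => [|n IH]; first by rewrite big_geq// complex_variation_ge0.
  rewrite big_nat_recr//= big_ord_recr/=.
  apply: le_trans (complex_variation_super _ _); first by rewrite leeD2r.
  rewrite setIC; apply/seteqP; split=> // x [Anx].
  rewrite -bigcup_mkord => -[i /= ni Aix].
  have := tA n i I I; move=> /(_ (ex_intro _ x (conj Anx Aix))) ni'.
  by rewrite ni' ltnn in ni.
apply: ge_ereal_sup => _ [n [F [mF tF FU ->]]].
apply: (@le_trans _ _ (\sum_(j < n) \sum_(i <oo) (modulus mu (F j `&` A i))%:E)).
  apply: lee_sum => j _.
  rewrite {1}(_ : F j = \bigcup_i (F j `&` A i)).
    apply: modulus_sigma => [i|]; first exact: measurableI.
    exact: trivIset_setIl.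
  by rewrite -setI_bigcupr; apply/esym/setIidPl.
rewrite -nneseries_sum; last by move=> *; rewrite lee_fin sqrtr_ge0.
apply: lee_nneseries => [i _ _|i _].
  by apply: sume_ge0 => *; rewrite lee_fin sqrtr_ge0.
apply: ereal_sup_ubound; exists n, (fun j => F j `&` A i); split => //.
- by move=> j; exact: measurableI.
- exact: trivIset_setIr.
Qed.

HB.instance Definition _ mu := isMeasure.Build _ _ _ (complex_variation mu)
  (complex_variation0 mu) (complex_variation_ge0 mu)
  (@complex_variation_sigma_additive mu).

(* Integral against the Jordan decomposition; independent of the Hahn sets. *)
Definition charge_integral (nu : {charge set T -> \bar R}) (f : T -> R) : R :=
  let: exist P exN := cid (Hahn_decomposition nu) in
  let: exist N nuPN := cid exN in
  (Rintegral (jordan_pos nuPN) setT f - Rintegral (jordan_neg nuPN) setT f)%R.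

End complex_variation.

Section spacetime.
Context {R : realType} {k : nat}.
Local Notation V := (R * 'rV[R]_k)%type.
Local Notation leb := (lebesgue_measure \x @lebesgue_rV R k)%E.

Definition enorm (x : 'rV[R]_k) : R := Num.sqrt (\sum_i x ord0 i ^+ 2).

Definition dot (x y : 'rV[R]_k) : R := \sum_i x ord0 i * y ord0 i.

Definition iter_derive (vs : seq V) (f : V -> R) : V -> R :=
  foldr (fun v g => 'D_v g) f vs.

(* C^oo: all iterated directional derivatives exist and are continuous. *)
Definition smooth (f : V -> R) : Prop := forall vs : seq V,
  continuous (iter_derive vs f) /\
  forall p v, derivable (iter_derive vs f) p v.

Definition test_function (f : V -> R) : Prop :=
  smooth f /\ exists2 K : set V, compact K & forall p, ~ K p -> f p = 0.

Definition schwartz (f : V -> R) : Prop :=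
  smooth f /\ forall (n : nat) (vs : seq V),
    exists C : R, forall p, (1 + `|p|) ^+ n * `|iter_derive vs f p| <= C.

Definition phase (p q : V) : R := p.1 * q.1 + dot p.2 q.2.

(* Real and imaginary parts of the transform of a real-valued f, with kernel
   exp(- i (tau s + xi . y)). *)
Definition Re_fourier (f : V -> R) (q : V) : R :=
  Rintegral leb setT (fun p => cos (phase q p) * f p).

Definition Im_fourier (f : V -> R) (q : V) : R :=
  Rintegral leb setT (fun p => - sin (phase q p) * f p).

(* s acts on Schwartz functions by absolutely convergent integration; continuity
   of the functional is then automatic by the uniform boundedness principle. *)
Definition tempered (s : V -> R) : Prop :=
  forall f, schwartz f -> leb.-integrable setT (EFin \o (s \* f)).

(* <F s, f> = <s, F f> = \int f dmu for Schwartz f, split into real and imaginary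
   parts. Real-valued f suffice since both sides are complex-linear in f. *)
Definition is_fourier_transform (s : V -> R)
    (mu : complex_measure (measurableTypeR R * 'rV[R]_k)%type R) : Prop :=
  tempered s /\ forall f, schwartz f ->
    Rintegral leb setT (s \* Re_fourier f) = charge_integral (Re_measure mu) f /\
    Rintegral leb setT (s \* Im_fourier f) = charge_integral (Im_measure mu) f.

(* Covariance of the noise: space-time white noise if k = 1 = beta, and white in
   time with Riesz kernel in space otherwise. In the degenerate places 0 `^ (- beta)
   and x / 0 the library value is 0, which only affects Lebesgue-null sets. *)
Definition noise_inner (beta : R) (f g : V -> R) : \bar R :=
  if (k == 1%N) && (beta == 1) then
    (\int[lebesgue_measure]_(r in `[0%R, +oo[)
      \int[lebesgue_rV k]_y (f (r, y) * g (r, y))%:E)%E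
  else
    (\int[lebesgue_measure]_(r in `[0%R, +oo[)
      \int[lebesgue_rV k]_y \int[lebesgue_rV k]_z
        (f (r, y) * enorm (y - z) `^ (- beta) * g (r, z))%:E)%E.

Definition heat_kernel (t : R) (x : 'rV[R]_k) : R :=
  (4 * pi * t) `^ (- (k%:R / 2)) * expR (- (enorm x ^+ 2 / (4 * t))).

(* (s, y) |-> 1_{0 <= s < t} G(t - s, x - y) sigma(s, y) *)
Definition mild_kernel (s : V -> R) (t : R) (x : 'rV[R]_k) (p : V) : R :=
  if 0 <= p.1 < t then heat_kernel (t - p.1) (x - p.2) * s p else 0.

Definition alpha1 (beta : R) : R := (2 - beta) / 4.
Definition alpha2 (beta : R) : R := (2 - beta) / 2.
Definition gamma2 (beta : R) : R := (alpha2 beta)^-1 - 1.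

Definition D1 (beta a : R) : set V :=
  [set p | Num.max (`|p.1| `^ alpha1 beta) (enorm p.2 `^ alpha2 beta) < a].

Definition D2 (beta b : R) : set V :=
  [set p | Num.max (`|p.1| `^ alpha1 beta) (enorm p.2 `^ alpha2 beta) > b].

Section probability.
Context d0 (T : measurableType d0) (P : probability T R).

(* normal_prob with zero deviation is not a Dirac mass in the library, hence the
   separate degenerate case. *)
Definition centered_gaussian (X : T -> R) : Prop :=
  measurable_fun setT X /\
  exists s : R, if s == 0 then P [set w | X w = 0] = 1%E
    else forall B : set (measurableTypeR R), measurable B ->
           P (X @^-1` B) = normal_prob 0 s B.

(* The whole family (W l f) is jointly Gaussian, so the vanishing cross-covariances
   express the independence of the components. W is constrained on test functions
   only. *)
Definition gaussian_noise (beta : R) (d : nat)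
    (W : 'I_d -> (V -> R) -> T -> R) : Prop :=
  (forall n (c : 'I_n -> R) (l : 'I_n -> 'I_d) (f : 'I_n -> V -> R),
    (forall i, test_function (f i)) ->
    centered_gaussian (fun w => \sum_i c i * W (l i) (f i) w)) /\
  (forall l j f g, test_function f -> test_function g ->
    ('E_P[(fun w => W l f w * W j g w)%R] =
      if l == j then noise_inner beta f g else 0)%E).

(* X is (a version of) the Wiener integral of h: the L^2(P) limit of W (f n) for
   test functions f n converging to h in the norm of the noise. *)
Definition is_wiener_integral (beta : R) (W : (V -> R) -> T -> R)
    (h : V -> R) (X : T -> R) : Prop :=
  exists f : (V -> R)^nat,
  [/\ forall n, test_function (f n),
      noise_inner beta (h \- f n) (h \- f n) @[n --> \oo] --> 0%E &
      ('E_P[(fun w => (X w - W (f n) w) ^+ 2)%R])%E @[n --> \oo] --> 0%E].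

Definition mild_solution (beta : R) (d : nat)
    (W : 'I_d -> (V -> R) -> T -> R) (sigma : 'I_d -> V -> R)
    (v : R -> 'rV[R]_k -> T -> 'rV[R]_d) : Prop :=
  forall (j : 'I_d) (t : R) (x : 'rV[R]_k), 0 <= t ->
    measurable_fun setT (fun w => v t x w ord0 j) /\
    is_wiener_integral beta (W j) (mild_kernel (sigma j) t x)
      (fun w => v t x w ord0 j).

Definition continuous_paths (d : nat)
    (v : R -> 'rV[R]_k -> T -> 'rV[R]_d) : Prop :=
  forall w, {within [set p : V | 0 <= p.1], continuous (fun p : V => v p.1 p.2 w)}.

(* Measurability of the hitting event is part of the claim P(hit) = 0. *)
Definition points_polar (d : nat)
    (v : R -> 'rV[R]_k -> T -> 'rV[R]_d) : Prop :=
  forall z : 'rV[R]_d,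
    let hit := [set w | exists t x, 0 < t /\ v t x w = z] in
    measurable hit /\ P hit = 0%E.

End probability.
End spacetime.

(* Main.v *)
(* On a small space-time box, v is approximated along a tree of dyadic parabolic
   subboxes: a word u has side r(u) = 2^(-|u|) in space and r(u)^2 in time, the
   increments of v across the subbox of u have size q^|u| with q = 2^(-(2 - beta)/2),
   and criticality of d says exactly that (number of letters) * q^d = 1. The
   expected number of subboxes of a fixed depth in which v comes close to z is
   therefore only bounded, and Talagrand's improved covering is needed to make it
   small. Around a given time, the part of v driven by the noise in the time
   annulus rho^2/K <= |r - t| <= K rho^2 carries the increments of v at scale rho
   up to an error that is small with 1/K, and such parts are independent for
   well separated scales rho. Each of them has oscillation at most e q^n with
   probability bounded below, so with probability close to one a given subbox lies
   in an ancestor on which the oscillation of v is abnormally small, and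
   covering by these ancestors has small d-dimensional cost.
   To pass from a cost estimate to the hitting of a fixed z, write v = w + gamma N,
   where N is a normalised value of v at an earlier time, w is independent of N
   and gamma is bounded away from zero and smoother than v: z is hit in a
   subbox only if N lies in a ball whose radius is comparable to the oscillation.
   The increments of v are estimated directly on the heat kernel, and the Riesz
   kernel is handled as a mixture of Gaussians. *)
Require Import Defs.
From HB Require Import structures.
From mathcomp Require Import all_boot all_order all_algebra.
From mathcomp Require Import all_classical all_reals all_analysis.
From mathcomp Require Import measurable_realfun ring lra.

Set Implicit Arguments.
Unset Strict Implicit.
Unset Printing Implicit Defensive.

Import Order.TTheory GRing.Theory Num.Theory.
Import numFieldNormedType.Exports.

Local Open Scope classical_set_scope.
Local Open Scope ring_scope.

(** * Gaussian integrals *)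

(** Three obstacles shape the proof. The noise is given on test functions only, and not as a linear
    map. Wiener integrals are therefore handled through pairs of a test function and a variable, the
    cutoff to a time annulus is smooth and acts on approximating test functions, and disjoint annuli
    then give covariances that are exactly zero. Next, the covariance form is used through squares:
    the norm of a kernel is the time integral of a nonnegative [energy], all estimates are
    inequalities between energies, and covariances with the reference value are read off from the
    norms of a sum and a difference. Finally, independence comes from characteristic functions:
    explicit trigonometric polynomials approximate half-lines, so equal characteristic functions
    give equal laws on cylinder sets. This yields the rotation invariance behind the small ball
    estimate, the independence of scales, and the replacement of [(w, N)] by copies on a product
    space, where hitting is computed by Fubini. The choices are nested: small ball probability,
    number M of scales, tolerated remainder, K, spacing s of the scales. *)

Section gaussian_integrals.
Context {R : realType}.
Local Notation mu := (@lebesgue_measure R).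

(** The normal density of variance [1 / (2 a)] has exponent [- a (x - m)^2]; total mass and
    integrability of the Gaussians below are inherited from it. *)
Lemma gauss_normal_pdf (a m x : R) : 0 < a ->
  expR (- (a * (x - m) ^+ 2)) =
  Num.sqrt (pi / a) * normal_pdf m (Num.sqrt (a *+ 2)^-1) x.
Proof.
move=> a0; have s0 : Num.sqrt (a *+ 2)^-1 != 0 :> R.
  by rewrite sqrtr_eq0 -ltNge invr_gt0 pmulrn_lgt0.
have s2 : (Num.sqrt (a *+ 2)^-1 ^+ 2) *+ 2 = a^-1.
  rewrite sqr_sqrtr; last by rewrite invr_ge0 mulrn_wge0// ltW.
  by rewrite -mulr_natr -(mulr_natr a) invfM -mulrA mulVf ?mulr1.
have -> : normal_pdf m (Num.sqrt (a *+ 2)^-1) x = normal_peak (Num.sqrt (a *+ 2)^-1) * normal_fun m (Num.sqrt (a *+ 2)^-1) x.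
  by rewrite /normal_pdf (negbTE s0).
have e2 : Num.sqrt (a *+ 2)^-1 ^+ 2 * pi *+ 2 = pi / a by rewrite -mulrnAl s2 mulrC.
rewrite /normal_peak /normal_fun e2 s2 [RHS]mulrA mulfV ?mul1r; last first.
  by rewrite gt_eqF// sqrtr_gt0 mulr_gt0 ?pi_gt0 ?invr_gt0.
by rewrite invrK mulNr mulrC.
Qed.

Lemma integral_gauss (a m : R) : 0 < a ->
  (\int[mu]_x (expR (- (a * (x - m) ^+ 2)))%:E = (Num.sqrt (pi / a))%:E)%E.
Proof.
move=> a0; under eq_integral do rewrite gauss_normal_pdf// EFinM.
by rewrite integralZl// ?integral_normal_pdf ?mule1//; exact: integrable_normal_pdf.
Qed.

Lemma integrable_gauss (a m : R) : 0 < a ->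
  mu.-integrable setT (EFin \o (fun x => expR (- (a * (x - m) ^+ 2)))).
Proof.
move=> a0; apply: eq_integrable (integrableZl measurableT (Num.sqrt (pi / a)) (integrable_normal_pdf m (Num.sqrt (a *+ 2)^-1))) => //.
by move=> x _ /=; rewrite -EFinM -gauss_normal_pdf.
Qed.

Definition gauss0 (x : R) := expR (- (2^-1 * x ^+ 2)).

Lemma continuous_gauss0 : continuous gauss0.
Proof.
move=> x; apply: continuous_comp; last exact: continuous_expR.
by apply: cvgN; apply: cvgM; [exact: cvg_cst|exact: exprn_continuous].
Qed.

Lemma measurable_gauss0 : measurable_fun setT gauss0.
Proof.
by apply: measurableT_comp => //; apply: measurableT_comp => //; apply: measurable_funM => //; exact: exprn_measurable.
Qed.

(** A single Taylor term of the exponential of [x ^+ 2 / 4] absorbs the power, at the price of half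
    the Gaussian exponent. The term of order [n.+1] controls [(x ^+ 2) ^+ n.+1], hence [x ^+ n] once
    x exceeds 1 in absolute value. *)
Lemma pow_gauss0_le n (x : R) : `|x ^+ n * gauss0 x| <=
  (1 + 4 ^+ n.+1 * n.+1`!%:R) * expR (- (4^-1 * (x - 0) ^+ 2)).
Proof.
have h : `|x ^+ n| <= (1 + 4 ^+ n.+1 * n.+1`!%:R) * expR (4^-1 * x ^+ 2).
  have u0 : 0 <= 4^-1 * x ^+ 2 by rewrite mulr_ge0 ?sqr_ge0.
  have := expR_ge1Dxn n u0; set E := expR _ => hE.
  have E1 : 1 <= E by rewrite -expR0 ler_expR.
  have nf : 0 < n.+1`!%:R :> R by rewrite ltr0n fact_gt0.
  have h2 : (x ^+ 2) ^+ n.+1 <= 4 ^+ n.+1 * n.+1`!%:R * E.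
    have : (4^-1 * x ^+ 2) ^+ n.+1 / n.+1`!%:R <= E by rewrite (le_trans _ hE)// lerDr.
    rewrite ler_pdivrMr// exprMn exprVn mulrC ler_pdivrMr ?exprn_gt0// => /le_trans; apply.
    by rewrite le_eqVlt; apply/orP; left; apply/eqP; ring.
  rewrite normrX mulrDl mul1r.
  have [x1|x1] := lerP `|x| 1.
    by rewrite (le_trans (exprn_ile1 _ _ _))// (le_trans E1)// lerDl !mulr_ge0 ?exprn_ge0// ?expR_ge0// ltW.
  rewrite (@le_trans _ _ ((x ^+ 2) ^+ n.+1))//; last first.
    by rewrite (le_trans h2)// lerDr (le_trans ler01).
  rewrite -(real_normK (num_real x)) -exprM ler_weXn2l// ?ltW//.
  by rewrite mul2n -addnn addSn ltnW// ltnS leq_addr.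
rewrite normrM (ger0_norm (expR_ge0 _)) (le_trans (ler_wpM2r (expR_ge0 _) h))//.
by rewrite -mulrA -expRD subr0 ler_wpM2l ?addr_ge0 ?mulr_ge0 ?exprn_ge0// ler_expR; nra.
Qed.

Lemma integrable_pow_gauss0 n :
  mu.-integrable setT (EFin \o (fun x => x ^+ n * gauss0 x)).
Proof.
have i4 : mu.-integrable setT (EFin \o (fun x : R => (1 + 4 ^+ n.+1 * n.+1`!%:R) * expR (- (4^-1 * (x - 0) ^+ 2)))).
  exact: (integrableZl measurableT _ (integrable_gauss 0 _)).
apply: le_integrable i4 => //.
  by apply/measurable_EFinP; apply: measurable_funM; [exact: exprn_measurable|exact: measurable_gauss0].
move=> x _ /=; rewrite lee_fin (le_trans (pow_gauss0_le n x))// ler_norm //.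
Qed.

Lemma is_derive_gauss0 (x : R) : is_derive x 1 gauss0 (- x * gauss0 x).
Proof.
have h : is_derive x 1 (fun x : R => - (2^-1 * x ^+ 2)) (- x).
  by apply: is_derive_eq; rewrite /GRing.scale /=; lra.
exact: is_derive_eq (is_derive1_comp (is_derive_expR _) h) (mulrC _ _).
Qed.

Lemma integral_itvN_cvg (f : R -> R) : mu.-integrable setT (EFin \o f) ->
  \int[mu]_(x in `[- n%:R, n%:R]) f x @[n --> \oo] --> \int[mu]_x f x.
Proof.
move=> intf.
have mf : measurable_fun setT f by apply/measurable_EFinP; case/integrableP: intf.
have := @dominated_convergence _ _ _ mu setT measurableT
  (fun n x => (f \_ `[- n%:R, n%:R] x)%:E) (EFin \o f) (fun x => `|f x|%:E).
case.
- move=> n; apply/measurable_EFinP; apply/(measurable_restrictT _ _).1 => //.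
  exact: measurable_funS mf.
- exact/measurable_EFinP.
- apply: aeW => x _ /=; apply: cvg_near_cst; near=> n.
  rewrite patchE ifT// inE /= in_itv/= -ler_norml.
  by near: n; exact: nbhs_infty_ger.
- by have := integrable_norm intf.
- apply: aeW => x n _ /=; rewrite lee_fin patchE; case: ifP => // _.
  by rewrite normr0.
move=> _ _ h.
have -> : \int[mu]_x f x = fine (\int[mu]_x (f x)%:E)%E by [].
have -> : (fun n => \int[mu]_(x in `[- n%:R, n%:R]) f x) =
   fine \o (fun n => \int[mu]_x (f \_ `[- n%:R, n%:R] x)%:E)%E.
  apply/funext => n /=; rewrite /Rintegral integral_mkcond /=; congr fine.
  by apply: eq_integral => x _; rewrite restrict_EFin.
apply: fine_cvg; rewrite fineK ?integrable_fin_num//.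
Unshelve. all: end_near. Qed.


Let J (t : R) := \int[mu]_x (cos (t * x) * gauss0 x).

Let dcos (t x : R) : is_derive t 1 (fun t => cos (t * x)) (- sin (t * x) * x).
Proof.
have h : is_derive t 1 (fun t : R => t * x) x.
  by apply: is_derive_eq; rewrite /GRing.scale /=; lra.
exact: is_derive1_comp (is_derive_cos _) h.
Qed.

Let dsin (t x : R) : is_derive t 1 (fun t => sin (t * x)) (cos (t * x) * x).
Proof.
have h : is_derive t 1 (fun t : R => t * x) x.
  by apply: is_derive_eq; rewrite /GRing.scale /=; lra.
exact: is_derive1_comp (is_derive_sin _) h.
Qed.

Let mtrig (f : R -> R) (t : R) : continuous f -> measurable_fun setT (fun x : R => f (t * x)).
Proof.
by move=> cf; apply: measurableT_comp; [exact: continuous_measurable_fun|exact: measurable_funM].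
Qed.

Let int_trig (f : R -> R) (t : R) n : continuous f -> (forall x, `|f x| <= 1) ->
  mu.-integrable setT (EFin \o (fun x => f (t * x) * (x ^+ n * gauss0 x))).
Proof.
move=> cf f1; apply: le_integrable (integrable_pow_gauss0 n) => //.
  apply/measurable_EFinP; apply: measurable_funM; first exact: mtrig.
  by apply: measurable_funM; [exact: exprn_measurable|exact: measurable_gauss0].
by move=> x _ /=; rewrite lee_fin normrM ler_piMl.
Qed.

Let cos1 (x : R) : `|cos x| <= 1. Proof. by rewrite ler_norml cos_geN1 cos_le1. Qed.
Let sin1 (x : R) : `|sin x| <= 1. Proof. by rewrite ler_norml sin_geN1 sin_le1. Qed.

(** Integration by parts: the derivative of [F] is the difference of the two integrands, and
    [x * gauss0 x] is bounded, so the boundary terms are of order 1/n. Read for [J], the identity is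
    the differential equation [J' = - t J]. *)
Lemma gauss0_by_parts (t : R) :
  \int[mu]_x (sin (t * x) * (x ^+ 1 * gauss0 x)) = t * J t.
Proof.
have i1 := int_trig t 1 (@continuous_sin R) sin1.
have i0 : mu.-integrable setT (EFin \o (fun x => cos (t * x) * gauss0 x)).
  apply: eq_integrable (int_trig t 0 (@continuous_cos R) cos1) => // x _ /=.
  by rewrite expr0 mul1r.
pose F (x : R) := sin (t * x) * gauss0 x.
pose f (x : R) := t * (cos (t * x) * gauss0 x) - sin (t * x) * (x ^+ 1 * gauss0 x).
have dF (x : R) : is_derive x 1 F (f x).
  have h : is_derive x 1 (fun x => sin (t * x)) (cos (t * x) * t).
    have h : is_derive x 1 (fun x : R => t * x) t.
      by apply: is_derive_eq; rewrite /GRing.scale /=; lra.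
    exact: is_derive1_comp (is_derive_sin _) h.
  have g := is_derive_gauss0 x.
  by apply: is_derive_eq; rewrite /GRing.scale /= /f expr1; ring.
have cf : continuous f.
  move=> x; rewrite /f; apply: cvgB; apply: cvgM.
  - exact: cvg_cst.
  - apply: cvgM; last exact: continuous_gauss0.
    apply: continuous_comp; last exact: continuous_cos.
    by apply: cvgM; [exact: cvg_cst|exact: cvg_id].
  - apply: continuous_comp; last exact: continuous_sin.
    by apply: cvgM; [exact: cvg_cst|exact: cvg_id].
  - by apply: cvgM; [exact: exprn_continuous|exact: continuous_gauss0].
have if_ : mu.-integrable setT (EFin \o f).
  apply: eq_integrable (integrableB measurableT (integrableZl measurableT t i0) i1) => //.
have : \int[mu]_x f x = 0.
  have h1 := integral_itvN_cvg if_.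
  suff : \int[mu]_(x in `[- n%:R, n%:R]) f x @[n --> \oo] --> (0 : R).
    by move=> h2; rewrite -(cvg_lim _ h1) ?(cvg_lim _ h2).
  have E n : (0 < n)%N -> \int[mu]_(x in `[- n%:R, n%:R]) f x = 2 * F n%:R.
    move=> n0; rewrite /Rintegral (@continuous_FTC2 _ f F).
    - by rewrite -EFinB /= /F mulrN sinN /gauss0 sqrrN; lra.
    - by rewrite gtrN ?ltr0n.
    - exact: continuous_subspaceT.
    - split.
      + by move=> x _; have := dF x; case.
      + apply: cvg_at_right_filter; apply: differentiable_continuous; apply/derivable1_diffP.
        by have := dF (- n%:R); case.
      + apply: cvg_at_left_filter; apply: differentiable_continuous; apply/derivable1_diffP.
        by have := dF n%:R; case.
    - by move=> x _; rewrite derive1E derive_val.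
  have [C hC] : exists C, forall x : R, `|x * gauss0 x| <= C.
    exists (1 + 4 ^+ 2 * 2`!%:R) => x; rewrite -[x in x * _]expr1 (le_trans (pow_gauss0_le 1 x))//.
    rewrite ler_piMr ?addr_ge0 ?mulr_ge0 ?exprn_ge0//.
    by rewrite -[leRHS]expR0 ler_expR oppr_le0 mulr_ge0 ?sqr_ge0.
  apply/cvgr0Pnorm_le => e e0; near=> n.
  have n0 : (0 < n)%N by near: n; exists 1%N.
  have nR : 0 < n%:R :> R by rewrite ltr0n.
  rewrite E// normrM ger0_norm// /F normrM.
  rewrite (@le_trans _ _ (2 * (C / n%:R)))//.
    rewrite ler_pM2l// (le_trans (ler_piMl _ (sin1 _)))// ler_pdivlMr//.
    by rewrite mulrC -[X in X * _]gtr0_norm// -normrM.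
  rewrite mulrA ler_pdivrMr// -ler_pdivrMl//.
  by near: n; exact: nbhs_infty_ger.
rewrite /f RintegralB//; last first.
  exact: (integrableZl measurableT t i0).
by rewrite RintegralZl// => /eqP; rewrite subr_eq0 => /eqP <-.
Unshelve. all: end_near. Qed.

Let is_derive_J (t : R) : is_derive t 1 J (- (t * J t)).
Proof.
have /= h := @cvg_differentiation_under_integral R _ _ mu
  (fun t x => cos (t * x) * gauss0 x) setT measurableT t (t - 1) (t + 1) _ _ _
  (fun x => `|x ^+ 1 * gauss0 x|) _ _ _.
have d t' x : partial1of2 (fun t x => cos (t * x) * gauss0 x) t' x = - (sin (t' * x) * (x ^+ 1 * gauss0 x)).
  rewrite partial1of2E; have g := dcos t' x.
  by rewrite derive_val /GRing.scale/= expr1; ring.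
have {}h : h^-1 *: (J (h + t) - J t) @[h --> 0^'] --> - (t * J t).
  have -> : - (t * J t) = \int[mu]_x partial1of2 (fun t x => cos (t * x) * gauss0 x) t x.
    rewrite -gauss0_by_parts -mulN1r -RintegralZl//; last first.
      exact: (int_trig t 1 (@continuous_sin R) sin1).
    by apply: eq_Rintegral => x _; rewrite d mulN1r.
  apply: h.
  - by rewrite /= in_itv/=; apply/andP; split; lra.
  - move=> x _; apply: eq_integrable (int_trig x 0 (@continuous_cos R) cos1) => // y _ /=.
    by rewrite expr0 mul1r.
  - by move=> x y _ _; have g := dcos x y; exact: ex_derive.
  - by move=> y; exact: normr_ge0.
  - by have := integrable_norm (integrable_pow_gauss0 1).
  - by move=> x y _ _; rewrite d normrN normrM ler_piMl.
apply: DeriveDef.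
  by apply/cvg_ex; eexists; under eq_fun do rewrite scaler1; exact: h.
by apply: cvg_lim => //; under eq_fun do rewrite scaler1; exact: h.
Qed.

(** The product of [J t] with the exponential of [t ^+ 2 / 2] has zero derivative, hence equals its
    value at 0. *)
Lemma integral_cos_gauss0 (t : R) : J t = Num.sqrt (pi *+ 2) * gauss0 t.
Proof.
have J0 : J 0 = Num.sqrt (pi *+ 2).
  rewrite /J /Rintegral; under eq_integral do rewrite mul0r cos0 mul1r /gauss0 -[X in X ^+ 2]subr0.
  by rewrite integral_gauss ?invr_gt0//= invrK mulr_natr.
have c (x : R) : is_derive x 1 (fun x => J x * expR (2^-1 * x ^+ 2)) 0.
  have h1 := is_derive_J x.
  have h2 : is_derive x 1 (fun x : R => expR (2^-1 * x ^+ 2)) (expR (2^-1 * x ^+ 2) * x).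
    have h : is_derive x 1 (fun x : R => 2^-1 * x ^+ 2) x.
      by apply: is_derive_eq; rewrite /GRing.scale /=; lra.
    exact: is_derive1_comp (is_derive_expR _) h.
  by apply: is_derive_eq; rewrite /GRing.scale/=; ring.
have /= := is_derive_0_is_cst t 0 c.
rewrite expr0n mulr0 expR0 mulr1 J0 => <-.
by rewrite /gauss0 -mulrA -expRD subrr expR0 mulr1.
Qed.

Lemma integral_sin_gauss0 (t : R) : \int[mu]_x (sin (t * x) * gauss0 x) = 0.
Proof.
have i0 : mu.-integrable setT (EFin \o (fun x => sin (t * x) * gauss0 x)).
  apply: eq_integrable (int_trig t 0 (@continuous_sin R) sin1) => // x _ /=.
  by rewrite expr0 mul1r.
have h1 := integral_itvN_cvg i0.
suff : \int[mu]_(x in `[- n%:R, n%:R]) (sin (t * x) * gauss0 x) @[n --> \oo] --> (0 : R).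
  by move=> h2; rewrite -(cvg_lim _ h1) ?(cvg_lim _ h2).
apply: cvg_near_cst; apply: nearW => n.
have : \int[mu]_(x in `[- n%:R, n%:R]) (sin (t * x) * gauss0 x) =
   - \int[mu]_(x in `[- n%:R, n%:R]) (sin (t * x) * gauss0 x).
  have e1 : (\int[mu]_(x in `[(- n%:R)%R, n%:R%R]) (sin (t * x) * gauss0 x)%:E =
      \int[mu]_(x in `[(- n%:R)%R, n%:R%R]) (- (sin (t * x) * gauss0 x)%:E))%E.
    have := @integration_by_substitution_oppr _ (fun x => sin (t * x) * gauss0 x) (- n%:R) n%:R.
    rewrite opprK => ->.
    - by apply: eq_integral => x _ /=; rewrite mulrN sinN /gauss0 sqrrN mulNr.
    - by rewrite ge0_cp.
    - apply: continuous_subspaceT => x; apply: cvgM; last exact: continuous_gauss0.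
      apply: continuous_comp; last exact: continuous_sin.
      by apply: cvgM; [exact: cvg_cst|exact: cvg_id].
  rewrite {1}/Rintegral e1 integralN ?fineN//; apply: integrable_add_def => //.
  by apply: (integrableS _ _ (@subsetT _ _)) => //; exact: i0.
move=> /eqP; rewrite -addr_eq0 -mulr2n mulrn_eq0 /= => /eqP //.
Qed.


Lemma integral_normal_prob (s : R) (f : R -> R) : s != 0 -> measurable_fun setT f ->
  (forall x, 0 <= f x) ->
  (\int[normal_prob 0 s]_x (f x)%:E = \int[mu]_x (f x * normal_pdf 0 s x)%:E)%E.
Proof.
move=> s0 mf f0; have dom := normal_prob_dominates 0 s.
pose nu : {finite_measure set _ -> \bar R} := normal_prob 0 s.
rewrite -(@Radon_Nikodym_SigmaFinite.change_of_variables _ _ R nu mu dom (EFin \o f) setT)//=.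
- apply: ae_eq_integral => //.
  + apply: emeasurable_funM; first exact/measurable_EFinP.
    by have /integrableP[] := Radon_Nikodym_SigmaFinite.f_integrable dom.
  + by apply/measurable_EFinP; apply: measurable_funM => //; exact: measurable_normal_pdf.
  + under [X in ae_eq _ _ _ X]eq_fun do rewrite EFinM.
    apply: ae_eqe_mul2l; apply: integral_ae_eq => //.
    * exact: Radon_Nikodym_SigmaFinite.f_integrable.
    * by apply/measurable_EFinP; exact: measurable_normal_pdf.
    * by move=> E _ mE; rewrite -Radon_Nikodym_SigmaFinite.f_integral.
- exact/measurable_EFinP.
Qed.

Lemma sin_norm_le (x : R) : `|sin x| <= `|x|.
Proof.
have h (y : R) : 0 <= y -> `|sin y| <= y.
  move=> y0; have [->|yn] := eqVneq y 0; first by rewrite sin0 normr0.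
  have y1 : 0 < y by rewrite lt_neqAle eq_sym yn.
  have h1 (z : R) : z \in `]0, y[ -> is_derive z 1 sin (cos z) by move=> _; exact: is_derive_sin.
  have h2 : {within `[0, y], continuous (@sin R)}.
    by apply: continuous_subspaceT; exact: continuous_sin.
  have [c _] := MVT y1 h1 h2.
  rewrite sin0 !subr0 => ->; rewrite normrM (ger0_norm y0) ler_piMl//; exact: cos1.
have [x0|/ltW x0] := leP 0 x; first by rewrite (ger0_norm x0); exact: h.
by rewrite -(normrN (sin x)) -sinN (ler0_norm x0); apply: h; rewrite oppr_ge0.
Qed.

(** Positivity is read off from the integration by parts at t = 1, since [sin x * x <= x ^+ 2]. *)
Lemma second_moment_gauss0 : 0 < \int[mu]_x (x ^+ 2 * gauss0 x).
Proof.
have := gauss0_by_parts 1; rewrite integral_cos_gauss0 mul1r => h.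
apply: (@lt_le_trans _ _ (Num.sqrt (pi *+ 2) * gauss0 1)).
  by rewrite mulr_gt0 ?expR_gt0// sqrtr_gt0 mulrn_wgt0 ?pi_gt0.
rewrite -h; apply: le_Rintegral => //.
- exact: (int_trig 1 1 (@continuous_sin R) sin1).
- exact: (integrable_pow_gauss0 2).
- move=> x _; rewrite mul1r mulrA ler_wpM2r ?expR_ge0// expr1 expr2.
  rewrite (le_trans (ler_norm _))// normrM -[leRHS]ger0_norm -?expr2 ?sqr_ge0// normrX expr2.
  by rewrite ler_wpM2r// sin_norm_le.
Qed.

Lemma integral_normal_prob_scale (s : R) (f : R -> R) : s != 0 -> continuous f ->
  (forall x, 0 <= f x) ->
  (\int[normal_prob 0 s]_x (f x)%:E =
   \int[mu]_x ((Num.sqrt (pi *+ 2))^-1 * (f (`|s| * x) * gauss0 x))%:E)%E.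
Proof.
move=> s0 cf f0; have s1 : 0 < `|s| by rewrite normr_gt0.
rewrite integral_normal_prob//; last exact: continuous_measurable_fun.
pose F := (fun x : R => `|s| * x) : R -> R.
have dF (x : R) : is_derive x 1 F `|s|.
  by apply: is_derive_eq; rewrite /GRing.scale /= ?mulr0 ?add0r ?mulr1.
have F' : derive1 F = cst `|s|.
  by apply/funext => x; rewrite derive1E derive_val.
rewrite (@increasing_ge0_integration_by_substitutionT _ F (fun x => f x * normal_pdf 0 s x)).
- apply: eq_integral => x _; congr EFin; rewrite F' /= !fctE /cst /F.
  have -> : normal_pdf 0 s (`|s| * x) = normal_peak s * normal_fun 0 s (`|s| * x).
    by rewrite /normal_pdf (negbTE s0).
  have -> : normal_fun 0 s (`|s| * x) = gauss0 x.
    rewrite /normal_fun /gauss0 subr0 exprMn real_normK ?num_real//; congr expR.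
    by rewrite -mulr_natr; field.
  have -> : normal_peak s = (`|s| * Num.sqrt (pi *+ 2))^-1.
    by rewrite /normal_peak -mulrnAr sqrtrM ?sqr_ge0// sqrtr_sqr.
  have p0 : Num.sqrt (pi *+ 2) != 0 :> R by rewrite gt_eqF// sqrtr_gt0 mulrn_wgt0 ?pi_gt0.
  by field; rewrite p0 gt_eqF.
- by move=> x y xy; rewrite /F ltr_pM2l.
- by rewrite F' => x; exact: cst_continuous.
- by rewrite F'; exact: is_cvg_cst.
- by rewrite F'; exact: is_cvg_cst.
- by move=> x; exact: ex_derive.
- by apply: gt0_cvgMrNy => //; exact: cvg_id.
- by apply: gt0_cvgMry => //; exact: cvg_id.
- by move=> x; apply: cvgM; [exact: cf|exact: continuous_normal_pdf].
- by move=> x; rewrite mulr_ge0// normal_pdf_ge0.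
Qed.

End gaussian_integrals.

(** * Square-integrable functions *)

Section square_integrable.
Context d (T : measurableType d) (R : realType) (m : {measure set T -> \bar R}).
Implicit Types f g h : T -> R.

Definition L2 f := measurable_fun setT f /\ (\int[m]_x (f x ^+ 2)%:E < +oo)%E.

Definition ip f g : R := \int[m]_x (f x * g x).

Lemma L2_measurable f : L2 f -> measurable_fun setT f. Proof. by case. Qed.

Lemma L2_sqr_integrable f : L2 f -> m.-integrable setT (EFin \o (fun x => f x ^+ 2)).
Proof.
move=> [mf f2]; apply/integrableP; split.
  by apply/measurable_EFinP; exact: measurable_funX.
by under eq_integral do rewrite /= ger0_norm ?sqr_ge0//.
Qed.

Lemma L2_mul_integrable f g : L2 f -> L2 g -> m.-integrable setT (EFin \o (fun x => f x * g x)).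
Proof.
move=> Lf Lg; apply: le_integrable (integrableD measurableT (L2_sqr_integrable Lf) (L2_sqr_integrable Lg)) => //.
  by apply/measurable_EFinP; apply: measurable_funM; exact: L2_measurable.
move=> x _ /=; rewrite lee_fin (le_trans _ (ler_norm _))// normrM.
have := sqr_ge0 (`|f x| - `|g x|); rewrite sqrrB !real_normK ?num_real//.
have := sqr_ge0 (`|f x| + `|g x|); rewrite sqrrD !real_normK ?num_real//.
have := mulr_ge0 (normr_ge0 (f x)) (normr_ge0 (g x)); lra.
Qed.

Lemma L2_le f g : measurable_fun setT f -> L2 g -> (forall x, `|f x| <= `|g x|) -> L2 f.
Proof.
move=> mf [mg g2] fg; split => //; apply: le_lt_trans g2.
apply: ge0_le_integral => //.
- by move=> x _; rewrite lee_fin sqr_ge0.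
- by apply/measurable_EFinP; exact: measurable_funX.
- by apply/measurable_EFinP; exact: measurable_funX.
- by move=> x _; rewrite lee_fin -(real_normK (num_real (f x))) -(real_normK (num_real (g x))) lerXn2r ?nnegrE.
Qed.

Lemma L2D f g : L2 f -> L2 g -> L2 (fun x => f x + g x).
Proof.
move=> Lf Lg; split; first by apply: measurable_funD; exact: L2_measurable.
have /integrableP[_] := integrableD measurableT
  (integrableZl measurableT 2 (L2_sqr_integrable Lf)) (integrableZl measurableT 2 (L2_sqr_integrable Lg)).
apply: le_lt_trans; apply: ge0_le_integral => //.
- by move=> x _; rewrite lee_fin sqr_ge0.
- by apply/measurable_EFinP; apply: measurable_funX; apply: measurable_funD; exact: L2_measurable.
- apply: measurableT_comp => //; apply/measurable_EFinP.
  by apply: measurable_funD; apply: measurable_funM => //; apply: measurable_funX; exact: L2_measurable.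
- move=> x _ /=; rewrite lee_fin (le_trans _ (ler_norm _))//.
  by have := sqr_ge0 (f x - g x); rewrite sqrrB sqrrD; lra.
Qed.

Lemma L2Z (a : R) f : L2 f -> L2 (fun x => a * f x).
Proof.
move=> Lf; split; first by apply: measurable_funM => //; exact: L2_measurable.
have /integrableP[_] := integrableZl measurableT (a ^+ 2) (L2_sqr_integrable Lf).
apply: le_lt_trans; apply: ge0_le_integral => //.
- by move=> x _; rewrite lee_fin sqr_ge0.
- by apply/measurable_EFinP; apply: measurable_funX; apply: measurable_funM => //; exact: L2_measurable.
- apply: measurableT_comp => //; apply/measurable_EFinP.
  by apply: measurable_funM => //; apply: measurable_funX; exact: L2_measurable.
- by move=> x _ /=; rewrite lee_fin exprMn ler_norm.
Qed.

Lemma L20 : L2 (fun=> 0).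
Proof.
split => //; under eq_integral do rewrite expr0n.
by rewrite integral0.
Qed.

Lemma L2N f : L2 f -> L2 (fun x => - f x).
Proof. by move=> /(L2Z (-1)); under eq_fun do rewrite mulN1r. Qed.

Lemma L2B f g : L2 f -> L2 g -> L2 (fun x => f x - g x).
Proof. by move=> Lf Lg; apply: L2D => //; exact: L2N. Qed.

Lemma L2_sum (I : Type) (s : seq I) (F : I -> T -> R) : (forall i, L2 (F i)) ->
  L2 (fun x => \sum_(i <- s) F i x).
Proof.
move=> LF; elim: s => [|i s IH].
  by under eq_fun do rewrite big_nil; exact: L20.
by under eq_fun do rewrite big_cons; exact: L2D.
Qed.

Lemma ipC f g : ip f g = ip g f.
Proof. by apply: eq_Rintegral => x _; rewrite mulrC. Qed.

Lemma ipDl f g h : L2 f -> L2 g -> L2 h -> ip (fun x => f x + g x) h = ip f h + ip g h.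
Proof.
move=> Lf Lg Lh; rewrite /ip -RintegralD//; try exact: L2_mul_integrable.
by apply: eq_Rintegral => x _; rewrite mulrDl.
Qed.

Lemma ipZl (a : R) f h : L2 f -> L2 h -> ip (fun x => a * f x) h = a * ip f h.
Proof.
move=> Lf Lh; rewrite /ip -RintegralZl//; last exact: L2_mul_integrable.
by apply: eq_Rintegral => x _; rewrite mulrA.
Qed.

Lemma ipBl f g h : L2 f -> L2 g -> L2 h -> ip (fun x => f x - g x) h = ip f h - ip g h.
Proof.
move=> Lf Lg Lh; rewrite ipDl//; last exact: L2N.
congr (_ + _); rewrite -mulN1r -ipZl//; congr ip.
by apply/funext => x; rewrite mulN1r.
Qed.

Lemma ip_suml (I : Type) (s : seq I) (F : I -> T -> R) h : (forall i, L2 (F i)) -> L2 h ->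
  ip (fun x => \sum_(i <- s) F i x) h = \sum_(i <- s) ip (F i) h.
Proof.
move=> LF Lh; elim: s => [|i s IH].
  rewrite big_nil /ip; under eq_Rintegral do rewrite big_nil mul0r.
  by rewrite /Rintegral integral0.
rewrite big_cons -IH; under [X in ip X _]eq_fun do rewrite big_cons.
by rewrite ipDl//; exact: L2_sum.
Qed.

Lemma ip_ge0 f : 0 <= ip f f.
Proof. by apply: Rintegral_ge0 => x _; rewrite -expr2 sqr_ge0. Qed.

Lemma ip_sqrE f : L2 f -> (\int[m]_x (f x ^+ 2)%:E = (ip f f)%:E)%E.
Proof.
move=> Lf; rewrite /ip /Rintegral; under [in RHS]eq_integral do rewrite -expr2.
by rewrite fineK//; exact: integrable_fin_num (L2_sqr_integrable Lf).
Qed.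

Lemma ip_sqrD f g : L2 f -> L2 g ->
  ip (fun x => f x + g x) (fun x => f x + g x) = ip f f + 2 * ip f g + ip g g.
Proof.
move=> Lf Lg; have Lfg := L2D Lf Lg.
by rewrite ipDl// (ipC f) (ipC g) !ipDl// (ipC g f); ring.
Qed.

Lemma ip_sqrZ (a : R) f : L2 f -> ip (fun x => a * f x) (fun x => a * f x) = a ^+ 2 * ip f f.
Proof. by move=> Lf; rewrite ipZl//; [rewrite ipC ipZl//; ring|exact: L2Z]. Qed.

Lemma ip_sqrB f g : L2 f -> L2 g ->
  ip (fun x => f x - g x) (fun x => f x - g x) = ip f f - 2 * ip f g + ip g g.
Proof.
move=> Lf Lg; have Lfg := L2B Lf Lg.
by rewrite ipBl// (ipC f) (ipC g) !ipBl// (ipC g f); ring.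
Qed.

Lemma ip_CauchySchwarz f g : L2 f -> L2 g -> ip f g ^+ 2 <= ip f f * ip g g.
Proof.
move=> Lf Lg; set a := ip f f; set b := ip f g; set c := ip g g.
have h (x y : R) : 0 <= x ^+ 2 * a + 2 * (x * y) * b + y ^+ 2 * c.
  have := ip_ge0 (fun w => x * f w + y * g w).
  rewrite ip_sqrD; try exact: L2Z.
  rewrite !ip_sqrZ// ipZl//; last exact: L2Z.
  rewrite (ipC f (fun w => y * g w)) ipZl// (ipC g f) -/a -/b -/c.
  by move=> H; apply: le_trans H _; rewrite le_eqVlt; apply/orP; left; apply/eqP; ring.
(* If [f] has norm zero, the form is affine in x for y = 1, and the chosen x would give it the value
   -1 unless [b] vanishes. Otherwise [(- b, a)] is the minimising direction. *)
have [a0|a0] := eqVneq a 0.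
  have [b0|b0] := eqVneq b 0; first by rewrite b0 expr0n/= a0 mul0r.
  have := h (- (c + 1) / (2 * b)) 1; rewrite a0 mulr0 add0r expr1n mulr1 mul1r.
  suff -> : 2 * (- (c + 1) / (2 * b)) * b + c = -1 by rewrite leNgt ltrN10.
  by field.
have a1 : 0 < a by rewrite lt_neqAle eq_sym a0 ip_ge0.
have := h (- b) a; have -> : (- b) ^+ 2 * a + 2 * (- b * a) * b + a ^+ 2 * c = a * (a * c - b ^+ 2) by ring.
by rewrite pmulr_rge0// subr_ge0.
Qed.

Lemma ip_sqrD_le f g : L2 f -> L2 g ->
  ip (fun x => f x + g x) (fun x => f x + g x) <= 2 * ip f f + 2 * ip g g.
Proof.
move=> Lf Lg; have := ip_ge0 (fun x => f x - g x).
by rewrite (ip_sqrD Lf Lg) (ip_sqrB Lf Lg); lra.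
Qed.

Lemma ip_le f g : L2 f -> L2 g -> (forall x, `|f x| <= `|g x|) -> ip f f <= ip g g.
Proof.
move=> Lf Lg fg; apply: le_Rintegral => //; try exact: L2_mul_integrable.
by move=> x _; rewrite -!expr2 -(real_normK (num_real (f x))) -(real_normK (num_real (g x))) lerXn2r ?nnegrE.
Qed.

End square_integrable.

Section square_integrable_probability.
Context d (T : measurableType d) (R : realType) (P : probability T R).

Lemma integrable_bounded (f : T -> R) (C : R) : measurable_fun setT f ->
  (forall x, `|f x| <= C) -> P.-integrable setT (EFin \o f).
Proof.
move=> mf fC; apply: le_integrable (finite_measure_integrable_cst P C measurableT) => //.
  exact/measurable_EFinP.
by move=> x _ /=; rewrite lee_fin (le_trans (fC x))// ler_norm.
Qed.

Lemma L2_bounded (f : T -> R) (C : R) : measurable_fun setT f ->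
  (forall x, `|f x| <= C) -> L2 P f.
Proof.
move=> mf fC; split => //.
have : P.-integrable setT (EFin \o (fun x => f x ^+ 2)).
  apply: (@integrable_bounded _ (C ^+ 2)); first exact: measurable_funX.
  by move=> x; rewrite normrX lerXn2r ?nnegrE// (le_trans _ (fC x)).
move=> /integrableP[_]; apply: le_lt_trans.
apply: ge0_le_integral => //.
- by move=> x _; rewrite lee_fin sqr_ge0.
- by apply/measurable_EFinP; exact: measurable_funX.
- by apply: measurableT_comp => //; apply/measurable_EFinP; exact: measurable_funX.
- by move=> x _ /=; rewrite lee_fin ler_norm.
Qed.

Lemma L2_cst (c : R) : L2 P (fun=> c).
Proof. by apply: (@L2_bounded _ `|c|). Qed.

Lemma L2_integrable (f : T -> R) : L2 P f -> P.-integrable setT (EFin \o f).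
Proof.
move=> Lf; apply: eq_integrable (L2_mul_integrable Lf (L2_cst 1)) => // x _ /=.
by rewrite mulr1.
Qed.

Lemma Rintegral_cst1 (c : R) : \int[P]_x c = c.
Proof. by rewrite Rintegral_cst// (_ : fine _ = 1) ?mulr1//=; have -> := probability_setT P. Qed.

Lemma abs_expectation_sqr_le (f : T -> R) : L2 P f ->
  (\int[P]_x `|f x|) ^+ 2 <= ip P f f.
Proof.
move=> Lf; have La : L2 P (fun x => `|f x|).
  apply: (L2_le _ Lf) => [|x]; last by rewrite normr_id.
  by apply: measurableT_comp => //; exact: (L2_measurable Lf).
have := ip_CauchySchwarz La (L2_cst 1).
rewrite {1 4}/ip; under eq_Rintegral do rewrite mulr1.
under [X in _ <= _ * X]eq_Rintegral do rewrite mulr1.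
rewrite Rintegral_cst1 mulr1 => /le_trans; apply.
by apply: ip_le => // x; rewrite normr_id.
Qed.

Lemma chebyshev_L2 (f : T -> R) (e : R) : L2 P f -> 0 < e ->
  (P [set w | e <= `|f w|]%R <= (ip P f f / e ^+ 2)%:E)%E.
Proof.
move=> Lf e0; have mf := L2_measurable Lf.
pose f' : {mfun T >-> R} := HB.pack f (isMeasurableFun.Build _ _ _ _ f mf).
have := @markov _ _ _ P f' (fun x => x ^+ 2) e e0 (@exprn_measurable R setT 2).
move=> h; rewrite -(@lee_pmul2l _ (e ^+ 2)%:E) ?lte_fin ?exprn_gt0//.
rewrite -EFinM mulrCA divff ?mulr1 ?expf_neq0 ?gt_eqF// -ip_sqrE//.
have -> : (\int[P]_x (f x ^+ 2)%:E = 'E_P[(((@GRing.exp R)^~ 2%N \o [eta Num.Def.normr]) \o f')])%E.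
  by rewrite unlock; apply: eq_integral => x _ /=; rewrite real_normK ?num_real.
apply: h; first by move=> r _; exact: sqr_ge0.
by move=> x y; rewrite !nnegrE => x0 y0 xy; rewrite lerXn2r.
Qed.

End square_integrable_probability.

(** * Gaussian variables and families *)

Lemma exprD_le2 {R : realDomainType} (a b : R) n : 0 <= a -> 0 <= b ->
  (a + b) ^+ n <= 2 ^+ n * (a ^+ n + b ^+ n).
Proof.
wlog ab : a b / a <= b => [H a0 b0|a0 b0].
  have [ab|/ltW ab] := leP a b; first exact: H.
  by rewrite addrC [X in _ * X]addrC; exact: H.
apply: (@le_trans _ _ (2 ^+ n * b ^+ n)); last by rewrite ler_wpM2l ?exprn_ge0// lerDr exprn_ge0.
by rewrite -exprMn lerXn2r ?nnegrE ?addr_ge0 ?mulr_ge0// mulr_natl mulr2n lerD2r.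
Qed.

Lemma lipschitz_of_derive {R : realType} (f df : R -> R) : (forall x : R, is_derive x 1 f (df x)) ->
  (forall x, `|df x| <= 1) -> forall x y, `|f x - f y| <= `|x - y|.
Proof.
move=> Df d1.
have h x y : x < y -> `|f x - f y| <= `|x - y|.
  move=> xy; have h1 z : z \in `]x, y[ -> is_derive z 1 f (df z) by move=> _; exact: Df.
  have h2 : {within `[x, y], continuous f}.
    apply: continuous_subspaceT => z; apply: differentiable_continuous; apply/derivable1_diffP.
    by have := Df z; case.
  have [c' _ e] := MVT xy h1 h2.
  by rewrite distrC e normrM (distrC x) ler_piMl.
move=> x y; have [xy|xy|->] := ltgtP x y; first exact: h.
  by rewrite distrC (distrC x); exact: h.
by rewrite !subrr.
Qed.

Section centered_gaussian_law.
Context d (T : measurableType d) (R : realType) (P : probability T R).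
Local Notation mu := (@lebesgue_measure R).
Local Notation c := ((Num.sqrt (pi *+ 2))^-1 : R).

Let c0 : 0 < c. Proof. by rewrite invr_gt0 sqrtr_gt0 mulrn_wgt0 ?pi_gt0. Qed.

Let cJ : c * Num.sqrt (pi *+ 2) = 1.
Proof. by rewrite mulVf// gt_eqF// -invr_gt0. Qed.

Let int_gauss0 : \int[mu]_x gauss0 x = Num.sqrt (pi *+ 2) :> R.
Proof.
have := integral_cos_gauss0 (0 : R); rewrite /gauss0 expr0n mulr0 oppr0 expR0 mulr1 => <-.
by apply: eq_Rintegral => x _; rewrite mul0r cos0 mul1r.
Qed.

Let i0 : mu.-integrable setT (EFin \o @gauss0 R).
Proof.
by apply: eq_integrable (integrable_pow_gauss0 0) => // x _ /=; rewrite expr0 mul1r.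
Qed.

(** One formula for both cases of [centered_gaussian]: the law of X is that of s times a standard
    normal variable, with [s = 0] when X vanishes almost surely. *)
Lemma centered_gaussian_integral (X : T -> R) : centered_gaussian P X ->
  exists2 s, 0 <= s & forall f : R -> R, continuous f -> (forall x, 0 <= f x) ->
  (\int[P]_w (f (X w))%:E = \int[mu]_x (c * (f (s * x) * gauss0 x))%:E)%E.
Proof.
move=> [mX [s]]; have [_ X0|s0 XP] := eqVneq s 0.
  exists 0 => // f cf f0.
  have mf : measurable_fun setT f by exact: continuous_measurable_fun.
  have mA : measurable [set w | X w = 0].
    by rewrite -[X in measurable X]setTI; exact: (mX measurableT _ (measurable_set1 0)).
  have -> : (\int[P]_w (f (X w))%:E = \int[P]_w (cst (f 0)%:E) w)%E.
    apply: ae_eq_integral => //.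
      by apply/measurable_EFinP; exact: measurableT_comp.
    exists (~` [set w | X w = 0]); split; first exact: measurableC.
      exact: (etrans (probability_setC P mA) (etrans (congr1 (fun x => 1 - x)%E X0) (subee _))).
    move=> w /= h XW; apply: h => _; by rewrite XW.
  rewrite integral_cst// [X in (_ * X)%E](probability_setT P) mule1.
  under eq_integral do rewrite mul0r mulrA EFinM.
  have ig : (\int[mu]_x (gauss0 x)%:E = (Num.sqrt (pi *+ 2))%:E :> \bar R)%E.
    by rewrite -int_gauss0 /Rintegral fineK ?integrable_fin_num.
  by rewrite integralZl// ig -EFinM mulrAC cJ mul1r.
exists `|s| => // f cf f0; rewrite -integral_normal_prob_scale//.
have mf : measurable_fun setT f by exact: continuous_measurable_fun.
pose X' : {mfun T >-> measurableTypeR R} := HB.pack X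
  (isMeasurableFun.Build _ _ T (measurableTypeR R) X (mX : @measurable_fun _ _ T (measurableTypeR R) setT X)).
pose PX : {measure set (measurableTypeR R) -> \bar R} := distribution P X'.
transitivity (\int[PX]_x (f x)%:E)%E; last first.
  by apply: eq_measure_integral => A mA _; exact: XP.
by rewrite ge0_integral_pushforward//; [exact/measurable_EFinP|move=> x _; rewrite lee_fin].
Qed.

Definition gmoment n : R := c * \int[mu]_x (x ^+ n.*2 * gauss0 x).

Lemma gmoment1_gt0 : 0 < gmoment 1.
Proof. by rewrite mulr_gt0// second_moment_gauss0. Qed.

(** The value is 1/2. The second moment [gmoment 1] is never evaluated; it is kept as a
    normalisation here and in [gmoment_const], which lets the variance [ip P X X] replace the scale
    s. *)
Definition gauss_rate : R := (2 * gmoment 1)^-1.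
Definition gmoment_const n : R := gmoment n / gmoment 1 ^+ n.

Lemma gmoment_const_ge0 n : 0 <= gmoment_const n.
Proof.
apply: divr_ge0; last by rewrite exprn_ge0// ltW// gmoment1_gt0.
rewrite mulr_ge0 ?(ltW c0)//; apply: Rintegral_ge0 => x _.
by rewrite mulr_ge0 ?expR_ge0// exprn_even_ge0// odd_double.
Qed.

Lemma centered_gaussian_props (X : T -> R) : centered_gaussian P X ->
  [/\ L2 P X,
      forall t, \int[P]_w cos (t * X w) = expR (- (gauss_rate * t ^+ 2 * ip P X X)),
      forall t, \int[P]_w sin (t * X w) = 0 &
      forall n, (\int[P]_w (X w ^+ n.*2)%:E = (gmoment_const n * ip P X X ^+ n)%:E)%E].
Proof.
move=> cX; have [mX _] := cX; have [s s0 Xs] := centered_gaussian_integral cX.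
have mom n : (\int[P]_w (X w ^+ n.*2)%:E = (s ^+ n.*2 * gmoment n)%:E)%E.
  rewrite (Xs (fun x => x ^+ n.*2)).
  - under eq_integral do rewrite exprMn -!mulrA mulrA EFinM.
    rewrite integralZl//; last exact: integrable_pow_gauss0.
    have ig := integrable_fin_num measurableT (@integrable_pow_gauss0 R n.*2).
    by rewrite /gmoment mulrA (mulrC (s ^+ _)) [in RHS]EFinM /Rintegral fineK.
  - exact: exprn_continuous.
  - by move=> x; rewrite exprn_even_ge0// odd_double.
have LX : L2 P X by split => //; rewrite (mom 1%N) ltry.
have ipE : ip P X X = s ^+ 2 * gmoment 1.
  by have := mom 1%N; rewrite (ip_sqrE LX) => -[].
have g1 := gmoment1_gt0.
have mcos (f : R -> R) t : continuous f -> measurable_fun setT (fun w => f (t * X w)).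
  by move=> cf; apply: measurableT_comp; [exact: continuous_measurable_fun|exact: measurable_funM].
have ccos (f : R -> R) (t : R) : continuous f -> continuous (fun x : R => f (t * x)).
  by move=> cf x; apply: continuous_comp; [apply: cvgM; [exact: cvg_cst|exact: cvg_id]|exact: cf].
have cs1 (x : R) : `|cos x| <= 1 by rewrite ler_norml cos_geN1 cos_le1.
have sn1 (x : R) : `|sin x| <= 1 by rewrite ler_norml sin_geN1 sin_le1.
have trig (f : R -> R) t : continuous f -> (forall x, `|f x| <= 1) ->
    \int[P]_w f (t * X w) = c * \int[mu]_x (f (t * s * x) * gauss0 x).
  move=> cf f1.
  have iP : P.-integrable setT (EFin \o (fun w => f (t * X w))).
    by apply: (@integrable_bounded _ _ _ _ _ 1) => //; exact: mcos.
  have imu : mu.-integrable setT (EFin \o (fun x => f (t * s * x) * gauss0 x)).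
    apply: le_integrable i0 => //.
      apply/measurable_EFinP; apply: measurable_funM; last exact: measurable_gauss0.
      by apply: continuous_measurable_fun; exact: ccos.
    by move=> x _ /=; rewrite lee_fin normrM ler_piMl.
  (* The law is available on nonnegative functions, hence the shift by 1, which cancels at the
     end. *)
  have := Xs (fun x => 1 + f (t * x)); move=> /(_ _ _)/wrap[].
  - by move=> x; apply: cvgD; [exact: cvg_cst|exact: ccos].
  - by move=> x; have := f1 (t * x); rewrite ler_norml => /andP[h _]; lra.
  move=> /(congr1 fine); rewrite -!/(Rintegral _ _ _) RintegralD//; last first.
    exact: (finite_measure_integrable_cst P 1 measurableT).
  rewrite Rintegral_cst1; under [X in _ = X]eq_Rintegral do rewrite mulrDl mul1r mulrA.
  rewrite RintegralZl//; last exact: (integrableD measurableT i0 imu).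
  by rewrite RintegralD// int_gauss0 mulrDr cJ => /addrI.
split => //.
- move=> t; rewrite (trig cos)//; last exact: continuous_cos.
  rewrite integral_cos_gauss0 mulrA cJ mul1r /gauss0 ipE; congr (expR (- _)).
  by rewrite /gauss_rate; field; rewrite gt_eqF.
- move=> t; rewrite (trig sin)//; last exact: continuous_sin.
  by rewrite integral_sin_gauss0 mulr0.
- move=> n; rewrite mom; congr EFin; rewrite ipE exprMn /gmoment_const -exprM mul2n.
  by field; rewrite expf_neq0// gt_eqF.
Qed.

(** The L2 closure of the centered Gaussian variables, to which Wiener integrals belong. The law
    itself is not carried to the limit: what passes is the characteristic function, together with a
    bound on even moments. *)
Definition near_gauss (X : T -> R) := measurable_fun setT X /\
  forall e, 0 < e -> exists Y, [/\ centered_gaussian P Y,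
    L2 P (fun w => X w - Y w) & ip P (fun w => X w - Y w) (fun w => X w - Y w) <= e].

Lemma near_gauss_props (X : T -> R) : near_gauss X ->
  [/\ L2 P X,
      forall t, \int[P]_w cos (t * X w) = expR (- (gauss_rate * t ^+ 2 * ip P X X)),
      forall t, \int[P]_w sin (t * X w) = 0 &
      forall n, (\int[P]_w (X w ^+ n.*2)%:E <= (4 ^+ n * gmoment_const n * ip P X X ^+ n)%:E)%E].
Proof.
move=> [mX nX].
have /choice[Y hY] (n : nat) : exists Y, [/\ centered_gaussian P Y,
    L2 P (fun w => X w - Y w) & ip P (fun w => X w - Y w) (fun w => X w - Y w) <= n.+1%:R^-1].
  by apply: nX; rewrite invr_gt0.
have LY n : L2 P (Y n) by have [/centered_gaussian_props[]] := hY n.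
pose D n w := X w - Y n w.
have LD n : L2 P (D n) by have [] := hY n.
have LX : L2 P X.
  have := L2D (LD 0%N) (LY 0%N); rewrite /D; under eq_fun do rewrite subrK.
  by [].
have D0 : ip P (D n) (D n) @[n --> \oo] --> (0 : R).
  apply: (squeeze_cvgr _ (cvg_cst 0) (@cvg_harmonic R)).
  by apply: nearW => n; rewrite ip_ge0/=; have [] := hY n.
have sD0 : Num.sqrt (ip P (D n) (D n)) @[n --> \oo] --> (0 : R).
  rewrite -(sqrtr0 R); apply: continuous_cvg => //; exact: sqrt_continuous.
(* Bounded 1-Lipschitz functions pass to the limit, since the mean of the absolute value of [D n] is
   at most its L2 norm. *)
have Lip (f : R -> R) t : continuous f -> (forall x, `|f x| <= 1) -> (forall x y, `|f x - f y| <= `|x - y|) ->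
    \int[P]_w f (t * Y n w) @[n --> \oo] --> \int[P]_w f (t * X w).
  move=> cf f1 fl.
  have iP Z : L2 P Z -> P.-integrable setT (EFin \o (fun w => f (t * Z w))).
    move=> LZ; apply: (@integrable_bounded _ _ _ _ _ 1) => //; apply: measurableT_comp.
      exact: continuous_measurable_fun.
    by apply: measurable_funM => //; exact: L2_measurable LZ.
  apply/subr_cvg0; apply: norm_cvg0.
  apply: (squeeze_cvgr _ (cvg_cst 0) (_ : `|t| * Num.sqrt (ip P (D n) (D n)) @[n --> \oo] --> (0 : R))); last first.
    by rewrite -(mulr0 `|t|); apply: cvgM => //; exact: cvg_cst.
  apply: nearW => n; rewrite normr_ge0/= -RintegralB//; try exact: iP.
  have Lab : L2 P (fun w => `|D n w|).
    by apply: (L2_le _ (LD n)) => [|w]; [apply: measurableT_comp => //; exact: (L2_measurable (LD n))|rewrite normr_id].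
  apply: (@le_trans _ _ (\int[P]_w (`|t| * `|D n w|))).
    have iB : P.-integrable setT (EFin \o (fun w => f (t * Y n w) - f (t * X w))).
      exact: (integrableB measurableT (iP _ (LY n)) (iP _ LX)).
    apply: le_trans (le_normr_Rintegral _ iB) _ => //; apply: le_Rintegral => //.
    - exact: (integrable_norm iB).
    - by apply: L2_integrable; exact: L2Z.
    - by move=> w _; rewrite (le_trans (fl _ _))// -mulrBr normrM /D (distrC (X w)).
  rewrite RintegralZl//; last exact: L2_integrable.
  rewrite ler_wpM2l// -(@ler_pXn2r _ 2)// ?nnegrE ?sqrtr_ge0//; last by apply: Rintegral_ge0.
  by rewrite sqr_sqrtr ?ip_ge0// abs_expectation_sqr_le.
have ipY : ip P (Y n) (Y n) @[n --> \oo] --> ip P X X.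
  have E n : ip P (Y n) (Y n) = ip P X X - 2 * ip P X (D n) + ip P (D n) (D n).
    rewrite -(ip_sqrB LX (LD n)) /D; congr (ip P _ _); apply/funext => w; ring.
  rewrite (eq_cvg _ _ E).
  suff : ip P X X - 2 * ip P X (D n) + ip P (D n) (D n) @[n --> \oo] --> ip P X X - 2 * 0 + 0.
    by rewrite mulr0 subr0 addr0.
  apply: cvgD => //; apply: cvgB; first exact: cvg_cst.
  apply: cvgM; first exact: cvg_cst.
  apply: norm_cvg0.
  apply: (squeeze_cvgr _ (cvg_cst 0) (_ : Num.sqrt (ip P X X) * Num.sqrt (ip P (D n) (D n)) @[n --> \oo] --> (0 : R))); last first.
    by rewrite -(mulr0 (Num.sqrt (ip P X X))); apply: cvgM => //; exact: cvg_cst.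
  apply: nearW => n; rewrite normr_ge0/= -sqrtr_sqr -sqrtrM ?ip_ge0//.
  by rewrite ler_wsqrtr// ip_CauchySchwarz.
have cs1 (x : R) : `|cos x| <= 1 by rewrite ler_norml cos_geN1 cos_le1.
have sn1 (x : R) : `|sin x| <= 1 by rewrite ler_norml sin_geN1 sin_le1.
have lc := @lipschitz_of_derive R cos (fun x => - sin x) (fun x => is_derive_cos x).
have ls := @lipschitz_of_derive R sin cos (fun x => is_derive_sin x) cs1.
split => //.
- move=> t; have h1 := Lip cos t (@continuous_cos R) cs1 (lc (fun x => _)).
  have {}h1 := h1 (fun x => eq_ind_r (fun y => is_true (y <= 1)) (sn1 x) (normrN (sin x))).
  have h2 : \int[P]_w cos (t * Y n w) @[n --> \oo] --> expR (- (gauss_rate * t ^+ 2 * ip P X X)).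
    have E n : \int[P]_w cos (t * Y n w) = expR (- (gauss_rate * t ^+ 2 * ip P (Y n) (Y n))).
      by have [/centered_gaussian_props[]] := hY n.
    rewrite (eq_cvg _ _ E); apply: continuous_cvg; first exact: continuous_expR.
    by apply: cvgN; apply: cvgM => //; exact: cvg_cst.
  by rewrite -(cvg_lim _ h1) ?(cvg_lim _ h2).
- move=> t; have h1 := Lip sin t (@continuous_sin R) sn1 ls.
  rewrite -(cvg_lim _ h1)//; apply: cvg_lim => //; apply: cvg_near_cst; apply: nearW => n.
  by have [/centered_gaussian_props[]] := hY n.
- case=> [|k]; first by rewrite !expr0 !mul1r mulr1 /gmoment_const expr0 divr1 /gmoment;
    under eq_integral do rewrite expr0; rewrite integral_cst// [X in (_ * X)%E](probability_setT P) mul1e;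
    under eq_Rintegral do rewrite mul1r; rewrite int_gauss0 cJ.
  (* L2 distance does not control higher moments, so X is truncated at level m. The truncated error
     then contributes at most [m ^+ (2k)] times the square of [D n], which vanishes with n;
     afterwards m tends to infinity by monotone convergence. The factor [4 ^+ n] comes from
     splitting an even power of a sum. *)
  set L := 4 ^+ _ * _ * _; pose f m w := Num.min `|X w| m%:R ^+ k.+1.*2.
  have mf m : measurable_fun setT (f m).
    apply: measurable_funX; apply: measurable_minr => //.
    exact: measurableT_comp.
  have f0 m w : 0 <= f m w by rewrite exprn_even_ge0// odd_double.
  have fL m : (\int[P]_w (f m w)%:E <= L%:E)%E.
    have fi : P.-integrable setT (EFin \o f m).
      apply: (@integrable_bounded _ _ _ _ _ (m%:R ^+ k.+1.*2)) => // w.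
      rewrite ger0_norm// /f lerXn2r ?nnegrE ?le_min ?normr_ge0//=.
      by rewrite ge_min lexx orbT.
    rewrite -(fineK (integrable_fin_num measurableT fi)) lee_fin.
    pose u n := 4 ^+ k.+1 * (gmoment_const k.+1 * ip P (Y n) (Y n) ^+ k.+1 + m%:R ^+ k.*2 * ip P (D n) (D n)).
    have uL : u n @[n --> \oo] --> L.
      have -> : L = 4 ^+ k.+1 * (gmoment_const k.+1 * ip P X X ^+ k.+1 + m%:R ^+ k.*2 * 0).
        by rewrite mulr0 addr0 mulrA.
      apply: cvgM; first exact: cvg_cst.
      apply: cvgD; (apply: cvgM; first exact: cvg_cst) => //.
      apply: (@cvg_comp _ _ _ (fun n => ip P (Y n) (Y n)) (fun x : R => x ^+ k.+1) _ _ _ ipY).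
      exact: exprn_continuous.
    apply: (ler_cvg_to (cvg_cst _) uL); apply: nearW => n.
    have i1 : P.-integrable setT (EFin \o (fun w => Y n w ^+ k.+1.*2)).
      apply/integrableP; split; first by apply/measurable_EFinP; apply: measurable_funX; exact: L2_measurable (LY n).
      under eq_integral do rewrite /= ger0_norm ?exprn_even_ge0 ?odd_double//.
      by have [/centered_gaussian_props[_ _ _ ->]] := hY n; rewrite ltry.
    have i2 := L2_sqr_integrable (LD n).
    have E1 : \int[P]_w (Y n w ^+ k.+1.*2) = gmoment_const k.+1 * ip P (Y n) (Y n) ^+ k.+1.
      by rewrite /Rintegral; have [/centered_gaussian_props[_ _ _ ->]] := hY n.
    have E2 : \int[P]_w (D n w ^+ 2) = ip P (D n) (D n).
      by rewrite /Rintegral ip_sqrE.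
    have i3 : P.-integrable setT (EFin \o (fun w => m%:R ^+ k.*2 * D n w ^+ 2)).
      exact: (integrableZl measurableT _ i2).
    have i4 : P.-integrable setT (EFin \o (fun w => Y n w ^+ k.+1.*2 + m%:R ^+ k.*2 * D n w ^+ 2)).
      exact: (integrableD measurableT i1 i3).
    rewrite /u -E1 -E2 -RintegralZl// -RintegralD// -RintegralZl//.
    apply: le_Rintegral => //; first exact: (integrableZl measurableT _ i4).
    move=> w _; pose b := Num.min `|D n w| m%:R.
    have b0 : 0 <= b by rewrite le_min normr_ge0/=.
    have h1 : Num.min `|X w| m%:R <= `|Y n w| + b.
      rewrite /b /D; case: (leP `|X w - Y n w| m%:R) => h.
        rewrite ge_min; apply/orP; left.
        by have := ler_normD (X w - Y n w) (Y n w); rewrite subrK addrC.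
      by rewrite ge_min lerDr normr_ge0 orbT.
    have h2 : b ^+ k.+1.*2 <= m%:R ^+ k.*2 * D n w ^+ 2.
      have -> : k.+1.*2 = (k.*2 + 2)%N by rewrite doubleS addn2.
      rewrite exprD ler_pM ?exprn_ge0//.
        by rewrite lerXn2r ?nnegrE// ge_min lexx orbT.
      by rewrite -(real_normK (num_real (D n w))) lerXn2r ?nnegrE// ge_min lexx.
    have h3 : `|Y n w| ^+ k.+1.*2 = Y n w ^+ k.+1.*2.
      by rewrite -mul2n exprM real_normK ?num_real// -exprM.
    apply: (@le_trans _ _ ((`|Y n w| + b) ^+ k.+1.*2)).
      by rewrite lerXn2r ?nnegrE ?addr_ge0// le_min normr_ge0/=.
    apply: (@le_trans _ _ (4 ^+ k.+1 * (`|Y n w| ^+ k.+1.*2 + b ^+ k.+1.*2))); last first.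
      by rewrite ler_wpM2l ?exprn_ge0// h3 lerD2l.
    have -> : 4 ^+ k.+1 = 2 ^+ k.+1.*2 :> R by rewrite -mul2n exprM; congr (_ ^+ _); ring.
    exact: exprD_le2.
  have -> : (\int[P]_w (X w ^+ k.+1.*2)%:E = \int[P]_w limn (fun m => (f m w)%:E))%E.
    apply: eq_integral => w _; apply/esym/cvg_lim => //.
    apply: cvg_near_cst; near=> m; congr EFin.
    rewrite /f min_l; first by rewrite -mul2n exprM real_normK ?num_real// -exprM.
    by near: m; exact: nbhs_infty_ger.
  rewrite monotone_convergence//.
  + apply: lime_le; last by apply: nearW => m; exact: fL.
    apply: ereal_nondecreasing_is_cvgn => m m' mm'; apply: ge0_le_integral => //.
    * by move=> w _; rewrite lee_fin.
    * exact/measurable_EFinP.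
    * exact/measurable_EFinP.
    * move=> w _; rewrite lee_fin lerXn2r ?nnegrE ?le_min ?normr_ge0//=.
      by rewrite ge_min lexx/= ge_min ler_nat mm' orbT.
  + by move=> m; exact/measurable_EFinP.
  + by move=> m w _; rewrite lee_fin.
  + move=> w _ m m' mm'; rewrite lee_fin lerXn2r ?nnegrE ?le_min ?normr_ge0//=.
    by rewrite ge_min lexx/= ge_min ler_nat mm' orbT.
Unshelve. all: end_near. Qed.

End centered_gaussian_law.

Section bernoulli_inequalities.
Context {R : realType}.

Lemma expr_succ_ge1D (n : nat) (x : R) : 0 <= x -> 1 + n%:R * x <= (1 + x) ^+ n.
Proof.
move=> x0; elim: n => [|n IH]; first by rewrite mul0r addr0 expr0.
rewrite exprS; apply: (@le_trans _ _ ((1 + x) * (1 + n%:R * x))); last first.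
  by rewrite ler_wpM2l// addr_ge0.
have := mulr_ge0 (ler0n R n) (mulr_ge0 x0 x0); rewrite -natr1; nra.
Qed.

Lemma expr_onem_ge (n : nat) (x : R) : 0 <= x <= 1 -> 1 - n%:R * x <= (1 - x) ^+ n.
Proof.
move=> /andP[x0 x1]; elim: n => [|n IH]; first by rewrite mul0r subr0 expr0.
rewrite exprS; apply: (@le_trans _ _ ((1 - x) * (1 - n%:R * x))); last first.
  by rewrite ler_wpM2l// subr_ge0.
have := mulr_ge0 (ler0n R n) (mulr_ge0 x0 x0); rewrite -natr1; nra.
Qed.

End bernoulli_inequalities.

Lemma nbhs_infty_gerS {R : realType} (r : R) : \forall m \near \oo, r <= m.+1%:R.
Proof. by apply: filterS (nbhs_infty_ger r) => m /le_trans; apply; rewrite ler_nat. Qed.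

(** * Characteristic functions determine laws on cylinder sets *)

Section trigonometric_polynomials.
Context {R : realType} {I : Type}.

Definition comb (s : seq (R * I)) (x : I -> R) : R := \sum_(c <- s) c.1 * x c.2.

(** Cosines with a phase also give sines; the product-to-sum formulas make the class an algebra, and
    the mean of each member is determined by characteristic functions. *)
Inductive trigpoly : ((I -> R) -> R) -> Prop :=
| trigpoly_cos c t s : trigpoly (fun x => c * cos (t + comb s x))
| trigpoly_add F G : trigpoly F -> trigpoly G -> trigpoly (fun x => F x + G x).

Lemma comb_cat s s' x : comb (s ++ s') x = comb s x + comb s' x.
Proof. by rewrite /comb big_cat. Qed.

Lemma comb_neg s x : comb [seq (- c.1, c.2) | c <- s] x = - comb s x.
Proof. by rewrite /comb big_map -sumrN; apply: eq_bigr => c _; rewrite mulNr. Qed.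

Lemma trigpoly_ext F G : F =1 G -> trigpoly F -> trigpoly G.
Proof. by move=> /funext ->. Qed.

Lemma trigpoly_cst c : trigpoly (fun=> c).
Proof.
by apply: trigpoly_ext (trigpoly_cos c 0 [::]) => x; rewrite /comb big_nil addr0 cos0 mulr1.
Qed.

Lemma trigpoly_mul F G : trigpoly F -> trigpoly G -> trigpoly (fun x => F x * G x).
Proof.
move=> tF tG; elim: tF => [c t s|F1 F2 _ h1 _ h2]; last first.
  by apply: trigpoly_ext (trigpoly_add h1 h2) => x; rewrite mulrDl.
elim: tG => [c' t' s'|G1 G2 _ h1 _ h2]; last first.
  by apply: trigpoly_ext (trigpoly_add h1 h2) => x; rewrite mulrDr.
apply: trigpoly_ext (trigpoly_add
  (trigpoly_cos (c * c' / 2) (t + t') (s ++ s'))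
  (trigpoly_cos (c * c' / 2) (t - t') (s ++ [seq (- c.1, c.2) | c <- s']))) => x.
rewrite !comb_cat comb_neg.
have -> : t + t' + (comb s x + comb s' x) = (t + comb s x) + (t' + comb s' x) by ring.
have -> : t - t' + (comb s x - comb s' x) = (t + comb s x) - (t' + comb s' x) by ring.
by rewrite cosD cosB; field.
Qed.

Lemma trigpoly_exp F n : trigpoly F -> trigpoly (fun x => F x ^+ n).
Proof.
move=> tF; elim: n => [|n IH]; first exact: trigpoly_ext (trigpoly_cst 1).
by apply: trigpoly_ext (trigpoly_mul tF IH) => x; rewrite exprS.
Qed.

Lemma trigpoly_scale c F : trigpoly F -> trigpoly (fun x => c * F x).
Proof. by move=> tF; exact: trigpoly_mul (trigpoly_cst c) tF. Qed.

Lemma trigpoly_prod (J : Type) (q : seq J) (F : J -> (I -> R) -> R) :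
  (forall j, trigpoly (F j)) -> trigpoly (fun x => \prod_(j <- q) F j x).
Proof.
move=> tF; elim: q => [|j q IH].
  by apply: trigpoly_ext (trigpoly_cst 1) => x; rewrite big_nil.
by apply: trigpoly_ext (trigpoly_mul (tF j) IH) => x; rewrite big_cons.
Qed.

Lemma trigpoly_sin (i : I) (t c : R) : trigpoly (fun x => sin (t + c * x i)).
Proof.
apply: trigpoly_ext (trigpoly_cos 1 (t - pi / 2) [:: (c, i)]) => x.
by rewrite /comb big_seq1 mul1r addrAC cosBpihalf.
Qed.

(** With [s = (1 - sin t) / 2], the Stone-Weierstrass device [(1 - s ^+ n) ^+ (2 ^ n)] tends to 1
    for [2 s < 1] and to 0 for [2 s > 1], so it tests the sign of [sin t]. Dividing by [m.+1] slows
    the sine down, so that t stays in [-1, 1] for fixed y and large m. Subtracting the inverse of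
    [m.+1] makes the limit 0 also at [y = a], where t is of order [m.+1 ^- 2], which the exponent
    [m.+1 ^ 4] still resolves. *)
Definition softstep (m : nat) (a y : R) : R :=
  (1 - ((1 - sin ((y - a - m.+1%:R^-1) / m.+1%:R)) / 2) ^+ (m.+1 ^ 4)) ^+ (2 ^ (m.+1 ^ 4)).

Lemma softstep_itv m a y : 0 <= softstep m a y <= 1.
Proof.
rewrite /softstep; set s := _ / 2.
have s0 : 0 <= s by rewrite divr_ge0// subr_ge0 sin_le1.
have s1 : s <= 1 by rewrite ler_pdivrMr// mul1r lerBlDr -lerBlDl (le_trans _ (sin_geN1 _))//; lra.
have sn : 0 <= 1 - s ^+ (m.+1 ^ 4) by rewrite subr_ge0 exprn_ile1.
by rewrite exprn_ge0//= exprn_ile1// lerBlDr lerDl exprn_ge0.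
Qed.

Lemma trigpoly_softstep m a i : trigpoly (fun x => softstep m a (x i)).
Proof.
rewrite /softstep; apply: trigpoly_exp.
apply: trigpoly_ext (trigpoly_add (trigpoly_cst 1) (trigpoly_scale (-1) (trigpoly_exp (m.+1 ^ 4)
   (trigpoly_scale 2^-1 (trigpoly_add (trigpoly_cst 1) (trigpoly_scale (-1)
   (trigpoly_sin i (- (a + m.+1%:R^-1) / m.+1%:R) m.+1%:R^-1))))))) => x /=.
have -> : (x i - a - m.+1%:R^-1) / m.+1%:R = - (a + m.+1%:R^-1) / m.+1%:R + m.+1%:R^-1 * x i.
  have : m.+1%:R != 0 :> R by rewrite pnatr_eq0.
  by move: (m.+1%:R : R) => M M0; field.
by rewrite !mulN1r (mulrC 2^-1).
Qed.

Lemma sin_ge_half (t : R) : 0 <= t <= 1 -> t / 2 <= sin t.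
Proof.
move=> /andP[t0 t1]; have [->|tn] := eqVneq t 0; first by rewrite mul0r sin0.
have tp : 0 < t by rewrite lt_neqAle eq_sym tn.
have h1 (z : R) : z \in `]0, t[ -> is_derive z 1 sin (cos z) by move=> _; exact: is_derive_sin.
have h2 : {within `[0, t], continuous (@sin R)}.
  by apply: continuous_subspaceT; exact: continuous_sin.
have [c + +] := MVT tp h1 h2; rewrite in_itv/= sin0 !subr0 => /andP[c0 ct] ->.
rewrite mulrC ler_wpM2r//.
have -> : cos c = 1 - sin (c / 2) ^+ 2 *+ 2.
  have := cos_mulr2n (c / 2); have -> : (c / 2) *+ 2 = c by rewrite -mulr_natr divfK.
  move=> ->.
  by have := cos2Dsin2 (c / 2); lra.
have : sin (c / 2) ^+ 2 <= (c / 2) ^+ 2.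
  rewrite -(real_normK (num_real (sin _))) -(real_normK (num_real (c / 2))).
  by rewrite lerXn2r ?nnegrE// sin_norm_le.
by nra.
Qed.

Let N m : nat := m.+1 ^ 4.

Let half_pow (s : R) n : 0 <= s <= 1 -> 1 - (2 * s) ^+ n <= (1 - s ^+ n) ^+ (2 ^ n).
Proof.
move=> /andP[s0 s1]; have sn : 0 <= s ^+ n <= 1 by rewrite exprn_ge0//= exprn_ile1.
by have := expr_onem_ge (2 ^ n) sn; rewrite natrX -exprMn.
Qed.

(** The product of [(1 - x) ^+ N] and [(1 + x) ^+ N] is at most 1, and Bernoulli's inequality bounds
    the second factor from below. *)
Let half_pow' (s : R) n : 0 < s <= 1 -> (1 - s ^+ n) ^+ (2 ^ n) <= ((2 * s) ^+ n)^-1.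
Proof.
move=> /andP[sp s1]; have sn0 : 0 < s ^+ n by rewrite exprn_gt0.
have sn1 : s ^+ n <= 1 by rewrite exprn_ile1// ltW.
have h1 : 2 ^+ n * s ^+ n <= (1 + s ^+ n) ^+ (2 ^ n).
  by have := expr_succ_ge1D (2 ^ n) (ltW sn0); rewrite natrX => /(le_trans _); apply; rewrite lerDr.
have h2 : (1 - s ^+ n) ^+ (2 ^ n) * (1 + s ^+ n) ^+ (2 ^ n) <= 1.
  rewrite -exprMn exprn_ile1//; first by rewrite mulr_ge0 ?subr_ge0// addr_ge0// ltW.
  by nra.
rewrite -[leRHS]mul1r ler_pdivlMr ?exprn_gt0 ?mulr_gt0// exprMn.
by apply: le_trans h2; rewrite ler_wpM2l// exprn_ge0// subr_ge0.
Qed.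

Lemma cvg_softstep_gt (a y : R) : a < y -> softstep m a y @[m --> \oo] --> (1 : R).
Proof.
move=> ay; have h : 1 - 4 / (y - a) * m.+1%:R^-1 @[m --> \oo] --> (1 : R).
  rewrite -[X in _ --> X]subr0 -[in X in _ --> X](mulr0 (4 / (y - a))); apply: cvgB; first exact: cvg_cst.
  by apply: cvgM; [exact: cvg_cst|exact: cvg_harmonic].
refine (@squeeze_cvgr _ _ _ _ (fun m => 1 - 4 / (y - a) * m.+1%:R^-1) (fun=> 1 : R) _ _ (1 : R) h (cvg_cst (1 : R))).
near=> m; have /andP[_ ->] := softstep_itv m a y; rewrite andbT.
have M0 : 0 < m.+1%:R :> R by [].
have [M ME] : exists M : R, M = m.+1%:R by eexists.
rewrite -ME in M0 *.
have M1 : M^-1 <= (y - a) / 2.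
  by rewrite invf_ple ?posrE ?divr_gt0 ?subr_gt0// invf_div ME; near: m; apply: nbhs_infty_gerS.
have M2 : y - a <= M by rewrite ME; near: m; apply: nbhs_infty_gerS.
have [t tE] : exists t : R, t = (y - a - M^-1) / M by eexists.
have Mi : 0 < M^-1 by rewrite invr_gt0.
have t1 : (y - a) / 2 / M <= t.
  have h1 (x z : R) : x <= z / 2 -> z / 2 <= z - x by move=> ?; lra.
  by rewrite tE ler_pM2r ?invr_gt0// h1.
have t2 : t <= 1 by rewrite tE ler_pdivrMr// mul1r; lra.
have t0 : 0 < t by apply: lt_le_trans t1; rewrite !divr_gt0// subr_gt0.
have st : t / 2 <= sin t by apply: sin_ge_half; rewrite t2 (ltW t0).
have s1 := sin_le1 t.
rewrite /softstep -ME -tE; set s := _ / 2.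
have s01 : 0 <= s <= 1 by rewrite /s; apply/andP; split; lra.
apply: le_trans (half_pow _ s01); rewrite lerD2l lerN2.
have -> : 2 * s = 1 - sin t by rewrite /s; field.
have h2 : (1 - sin t) ^+ (m.+1 ^ 4) * (1 + (m.+1 ^ 4)%:R * sin t) <= 1.
  apply: (@le_trans _ _ ((1 - sin t) ^+ (m.+1 ^ 4) * (1 + sin t) ^+ (m.+1 ^ 4))).
    rewrite ler_wpM2l ?exprn_ge0 ?subr_ge0// expr_succ_ge1D// (le_trans _ st)// divr_ge0// ltW//.
  by rewrite -exprMn exprn_ile1//; nra.
have p0 : 0 <= (1 - sin t) ^+ (m.+1 ^ 4) by rewrite exprn_ge0 ?subr_ge0.
have NM : (m.+1 ^ 4)%:R = M ^+ 4 by rewrite natrX ME.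
have h3 : (y - a) * M / 4 <= 1 + (m.+1 ^ 4)%:R * sin t.
  rewrite NM; apply: (@le_trans _ _ (M ^+ 4 * ((y - a) / 2 / M / 2))).
    have -> : M ^+ 4 * ((y - a) / 2 / M / 2) = (y - a) * M / 4 * M ^+ 2 by field; rewrite gt_eqF.
    by rewrite ler_peMr// ?divr_ge0 ?mulr_ge0 ?subr_ge0 ?(ltW M0) ?(ltW ay)// exprn_ege1// ME ler1n.
  have h4 : M ^+ 4 * ((y - a) / 2 / M / 2) <= M ^+ 4 * sin t.
    by rewrite ler_wpM2l ?exprn_ge0 ?(ltW M0)// (le_trans _ st)// ler_wpM2r.
  lra.
have yM : 0 < (y - a) * M / 4 by rewrite divr_gt0// mulr_gt0// subr_gt0.
have -> : 4 / (y - a) * M^-1 = ((y - a) * M / 4)^-1.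
  by field; rewrite gt_eqF// subr_eq0 gt_eqF.
rewrite -[leRHS]mul1r ler_pdivlMr//; apply: le_trans h2.
by rewrite ler_wpM2l.
Unshelve. all: end_near. Qed.

Lemma cvg_softstep_le (a y : R) : y <= a -> softstep m a y @[m --> \oo] --> (0 : R).
Proof.
move=> ya; have h : 2 * m.+1%:R^-1 @[m --> \oo] --> (0 : R).
  by rewrite -[in X in _ --> X](mulr0 2); apply: cvgM; [exact: cvg_cst|exact: cvg_harmonic].
refine (@squeeze_cvgr _ _ _ _ (fun=> 0 : R) (fun m => 2 * m.+1%:R^-1) _ _ (0 : R) (cvg_cst (0 : R)) h).
near=> m; have /andP[-> _] := softstep_itv m a y; rewrite /=.
have M0 : 0 < m.+1%:R :> R by [].
have [M ME] : exists M : R, M = m.+1%:R by eexists.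
rewrite -ME in M0 *.
have M2 : a - y + 1 <= M by rewrite ME; near: m; apply: nbhs_infty_gerS.
have [t tE] : exists t : R, t = (a - y + M^-1) / M by eexists.
have Mi : 0 < M^-1 by rewrite invr_gt0.
have M1 : 1 <= M by rewrite ME ler1n.
have Mi1 : M^-1 <= 1 by rewrite invf_le1.
have t1 : M^-1 / M <= t by rewrite tE ler_pM2r ?invr_gt0// lerDr subr_ge0.
have t2 : t <= 1 by rewrite tE ler_pdivrMr// mul1r; lra.
have t0 : 0 < t by apply: lt_le_trans t1; rewrite divr_gt0.
have st : t / 2 <= sin t by apply: sin_ge_half; rewrite t2 (ltW t0).
have s1 := sin_le1 t.
rewrite /softstep -ME; have -> : (y - a - M^-1) / M = - t by rewrite tE; field; rewrite gt_eqF.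
rewrite sinN opprK; set s := _ / 2.
have s01 : 0 < s <= 1 by rewrite /s; apply/andP; split; lra.
apply: le_trans (half_pow' _ s01) _.
have -> : 2 * s = 1 + sin t by rewrite /s; field.
have sp : 0 <= sin t by lra.
have NM : (m.+1 ^ 4)%:R = M ^+ 4 by rewrite natrX ME.
have h3 : M / 2 <= (1 + sin t) ^+ (m.+1 ^ 4).
  apply: le_trans (expr_succ_ge1D _ sp); rewrite NM.
  apply: (@le_trans _ _ (M ^+ 4 * (M^-1 / M / 2))).
    have -> : M ^+ 4 * (M^-1 / M / 2) = M / 2 * M by field; rewrite gt_eqF.
    by rewrite ler_peMr// divr_ge0// ltW.
  have h4 : M ^+ 4 * (M^-1 / M / 2) <= M ^+ 4 * sin t.
    by rewrite ler_wpM2l ?exprn_ge0 ?(ltW M0)// (le_trans _ st)// ler_wpM2r.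
  lra.
have -> : 2 * M^-1 = (M / 2)^-1 by rewrite invf_div.
by rewrite lef_pV2// ?posrE ?divr_gt0// exprn_gt0//; lra.
Unshelve. all: end_near. Qed.

End trigonometric_polynomials.

Section equal_laws.
Context {R : realType} {I : Type}.

(** These sets form a pi-system generating the cylinder sets, and their indicators are the limits of
    products of [softstep]. Membership is [List.In] because the index type has no decidable
    equality. *)
Definition upper_orthant (q : seq (I * R)) : set (I -> R) :=
  [set x | forall c, List.In c q -> c.2 < x c.1].

Definition cylinders : set (set (I -> R)) := range upper_orthant.

Lemma cylinders_setI : setI_closed cylinders.
Proof.
move=> _ _ [q _ <-] [q' _ <-]; exists (q ++ q') => //.
apply/seteqP; split => x /=.
  by move=> h; split => c cq; apply: h; apply: List.in_or_app; [left|right].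
by move=> [h h'] c cq; have [] := List.in_app_or _ _ _ cq; [exact: h|exact: h'].
Qed.

Lemma measurable_preimage_cylinder d (T : measurableType d) (X : I -> T -> R) (A : set (I -> R)) :
  (forall i, measurable_fun setT (X i)) -> <<s cylinders >> A -> measurable [set w | A (X ^~ w)].
Proof.
move=> mX; apply: (@smallest_sub _ _ _ [set A | measurable [set w | A (X ^~ w)]]).
  split => /=.
  - by rewrite (_ : [set _ | _] = set0)//; exact/seteqP.
  - move=> B mB; rewrite (_ : [set _ | _] = ~` [set w | B (X ^~ w)]); first exact: measurableC.
    by apply/seteqP; split => w /=; [move=> [] |move=> ?; split].
  - move=> F mF; rewrite (_ : [set _ | _] = \bigcup_n [set w | F n (X ^~ w)]).
      exact: bigcup_measurable.
    by apply/seteqP; split => w [n _ ?]; exists n.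
move=> _ [q _ <-]; elim: q => [|c q IH].
  have -> : upper_orthant [::] = setT by apply/seteqP; split => // w _ c [].
  exact: measurableT.
rewrite /= (_ : [set _ | _] = (X c.1 @^-1` `]c.2, +oo[) `&` [set w | upper_orthant q (X ^~ w)]).
  apply: measurableI => //; rewrite -[X in measurable X]setTI; exact: mX.
apply/seteqP; split => w /=.
  move=> h; split; first by rewrite in_itv/= andbT; apply: h; left.
  by move=> c' cq; apply: h; right.
by move=> [+ h] c' [<-|/h//]; rewrite in_itv/= andbT.
Qed.

Context d (T : measurableType d) (P : probability T R) d' (T' : measurableType d') (P' : probability T' R).
Variables (X : I -> T -> R) (X' : I -> T' -> R).
Hypothesis mX : forall i, measurable_fun setT (X i).
Hypothesis mX' : forall i, measurable_fun setT (X' i).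
Hypothesis cosE : forall s, \int[P]_w cos (comb s (X ^~ w)) = \int[P']_w cos (comb s (X' ^~ w)).
Hypothesis sinE : forall s, \int[P]_w sin (comb s (X ^~ w)) = \int[P']_w sin (comb s (X' ^~ w)).

Let measurable_comb d0 (T0 : measurableType d0) (Y : I -> T0 -> R) s :
  (forall i, measurable_fun setT (Y i)) -> measurable_fun setT (fun w => comb s (Y ^~ w)).
Proof.
by move=> mY; apply: measurable_sum => c; apply: measurable_funM.
Qed.

Let int_trig d0 (T0 : measurableType d0) (P0 : probability T0 R) (Y : I -> T0 -> R) (F : (I -> R) -> R) :
  (forall i, measurable_fun setT (Y i)) -> trigpoly F -> P0.-integrable setT (EFin \o (fun w => F (Y ^~ w))).
Proof.
move=> mY; elim=> [c t s|F1 F2 _ h1 _ h2]; last exact: (integrableD measurableT h1 h2).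
apply: (@integrable_bounded _ _ _ _ _ `|c|).
  apply: measurable_funM => //; apply: measurableT_comp.
    by apply: continuous_measurable_fun; exact: continuous_cos.
  by apply: measurable_funD => //; exact: measurable_comb.
by move=> w; rewrite normrM ler_piMr// ler_norml cos_geN1 cos_le1.
Qed.

Lemma trigpoly_integral F : trigpoly F -> \int[P]_w F (X ^~ w) = \int[P']_w F (X' ^~ w).
Proof.
elim=> [c t s|F1 F2 t1 h1 t2 h2]; last first.
  rewrite RintegralD//; [|exact: int_trig|exact: int_trig].
  rewrite RintegralD//; [|exact: int_trig|exact: int_trig].
  by rewrite h1 h2.
have bd (f : R -> R) d0 (T0 : measurableType d0) (P0 : probability T0 R) (Y : I -> T0 -> R) :
   continuous f -> (forall x, `|f x| <= 1) -> (forall i, measurable_fun setT (Y i)) ->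
   P0.-integrable setT (EFin \o (fun w => f (comb s (Y ^~ w)))).
  move=> cf f1 mY; apply: (@integrable_bounded _ _ _ _ _ 1) => //.
  apply: measurableT_comp; last exact: measurable_comb.
  exact: continuous_measurable_fun.
have cs1 (x : R) : `|cos x| <= 1 by rewrite ler_norml cos_geN1 cos_le1.
have sn1 (x : R) : `|sin x| <= 1 by rewrite ler_norml sin_geN1 sin_le1.
have E d0 (T0 : measurableType d0) (P0 : probability T0 R) (Y : I -> T0 -> R) :
   (forall i, measurable_fun setT (Y i)) -> \int[P0]_w (c * cos (t + comb s (Y ^~ w))) =
   c * cos t * \int[P0]_w cos (comb s (Y ^~ w)) - c * sin t * \int[P0]_w sin (comb s (Y ^~ w)).
  move=> mY; have i1 := bd cos _ _ P0 Y (@continuous_cos R) cs1 mY.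
  have i2 := bd sin _ _ P0 Y (@continuous_sin R) sn1 mY.
  rewrite -RintegralZl// -RintegralZl// -RintegralB//.
  - by apply: eq_Rintegral => w _; rewrite cosD; ring.
  - exact: (integrableZl measurableT _ i1).
  - exact: (integrableZl measurableT _ i2).
by rewrite !E// cosE sinE.
Qed.

Let lim_orthant d0 (T0 : measurableType d0) (P0 : probability T0 R) (Y : I -> T0 -> R) q :
  (forall i, measurable_fun setT (Y i)) ->
  (fun m => \int[P0]_w \prod_(c <- q) softstep m c.2 (Y c.1 w)) @ \oo -->
  fine (P0 [set w | upper_orthant q (Y ^~ w)]).
Proof.
move=> mY; pose F m w := \prod_(c <- q) softstep m c.2 (Y c.1 w).
pose A := [set w | upper_orthant q (Y ^~ w)].
have mA : measurable A by apply: measurable_preimage_cylinder => //; apply: sub_sigma_algebra; exists q.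
have iF m := int_trig P0 mY (@trigpoly_prod _ _ _ q _ (fun c => trigpoly_softstep m c.2 c.1)).
have [|||||_ _] := @dominated_convergence _ _ _ P0 setT measurableT (fun m w => (F m w)%:E)
   (fun w => (\1_A w)%:E) (fun=> 1%E).
- by move=> m; case/integrableP: (iF m).
- exact/measurable_EFinP.
- apply: aeW => w _; apply: cvg_EFin; first by apply: nearW.
  have -> : \1_A w = \prod_(c <- q) (if c.2 < Y c.1 w then 1 else 0) :> R.
    rewrite indicE; case: (boolP (w \in A)) => /=; rewrite ?inE ?notin_setE /A /=.
      elim: q {F A mA iF} => [|c q IH] h; first by rewrite big_nil.
      rewrite big_cons -IH; last by move=> c' cq; apply: h; right.
      by rewrite ifT ?mulr1//; apply: h; left.
    elim: q {F A mA iF} => [|c q IH] h; first by exfalso; apply: h => c [].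
    rewrite big_cons; case: ifPn => cw; last by rewrite mul0r.
    rewrite mul1r; apply: IH => h'; apply: h => c' [<-//|]; exact: h'.
  rewrite /F; elim: q {F A mA iF} => [|c q IH] /=.
    by rewrite big_nil; under eq_fun do rewrite big_nil; exact: cvg_cst.
  rewrite big_cons; under eq_fun do rewrite big_cons; apply: cvgM => //.
  by case: ltP => h; [exact: cvg_softstep_gt|exact: cvg_softstep_le].
- exact: (finite_measure_integrable_cst P0 1 measurableT).
- apply: aeW => w m _; rewrite lee_fin /F; elim: q {F A mA iF} => [|c q IH].
    by rewrite big_nil normr1.
  rewrite big_cons normrM mulr_ile1//; have /andP[h0 h1] := softstep_itv m c.2 (Y c.1 w).
  by rewrite ger0_norm.
rewrite integral_indic// setIT => h; apply: fine_cvg.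
by rewrite fineK//; exact: fin_num_measure.
Qed.

Lemma orthant_law q :
  P [set w | upper_orthant q (X ^~ w)] = P' [set w | upper_orthant q (X' ^~ w)].
Proof.
have mA d0 (T0 : measurableType d0) (Y : I -> T0 -> R) : (forall i, measurable_fun setT (Y i)) ->
   measurable [set w | upper_orthant q (Y ^~ w)].
  by move=> mY; apply: measurable_preimage_cylinder => //; apply: sub_sigma_algebra; exists q.
rewrite -(fineK (fin_num_measure P _ (mA _ _ _ mX))) -(fineK (fin_num_measure P' _ (mA _ _ _ mX'))).
congr EFin; rewrite -(cvg_lim _ (@lim_orthant _ _ P X q mX))// -(cvg_lim _ (@lim_orthant _ _ P' X' q mX'))//.
congr (limn _); apply/funext => m.
exact: (trigpoly_integral (trigpoly_prod q (fun c => trigpoly_softstep m c.2 c.1))).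
Qed.

(** Products of [softstep] are trigonometric polynomials that converge boundedly to indicators of
    orthants, so the two laws agree on orthants; Dynkin's lemma extends this to all cylinder
    sets. *)
Lemma equal_laws (A : set (I -> R)) : <<s cylinders >> A ->
  P [set w | A (X ^~ w)] = P' [set w | A (X' ^~ w)].
Proof.
pose D (A : set (I -> R)) := [/\ measurable [set w | A (X ^~ w)], measurable [set w | A (X' ^~ w)] &
  P [set w | A (X ^~ w)] = P' [set w | A (X' ^~ w)]].
suff : <<s cylinders >> `<=` D by move=> + /[dup] hA => /(_ _ hA)[].
rewrite -(setI_closed_g_dynkin_g_sigma_algebra cylinders_setI).
apply: smallest_sub; last first.
  move=> _ [q _ <-]; split; last exact: orthant_law.
    by apply: measurable_preimage_cylinder => //; apply: sub_sigma_algebra; exists q.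
  by apply: measurable_preimage_cylinder => //; apply: sub_sigma_algebra; exists q.
split.
- by split; [exact: measurableT|exact: measurableT|exact: (etrans (probability_setT P) (esym (probability_setT P')))].
- move=> B [m1 m2 e]; rewrite /D.
  split; [exact: measurableC|exact: measurableC|].
  exact: (etrans (probability_setC P m1) (etrans (congr1 (fun x => 1 - x)%E e) (esym (probability_setC P' m2)))).
- move=> F tF mF; rewrite /D.
  have -> : [set w | (\bigcup_n F n) (X ^~ w)] = \bigcup_n [set w | F n (X ^~ w)] by [].
  have -> : [set w | (\bigcup_n F n) (X' ^~ w)] = \bigcup_n [set w | F n (X' ^~ w)] by [].
  have m1 n : measurable [set w | F n (X ^~ w)] by case: (mF n).
  have m2 n : measurable [set w | F n (X' ^~ w)] by case: (mF n).
  split; [exact: bigcup_measurable|exact: bigcup_measurable|].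
  rewrite !measure_semi_bigcup//; try exact: bigcup_measurable.
  + by apply: eq_eseriesr => n _; case: (mF n).
  + by move=> i j _ _ [w /= [h1 h2]]; apply: tF => //; exists (X' ^~ w).
  + by move=> i j _ _ [w /= [h1 h2]]; apply: tF => //; exists (X ^~ w).
Qed.

End equal_laws.

(** * Independence of uncorrelated Gaussian families *)

Section product_probability.
Context d (T : measurableType d) {R : realType} (P : probability T R)
  d' (T' : measurableType d') (P' : probability T' R).

Local Notation PP := (P \x P')%E.

Lemma Rintegral_prod_mul (f : T -> R) (g : T' -> R) (C : R) :
  measurable_fun setT f -> measurable_fun setT g ->
  (forall x, `|f x| <= C) -> (forall x, `|g x| <= C) ->
  \int[PP]_w (f w.1 * g w.2) = (\int[P]_x f x) * (\int[P']_x g x).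
Proof.
move=> mf mg fC gC.
have if_ := integrable_bounded P mf fC.
have ig := integrable_bounded P' mg gC.
have mfg : measurable_fun setT (fun w : T * T' => f w.1 * g w.2).
  apply: measurable_funM; [exact: measurableT_comp mf measurable_fst|exact: measurableT_comp mg measurable_snd].
have ifg : PP.-integrable setT (EFin \o (fun w => f w.1 * g w.2)).
  apply: (@integrable_bounded _ _ _ _ _ (C * C)) => // w.
  by rewrite normrM ler_pM.
have E x : (\int[P']_y (f x * g y)%:E = (f x * \int[P']_y g y)%:E)%E.
  under eq_integral do rewrite EFinM.
  by rewrite integralZl// EFinM /Rintegral [in RHS]fineK// (integrable_fin_num measurableT ig).
rewrite {1}/Rintegral -(integral12_prod_meas1 ifg).
have -> : (\int[P]_x fubini_F P' (EFin \o (fun w : T * T' => f w.1 * g w.2)%R) x =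
    \int[P]_x (f x * \int[P']_y g y)%:E)%E by apply: eq_integral => x _; exact: E.
exact: (RintegralZr _ measurableT if_).
Qed.

End product_probability.

Section gaussian_families.
Context d (T : measurableType d) {R : realType} (P : probability T R).

Definition gauss_family {I : Type} (X : I -> T -> R) :=
  forall s, near_gauss P (fun w => comb s (X ^~ w)).

Section family.
Context {I : Type} (X : I -> T -> R).
Hypothesis gX : gauss_family X.

Lemma gauss_family_near i : near_gauss P (X i).
Proof.
have := gX [:: (1, i)]; rewrite /comb; under eq_fun do rewrite big_seq1 mul1r.
by [].
Qed.

Lemma gauss_family_L2 i : L2 P (X i).
Proof. by have [] := near_gauss_props (gauss_family_near i). Qed.

Lemma gauss_family_measurable i : measurable_fun setT (X i).
Proof. exact: L2_measurable (gauss_family_L2 i). Qed.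

Lemma gauss_family_combL2 s : L2 P (fun w => comb s (X ^~ w)).
Proof. by have [] := near_gauss_props (gX s). Qed.

Lemma gauss_family_cos s t : \int[P]_w cos (t * comb s (X ^~ w)) =
  expR (- (gauss_rate R * t ^+ 2 * ip P (fun w => comb s (X ^~ w)) (fun w => comb s (X ^~ w)))).
Proof. by have [_ h _ _] := near_gauss_props (gX s); rewrite h. Qed.

Lemma gauss_family_sin s t : \int[P]_w sin (t * comb s (X ^~ w)) = 0.
Proof. by have [_ _ h _] := near_gauss_props (gX s); rewrite h. Qed.

End family.

Lemma gauss_family_reindex {I J : Type} (X : I -> T -> R) (f : J -> I) :
  gauss_family X -> gauss_family (X \o f).
Proof.
move=> gX s; have := gX [seq (c.1, f c.2) | c <- s].
by rewrite /comb; under eq_fun do rewrite big_map.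
Qed.

Let mtrig (f : R -> R) (Y : T -> R) : continuous f -> measurable_fun setT Y ->
  measurable_fun setT (fun w => f (Y w)).
Proof. by move=> cf mY; apply: measurableT_comp => //; exact: continuous_measurable_fun. Qed.

Let cos1 (x : R) : `|cos x| <= 1. Proof. by rewrite ler_norml cos_geN1 cos_le1. Qed.
Let sin1 (x : R) : `|sin x| <= 1. Proof. by rewrite ler_norml sin_geN1 sin_le1. Qed.

Local Notation PP := (P \x P)%E.

Let trig2 (Y Z : T -> R) : measurable_fun setT Y -> measurable_fun setT Z ->
  \int[PP]_w cos (Y w.1 + Z w.2) =
    (\int[P]_w cos (Y w)) * (\int[P]_w cos (Z w)) - (\int[P]_w sin (Y w)) * (\int[P]_w sin (Z w)) /\
  \int[PP]_w sin (Y w.1 + Z w.2) =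
    (\int[P]_w sin (Y w)) * (\int[P]_w cos (Z w)) + (\int[P]_w cos (Y w)) * (\int[P]_w sin (Z w)).
Proof.
move=> mY mZ; have cc := @continuous_cos R; have cs := @continuous_sin R.
have i (f g : R -> R) : continuous f -> continuous g -> (forall x, `|f x| <= 1) -> (forall x, `|g x| <= 1) ->
    PP.-integrable setT (EFin \o (fun w => f (Y w.1) * g (Z w.2))).
  move=> cf cg f1 g1; apply: (@integrable_bounded _ _ _ _ _ 1).
    apply: measurable_funM.
      exact: measurableT_comp (mtrig cf mY) measurable_fst.
    exact: measurableT_comp (mtrig cg mZ) measurable_snd.
  by move=> w; rewrite normrM mulr_ile1.
rewrite -!(@Rintegral_prod_mul _ _ _ P _ _ P _ _ 1)//; try exact: mtrig.
split.
  rewrite -RintegralB//; [|exact: i|exact: i].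
  by apply: eq_Rintegral => w _; rewrite cosD.
rewrite -RintegralD//; [|exact: i|exact: i].
by apply: eq_Rintegral => w _; rewrite sinD.
Qed.

Section independent_copies.
Context {I1 I2 : Type} (X1 : I1 -> T -> R) (X2 : I2 -> T -> R).

Definition sum_family (i : I1 + I2) : T -> R :=
  match i with inl i => X1 i | inr i => X2 i end.

Definition copies_family (i : I1 + I2) (w : T * T) : R :=
  match i with inl i => X1 i w.1 | inr i => X2 i w.2 end.

Hypothesis gX : gauss_family sum_family.
Hypothesis X12 : forall i j, ip P (X1 i) (X2 j) = 0.

Let part1 (s : seq (R * (I1 + I2))) := pmap (fun c => if c.2 is inl i then Some (c.1, i) else None) s.
Let part2 (s : seq (R * (I1 + I2))) := pmap (fun c => if c.2 is inr i then Some (c.1, i) else None) s.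

Let comb_sum s (x : I1 -> R) (y : I2 -> R) :
  comb s (fun i => match i with inl i => x i | inr i => y i end) = comb (part1 s) x + comb (part2 s) y.
Proof.
rewrite /comb; elim: s => [|[c [i|i]] s IH] /=; first by rewrite !big_nil addr0.
  by rewrite !big_cons IH addrA.
by rewrite !big_cons IH addrCA.
Qed.

Let g1 : gauss_family X1. Proof. exact: (gauss_family_reindex inl gX). Qed.
Let g2 : gauss_family X2. Proof. exact: (gauss_family_reindex inr gX). Qed.

Let ip_comb s1 s2 : ip P (fun w => comb s1 (X1 ^~ w)) (fun w => comb s2 (X2 ^~ w)) = 0.
Proof.
have L1 (c : R * I1) : L2 P (fun w => c.1 * X1 c.2 w) by apply: L2Z; exact: gauss_family_L2 g1 _.
have L2' (c : R * I2) : L2 P (fun w => c.1 * X2 c.2 w) by apply: L2Z; exact: gauss_family_L2 g2 _.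
rewrite /comb ip_suml//; last exact: L2_sum.
apply: big1 => c _; rewrite ipC ip_suml//; apply: big1 => c' _.
rewrite ipZl//; last exact: gauss_family_L2 g2 _.
rewrite ipC ipZl ?X12 ?mulr0//; [exact: gauss_family_L2 g1 _|exact: gauss_family_L2 g2 _].
Qed.

Lemma copies_family_measurable i : measurable_fun setT (copies_family i).
Proof.
case: i => i /=.
  exact: measurableT_comp (gauss_family_measurable g1 i) measurable_fst.
exact: measurableT_comp (gauss_family_measurable g2 i) measurable_snd.
Qed.

(** For uncorrelated families the variance of a combination is the sum of the variances of its two
    parts, so its characteristic function factors as on a product space. Besides independence this
    supports the Fubini argument of the hitting estimate. *)
Lemma copies_law (A : set (I1 + I2 -> R)) : <<s cylinders >> A ->
  P [set w | A (sum_family ^~ w)] = PP [set w | A (copies_family ^~ w)].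
Proof.
have E w : sum_family ^~ w = fun i => match i with inl i => X1 i w | inr i => X2 i w end.
  by apply/funext => -[].
have E' w : copies_family ^~ w = fun i => match i with inl i => X1 i w.1 | inr i => X2 i w.2 end.
  by apply/funext => -[].
have L1 s := gauss_family_combL2 g1 s; have L2' s := gauss_family_combL2 g2 s.
apply: equal_laws => [i|i|s|s].
- exact: gauss_family_measurable gX i.
- exact: copies_family_measurable.
- have := gauss_family_cos gX s 1; under eq_Rintegral do rewrite mul1r.
  move=> ->; under [in LHS]eq_fun do rewrite E comb_sum.
  under [in RHS]eq_Rintegral do rewrite E' comb_sum.
  have [-> _] := trig2 (L2_measurable (L1 (part1 s))) (L2_measurable (L2' (part2 s))).
  have := gauss_family_cos g1 (part1 s) 1; under eq_Rintegral do rewrite mul1r.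
  move=> ->; have := gauss_family_cos g2 (part2 s) 1; under eq_Rintegral do rewrite mul1r.
  move=> ->; have := gauss_family_sin g1 (part1 s) 1; under eq_Rintegral do rewrite mul1r.
  move=> ->; rewrite mul0r subr0 -expRD ip_sqrD// ip_comb; congr expR; ring.
- have := gauss_family_sin gX s 1; under eq_Rintegral do rewrite mul1r.
  move=> ->; under [in RHS]eq_Rintegral do rewrite E' comb_sum.
  have [_ ->] := trig2 (L2_measurable (L1 (part1 s))) (L2_measurable (L2' (part2 s))).
  have := gauss_family_sin g1 (part1 s) 1; under eq_Rintegral do rewrite mul1r.
  move=> ->; have := gauss_family_sin g2 (part2 s) 1; under eq_Rintegral do rewrite mul1r.
  by move=> ->; rewrite mul0r mulr0 addr0.
Qed.

Lemma uncorrelated_independent (A : set (I1 -> R)) (B : set (I2 -> R)) :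
  <<s cylinders >> A -> <<s cylinders >> B ->
  (P [set w | A (X1 ^~ w) /\ B (X2 ^~ w)] =
   P [set w | A (X1 ^~ w)] * P [set w | B (X2 ^~ w)])%E.
Proof.
move=> cA cB.
have cyl (J : Type) (f : J -> I1 + I2) (C : set (J -> R)) : <<s cylinders >> C ->
    <<s cylinders >> [set x : I1 + I2 -> R | C (x \o f)].
  suff : <<s cylinders >> `<=` [set C : set (J -> R) | <<s cylinders >> [set x : I1 + I2 -> R | C (x \o f)]] by apply.
  apply: smallest_sub.
    split => /=.
    - exact: sigma_algebra0.
    - move=> C' mC; rewrite (_ : [set _ | _] = ~` [set x : I1 + I2 -> R | C' (x \o f)]); first exact: sigma_algebraC.
      by apply/seteqP; split => x /=; [move=> [] |move=> ?; split].
    - move=> F mF; rewrite (_ : [set _ | _] = \bigcup_n [set x : I1 + I2 -> R | F n (x \o f)]).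
        exact: sigma_algebra_bigcup.
      by apply/seteqP; split => x [n _ ?]; exists n.
  move=> _ [q _ <-]; apply: sub_sigma_algebra; exists [seq (f c.1, c.2) | c <- q] => //.
  apply/seteqP; split => x /=.
    by move=> h c cq; apply: (h (f c.1, c.2)); exact: (List.in_map (fun c => (f c.1, c.2))).
  by move=> h c /List.in_map_iff[c' [<- cq]]; exact: h.
have mm : <<s cylinders >> [set x : I1 + I2 -> R | A (x \o inl) /\ B (x \o inr)].
  rewrite (_ : [set _ | _] = [set x : I1 + I2 -> R | A (x \o inl)] `&` [set x : I1 + I2 -> R | B (x \o inr)])//.
  by apply: (@measurableI _ (g_sigma_algebraType (@cylinders R (I1 + I2)%type))); exact: cyl.
have mA : measurable [set w | A (X1 ^~ w)].
  by apply: measurable_preimage_cylinder => //; exact: gauss_family_measurable g1.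
have mB : measurable [set w | B (X2 ^~ w)].
  by apply: measurable_preimage_cylinder => //; exact: gauss_family_measurable g2.
exact: (etrans (copies_law mm) (product_measure1E P P mA mB)).
Qed.

End independent_copies.

Section rotation.
Context {I : Type} (X : I -> T -> R).
Hypothesis gX : gauss_family X.

(** Two independent copies double the variance of each combination and the factor [1 / sqrt 2]
    halves it again, so the characteristic functions agree. *)
Lemma rotation_law (A : set (I -> R)) : <<s cylinders >> A ->
  P [set w | A (X ^~ w)] =
  PP [set w : T * T | A (fun i => (Num.sqrt 2)^-1 * (X i w.1 - X i w.2))].
Proof.
set c : R := (Num.sqrt 2)^-1.
have c2 : c ^+ 2 = 2^-1 by rewrite exprVn sqr_sqrtr.
have E s (w : T * T) : comb s (fun i => c * (X i w.1 - X i w.2)) =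
    c * comb s (X ^~ w.1) + (- c) * comb s (X ^~ w.2).
  rewrite /comb !mulr_sumr -big_split; apply: eq_bigr => i _ /=; ring.
have mL s t := L2_measurable (L2Z t (gauss_family_combL2 gX s)).
apply: (@equal_laws _ _ _ _ _ _ _ _ X (fun i w => c * (X i w.1 - X i w.2))) => [i|i|s|s].
- exact: gauss_family_measurable gX i.
- apply: measurable_funM => //; apply: measurable_funB.
    exact: measurableT_comp (gauss_family_measurable gX i) measurable_fst.
  exact: measurableT_comp (gauss_family_measurable gX i) measurable_snd.
- under [in RHS]eq_Rintegral do rewrite E.
  have [-> _] := trig2 (mL s c) (mL s (- c)).
  rewrite !gauss_family_cos// !gauss_family_sin// mul0r subr0 -expRD sqrrN c2.
  have := gauss_family_cos gX s 1; under eq_Rintegral do rewrite mul1r.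
  by move=> ->; congr expR; field.
- under [in RHS]eq_Rintegral do rewrite E.
  have [_ ->] := trig2 (mL s c) (mL s (- c)).
  rewrite !gauss_family_sin// mul0r mulr0 addr0.
  by have := gauss_family_sin gX s 1; under eq_Rintegral do rewrite mul1r.
Qed.

End rotation.

End gaussian_families.

(** * Chaining along a tree *)

Lemma markov_ge0 d (T : measurableType d) (R : realType) (P : probability T R) (f : T -> R) (M : R) :
  measurable_fun setT f -> (forall w, 0 <= f w) -> 0 < M ->
  (P [set w | M < f w]%R <= (M^-1)%:E * \int[P]_w (f w)%:E)%E.
Proof.
move=> mf f0 M0.
have mA : measurable [set w | M < f w].
  rewrite (_ : [set _ | _] = f @^-1` `]M, +oo[%classic); last first.
    by apply/seteqP; split => x /=; rewrite in_itv/= andbT.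
  by rewrite -[X in measurable X]setTI; exact: mf.
rewrite lee_pdivlMl//.
have -> : (M%:E * P [set w | (M < f w)%R])%E = (\int[P]_w (M * \1_[set w | M < f w] w)%:E)%E.
  under eq_integral do rewrite EFinM; rewrite integralZl//; last first.
    by apply: (@integrable_bounded _ _ _ _ _ 1) => // w; rewrite ger0_norm// indicE; case: (_ \in _).
  by rewrite integral_indic// setIT.
apply: ge0_le_integral => //.
- by move=> w _; rewrite lee_fin mulr_ge0// ltW.
- by apply/measurable_EFinP; apply: measurable_funM.
- exact/measurable_EFinP.
- move=> w _; rewrite lee_fin indicE; case: (boolP (w \in _)); rewrite ?inE /=.
    by rewrite mulr1 => /ltW.
  by rewrite mulr0.
Qed.

Section chaining.
Context {R : realType} (D : finType) (d : nat) (q : R).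
Hypothesis q01 : 0 < q < 1.
Hypothesis Dq : #|D|%:R * q ^+ d = 1.
Hypothesis d0 : (0 < d)%N.

Let q0 : 0 < q. Proof. by case/andP: q01. Qed.
Let q1 : q < 1. Proof. by case/andP: q01. Qed.

(** The exponent is even, so that moments need no absolute values, and large enough for summing over
    levels: at level l there are [q ^- (l d)] words, the weight costs [q ^- (l (d + 2))], and the
    moment gives [q ^+ (l (p - 1))], which leaves [q ^+ l]. One power of [q ^+ l] in the moment is
    given up to the interpolation of [near_gauss_chain_sum]. *)
Definition chain_exp : nat := d.+2.*2.
Local Notation p := chain_exp.
Definition chain_root : R := Num.sqrt q.
Local Notation th := chain_root.

Let th0 : 0 < th. Proof. by rewrite sqrtr_gt0. Qed.
Let th1 : th < 1. Proof. by rewrite -sqrtr1 ltr_sqrt. Qed.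
Let th2 : th ^+ 2 = q. Proof. by rewrite sqr_sqrtr// ltW. Qed.

(** The increment allowed at level l in units of M, normalised so that the total from level a on is
    at most [th ^+ a]. Taking [th] as the square root of q leaves room between increments of size
    [q ^+ l] and their allowance. *)
Definition chain_wt l : R := (1 - th) * th ^+ l.

Lemma chain_wt_gt0 l : 0 < chain_wt l.
Proof. by rewrite mulr_gt0 ?subr_gt0// exprn_gt0. Qed.

Lemma chain_wt_sum a L : \sum_(a <= l < L) chain_wt l <= th ^+ a.
Proof.
have h : forall n, \sum_(a <= l < a + n) chain_wt l = th ^+ a - th ^+ (a + n).
  elim=> [|n IH]; first by rewrite addn0 big_geq// subrr.
  by rewrite addnS big_nat_recr ?leq_addr//= IH /chain_wt exprS; ring.
have [aL|La] := leqP a L; last by rewrite (big_geq (ltnW La)) exprn_ge0// ltW.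
by rewrite -(subnKC aL) h gerBl exprn_ge0// ltW.
Qed.

Implicit Types (X : 'I_d -> seq D -> R).

(** All terms are nonnegative, so a bound [M ^+ p] on the sum bounds every single increment by M
    times its weight. *)
Definition chain_sum L X : R := \sum_(l < L) (chain_wt l)^-1 ^+ p *
  \sum_(u : l.-tuple D) \sum_(a : D) \sum_(j < d) (X j (rcons u a) - X j u) ^+ p.

Lemma chain_exp_even (x : R) : 0 <= x ^+ p.
Proof. by rewrite exprn_even_ge0// odd_double. Qed.

Lemma chain_sum_ge0 L X : 0 <= chain_sum L X.
Proof.
apply: sumr_ge0 => l _; rewrite mulr_ge0 ?exprn_ge0 ?invr_ge0 ?(ltW (chain_wt_gt0 _))//.
by do 3 (apply: sumr_ge0 => ? _); exact: chain_exp_even.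
Qed.

Lemma chain_step L X M j (u : seq D) a : chain_sum L X <= M ^+ p -> 0 <= M -> (size u < L)%N ->
  `|X j (rcons u a) - X j u| <= M * chain_wt (size u).
Proof.
move=> XM M0 uL; have p0 : (0 < p)%N by rewrite double_gt0.
have h : (chain_wt (size u))^-1 ^+ p * (X j (rcons u a) - X j u) ^+ p <= M ^+ p.
  apply: le_trans XM; rewrite /chain_sum (bigD1 (Ordinal uL))//= ler_wpDr//.
    apply: sumr_ge0 => l _; rewrite mulr_ge0 ?exprn_ge0 ?invr_ge0 ?(ltW (chain_wt_gt0 _))//.
    by do 3 (apply: sumr_ge0 => ? _); exact: chain_exp_even.
  rewrite ler_wpM2l ?exprn_ge0 ?invr_ge0 ?(ltW (chain_wt_gt0 _))//.
  have us : size u == size u by [].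
  rewrite (bigD1 (Tuple us))//= ler_wpDr//.
    by do 3 (apply: sumr_ge0 => ? _); exact: chain_exp_even.
  rewrite (bigD1 a)//= ler_wpDr//; first by do 2 (apply: sumr_ge0 => ? _); exact: chain_exp_even.
  by rewrite (bigD1 j)//= ler_wpDr//; apply: sumr_ge0 => ? _; exact: chain_exp_even.
have wt := chain_wt_gt0 (size u).
rewrite -ler_pdivrMr// -(@ler_pXn2r _ p)// ?nnegrE ?divr_ge0 ?(ltW wt)//.
rewrite exprMn mulrC (_ : `|_| ^+ p = (X j (rcons u a) - X j u) ^+ p)//.
by rewrite -normrX ger0_norm// chain_exp_even.
Qed.

Lemma chain_path L X M j (u v : seq D) : chain_sum L X <= M ^+ p -> 0 <= M ->
  (size u + size v <= L)%N ->
  `|X j (u ++ v) - X j u| <= M * th ^+ (size u).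
Proof.
move=> XM M0 uvL; apply: (@le_trans _ _ (M * \sum_(size u <= l < size u + size v) chain_wt l)); last first.
  by rewrite ler_wpM2l// chain_wt_sum.
elim/last_ind: v uvL => [|v a IH]; first by rewrite cats0 addn0 subrr normr0 big_geq// mulr0.
rewrite size_rcons addnS => uvL; rewrite big_nat_recr ?leq_addr//= mulrDr.
rewrite -rcons_cat (le_trans (ler_distD (X j (u ++ v)) _ _))// addrC lerD ?IH 1?ltnW//.
by rewrite -size_cat; apply: (chain_step _ _ XM) => //; rewrite size_cat.
Qed.

Lemma chain_osc L X M j (u : seq D) : chain_sum L X <= M ^+ p -> 0 <= M -> (size u <= L)%N ->
  `|X j u - X j [::]| <= M.
Proof. by move=> XM M0 uL; have := @chain_path L X M j [::] u XM M0 uL; rewrite expr0 mulr1. Qed.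

Section expectation.
Context d' (T : measurableType d') (P : probability T R).

Definition chain_cst : R := (1 - th)^-1 ^+ p * (#|D|%:R * d%:R) * (1 - q)^-1.

Lemma chain_cst_ge0 : 0 <= chain_cst.
Proof.
apply: mulr_ge0; last by rewrite invr_ge0 subr_ge0 ltW.
by apply: mulr_ge0 => //; rewrite exprn_ge0// invr_ge0 subr_ge0 ltW.
Qed.

Lemma geometric_sum_le L : \sum_(l < L) q ^+ l <= (1 - q)^-1.
Proof.
rewrite -[leRHS]mul1r ler_pdivlMr ?subr_gt0//.
suff -> : (\sum_(l < L) q ^+ l) * (1 - q) = 1 - q ^+ L by rewrite gerBl exprn_ge0// ltW.
by elim: L => [|L IH]; rewrite ?big_ord0 ?mul0r ?expr0 ?subrr// big_ord_recr/= mulrDl IH exprS; ring.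
Qed.

Lemma chain_sum_measurable L (X : 'I_d -> seq D -> T -> R) :
  (forall j u, measurable_fun setT (X j u)) -> measurable_fun setT (fun w => chain_sum L (fun j u => X j u w)).
Proof.
move=> mX; apply: measurable_sum => l; apply: measurable_funM => //.
apply: measurable_sum => u; apply: measurable_sum => a; apply: measurable_sum => j.
by apply: measurable_funX; apply: measurable_funB.
Qed.

Lemma chain_expectation L (X : 'I_d -> seq D -> T -> R) (B : R) : 0 <= B ->
  (forall j u, measurable_fun setT (X j u)) ->
  (forall j u a, (size u < L)%N ->
    (\int[P]_w ((X j (rcons u a) w - X j u w) ^+ p)%:E <= (B * (q ^+ (size u)) ^+ p.-1)%:E)%E) ->
  (\int[P]_w (chain_sum L (fun j u => X j u w))%:E <= (B * chain_cst)%:E)%E.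
Proof.
move=> B0 mX hX.
have me j u a : measurable_fun setT (fun w => (X j (rcons u a) w - X j u w) ^+ p).
  by apply: measurable_funX; apply: measurable_funB.
have ge2 l (u : l.-tuple D) a w : 0 <= \sum_(j < d) (X j (rcons u a) w - X j u w) ^+ p.
  by apply: sumr_ge0 => j _; exact: chain_exp_even.
have ge3 l (u : l.-tuple D) w : 0 <= \sum_(a : D) \sum_(j < d) (X j (rcons u a) w - X j u w) ^+ p.
  by apply: sumr_ge0 => a _; exact: ge2.
have ge4 l w : 0 <= \sum_(u : l.-tuple D) \sum_(a : D) \sum_(j < d) (X j (rcons u a) w - X j u w) ^+ p.
  by apply: sumr_ge0 => u _; exact: ge3.
have m2 l (u : l.-tuple D) a : measurable_fun setT (fun w => \sum_(j < d) (X j (rcons u a) w - X j u w) ^+ p).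
  by apply: measurable_sum => j.
have m3 l (u : l.-tuple D) : measurable_fun setT (fun w => \sum_(a : D) \sum_(j < d) (X j (rcons u a) w - X j u w) ^+ p).
  by apply: measurable_sum => a.
have m4 l : measurable_fun setT (fun w => \sum_(u : l.-tuple D) \sum_(a : D) \sum_(j < d) (X j (rcons u a) w - X j u w) ^+ p).
  by apply: measurable_sum => u.
have wt0 l : 0 <= (chain_wt l)^-1 ^+ p by rewrite exprn_ge0// invr_ge0 ltW// chain_wt_gt0.
rewrite /chain_sum; under eq_integral do rewrite -sumEFin.
rewrite ge0_integral_sum//; [|by move=> l; apply/measurable_EFinP; apply: measurable_funM|by move=> l w _; rewrite lee_fin mulr_ge0].
apply: (@le_trans _ _ (\sum_(l < L) ((chain_wt l)^-1 ^+ p * (#|D|%:R ^+ l * (#|D|%:R * (d%:R * (B * (q ^+ l) ^+ p.-1)))))%:E)%E).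
  apply: lee_sum => l _; under eq_integral do rewrite EFinM.
  rewrite ge0_integralZl//; last 3 first.
  - exact/measurable_EFinP.
  - by move=> w _; rewrite lee_fin.
  - by rewrite lee_fin.
  rewrite [leRHS]EFinM lee_wpmul2l ?lee_fin//.
  under eq_integral do rewrite -sumEFin.
  rewrite ge0_integral_sum//; [|by move=> u; exact/measurable_EFinP|by move=> u w _; rewrite lee_fin].
  apply: (@le_trans _ _ (\sum_(u : l.-tuple D) (#|D|%:R * (d%:R * (B * (q ^+ l) ^+ p.-1)))%:E)%E); last first.
    by rewrite sumEFin lee_fin sumr_const card_tuple -[leLHS]mulr_natl natrX.
  apply: lee_sum => u _; under eq_integral do rewrite -sumEFin.
  rewrite ge0_integral_sum//; [|by move=> a; exact/measurable_EFinP|by move=> a w _; rewrite lee_fin].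
  apply: (@le_trans _ _ (\sum_(a : D) (d%:R * (B * (q ^+ l) ^+ p.-1))%:E)%E); last first.
    by rewrite sumEFin lee_fin sumr_const -[leLHS]mulr_natl.
  apply: lee_sum => a _; under eq_integral do rewrite -sumEFin.
  rewrite ge0_integral_sum//; [|by move=> j; exact/measurable_EFinP|by move=> j w _; rewrite lee_fin chain_exp_even].
  apply: (@le_trans _ _ (\sum_(j < d) (B * (q ^+ l) ^+ p.-1)%:E)%E); last first.
    by rewrite sumEFin lee_fin sumr_const card_ord -[leLHS]mulr_natl.
  by apply: lee_sum => j _; have := hX j u a; rewrite size_tuple; apply.
rewrite sumEFin lee_fin.
have E l : (chain_wt l)^-1 ^+ p * (#|D|%:R ^+ l * (#|D|%:R * (d%:R * (B * (q ^+ l) ^+ p.-1)))) =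
    B * ((1 - th)^-1 ^+ p * (#|D|%:R * d%:R)) * q ^+ l.
  have -> : (chain_wt l)^-1 ^+ p = (1 - th)^-1 ^+ p * (q ^+ (l * d.+2))^-1.
    rewrite /chain_wt invfM exprMn; congr (_ * _).
    by rewrite exprVn -exprM mulnC /p -mul2n -mulnA exprM th2 mulnC.
  have -> : (q ^+ l) ^+ p.-1 = q ^+ (l * d) * q ^+ (l * d.+2) * q ^+ l.
    have -> : p.-1 = (d + d.+2 + 1)%N by rewrite /p -addnn addn1 !addSn !addnS.
    by rewrite -exprM !mulnDr muln1 !exprD.
  have h : #|D|%:R ^+ l * q ^+ (l * d) = 1 by rewrite mulnC exprM -exprMn Dq expr1n.
  rewrite -[RHS]mulr1 -[X in _ = _ * X]h; have hq : q ^+ (l * d.+2) != 0 by rewrite expf_neq0 ?gt_eqF.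
  clear h; move: (q ^+ (l * d.+2)) hq (q ^+ (l * d)) (q ^+ l) (#|D|%:R ^+ l) ((1 - th)^-1 ^+ p).
  by move=> x x0 y z t u; field.
under eq_bigr do rewrite E.
rewrite -mulr_sumr /chain_cst [leRHS]mulrA ler_wpM2l ?geometric_sum_le//.
apply: mulr_ge0 => //; apply: mulr_ge0; last exact: mulr_ge0.
by rewrite exprn_ge0// invr_ge0 subr_ge0 ltW.
Qed.

End expectation.
End chaining.

Section measurable_quantifiers.
Context d (T : measurableType d).

Lemma measurable_forall (I : countType) (F : I -> set T) :
  (forall i, measurable (F i)) -> measurable [set w | forall i, F i w].
Proof.
move=> mF; pose G n := if unpickle n is Some i then F i else setT.
rewrite (_ : [set w | _] = \bigcap_n G n).
  by apply: bigcap_measurableType => n _; rewrite /G; case: (unpickle n).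
apply/seteqP; split => w /=.
  by move=> h n _; rewrite /G; case: (unpickle n).
by move=> h i; have := h (pickle i) Logic.I; rewrite /G pickleK.
Qed.

Lemma measurable_exists (I : countType) (F : I -> set T) :
  (forall i, measurable (F i)) -> measurable [set w | exists i, F i w].
Proof.
move=> mF; rewrite (_ : [set w | _] = ~` [set w | forall i, (~` F i) w]).
  by apply: measurableC; apply: measurable_forall => i; exact: measurableC.
apply/seteqP; split => w /=; first by move=> [i Fi] /(_ i).
by move=> h; apply: contrapT => h'; apply: h => i Fi; apply: h'; exists i.
Qed.

Lemma measurable_implies (A : Prop) (F : set T) : measurable F -> measurable [set w | A -> F w].
Proof.
move=> mF; have [a|na] := pselect A.
  rewrite (_ : [set w | _] = F)//; apply/seteqP; split => w /=; first exact.
  by [].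
by rewrite (_ : [set w | _] = setT)//; apply/seteqP; split => // w _ /=.
Qed.

Lemma measurable_le_cst {R : realType} (f : T -> R) (M : R) : measurable_fun setT f ->
  measurable [set w | f w <= M].
Proof.
move=> mf; rewrite (_ : [set w | _] = f @^-1` `]-oo, M]%classic); last first.
  by apply/seteqP; split => w /=; rewrite in_itv/=.
by rewrite -[X in measurable X]setTI; exact: mf.
Qed.

Lemma measurable_lt_cst {R : realType} (f : T -> R) (M : R) : measurable_fun setT f ->
  measurable [set w | f w < M].
Proof.
move=> mf; rewrite (_ : [set w | _] = f @^-1` `]-oo, M[%classic); last first.
  by apply/seteqP; split => w /=; rewrite in_itv/=.
by rewrite -[X in measurable X]setTI; exact: mf.
Qed.

Lemma measure_exists_le {R : realType} (P : {measure set T -> \bar R}) (I : eqType) (s : seq I) (F : I -> set T) :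
  (forall i, measurable (F i)) ->
  (P [set w | exists2 i, i \in s & F i w] <= \sum_(i <- s) P (F i))%E.
Proof.
move=> mF; elim: s => [|i s IH].
  rewrite big_nil (_ : [set w | _] = set0) ?measure0//.
  by apply/seteqP; split => w // [].
have ms : measurable [set w | exists2 i, i \in s & F i w].
  elim: s {IH} => [|j s IH].
    by rewrite (_ : [set w | _] = set0)//; apply/seteqP; split => w // [].
  rewrite (_ : [set w | _] = F j `|` [set w | exists2 i, i \in s & F i w]); first exact: measurableU.
  apply/seteqP; split => w /=.
    by move=> [k]; rewrite inE => /orP[/eqP ->|ks] Fk; [left|right; exists k].
  by move=> [Fj|[k ks Fk]]; [exists j; rewrite ?mem_head|exists k; rewrite ?inE ?ks ?orbT].
rewrite big_cons (_ : [set w | _] = F i `|` [set w | exists2 i, i \in s & F i w]).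
  by apply: le_trans (measureU2 _ _ _) _ => //; rewrite leeD2l.
apply/seteqP; split => w /=.
  by move=> [k]; rewrite inE => /orP[/eqP ->|ks] Fk; [left|right; exists k].
by move=> [Fj|[k ks Fk]]; [exists i; rewrite ?mem_head|exists k; rewrite ?inE ?ks ?orbT].
Qed.

End measurable_quantifiers.

Section cylinder_coordinates.
Context {R : realType} {I : Type}.

Lemma cylinder_coordinate (i : I) :
  @measurable_fun _ _ (g_sigma_algebraType (@cylinders R I)) R setT (fun x : I -> R => x i).
Proof.
apply: (measurability _ (RGenOInfty.measurableE R)).
move=> _ [_ [a ->] <-]; rewrite setTI; apply: sub_sigma_algebra; exists [:: (i, a)] => //.
apply/seteqP; split => x /=.
  by move=> h; rewrite in_itv/= andbT; apply: (h (i, a)); left.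
by rewrite in_itv/= andbT => h c [<-|].
Qed.

End cylinder_coordinates.

Section oscillation.
Context {R : realType} (D : finType) (d : nat) (q : R).
Hypothesis q01 : 0 < q < 1.
Hypothesis Dq : #|D|%:R * q ^+ d = 1.
Hypothesis d0 : (0 < d)%N.

Definition osc_le (L : nat) (M : R) (x : 'I_d -> seq D -> R) : Prop :=
  forall j (u : seq D), (size u <= L)%N -> `|x j u - x j [::]| <= M.

Lemma osc_le_cylinder L M :
  <<s @cylinders R ('I_d * seq D)%type >> [set x | osc_le L M (fun j u => x (j, u))].
Proof.
pose Z := g_sigma_algebraType (@cylinders R ('I_d * seq D)%type).
suff : @measurable _ Z [set x : Z | osc_le L M (fun j u => x (j, u))] by [].
apply: measurable_forall => j; apply: measurable_forall => u; apply: measurable_implies.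
apply: measurable_le_cst; apply: measurableT_comp => //.
by apply: measurable_funB; exact: cylinder_coordinate.
Qed.

Section expectation.
Context d' (T : measurableType d') (P : probability T R).
Variable X : 'I_d -> seq D -> T -> R.

Lemma osc_le_measurable L M : (forall j u, measurable_fun setT (X j u)) ->
  measurable [set w | osc_le L M (fun j u => X j u w)].
Proof.
move=> mX; exact: (@measurable_preimage_cylinder R ('I_d * seq D)%type _ T
  (fun i => X i.1 i.2) _ (fun i => mX i.1 i.2) (osc_le_cylinder L M)).
Qed.

Definition osc_cst : R := 4 ^+ d.+2 * gmoment_const R d.+2 * chain_cst D d q.

Lemma osc_cst_ge0 : 0 <= osc_cst.
Proof. by rewrite mulr_ge0 ?chain_cst_ge0// mulr_ge0 ?exprn_ge0// gmoment_const_ge0. Qed.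

(** The variance I of an increment is interpolated: in [I ^+ p] all factors but one use the
    scale-dependent bound and the last one uses B. The mean thus tends to 0 with B while A stays
    fixed, which is how small remainders are treated. *)
Lemma near_gauss_chain_sum L (A B : R) : 0 <= A -> 0 <= B ->
  (forall j u a, near_gauss P (fun w => X j (rcons u a) w - X j u w)) ->
  (forall j u, measurable_fun setT (X j u)) ->
  (forall j u a, (size u < L)%N ->
     ip P (fun w => X j (rcons u a) w - X j u w) (fun w => X j (rcons u a) w - X j u w) <=
     Num.min (A * q ^+ (size u) ^+ 2) B) ->
  (\int[P]_w (chain_sum q L (fun j u => X j u w))%:E <=
    (Num.sqrt (A ^+ (d.+2.*2.-1) * B) * osc_cst)%:E)%E.
Proof.
move=> A0 B0 ng mX hX; have q0 : 0 < q by case/andP: q01.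
have -> : Num.sqrt (A ^+ (d.+2.*2.-1) * B) * osc_cst =
   (Num.sqrt (A ^+ (d.+2.*2.-1) * B) * (4 ^+ d.+2 * gmoment_const R d.+2)) * chain_cst D d q.
  by rewrite /osc_cst; ring.
have G0 : 0 <= 4 ^+ d.+2 * gmoment_const R d.+2 by rewrite mulr_ge0 ?exprn_ge0// gmoment_const_ge0.
apply: (chain_expectation q01 Dq) => //; first by rewrite mulr_ge0// sqrtr_ge0.
move=> j u a uL; have [_ _ _ mom] := near_gauss_props (ng j u a).
apply: le_trans (mom d.+2) _; rewrite lee_fin.
rewrite [leRHS]mulrAC [leRHS]mulrC ler_wpM2l//.
have := hX j u a uL; set I := ip _ _ _; rewrite le_min => /andP[h1 h2].
have I0 : 0 <= I by exact: ip_ge0.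
have AB : 0 <= A ^+ d.+2.*2.-1 * B by apply: mulr_ge0 => //; exact: exprn_ge0.
have Q0 : 0 <= q ^+ size u ^+ d.+2.*2.-1 by do 2 apply: exprn_ge0; exact: ltW.
have Q1 : 0 <= A * q ^+ (size u) ^+ 2 by apply: mulr_ge0 => //; exact: sqr_ge0.
rewrite -(@ler_pXn2r _ 2)// ?nnegrE; last 2 first.
- exact: exprn_ge0.
- by apply: mulr_ge0; first exact: sqrtr_ge0.
rewrite [leRHS]exprMn sqr_sqrtr//.
have -> : I ^+ d.+2 ^+ 2 = I ^+ (d.+2.*2.-1) * I.
  by rewrite -exprM -exprSr muln2 prednK// double_gt0.
have -> : A ^+ d.+2.*2.-1 * B * q ^+ size u ^+ d.+2.*2.-1 ^+ 2 = (A * q ^+ (size u) ^+ 2) ^+ (d.+2.*2.-1) * B.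
  move: (d.+2.*2.-1) => n.
  have -> : (A * q ^+ size u ^+ 2) ^+ n = A ^+ n * (q ^+ size u ^+ 2) ^+ n by exact: exprMn.
  by rewrite mulrAC; congr (_ * _); congr (_ * _); rewrite -[LHS]exprM -[RHS]exprM mulnC.
apply: ler_pM => //; first exact: exprn_ge0.
by apply: lerXn2r.
Qed.

Lemma osc_prob L (C M : R) : 0 < M -> (forall j u, measurable_fun setT (X j u)) ->
  (\int[P]_w (chain_sum q L (fun j u => X j u w))%:E <= C%:E)%E ->
  (P (~` [set w | osc_le L M (fun j u => X j u w)]) <= (C / M ^+ (chain_exp d))%:E)%E.
Proof.
move=> M0 mX hC; have mS := chain_sum_measurable q L mX.
have Mp : 0 < M ^+ (chain_exp d) by rewrite exprn_gt0.
apply: (@le_trans _ _ (P [set w | M ^+ chain_exp d < chain_sum q L (fun j u => X j u w)])).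
  apply: le_measure; rewrite ?inE.
  - by apply: measurableC; exact: osc_le_measurable.
  - rewrite (_ : [set w | _] = ~` [set w | chain_sum q L (fun j u => X j u w) <= M ^+ chain_exp d]).
      by apply: measurableC; exact: measurable_le_cst.
    by apply/seteqP; split => w /=; [move=> + h; rewrite ltNge h|move/negP; rewrite -ltNge].
  - move=> w /= h; rewrite ltNge; apply/negP => h'; apply: h => j u uL.
    exact: (chain_osc q01 j h' (ltW M0) uL).
apply: le_trans (markov_ge0 P mS _ Mp) _; first by move=> w; exact: chain_sum_ge0.
rewrite EFinM muleC lee_wpmul2r// lee_fin invr_ge0 ltW//.
Qed.

End expectation.
End oscillation.

(** * Small balls and independent scales *)

Section small_ball.
Context {R : realType} (D : finType) (d : nat) (q : R).
Hypothesis q01 : 0 < q < 1.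
Hypothesis Dq : #|D|%:R * q ^+ d = 1.
Hypothesis d0 : (0 < d)%N.

Let q0 : 0 < q. Proof. by case/andP: q01. Qed.
Let th01 : 0 < Num.sqrt q < 1.
Proof. by rewrite sqrtr_gt0 q0/= -sqrtr1 ltr_sqrt//; case/andP: q01. Qed.

Definition increments_le d' (T : measurableType d') (P : probability T R)
    (X : 'I_d -> seq D -> T -> R) (L : nat) (A B : R) :=
  forall j u a, (size u < L)%N ->
     ip P (fun w => X j (rcons u a) w - X j u w) (fun w => X j (rcons u a) w - X j u w) <=
     Num.min (A * q ^+ (size u) ^+ 2) B.

Lemma gauss_family_near_B d' (T : measurableType d') (P : probability T R) (I : Type) (X : I -> T -> R) i j :
  gauss_family P X -> near_gauss P (fun w => X i w - X j w).
Proof.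
move=> /(_ [:: (1, i); (-1, j)]); rewrite /comb.
by under eq_fun do rewrite !big_cons big_nil mul1r mulN1r addr0.
Qed.

(* Pigeonhole: two independent copies fall with positive probability into the
   same cell of a finite partition, where they are uniformly close; by rotation
   invariance their normalized difference has the law of a single copy. *)
Lemma small_ball (A e : R) : 0 <= A -> 0 < e ->
  exists2 p0 : R, 0 < p0 <= 1 & forall d' (T : measurableType d') (P : probability T R)
    (X : 'I_d -> seq D -> T -> R) (L : nat),
    gauss_family P (fun i : 'I_d * seq D => X i.1 i.2) ->
    increments_le P X L A A ->
    (p0%:E <= P [set w | osc_le L e (fun j u => X j u w)])%E.
Proof.
move=> A0 e0; have /andP[t0 t1] := th01.
pose C := Num.sqrt (A ^+ (d.+2.*2.-1) * A) * osc_cst D d q.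
have C0 : 0 <= C by rewrite mulr_ge0 ?sqrtr_ge0// osc_cst_ge0.
(* By Markov's inequality this M gives the event [G] probability at least 1/2. *)
pose M := 1 + 2 * C; have M1 : 1 <= M by rewrite lerDl mulr_ge0.
have M0 : 0 < M by rewrite (lt_le_trans _ M1).
have Mp : 2 * C <= M ^+ chain_exp d.
  apply: (@le_trans _ _ M); first by rewrite lerDr.
  by rewrite -[leLHS]expr1 ler_weXn2l// double_gt0.
have [h hE] : exists h, h = e / 8 by exists (e / 8).
have h0 : 0 < h by rewrite hE divr_gt0.
have [l0 hl0] : exists l0, M * Num.sqrt q ^+ l0 <= h.
  have : Num.sqrt q ^+ n @[n --> \oo] --> (0 : R) by apply: cvg_expr; rewrite ger0_norm// ltW.
  move=> /cvgrPdist_le /(_ (h / M) (divr_gt0 h0 M0))[l0 _ /(_ l0 (leqnn _))] /=.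
  rewrite sub0r normrN ger0_norm ?exprn_ge0 ?(ltW t0)// => hh; exists l0.
  by rewrite mulrC -ler_pdivlMr.
pose N := `|Num.floor (2 * M / h)|%N.
pose I0 : finType := ('I_d * l0.-bseq D)%type.
pose F0 : finType := {ffun I0 -> 'I_N.+1}.
have F0g : (0 < #|F0|)%N by rewrite card_ffun card_ord expn_gt0.
have F0R : 0 < #|F0|%:R :> R by rewrite ltr0n.
(* Some cell has probability at least [1 / (2 #|F0|)], and both copies fall into it with at least
   the square of that. The number of cells depends neither on P and X nor on L. *)
pose p0 : R := ((2 * #|F0|%:R)^-1) ^+ 2.
have F1 : (2 * #|F0|%:R)^-1 <= 1 :> R.
  by rewrite invf_le1 ?mulr_gt0// mulr_ege1// ?ler1n// (_ : 1 = 1%:R)// ler_nat.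
exists p0.
  by rewrite exprn_gt0 ?invr_gt0 ?mulr_gt0//= exprn_ile1 ?invr_ge0 ?mulr_ge0 ?ler0n.
move=> d' T P X L gX incX.
have mX j u : measurable_fun setT (X j u) by exact: (gauss_family_measurable gX (j, u)).
have hC := near_gauss_chain_sum q01 Dq A0 A0
  (fun j u a => gauss_family_near_B (j, rcons u a) (j, u) gX) mX incX.
pose S w := chain_sum q L (fun j u => X j u w).
have mS : measurable_fun setT S by exact: chain_sum_measurable.
pose G := [set w | S w <= M ^+ chain_exp d].
have mG : measurable G by exact: measurable_le_cst.
have PG : ((2^-1)%:E <= P G)%E.
  have h1 : (P (~` G) <= (2^-1)%:E)%E.
    rewrite (_ : ~` G = [set w | M ^+ chain_exp d < S w]); last first.
      by apply/seteqP; split => w /=; [move/negP; rewrite -ltNge|move=> + hh; rewrite ltNge hh].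
    have Mpp : 0 < M ^+ chain_exp d by rewrite exprn_gt0.
    apply: le_trans (markov_ge0 P mS (fun w => chain_sum_ge0 _ _ _) Mpp) _ => //.
    apply: (@le_trans _ _ ((M ^+ chain_exp d)^-1%:E * C%:E)%E).
      by rewrite lee_wpmul2l// lee_fin invr_ge0 ltW.
    by rewrite -EFinM lee_fin mulrC ler_pdivrMr// ler_pdivlMl.
  have h2 := probability_setC P mG.
  have fG := fin_num_measure P _ mG.
  move: h1 fG; rewrite h2; case: (P G) => // r; rewrite -EFinB !lee_fin => ? _; lra.
(* Truncating words at length L keeps the index set of the cells independent of L; adding M makes
   the value nonnegative on [G], ready for rounding down. *)
pose Y j u w := (X j (take L u) w - X j [::] w + M) / h.
pose S_ (f : F0) := G `&` [set w | forall i : I0, (f i)%:R <= Y i.1 i.2 w] `&`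
   [set w | forall i : I0, Y i.1 i.2 w <= (f i)%:R + 1].
have mY j u : measurable_fun setT (Y j u).
  by apply: measurable_funM => //; apply: measurable_funD => //; apply: measurable_funB.
have mS_ f : measurable (S_ f).
  apply: measurableI; first apply: measurableI => //.
    apply: (@measurable_forall _ _ I0 (fun i => [set w | (f i)%:R <= Y i.1 i.2 w])) => i.
    rewrite (_ : [set w | _] = [set w | - Y i.1 i.2 w <= - (f i)%:R]).
      by apply: measurable_le_cst; apply: measurableT_comp => //.
    by apply/seteqP; split => w /=; rewrite lerN2.
  apply: (@measurable_forall _ _ I0 (fun i => [set w | Y i.1 i.2 w <= (f i)%:R + 1])) => i.
  exact: measurable_le_cst.
have oscG w j u : G w -> (size u <= L)%N -> `|X j u w - X j [::] w| <= M.
  by move=> Gw uL; exact: (chain_osc q01 j Gw (ltW M0) uL).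
have [f Pf] : exists f, (((2 * #|F0|%:R)^-1)%:E <= P (S_ f))%E.
  apply: contrapT => nf.
  have lt f : (P (S_ f) < ((2 * #|F0|%:R)^-1)%:E)%E.
    by rewrite ltNge; apply/negP => hh; apply: nf; exists f.
  have cov : G `<=` [set w | exists2 f, f \in index_enum F0 & S_ f w].
    move=> w Gw.
    have Yb (i : I0) : 0 <= Y i.1 i.2 w <= 2 * M / h.
      have := oscG w i.1 (take L i.2) Gw; rewrite size_take_min geq_minl => /(_ isT).
      rewrite ler_norml /Y => /andP[? ?]; rewrite divr_ge0 ?(ltW h0)//=; last by lra.
      by rewrite ler_pM2r ?invr_gt0//; lra.
    pose f : F0 := [ffun i : I0 => inord `|Num.floor (Y i.1 i.2 w)|%N].
    have fE (i : I0) : (f i)%:R <= Y i.1 i.2 w < (f i)%:R + 1.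
      have /andP[y0 yM] := Yb i.
      have fl0 : 0 <= Num.floor (Y i.1 i.2 w) by rewrite floor_ge0.
      have fl : ((`|Num.floor (Y i.1 i.2 w)|%N)%:R : R) = (Num.floor (Y i.1 i.2 w))%:~R.
        by rewrite -[in RHS](gez0_abs fl0).
      rewrite ffunE inordK.
        by rewrite fl floor_le//= -[1]/(1%:~R) -intrD floorD1_gt.
      rewrite ltnS /N; have : Num.floor (Y i.1 i.2 w) <= Num.floor (2 * M / h) by exact: le_floor.
      by move: fl0; case: (Num.floor (Y i.1 i.2 w)) => // n _; case: (Num.floor (2 * M / h)).
    exists f; first by rewrite mem_index_enum.
    by split; [split=> //|] => i; have /andP[h1 h2] := fE i; [|rewrite ltW].
  have : (P G < (2^-1)%:E)%E.
    apply: (@le_lt_trans _ _ (\sum_(f <- index_enum F0) P (S_ f))%E).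
      apply: le_trans (measure_exists_le P (index_enum F0) mS_).
      apply: le_measure; rewrite ?inE//.
      rewrite (_ : [set w | _] = [set w | exists f, S_ f w]); first exact: measurable_exists.
      by apply/seteqP; split => w [f] //; [move=> _; exists f|exists f; rewrite ?mem_index_enum].
    have fin f : P (S_ f) \is a fin_num by exact: fin_num_measure.
    rewrite (eq_bigr (fun f => (fine (P (S_ f)))%:E)); last by move=> f _; rewrite fineK.
    rewrite sumEFin lte_fin.
    apply: (@lt_le_trans _ _ (\sum_(f : F0) (2 * #|F0|%:R)^-1)).
      have /card_gt0P[f0 _] := F0g.
      apply: ltr_sum => [|f _]; first by apply/hasP; exists f0; rewrite ?mem_index_enum.
      by rewrite -lte_fin fineK.
    by rewrite sumr_const -[leLHS]mulr_natl invfM mulrCA divff ?mulr1 ?gt_eqF.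
  by rewrite ltNge PG.
have good w w' j u : S_ f w -> S_ f w' -> (size u <= L)%N ->
   `|(X j u w - X j [::] w) - (X j u w' - X j [::] w')| <= e.
  move=> [[Gw f1] f2] [[Gw' f3] f4] uL.
  have small v : (size v <= l0)%N -> (size v <= L)%N -> `|(X j v w - X j [::] w) - (X j v w' - X j [::] w')| <= h.
    move=> vl vL; pose i : I0 := (j, Bseq vl).
    have := f1 i; have := f2 i; have := f3 i; have := f4 i; rewrite /= /Y (take_oversize vL).
    set x := X j v w - X j [::] w; set y := X j v w' - X j [::] w'.
    rewrite !ler_pdivlMr// !ler_pdivrMr// => a1 a2 a3 a4.
    by rewrite ler_norml; apply/andP; split; lra.
  have [ul|lu] := leqP (size u) l0.
    by apply: le_trans (small u ul uL) _; rewrite hE ler_pdivrMr// ler_peMr ?(ltW e0)// ler1n.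
  have st : size (take l0 u) = l0 by rewrite size_takel// ltnW.
  have tail z : G z -> `|X j u z - X j (take l0 u) z| <= h.
    move=> Gz; apply: le_trans hl0.
    have hs : (size (take l0 u) + size (drop l0 u) <= L)%N by rewrite -size_cat cat_take_drop.
    by have := chain_path q01 j Gz (ltW M0) hs; rewrite cat_take_drop st.
  have := small (take l0 u); rewrite st => /(_ (leqnn _) (leq_trans (ltnW lu) uL)).
  have := tail w Gw; have := tail w' Gw'; rewrite !ler_norml hE => /andP[? ?] /andP[? ?] /andP[? ?].
  by apply/andP; split; lra.
have rot := rotation_law gX (@osc_le_cylinder R D d L e).
apply: (@le_trans _ _ (P (S_ f) * P (S_ f))%E).
  rewrite /p0 expr2 EFinM lee_pmul// lee_fin invr_ge0 mulr_ge0 ?ler0n//.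
rewrite -(product_measure1E P P (mS_ f) (mS_ f)).
apply: (@le_trans _ _ ((P \x P)%E [set w : T * T | osc_le L e (fun j u => (Num.sqrt 2)^-1 * (X j u w.1 - X j u w.2))])); last by rewrite le_eqVlt; apply/orP; left; apply/eqP; exact: esym rot.
apply: le_measure; rewrite ?inE.
- exact: measurableX.
- apply: (@osc_le_measurable _ _ _ _ _ (fun j u (w : T * T) => (Num.sqrt 2)^-1 * (X j u w.1 - X j u w.2))) => j u.
  apply: measurable_funM => //; apply: measurable_funB.
    exact: measurableT_comp (mX j u) measurable_fst.
  exact: measurableT_comp (mX j u) measurable_snd.
- move=> [w w'] /= [Sw Sw'] j u uL /=; rewrite -mulrBr normrM.
  have s2 : `|(Num.sqrt 2)^-1| <= 1 :> R.
    by rewrite ger0_norm ?invr_ge0// invf_le1 ?sqrtr_gt0// -[leLHS]sqrtr1 ler_sqrt// ler1n.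
  rewrite -[leRHS]mul1r; apply: ler_pM => //.
  rewrite (_ : X j u w - X j u w' - _ = (X j u w - X j [::] w) - (X j u w' - X j [::] w')); last by ring.
  exact: good.
Qed.

End small_ball.

Section independent_blocks.
Context d (T : measurableType d) {R : realType} (P : probability T R).
Context {I : countType} {J : Type} (Y : I -> J -> T -> R).
Hypothesis gY : gauss_family P (fun i : I * J => Y i.1 i.2).
Hypothesis uncorrelated : forall i i' j j', i != i' -> ip P (Y i j) (Y i' j') = 0.

(** One block at a time is split off: the remaining ones together form a single family uncorrelated
    with it, hence independent of it as a whole. *)
Lemma prob_blocks_le (s : seq I) (B : I -> set (J -> R)) (c : I -> R) : uniq s ->
  (forall i, <<s @cylinders R J >> (B i)) -> (forall i, 0 <= c i) ->
  (forall i, i \in s -> P [set w | B i (Y i ^~ w)] <= (c i)%:E)%E ->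
  (P [set w | forall i, i \in s -> B i (Y i ^~ w)] <= (\prod_(i <- s) c i)%:E)%E.
Proof.
move=> us cB c0; elim: s us => [_ _|i0 s IH /= /andP[i0s us] hc].
  rewrite big_nil (_ : [set w | _] = setT); last by apply/seteqP; split.
  by rewrite (probability_setT P).
pose X1 (k : {i : I | i \in s} * J) := Y (val k.1) k.2.
pose f (k : {i : I | i \in s} * J + J) : I * J :=
  match k with inl k => (val k.1, k.2) | inr j => (i0, j) end.
have gX : gauss_family P (sum_family X1 (Y i0)).
  have := gauss_family_reindex f gY; congr gauss_family.
  by apply/funext => -[].
have X12 k j : ip P (X1 k) (Y i0 j) = 0.
  by apply: uncorrelated; apply: contraNneq i0s => <-; exact: valP.
pose Z := g_sigma_algebraType (@cylinders R ({i : I | i \in s} * J)%type).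
pose A : set Z := [set x | forall k, B (val k) (fun j => x (k, j))].
have cA : <<s cylinders >> A.
  suff : measurable A by [].
  apply: measurable_forall => k.
  apply: (@measurable_preimage_cylinder R J _ Z (fun j x => x (k, j))) => // j.
  exact: cylinder_coordinate.
have := uncorrelated_independent gX X12 cA (cB i0).
rewrite (_ : [set w | _ /\ _] = [set w | forall i, i \in i0 :: s -> B i (Y i ^~ w)]); last first.
  apply/seteqP; split => w /=.
    by move=> [h1 h2] i; rewrite inE => /orP[/eqP ->//|is_]; exact: (h1 (exist _ i is_)).
  by move=> h; split => [k|]; apply: h; rewrite inE ?eqxx// (valP k) orbT.
move=> ->; rewrite big_cons EFinM muleC; apply: lee_pmul => //.
  by apply: hc; rewrite mem_head.
rewrite (_ : [set w | _] = [set w | forall i, i \in s -> B i (Y i ^~ w)]).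
  by apply: IH => // i is_; apply: hc; rewrite inE is_ orbT.
apply/seteqP; split => w /= h; first by move=> i is_; exact: (h (exist _ i is_)).
by move=> k; apply: h; exact: valP.
Qed.

End independent_blocks.

Section bad_scales.
Context {R : realType} (D : finType) (d : nat) (q : R).
Hypothesis q01 : 0 < q < 1.
Hypothesis Dq : #|D|%:R * q ^+ d = 1.

(** The order of choices is the point. The small ball probability at [e / 2] fixes the number M of
    trials; only then is [delta] taken so small that all M remainders Z oscillate by at most
    [e / 2], except on an event of probability [eta / 2]. The blocks Y are independent of each
    other, while the Z may depend on everything. *)
Lemma bad_scales (A e eta : R) : 0 <= A -> 0 < e -> 0 < eta ->
  exists M : nat, exists2 delta : R, 0 < delta &
  forall d' (T : measurableType d') (P : probability T R)
    (Y Z : nat -> 'I_d -> seq D -> T -> R) (L : nat),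
  gauss_family P (fun i : nat * ('I_d * seq D) => Y i.1 i.2.1 i.2.2) ->
  (forall i i' j j' u u', i != i' -> ip P (Y i j u) (Y i' j' u') = 0) ->
  (forall i, (i < M)%N -> increments_le q P (Y i) L A A) ->
  (forall i j u, measurable_fun setT (Z i j u)) ->
  (forall i j u a, near_gauss P (fun w => Z i j (rcons u a) w - Z i j u w)) ->
  (forall i, (i < M)%N -> increments_le q P (Z i) L A delta) ->
  (P [set w | forall i, (i < M)%N -> ~ osc_le L e (fun j u => Y i j u w + Z i j u w)%R] <= eta%:E)%E.
Proof.
move=> A0 e0 eta0.
have e20 : 0 < e / 2 by rewrite divr_gt0.
have [p0 /andP[p00 p01] sb] := small_ball q01 Dq A0 e20.
have [M hM] : exists M, (1 - p0) ^+ M <= eta / 2.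
  have : (1 - p0) ^+ n @[n --> \oo] --> (0 : R).
    by apply: cvg_expr; rewrite ger0_norm ?subr_ge0// gtrBl.
  move=> /cvgrPdist_le /(_ (eta / 2)) []; first by rewrite divr_gt0.
  move=> M _ /(_ M (leqnn _)); rewrite sub0r normrN ger0_norm ?exprn_ge0 ?subr_ge0// => h.
  by exists M.
(* The probability that one remainder is large is at most [(K - 1) / M] times the square root of
   [delta]. With that root equal to [eta / (2 K)], the M remainders together cost at most
   [eta / 2]. *)
have [K KE] : exists K, K = Num.sqrt (A ^+ (d.+2.*2.-1)) * osc_cst D d q / (e / 2) ^+ chain_exp d * M%:R + 1.
  by eexists.
have K1 : 1 <= K.
  rewrite KE lerDr mulr_ge0// divr_ge0 ?exprn_ge0 ?(ltW e20)// mulr_ge0 ?sqrtr_ge0//.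
  exact: osc_cst_ge0.
have K0 : 0 < K by exact: lt_le_trans K1.
pose delta := (eta / (2 * K)) ^+ 2.
have s0 : 0 < eta / (2 * K) by rewrite divr_gt0 ?mulr_gt0.
exists M, delta; first by rewrite exprn_gt0.
move=> d' T P Y Z L gY unc incY mZ gZ incZ.
have mY i j u : measurable_fun setT (Y i j u) := gauss_family_measurable gY (i, (j, u)).
pose B : set ('I_d * seq D -> R) := ~` [set x | osc_le L (e / 2) (fun j u => x (j, u))].
have cB : <<s cylinders >> B.
  suff : @measurable _ (g_sigma_algebraType (@cylinders R ('I_d * seq D)%type)) B by [].
  by apply: measurableC; exact: osc_le_cylinder.
pose G := [set w | forall i, i \in iota 0 M -> B (fun x => Y i x.1 x.2 w)].
have PG : (P G <= (eta / 2)%:E)%E.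
  have := @prob_blocks_le _ _ _ P _ _ (fun i (x : 'I_d * seq D) => Y i x.1 x.2) gY
    (fun i i' x x' ii => unc i i' x.1 x'.1 x.2 x'.2 ii) (iota 0 M) (fun=> B) (fun=> 1 - p0) (iota_uniq _ _) (fun=> cB).
  move=> /(_ (fun=> _)) h; apply: le_trans (h _ _) _.
  - by rewrite subr_ge0.
  - move=> i; rewrite mem_iota add0n => /= iM.
    have gi : gauss_family P (fun x : 'I_d * seq D => Y i x.1 x.2).
      exact: (gauss_family_reindex (fun x : 'I_d * seq D => (i, x)) gY).
    have := sb _ _ P (Y i) L gi (incY i iM).
    set E := [set w | _] => pE.
    have mE : measurable E by apply: osc_le_measurable.
    rewrite (_ : [set w | _] = ~` E)//.
    rewrite (probability_setC P mE).
    by rewrite EFinB leeB.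
  - by rewrite big_const_seq count_predT size_iota -Monoid.iteropE lee_fin.
pose H i := ~` [set w | osc_le L (e / 2) (fun j u => Z i j u w)].
have mH i : measurable (H i) by apply: measurableC; apply: osc_le_measurable.
have PH i : (i < M)%N -> (P (H i) <= ((K - 1) / M%:R * (eta / (2 * K)))%:E)%E.
  move=> iM; have M0 : M%:R != 0 :> R by rewrite pnatr_eq0 -lt0n (leq_trans _ iM).
  have dl0 : 0 <= delta by rewrite sqr_ge0.
  have := near_gauss_chain_sum q01 Dq A0 dl0 (gZ i) (mZ i) (incZ i iM).
  move=> /(osc_prob q01 e20 (mZ i)) h; apply: le_trans h _.
  rewrite lee_fin {1}KE addrK mulfK// sqrtrM ?exprn_ge0// /delta sqrtr_sqr ger0_norm ?(ltW s0)//.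
  by rewrite le_eqVlt; apply/orP; left; apply/eqP; ring.
have mE : measurable [set w | exists2 i, i \in iota 0 M & H i w].
  rewrite (_ : [set w | _] = [set w | exists i, (fun i => if i \in iota 0 M then H i else set0) i w]).
    by apply: measurable_exists => i; case: ifP.
  apply/seteqP; split => w /=; first by move=> [i iM Hi]; exists i; rewrite iM.
  by move=> [i]; case: ifPn => // iM Hi; exists i.
have mG : measurable G.
  apply: measurable_forall => i; apply: measurable_implies.
  apply: (@measurable_preimage_cylinder R _ _ T (fun x : 'I_d * seq D => Y i x.1 x.2)) => //.
apply: (@le_trans _ _ (P (G `|` [set w | exists2 i, i \in iota 0 M & H i w]))).
  apply: le_measure; rewrite ?inE.
  - apply: measurable_forall => i; apply: measurable_implies.
    apply: measurableC; apply: (@osc_le_measurable R D d _ T (fun j u w => Y i j u w + Z i j u w)) => j u.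
    exact: measurable_funD.
  - exact: measurableU.
  - move=> w /= h; have [[i iM Hi]|nH] := pselect (exists2 i, i \in iota 0 M & H i w).
      by right; exists i.
    left => i iM /= oY; apply: (h i); first by move: iM; rewrite mem_iota.
    have oZ : osc_le L (e / 2) (fun j u => Z i j u w).
      by apply: contrapT => nZ; apply: nH; exists i.
    move=> j u uL; have := oY j u uL; have := oZ j u uL => /= z y.
    rewrite (_ : _ - _ = (Y i j u w - Y i j [::] w) + (Z i j u w - Z i j [::] w)); last by ring.
    apply: le_trans (ler_normD _ _) _; lra.
apply: le_trans (measureU2 _ mG mE) _.
rewrite [eta]splitr EFinD leeD//.
apply: le_trans (measure_exists_le P (iota 0 M) mH) _.
apply: (@le_trans _ _ (\sum_(i <- iota 0 M) ((K - 1) / M%:R * (eta / (2 * K)))%:E)).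
  rewrite !big_seq; apply: lee_sum => i; rewrite mem_iota => /= iM; exact: PH.
rewrite sumEFin lee_fin big_const_seq count_predT size_iota iter_addr_0 -[leLHS]mulr_natr.
have [->|M0] := eqVneq M 0%N; first by rewrite mulr0 divr_ge0 ?(ltW eta0).
rewrite mulrAC divfK ?pnatr_eq0//.
have -> : (K - 1) * (eta / (2 * K)) = eta / 2 * ((K - 1) / K) by field; rewrite gt_eqF.
by rewrite ler_piMr ?divr_ge0 ?(ltW eta0)// ler_pdivrMr// mul1r gerBl.
Qed.

End bad_scales.

(** * Random coverings and hitting *)

Section random_cover.
Context {R : realType} (D : finType) (d : nat) (q : R).
Hypothesis q01 : 0 < q < 1.
Hypothesis Dq : #|D|%:R * q ^+ d = 1.
Hypothesis d0 : (0 < d)%N.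

Let q0 : 0 < q. Proof. by case/andP: q01. Qed.
Let q1 : q < 1. Proof. by case/andP: q01. Qed.
Local Notation p := (chain_exp d).

Let pE : p = (d + (d + 4))%N.
Proof. by rewrite /chain_exp -addnn -[d.+2]addn2 -addnA; congr addn; rewrite addnCA. Qed.

(** This is criticality: the weight [q ^+ size w ^+ d] of a word is conserved when the word is split
    into its extensions. *)
Lemma sum_tuple_scale s w : \sum_(u : s.-tuple D) q ^+ size (w ++ u) ^+ d = q ^+ size w ^+ d.
Proof.
under eq_bigr do rewrite size_cat size_tuple exprD exprMn.
rewrite sumr_const card_tuple -[LHS]mulr_natl natrX.
by rewrite mulrCA -[q ^+ s ^+ d]exprM mulnC exprM -exprMn Dq expr1n mulr1.
Qed.

Section deterministic.
Variables (x : 'I_d -> seq D -> R) (L M s n0 : nat) (e : R) (leaf : seq D -> R).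
Hypothesis e0 : 0 < e.
Hypothesis leaf0 : forall w, 0 <= leaf w.

Definition good_word w : Prop := osc_le L (e * q ^+ size w) (fun j u => x j (w ++ u)).

(** A stopping rule: descend s letters at a time until a good word is met, at most m times, and
    otherwise fall back on the radius [leaf]. The second component of a cell is a bound for the
    oscillation below it. *)
Fixpoint cover_below m w : seq (seq D * R) :=
  if m is m'.+1 then
    if `[< good_word w >] then [:: (w, e * q ^+ size w)]
    else flatten [seq cover_below m' (w ++ u) | u : s.-tuple D]
  else [:: (w, leaf w)].

Fixpoint leaf_sum (g : seq D -> R) m w : R :=
  if m is m'.+1 then \sum_(u : s.-tuple D) leaf_sum g m' (w ++ u) else g w.

Lemma big_cover_flatten (I : finType) (F : I -> seq (seq D * R)) (f : seq D * R -> R) :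
  \sum_(c <- flatten [seq F u | u : I]) f c = \sum_u \sum_(c <- F u) f c.
Proof. by rewrite big_flatten/= big_map big_enum. Qed.

Lemma cover_below_weight m w : \sum_(c <- cover_below m w) q ^+ size c.1 ^+ d = q ^+ size w ^+ d.
Proof.
elim: m w => [|m IH] w /=; first by rewrite big_seq1.
case: ifP => _; first by rewrite big_seq1.
by rewrite big_cover_flatten; under eq_bigr do rewrite IH; exact: sum_tuple_scale.
Qed.

Lemma cover_below_size m w c : c \in cover_below m w ->
  (size w <= size c.1 <= size w + m * s)%N /\ 0 <= c.2.
Proof.
elim: m w => [|m IH] w /=.
  by rewrite inE => /eqP -> /=; rewrite mul0n addn0 leqnn.
case: ifP => _.
  by rewrite inE => /eqP -> /=; rewrite leqnn leq_addr mulr_ge0 ?exprn_ge0 ?(ltW q0) ?(ltW e0).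
move=> /flattenP[t /mapP[u _ ->]] /IH[]; rewrite size_cat size_tuple => /andP[h1 h2] c0.
by split => //; apply/andP; split; [exact: leq_trans (leq_addr _ _) h1|rewrite mulSn addnA].
Qed.

Lemma cover_below_covers m w v : prefix w v -> (size w + m * s <= size v)%N ->
  exists2 c, c \in cover_below m w & prefix c.1 v.
Proof.
elim: m w => [|m IH] w wv /=; first by exists (w, leaf w); rewrite ?mem_head.
move=> sv; case: ifP => _; first by exists (w, e * q ^+ size w); rewrite ?mem_head.
have [t vE] := prefixP wv.
have st : (s <= size t)%N.
  by move: sv; rewrite vE size_cat leq_add2l; apply: leq_trans; rewrite mulSn leq_addr.
have ht : size (take s t) == s by rewrite size_takel.
have pu : prefix (w ++ Tuple ht) v.
  by rewrite vE /= -[in X in prefix _ X](cat_take_drop s t) catA; exact: prefix_prefix.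
have [|c cc cv] := IH _ pu; first by rewrite size_cat size_tuple -addnA -mulSn.
exists c => //; apply/flattenP; exists (cover_below m (w ++ Tuple ht)) => //.
exact: (map_f _ (mem_enum predT (Tuple ht))).
Qed.

Lemma cover_below_osc m w :
  (forall v, size v = (size w + m * s)%N -> osc_le L (leaf v) (fun j u => x j (v ++ u))) ->
  forall c, c \in cover_below m w -> osc_le L c.2 (fun j u => x j (c.1 ++ u)).
Proof.
elim: m w => [|m IH] w hl c /=.
  by rewrite inE => /eqP -> /=; apply: hl; rewrite mul0n addn0.
case: ifP => [/asboolP gw|_]; first by rewrite inE => /eqP ->.
move=> /flattenP[t /mapP[u _ ->]]; apply: IH => v sv; apply: hl.
by rewrite sv size_cat size_tuple mulSn addnA.
Qed.

Definition bad_word v : Prop :=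
  forall i, (i < M)%N -> ~ good_word (take (n0 + i * s) v).

Lemma cover_below_cost g m w : (m <= M)%N -> size w = (n0 + (M - m) * s)%N ->
  (forall i, (i < M - m)%N -> ~ good_word (take (n0 + i * s) w)) ->
  (forall v, size v = (n0 + M * s)%N -> 0 <= g v) ->
  (forall v, size v = (n0 + M * s)%N -> bad_word v -> leaf v ^+ d <= g v) ->
  \sum_(c <- cover_below m w) c.2 ^+ d <= e ^+ d * q ^+ size w ^+ d + leaf_sum g m w.
Proof.
move=> + + + g0 hg; elim: m w => [|m IH] w mM sw bw /=.
  rewrite big_seq1/= -[leLHS]add0r lerD ?mulr_ge0 ?exprn_ge0 ?(ltW q0) ?(ltW e0)//.
  rewrite subn0 in sw; apply: hg => // i iM; apply: bw; rewrite subn0//.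
have sM : (M - m = (M - m.+1).+1)%N by rewrite subnSK.
have ls_ge0 m' w' : (size w' + m' * s = n0 + M * s)%N -> 0 <= leaf_sum g m' w'.
  elim: m' w' => [|m' IH'] w' /=; first by rewrite mul0n addn0 => h; exact: g0.
  move=> h; apply: sumr_ge0 => u _; apply: IH'.
  by rewrite size_cat size_tuple -addnA -mulSn.
case: ifP => [_|/asboolP ngw].
  rewrite big_seq1/= exprMn lerDl; apply: sumr_ge0 => u _; apply: ls_ge0.
  rewrite size_cat size_tuple sw -!addnA -!mulSn -mulnDl; congr (_ + _ * _)%N.
  by rewrite subnK.
rewrite big_cover_flatten -(sum_tuple_scale s w) mulr_sumr -big_split/=.
apply: ler_sum => u _; apply: IH => //; first exact: ltnW.
  by rewrite size_cat size_tuple sw sM mulSn addnAC addnA.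
move=> i; rewrite sM ltnS leq_eqVlt => /orP[/eqP ->|iM].
  by rewrite -sw take_size_cat.
rewrite takel_cat; first exact: bw.
by rewrite sw leq_add2l leq_mul2r ltnW ?orbT.
Qed.

End deterministic.

Section random.
Context d' (T : measurableType d') (P : probability T R).
Variables (X : 'I_d -> seq D -> T -> R) (A : R).
Hypothesis A0 : 0 <= A.
Hypothesis gX : gauss_family P (fun i : 'I_d * seq D => X i.1 i.2).
Hypothesis incX : forall j u a,
  ip P (fun w => X j (rcons u a) w - X j u w) (fun w => X j (rcons u a) w - X j u w) <=
  A * q ^+ size u ^+ 2.
Hypothesis badX : forall e eta n1, 0 < e -> 0 < eta ->
  exists M s n0, (n1 <= n0)%N /\ forall L w, size w = (n0 + M * s)%N ->
  (P [set z | bad_word (fun j u => X j u z) L M s n0 e w] <= eta%:E)%E.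

Let mX j u : measurable_fun setT (X j u).
Proof. exact: (gauss_family_measurable gX (j, u)). Qed.

Let S L w z := chain_sum q L (fun j u => X j (w ++ u) z).

Let mS L w : measurable_fun setT (S L w).
Proof. by apply: chain_sum_measurable. Qed.

Let S0 L w z : 0 <= S L w z.
Proof. exact: chain_sum_ge0. Qed.

Let C := A ^+ d.+2 * osc_cst D d q.

Let C0 : 0 <= C.
Proof. by rewrite mulr_ge0 ?exprn_ge0// osc_cst_ge0. Qed.

Let ES L w : (\int[P]_z (S L w z)%:E <= (C * q ^+ size w ^+ p)%:E)%E.
Proof.
pose A' := A * q ^+ size w ^+ 2.
have A'0 : 0 <= A' by rewrite mulr_ge0// sqr_ge0.
have := @near_gauss_chain_sum R D d q q01 Dq _ _ P (fun j u => X j (w ++ u)) L A' A' A'0 A'0.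
rewrite -exprSr prednK ?double_gt0// -muln2 exprM sqrtr_sqr ger0_norm ?exprn_ge0//.
rewrite /A' exprMn -[(q ^+ _ ^+ 2) ^+ _]exprM mul2n mulrAC; apply => // [j u a|j u a uL].
  have := gauss_family_near_B (j, w ++ rcons u a) (j, w ++ u) gX; exact.
rewrite -rcons_cat; apply: le_trans (incX _ _ _) _; rewrite size_cat exprD exprMn mulrA.
rewrite le_min lexx/= -[leRHS]mulr1 ler_wpM2l// -exprM exprn_ile1 ?(ltW q0) ?(ltW q1)//.
Qed.

(** The maximal depth N is fixed before the resolution L of the field. The total weight 1 is kept in
    the conclusion because the hitting estimate adds to the radii errors that are compared with the
    weights. *)
Lemma random_cover (e : R) n1 : 0 < e ->
  exists N, forall L, exists H, [/\ measurable H, (P (~` H) <= e%:E)%E &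
    forall z, H z -> exists c : seq (seq D * R),
    [/\ forall x, x \in c -> [/\ (n1 <= size x.1)%N, (size x.1 <= N)%N, 0 <= x.2 &
          osc_le L x.2 (fun j u => X j (x.1 ++ u) z)],
        \sum_(x <- c) x.2 ^+ d <= e,
        \sum_(x <- c) q ^+ size x.1 ^+ d = 1 &
        forall v, (N <= size v)%N -> exists2 x, x \in c & prefix x.1 v]].
Proof.
move=> e_gt0.
have [e1 [e10 e11 e1e]] : exists e1 : R, [/\ 0 < e1, e1 <= 1 & e1 <= e / 2].
  exists (Num.min 1 (e / 2)); rewrite lt_min ltr01 divr_gt0// ge_min lexx ge_min lexx orbT.
  by split.
have e80 : 0 < e ^+ 2 / 8 by rewrite divr_gt0// exprn_gt0.
(* [K * q ^+ size w] separates ordinary leaf radii from exceptional ones. The exceptional ones are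
   charged to the moment and contribute at most [C / K] per unit of weight; the ordinary ones cost
   [K ^+ d], against which the probability of bad words is then made small. *)
have [K K1 KC] : exists2 K : R, 1 <= K & C / K <= e ^+ 2 / 8.
  exists (1 + C / (e ^+ 2 / 8)); first by rewrite lerDl divr_ge0// ltW.
  rewrite ler_pdivrMr; last by rewrite ltr_wpDr// divr_ge0// ltW.
  by rewrite mulrDr mulr1 mulrCA divff ?mulr1 ?gt_eqF// lerDr ltW.
have K0 : 0 < K by exact: lt_le_trans K1.
have eta0 : 0 < e ^+ 2 / 8 / K ^+ d by rewrite divr_gt0// exprn_gt0.
have [M [s [n0 [n10 hbad]]]] := badX n1 e10 eta0.
exists (n0 + M * s)%N => L.
pose bad w : set T := [set z | bad_word (fun j u => X j u z) L M s n0 e1 w].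
have mbad w : measurable (bad w).
  apply: measurable_forall => i; apply: measurable_implies; apply: measurableC.
  apply: (@osc_le_measurable R D d _ T (fun j u => X j (take (n0 + i * s) w ++ u))) => j u.
  exact: mX.
pose r (w : seq D) := K * q ^+ size w.
have r0 w : 0 < r w by rewrite mulr_gt0// exprn_gt0.
(* A leaf radius below [r w] costs at most [r w ^+ d], on the bad event only. Otherwise
   [leaf ^+ d <= leaf ^+ p / r ^+ (d + 4)], because [p = d + (d + 4)], and [leaf ^+ p] is the chain
   sum below w. *)
pose g w z := r w ^+ d * \1_(bad w) z + S L w z / r w ^+ (d + 4).
have mg w : measurable_fun setT (g w).
  apply: measurable_funD; first by apply: measurable_funM => //; exact: measurable_indic.
  by apply: measurable_funM.
have g0 w z : 0 <= g w z.
  apply: addr_ge0; first by rewrite mulr_ge0 ?exprn_ge0 ?(ltW (r0 w))// indicE ler0n.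
  by rewrite divr_ge0// exprn_ge0// ltW.
have Eg w : size w = (n0 + M * s)%N -> (\int[P]_z (g w z)%:E <= (e ^+ 2 / 4 * q ^+ size w ^+ d)%:E)%E.
  move=> sw; rewrite (_ : (fun z => (g w z)%:E) = (fun z => (r w ^+ d)%:E * (\1_(bad w) z)%:E + ((r w ^+ (d + 4))^-1)%:E * (S L w z)%:E)%E); last first.
    by apply/funext => z; rewrite /g EFinD !EFinM [X in (_ + X)%E]muleC.
  have rd0 : 0 <= r w ^+ d by rewrite exprn_ge0// ltW.
  have rd4 : 0 <= (r w ^+ (d + 4))^-1 by rewrite invr_ge0 exprn_ge0// ltW.
  rewrite ge0_integralD//; first last.
  - by apply/measurable_EFinP; apply: measurable_funM.
  - by move=> z _; rewrite mule_ge0 ?lee_fin.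
  - by apply/measurable_EFinP; apply: measurable_funM => //; exact: measurable_indic.
  - by move=> z _; rewrite mule_ge0 ?lee_fin// indicE ler0n.
  rewrite ge0_integralZl//; last by apply/measurable_EFinP; exact: measurable_indic.
  rewrite ge0_integralZl//; first last.
  - by move=> z _; rewrite lee_fin.
  - exact/measurable_EFinP.
  rewrite integral_indic// setIT.
  apply: (@le_trans _ _ ((r w ^+ d)%:E * (e ^+ 2 / 8 / K ^+ d)%:E + ((r w ^+ (d + 4))^-1)%:E * (C * q ^+ size w ^+ p)%:E)%E).
    apply: leeD.
      by apply: lee_wpmul2l; rewrite ?lee_fin//; exact: hbad.
    by apply: lee_wpmul2l; rewrite ?lee_fin//; exact: ES.
  rewrite -!EFinM -EFinD lee_fin /r.
  have [Q QE] : exists Q, Q = q ^+ size w by eexists.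
  have Q0 : 0 < Q by rewrite QE exprn_gt0.
  rewrite -QE !exprMn invfM.
  rewrite pE [Q ^+ (d + (d + 4))]exprD.
  have -> : K ^+ d * Q ^+ d * (e ^+ 2 / 8 / K ^+ d) = e ^+ 2 / 8 * Q ^+ d.
    by field; rewrite expf_neq0 ?gt_eqF.
  have -> : (K ^+ (d + 4))^-1 * (Q ^+ (d + 4))^-1 * (C * (Q ^+ d * Q ^+ (d + 4))) = C / K ^+ (d + 4) * Q ^+ d.
    by field; rewrite !expf_neq0 ?gt_eqF.
  rewrite -mulrDl ler_wpM2r ?exprn_ge0 ?(ltW Q0)//.
  suff : C / K ^+ (d + 4) <= e ^+ 2 / 8 by lra.
  apply: le_trans KC; rewrite ler_wpM2l// lef_pV2 ?posrE ?exprn_gt0//.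
  by rewrite -[leLHS]expr1 ler_weXn2l// addn4.
have Ez m w : (m <= M)%N -> size w = (n0 + (M - m) * s)%N ->
  (\int[P]_z (leaf_sum s (fun w => g w z) m w)%:E <= (e ^+ 2 / 4 * q ^+ size w ^+ d)%:E)%E /\
  measurable_fun setT (fun z => leaf_sum s (fun w => g w z) m w) /\
  (forall z, 0 <= leaf_sum s (fun w => g w z) m w).
  elim: m w => [|m IH] w mM sw /=.
    by split; [apply: Eg; rewrite sw subn0|].
  have sM : (M - m = (M - m.+1).+1)%N by rewrite subnSK.
  have su (u : s.-tuple D) : size (w ++ u) = (n0 + (M - m) * s)%N.
    by rewrite size_cat size_tuple sw sM mulSn addnAC addnA.
  have IH' (u : s.-tuple D) := IH (w ++ u) (ltnW mM) (su u).
  split; last first.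
    split; first by apply: measurable_sum => u; have [_ []] := IH' u.
    by move=> z; apply: sumr_ge0 => u _; have [_ [_]] := IH' u.
  under eq_integral do rewrite -sumEFin.
  rewrite ge0_integral_sum//; first last.
  - by move=> u z _; rewrite lee_fin; have [_ [_]] := IH' u.
  - by move=> u; apply/measurable_EFinP; have [_ []] := IH' u.
  apply: (@le_trans _ _ (\sum_(u : s.-tuple D) (e ^+ 2 / 4 * q ^+ size (w ++ u) ^+ d)%:E)%E).
    by apply: lee_sum => u _; have [] := IH' u.
  by rewrite sumEFin -mulr_sumr sum_tuple_scale.
pose Z z := leaf_sum n0 (fun w => leaf_sum s (fun w => g w z) M w) 1 [::].
have sz (u : n0.-tuple D) : size u = (n0 + (M - M) * s)%N by rewrite subnn mul0n addn0 size_tuple.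
have Eu (u : n0.-tuple D) := Ez M u (leqnn _) (sz u).
have mZ : measurable_fun setT Z.
  by apply: measurable_sum => u; have [_ []] := Eu u.
have Z0 z : 0 <= Z z by apply: sumr_ge0 => u _; have [_ [_]] := Eu u.
have EZ : (\int[P]_z (Z z)%:E <= (e ^+ 2 / 4)%:E)%E.
  rewrite /Z /=; under eq_integral do rewrite -sumEFin.
  rewrite ge0_integral_sum//; first last.
  - by move=> u z _; rewrite lee_fin; have [_ [_]] := Eu u.
  - by move=> u; apply/measurable_EFinP; have [_ []] := Eu u.
  apply: (@le_trans _ _ (\sum_(u : n0.-tuple D) (e ^+ 2 / 4 * q ^+ size ([::] ++ u) ^+ d)%:E)%E).
    by apply: lee_sum => u _; have [] := Eu u.
  by rewrite sumEFin -mulr_sumr sum_tuple_scale expr0 expr1n mulr1.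
have e20 : 0 < e / 2 by rewrite divr_gt0.
exists [set z | Z z <= e / 2]; split; first exact: measurable_le_cst.
  rewrite (_ : ~` _ = [set z | e / 2 < Z z]); last first.
    by apply/seteqP; split => z /=; [move/negP; rewrite -ltNge|move=> + h; rewrite ltNge h].
  apply: le_trans (markov_ge0 P mZ Z0 e20) _.
  apply: (@le_trans _ _ ((e / 2)^-1%:E * (e ^+ 2 / 4)%:E)%E).
    by rewrite lee_wpmul2l// lee_fin invr_ge0 ltW.
  rewrite -EFinM lee_fin (_ : (e / 2)^-1 * (e ^+ 2 / 4) = e / 2); first by lra.
  by field; rewrite gt_eqF.
move=> z /= Zz.
pose leaf w := S L w z `^ (p%:R^-1).
have leafE w : leaf w ^+ p = S L w z.
  by rewrite -powR_mulrn ?powR_ge0// -powRrM mulVf ?pnatr_eq0// powRr1.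
have leaf0 w : 0 <= leaf w by exact: powR_ge0.
pose x j u := X j u z.
exists (flatten [seq cover_below x L s e1 leaf M u | u : n0.-tuple D]); split.
- move=> c /flattenP[t /mapP[u _ ->]] cc.
  have [/andP[h1 h2] h3] := cover_below_size e10 leaf0 cc.
  rewrite size_tuple in h1 h2; split => //; first exact: leq_trans h1.
  apply: (cover_below_osc _ cc) => v _ j u' uL.
  have h : chain_sum q L (fun j u => x j (v ++ u)) <= leaf v ^+ p by rewrite leafE.
  exact: (chain_osc q01 j h (leaf0 v) uL).
- rewrite big_cover_flatten.
  apply: (@le_trans _ _ (\sum_(u : n0.-tuple D) (e1 ^+ d * q ^+ size u ^+ d + leaf_sum s (fun w => g w z) M u))).
    apply: ler_sum => u _; apply: (@cover_below_cost x L M s n0 e1 leaf e10) => //.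
    + by move=> i; rewrite subnn.
    + move=> v sv bv; rewrite /g indicE mem_set// mulr1.
      have [lr|rl] := leP (leaf v) (r v).
        rewrite -[leLHS]addr0 lerD ?divr_ge0 ?exprn_ge0 ?(ltW (r0 v))//.
        by rewrite lerXn2r// nnegrE// ltW.
      rewrite -[leLHS]add0r lerD ?exprn_ge0 ?(ltW (r0 v))//.
      rewrite ler_pdivlMr ?exprn_gt0// -leafE pE.
      rewrite [leRHS]exprD; apply: ler_wpM2l; first exact: exprn_ge0.
      by apply: lerXn2r; rewrite ?nnegrE ?(ltW (r0 v))// ltW.
  rewrite big_split/= -mulr_sumr.
  have -> : \sum_(u : n0.-tuple D) q ^+ size u ^+ d = 1.
    by have := sum_tuple_scale n0 [::]; rewrite expr0 expr1n.
  rewrite mulr1 [leRHS]splitr lerD//.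
  apply: le_trans e1e; rewrite -[leRHS]expr1 ler_wiXn2l// ltW//.
- rewrite big_cover_flatten; under eq_bigr do rewrite cover_below_weight.
  by have := sum_tuple_scale n0 [::]; rewrite expr0 expr1n.
- move=> v sv.
  have ht : size (take n0 v) == n0 by rewrite size_takel// (leq_trans _ sv)// leq_addr.
  have pv : prefix (Tuple ht) v by rewrite /= -[X in prefix _ X](cat_take_drop n0 v) prefix_prefix.
  have [|c cc cv] := @cover_below_covers x L s e1 leaf M _ _ pv; first by rewrite size_tuple.
  exists c => //; apply/flattenP; exists (cover_below x L s e1 leaf M (Tuple ht)) => //.
  exact: (map_f _ (mem_enum predT (Tuple ht))).
Qed.

End random.
End random_cover.

Section hitting.
Context {R : realType} (D : finType) (d : nat) (q : R).
Hypothesis q01 : 0 < q < 1.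
Hypothesis Dq : #|D|%:R * q ^+ d = 1.
Hypothesis d0 : (0 < d)%N.

Let q0 : 0 < q. Proof. by case/andP: q01. Qed.
Let q1 : q < 1. Proof. by case/andP: q01. Qed.

Context d' (T : measurableType d') (P : probability T R).
Variables (X : 'I_d -> seq D -> T -> R) (N : 'I_d -> T -> R) (A : R).
Hypothesis A0 : 0 <= A.
Hypothesis gXN : gauss_family P (sum_family (fun i : 'I_d * seq D => X i.1 i.2) N).
Hypothesis incX : forall j u a,
  ip P (fun w => X j (rcons u a) w - X j u w) (fun w => X j (rcons u a) w - X j u w) <=
  A * q ^+ size u ^+ 2.
Hypothesis badX : forall e eta n1, 0 < e -> 0 < eta ->
  exists M s n0, (n1 <= n0)%N /\ forall L w, size w = (n0 + M * s)%N ->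
  (P [set z | bad_word q (fun j u => X j u z) L M s n0 e w] <= eta%:E)%E.

Let gX : gauss_family P (fun i : 'I_d * seq D => X i.1 i.2).
Proof. exact: (gauss_family_reindex (fun i => inl i) gXN). Qed.

Let gN : gauss_family P N.
Proof. exact: (gauss_family_reindex (fun i => inr i) gXN). Qed.

Let mX j u : measurable_fun setT (X j u).
Proof. exact: (gauss_family_measurable gX (j, u)). Qed.

Lemma sup_bound (e : R) : 0 < e -> exists2 K, 0 < K & forall L,
  (P (~` [set w | forall j u, (size u <= L)%N -> (`|X j u w| <= K)%R]) <= e%:E)%E.
Proof.
move=> e0.
pose C := A ^+ d.+2 * osc_cst D d q.
have C0 : 0 <= C by rewrite mulr_ge0 ?exprn_ge0// osc_cst_ge0.
pose V := \sum_(j < d) ip P (X j [::]) (X j [::]).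
have V0 : 0 <= V by apply: sumr_ge0 => j _; exact: ip_ge0.
have [M [M1 MC MV]] : exists M : R, [/\ 1 <= M, C / M <= e / 2 & V / M <= e / 2].
  exists (1 + 2 * (C + V) / e); split.
  - by rewrite lerDl divr_ge0 ?(ltW e0)// mulr_ge0// addr_ge0.
  - have M0 : 0 < 1 + 2 * (C + V) / e by rewrite ltr_wpDr// divr_ge0 ?(ltW e0)// mulr_ge0// addr_ge0.
    rewrite ler_pdivrMr// (_ : e / 2 * _ = e / 2 + C + V); last by field; rewrite gt_eqF.
    by lra.
  - have M0 : 0 < 1 + 2 * (C + V) / e by rewrite ltr_wpDr// divr_ge0 ?(ltW e0)// mulr_ge0// addr_ge0.
    rewrite ler_pdivrMr// (_ : e / 2 * _ = e / 2 + C + V); last by field; rewrite gt_eqF.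
    by lra.
have M0 : 0 < M by exact: lt_le_trans M1.
exists (2 * M); first by rewrite mulr_gt0.
move=> L.
pose H := ~` [set w | osc_le L M (fun j u => X j u w)].
have mH : measurable H by apply: measurableC; exact: osc_le_measurable.
have PH : (P H <= (e / 2)%:E)%E.
  have := @near_gauss_chain_sum R D d q q01 Dq _ _ P X L A A A0 A0.
  rewrite -exprSr prednK ?double_gt0// -muln2 exprM sqrtr_sqr ger0_norm ?exprn_ge0//.
  move=> h; apply: le_trans (osc_prob q01 M0 mX (h _ mX _)) _.
  - by move=> j u a; exact: (gauss_family_near_B (j, rcons u a) (j, u) gX).
  - move=> j u a uL; rewrite le_min incX /=; apply: le_trans (incX _ _ _) _.
    by rewrite -[leRHS]mulr1 ler_wpM2l// -exprM exprn_ile1 ?(ltW q0) ?(ltW q1).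
  - rewrite lee_fin; apply: le_trans MC; rewrite ler_wpM2l// lef_pV2 ?posrE ?exprn_gt0//.
    by rewrite -[leLHS]expr1 ler_weXn2l// double_gt0.
pose B j : set T := [set w | M <= `|X j [::] w|].
have mB j : measurable (B j).
  rewrite (_ : B j = [set w | - `|X j [::] w| <= - M]).
    by apply: measurable_le_cst; apply: measurableT_comp => //; exact: measurableT_comp.
  by apply/seteqP; split => w /=; rewrite lerN2.
have PB : (P [set w | exists2 j, j \in index_enum 'I_d & B j w] <= (e / 2)%:E)%E.
  apply: le_trans (measure_exists_le P _ mB) _.
  apply: (@le_trans _ _ (\sum_(j <- index_enum 'I_d) (ip P (X j [::]) (X j [::]) / M ^+ 2)%:E)%E).
    apply: lee_sum => j _; apply: chebyshev_L2 => //.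
    exact: (gauss_family_L2 gX (j, [::])).
  rewrite sumEFin lee_fin -mulr_suml; apply: le_trans MV.
  by rewrite ler_wpM2l// lef_pV2 ?posrE ?exprn_gt0// -[leLHS]expr1 ler_weXn2l.
have mBU : measurable [set w | exists2 j, j \in index_enum 'I_d & B j w].
  rewrite (_ : [set w | _] = [set w | exists j, B j w]); first exact: measurable_exists.
  by apply/seteqP; split => w [j] //; [move=> _; exists j|exists j; rewrite ?mem_index_enum].
have mK : measurable [set w | forall j u, (size u <= L)%N -> `|X j u w| <= 2 * M].
  do 2 apply: measurable_forall => ?; apply: measurable_implies.
  by apply: measurable_le_cst; exact: measurableT_comp.
apply: (@le_trans _ _ (P (H `|` [set w | exists2 j, j \in index_enum 'I_d & B j w]))).
  apply: le_measure; rewrite ?inE; [exact: measurableC|exact: measurableU|].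
  move=> w /= nh; apply: contrapT => /not_orP[h1 h2]; apply: nh => j u uL.
  have h1' : osc_le L M (fun j u => X j u w) by exact: contrapT.
  have h2' : `|X j [::] w| <= M.
    rewrite leNgt; apply/negP => h; apply: h2; exists j; rewrite ?mem_index_enum//.
    exact: ltW.
  have := h1' j u uL => h3; rewrite -(subrK (X j [::] w) (X j u w)).
  by apply: le_trans (ler_normD _ _) _; lra.
apply: le_trans (measureU2 _ mH mBU) _.
by rewrite [e]splitr EFinD leeD.
Qed.

Variables (gam : 'I_d -> seq D -> R) (g G rho C0 : R).
Hypothesis g0 : 0 < g.
Hypothesis G0 : 0 <= G.
Hypothesis C00 : 0 <= C0.
Hypothesis rhoq : 0 < rho < q.
Hypothesis gam_ge : forall j u, g <= `|gam j u|.
Hypothesis gam_lip : forall j u v, `|gam j (u ++ v) - gam j u| <= G * rho ^+ size u.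
Hypothesis gamE : forall j u i, ip P (X j u) (N i) = if i == j then gam j u else 0.
Hypothesis ipN : forall i j, ip P (N i) (N j) = (i == j)%:R.
Hypothesis densN : forall j a r, 0 <= r -> (P [set w | (`|N j w - a| <= r)%R] <= (C0 * r)%:E)%E.

Lemma prob_cube_le (a : 'I_d -> R) r : 0 <= r ->
  (P [set w | forall j, (`|N j w - a j| <= r)%R] <= ((C0 * r) ^+ d)%:E)%E.
Proof.
move=> r0.
pose B j : set (unit -> R) := [set x | `|x tt - a j| <= r].
have gN' : gauss_family P (fun i : 'I_d * unit => N i.1).
  exact: (gauss_family_reindex (fun i : 'I_d * unit => i.1) gN).
have := @prob_blocks_le _ _ _ P _ unit (fun j _ => N j) gN' _ (enum 'I_d) B (fun=> C0 * r) (enum_uniq _).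
rewrite big_enum/= prodr_const card_ord => h.
rewrite (_ : [set w | _] = [set w | forall i, i \in enum 'I_d -> B i (fun=> N i w)]).
  apply: h.
  - by move=> i i' _ _ ii'; rewrite ipN (negbTE ii').
  - move=> i; suff : @measurable _ (g_sigma_algebraType (@cylinders R unit)) (B i) by [].
    apply: measurable_le_cst; apply: measurableT_comp => //.
    by apply: measurable_funB => //; exact: cylinder_coordinate.
  - by move=> _; rewrite mulr_ge0.
  - by move=> i _; exact: densN.
apply/seteqP; split => w /= h' j; first by move=> _; exact: h'.
by apply: h'; rewrite mem_enum.
Qed.

(** The residual of the regression on N. It is uncorrelated with N, which allows N to be resampled
    independently. *)
Let w_ (i : 'I_d * seq D) w := X i.1 i.2 w - gam i.1 i.2 * N i.1 w.

Let g_wN : gauss_family P (sum_family w_ N).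
Proof.
move=> s.
pose s' : seq (R * ('I_d * seq D + 'I_d)) :=
  flatten [seq match c.2 with inl i => [:: (c.1, inl i); (- (c.1 * gam i.1 i.2), inr i.1)]
                        | inr j => [:: (c.1, inr j)] end | c <- s].
have := gXN s'; congr (near_gauss P); apply/funext => w.
rewrite /comb /s' big_flatten/= big_map; apply: eq_bigr => -[c [[j u]|j]] _ /=.
  by rewrite !big_cons big_nil/= /w_ /=; ring.
by rewrite big_seq1.
Qed.

Let ip_wN i j : ip P (w_ i) (N j) = 0.
Proof.
case: i => i u; rewrite /w_ /=.
have L1 : L2 P (X i u) by exact: (gauss_family_L2 gX (i, u)).
have L2' k : L2 P (N k) by exact: gauss_family_L2 gN k.
rewrite ipBl//; last by apply: L2Z.
by rewrite ipZl// gamE ipN eq_sym; case: eqVneq; rewrite ?mulr1 ?subrr// mulr0 subr0.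
Qed.

(** Solve [x + gm * y = z] for y with x and gm frozen at the root of a cell. The tolerance and the
    oscillation of x enter divided by the slope; the variation of the slope enters multiplied by the
    size of [x0 - z]. *)
Lemma radius_le x x0 z y gm gm0 m kap K rh : g <= `|gm| -> g <= `|gm0| ->
  `|gm - gm0| <= G * rh -> `|x - x0| <= m -> `|x0| <= K -> 0 <= rh -> `|x + gm * y - z| <= kap ->
  `|y - (z - x0) / gm0| <= (kap + m) / g + (K + `|z|) * (G * rh) / g ^+ 2.
Proof.
move=> h1 h2 h3 h4 h5 rh0 h6.
have n1 : gm != 0 by rewrite -normr_gt0 (lt_le_trans g0).
have n2 : gm0 != 0 by rewrite -normr_gt0 (lt_le_trans g0).
have -> : y - (z - x0) / gm0 =
  (x + gm * y - z) / gm - (x - x0) / gm + (x0 - z) * ((gm - gm0) / (gm * gm0)).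
  by field; rewrite n1 n2.
have i1 : `|gm|^-1 <= g^-1 by rewrite lef_pV2 ?posrE// (lt_le_trans g0).
have i2 : `|gm0|^-1 <= g^-1 by rewrite lef_pV2 ?posrE// (lt_le_trans g0).
apply: le_trans (ler_normD _ _) _; apply: lerD.
  rewrite [leRHS]mulrDl; apply: le_trans (ler_normB _ _) _.
  by rewrite !normrM !normfV; apply: lerD; apply: ler_pM => //; rewrite invr_ge0.
have i3 : `|gm|^-1 * `|gm0|^-1 <= g^-1 * g^-1 by apply: ler_pM => //; rewrite invr_ge0.
have i4 : `|x0 - z| <= K + `|z| by apply: le_trans (ler_normB _ _) _; rewrite lerD2r.
rewrite !normrM normfV normrM -mulrA; apply: ler_pM => //.
rewrite invfM expr2 invfM; apply: ler_pM => //.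
Qed.

Lemma expr_add3_le (a b c : R) : 0 <= a -> 0 <= b -> 0 <= c ->
  (a + b + c) ^+ d <= 3 ^+ d * (a ^+ d + b ^+ d + c ^+ d).
Proof.
move=> a0 b0 c0.
have [m [h1 h2 h3 mE]] : exists m, [/\ a <= m, b <= m, c <= m & m = a \/ m = b \/ m = c].
  exists (Num.max a (Num.max b c)); rewrite !le_max !lexx ?orbT; split => //.
  by case: (leP b c) => _; case: leP => _; auto.
have m0 : 0 <= m by exact: le_trans h1.
apply: (@le_trans _ _ ((3 * m) ^+ d)).
  by rewrite lerXn2r ?nnegrE ?addr_ge0 ?mulr_ge0//; lra.
rewrite exprMn ler_wpM2l ?exprn_ge0//.
have [x0 [y0 z0]] : 0 <= a ^+ d /\ 0 <= b ^+ d /\ 0 <= c ^+ d by rewrite !exprn_ge0.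
by case: mE => [->|[->|->]]; lra.
Qed.

(** Once N is resampled, the first copy fixes the cover, and N has to fall for some cell into a cube
    whose radius adds up tolerance, oscillation and variation of [gam]. The d-th powers have a small
    sum for three separate reasons: [kap] is small against the depth [L0], the cover has small cost,
    and [rho < q] makes the variation negligible against the weights from depth [n1] on. *)
Lemma hitting_small (z : 'I_d -> R) (e : R) : 0 < e ->
  exists L0 kap, 0 < kap /\ forall L, (L0 <= L)%N ->
  (P [set w | exists u : L.-tuple D, forall j, (`|X j u w - z j| <= kap)%R] <= e%:E)%E.
Proof.
move=> e0; have /andP[rho0 rq] := rhoq.
have e40 : 0 < e / 4 by rewrite divr_gt0.
have [K K0 hK] := sup_bound e40.
pose Zm := \sum_j `|z j|.
have Zj j : `|z j| <= Zm by rewrite /Zm (bigD1 j)//= lerDl sumr_ge0.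
have Zm0 : 0 <= Zm by exact: sumr_ge0.
have [B B0 BE] : exists2 B, 0 <= B & B = C0 * (g^-1 + (K + Zm) * G / g ^+ 2).
  eexists; last reflexivity.
  rewrite mulr_ge0// addr_ge0 ?invr_ge0 ?(ltW g0)// divr_ge0 ?sqr_ge0// mulr_ge0// addr_ge0// ltW//.
pose B3 := (3 * B) ^+ d.
have B30 : 0 <= B3 by rewrite exprn_ge0// mulr_ge0.
have [e1 [e10 e1B e1e]] : exists e1 : R, [/\ 0 < e1, B3 * (e1 + e1 + e1) <= e / 2 & e1 <= e / 4].
  exists (e / (4 + 6 * B3)); have h : 0 < 4 + 6 * B3 by lra.
  split; first exact: divr_gt0.
    rewrite (_ : B3 * _ = 3 * B3 * e / (4 + 6 * B3)); last by field; rewrite gt_eqF.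
    by rewrite ler_pdivrMr// -subr_ge0 (_ : _ - _ = 2 * e); [lra|field].
  by rewrite ler_pM2l// lef_pV2 ?posrE//; lra.
have [n1 hn1] : exists n1, (rho / q) ^+ d ^+ n1 <= e1.
  have rq1 : 0 <= (rho / q) ^+ d < 1.
    rewrite exprn_ge0 ?divr_ge0 ?(ltW q0) ?(ltW rho0)//= exprn_ilt1 ?divr_ge0 ?(ltW q0) ?(ltW rho0)//.
      by rewrite -lt0n.
    by rewrite ltr_pdivrMr// mul1r.
  have /andP[r0 r1] := rq1.
  have : (rho / q) ^+ d ^+ n @[n --> \oo] --> (0 : R) by apply: cvg_expr; rewrite ger0_norm.
  move=> /cvgrPdist_le /(_ e1 e10)[n _ /(_ n (leqnn _))].
  rewrite sub0r normrN ger0_norm => [h|]; first by exists n.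
  exact: exprn_ge0.
have [L0 hL] := random_cover q01 Dq d0 A0 gX incX badX n1 e10.
have [kap kap0 kapE] : exists2 kap : R, 0 < kap & kap ^+ d <= e1 * q ^+ L0 ^+ d.
  exists (Num.min 1 (e1 * q ^+ L0 ^+ d)).
    by rewrite lt_min ltr01 mulr_gt0// !exprn_gt0.
  have m0 : 0 <= Num.min 1 (e1 * q ^+ L0 ^+ d) by rewrite le_min ler01 mulr_ge0 ?exprn_ge0 ?(ltW q0) ?(ltW e10).
  apply: (@le_trans _ _ (Num.min 1 (e1 * q ^+ L0 ^+ d) ^+ 1)).
    by apply: ler_wiXn2l => //; rewrite ge_min lexx.
  by rewrite expr1 ge_min lexx orbT.
exists L0, kap; split => // L L0L.
have [H [mH PH hH]] := hL L.
pose HK := [set w | forall j u, (size u <= L0)%N -> `|X j u w| <= K].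
have mHK : measurable HK.
  do 2 apply: measurable_forall => ?; apply: measurable_implies.
  by apply: measurable_le_cst; exact: measurableT_comp.
pose GG := H `&` HK.
have mGG : measurable GG by exact: measurableI.
have PGG : (P (~` GG) <= (e / 2)%:E)%E.
  rewrite setCI; apply: le_trans (measureU2 _ _ _) _; [exact: measurableC|exact: measurableC|].
  apply: (@le_trans _ _ (e1%:E + (e / 4)%:E)%E); first by apply: leeD => //; exact: hK.
  by rewrite -EFinD lee_fin; lra.
pose Cyl := @cylinders R ('I_d * seq D + 'I_d)%type.
pose AA : set (g_sigma_algebraType Cyl) := [set x | exists u : L.-tuple D, forall j,
  `|x (inl (j, tval u)) + gam j u * x (inr j) - z j| <= kap].
have mAA : <<s Cyl >> AA.
  suff : measurable AA by [].
  apply: measurable_exists => u; apply: measurable_forall => j.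
  apply: measurable_le_cst; apply: measurableT_comp => //; apply: measurable_funB => //.
  apply: measurable_funD; first exact: cylinder_coordinate.
  by apply: measurable_funM => //; exact: cylinder_coordinate.
have := copies_law g_wN ip_wN mAA.
rewrite (_ : [set w | _] = [set w | exists u : L.-tuple D, forall j, `|X j u w - z j| <= kap]); last first.
  by apply/seteqP; split => w /= [u hu]; exists u => j; have := hu j; rewrite /w_ /= subrK.
move=> ->.
pose F : set (T * T) := [set w | AA (copies_family w_ N ^~ w)].
have mF : measurable F.
  apply: measurable_preimage_cylinder => //.
  by move=> i; exact: (copies_family_measurable g_wN i).
apply: (@le_trans _ _ ((P \x P)%E ((F `&` (GG `*` setT)) `|` ((~` GG) `*` setT)))).
  have m1 : measurable (F `&` (GG `*` [set: T])).
    by apply: measurableI => //; apply: measurableX.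
  have m2 : measurable (~` GG `*` [set: T]) by apply: measurableX => //; exact: measurableC.
  apply: le_measure; rewrite ?inE//; first exact: measurableU.
  move=> [w1 w2] Fw; have [h|h] := pselect (GG w1); first by left.
  by right.
have m1 : measurable (F `&` (GG `*` [set: T])).
  by apply: measurableI => //; apply: measurableX.
have m2 : measurable (~` GG `*` [set: T]) by apply: measurableX => //; exact: measurableC.
apply: le_trans (measureU2 _ m1 m2) _.
rewrite [e]splitr EFinD; apply: leeD; last first.
  apply: (@le_trans _ _ (P (~` GG) * P setT)%E).
    by have <- := product_measure1E P P (measurableC mGG) measurableT; exact: lexx.
  by have -> := probability_setT P; rewrite mule1.
apply: (@le_trans _ _ (\int[P]_x P (xsection (F `&` (GG `*` setT)) x))%E); first exact: lexx.
apply: (@le_trans _ _ (\int[P]_x (e / 2)%:E)%E); last first.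
  rewrite integral_cst//; apply: (@le_trans _ _ ((e / 2)%:E * 1)%E); last by rewrite mule1.
  by apply: lee_wpmul2l; [rewrite lee_fin divr_ge0// ltW|exact: probability_le1].
apply: ge0_le_integral => //.
- exact: measurable_fun_xsection.
move=> w1 _.
have [[Hw1 Kw1]|nG] := pselect (GG w1); last first.
  rewrite (_ : xsection _ _ = set0) ?measure0 ?lee_fin ?divr_ge0 ?(ltW e0)//.
  by apply/seteqP; split => // w2 /xsectionP [_ [/= + _]].
have [c [c1 c2 c3 c4]] := hH w1 Hw1.
pose rad (x : seq D * R) := (kap + x.2) / g + (K + Zm) * (G * rho ^+ size x.1) / g ^+ 2.
pose ctr (x : seq D * R) j := N j w1 + (z j - X j x.1 w1) / gam j x.1.
pose E (x : seq D * R) := [set w2 | forall j, `|N j w2 - ctr x j| <= rad x].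
have mE x : measurable (E x).
  apply: measurable_forall => j; apply: measurable_le_cst; apply: measurableT_comp => //.
  by apply: measurable_funB => //; exact: gauss_family_measurable gN j.
have rad0 x : x \in c -> 0 <= rad x.
  move=> xc; have [_ _ x20 _] := c1 x xc.
  rewrite addr_ge0// divr_ge0 ?sqr_ge0 ?(ltW g0)// ?mulr_ge0 ?addr_ge0 ?exprn_ge0 ?(ltW rho0) ?(ltW K0) ?(ltW kap0)//.
apply: (@le_trans _ _ (P [set w2 | exists2 x, x \in c & E x w2])).
  apply: le_measure; rewrite ?inE; [exact: measurable_xsection| |].
    rewrite (_ : [set w | _] = \bigcup_(x in [set` c]) E x).
      by rewrite bigcup_seq; apply: bigsetU_measurable => x _; exact: mE.
    by apply/seteqP; split => w2 /= [x xc Ex]; exists x.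
  move=> w2 /xsectionP [[u hu] _].
  have Lu : (L0 <= size u)%N by rewrite size_tuple.
  have [x xc px] := c4 u Lu; exists x => // j.
  have [n1x xL0 x20 oscx] := c1 x xc.
  have [v uE] := prefixP px.
  (* The resampled field is the field of the first copy plus [gam] times the change of N; the centre
     [ctr] absorbs the old value of N. *)
  have := hu j; rewrite /= /w_ /= (_ : _ + _ - z j = X j u w1 + gam j u * (N j w2 - N j w1) - z j); last by ring.
  move=> hj; rewrite /ctr opprD addrA.
  apply: le_trans (radius_le (gam_ge j u) (gam_ge j x.1) _ _ (Kw1 j x.1 xL0) _ hj) _.
  - by rewrite uE; exact: gam_lip.
  - rewrite uE; have := oscx j v; rewrite cats0; apply.
    by rewrite -(size_tuple u) uE size_cat leq_addl.
  - by rewrite exprn_ge0// ltW.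
  - rewrite /rad lerD2l ler_wpM2r ?invr_ge0 ?sqr_ge0// ler_wpM2r ?mulr_ge0 ?exprn_ge0 ?(ltW rho0)//.
    by rewrite lerD2l.
apply: le_trans (measure_exists_le P c mE) _.
apply: (@le_trans _ _ (\sum_(x <- c) ((C0 * rad x) ^+ d)%:E)%E).
  by rewrite !big_seq; apply: lee_sum => x xc; apply: prob_cube_le; exact: rad0.
rewrite sumEFin lee_fin; apply: le_trans e1B.
apply: (@le_trans _ _ (\sum_(x <- c) B3 * (kap ^+ d + x.2 ^+ d + rho ^+ size x.1 ^+ d))).
  rewrite !big_seq; apply: ler_sum => x xc; have [_ _ x20 _] := c1 x xc.
  have r0 : 0 <= rho ^+ size x.1 by rewrite exprn_ge0// ltW.
  apply: (@le_trans _ _ ((B * (kap + x.2 + rho ^+ size x.1)) ^+ d)).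
    apply: lerXn2r; rewrite ?nnegrE.
    - by rewrite mulr_ge0// rad0.
    - by rewrite mulr_ge0// !addr_ge0// ltW.
    rewrite BE -[leRHS]mulrA; apply: ler_wpM2l => //; rewrite /rad [leRHS]mulrDl; apply: lerD.
      by rewrite mulrC ler_wpM2l ?invr_ge0 ?(ltW g0)// lerDl.
    rewrite mulrA mulrAC ler_wpM2l//; last by rewrite lerDr addr_ge0// ltW.
    by rewrite divr_ge0 ?sqr_ge0// mulr_ge0// addr_ge0// ltW.
  rewrite exprMn /B3 exprMn -mulrA [3 ^+ d * _]mulrC -mulrA ler_wpM2l ?exprn_ge0// mulrC.
  exact: (expr_add3_le (ltW kap0) x20 r0).
rewrite -mulr_sumr ler_wpM2l// !big_split/=; apply: lerD; first apply: lerD => //.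
  apply: (@le_trans _ _ (\sum_(x <- c) e1 * q ^+ size x.1 ^+ d)); last first.
    by rewrite -mulr_sumr c3 mulr1.
  rewrite !big_seq; apply: ler_sum => x xc; have [_ xL0 _ _] := c1 x xc.
  apply: le_trans kapE _; rewrite ler_wpM2l ?(ltW e10)// lerXn2r ?nnegrE ?exprn_ge0 ?(ltW q0)//.
  by rewrite ler_wiXn2l ?(ltW q0) ?(ltW q1).
apply: (@le_trans _ _ (\sum_(x <- c) e1 * q ^+ size x.1 ^+ d)); last first.
  by rewrite -mulr_sumr c3 mulr1.
rewrite !big_seq; apply: ler_sum => x xc; have [n1x _ _ _] := c1 x xc.
rewrite -ler_pdivrMr ?exprn_gt0// -expr_div_n -expr_div_n -exprM mulnC exprM.
apply: le_trans hn1; apply: ler_wiXn2l => //.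
  by rewrite exprn_ge0// divr_ge0// ltW.
rewrite exprn_ile1 ?divr_ge0 ?(ltW q0) ?(ltW rho0)// ler_pdivrMr// mul1r ltW//.
Qed.

End hitting.

(** * Gaussian and Riesz forms *)

Section row_vectors.
Context {R : realType}.

Definition sqn k (x : 'rV[R]_k) : R := \sum_i x ord0 i ^+ 2.

Lemma sqn_ge0 k (x : 'rV[R]_k) : 0 <= sqn x.
Proof. by apply: sumr_ge0 => i _; exact: sqr_ge0. Qed.

Lemma enorm_sqr k (x : 'rV[R]_k) : enorm x ^+ 2 = sqn x.
Proof. by rewrite /enorm sqr_sqrtr// sqn_ge0. Qed.

Lemma sqnN k (x : 'rV[R]_k) : sqn (- x) = sqn x.
Proof. by apply: eq_bigr => i _; rewrite mxE sqrrN. Qed.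

Lemma sqnB k (x y : 'rV[R]_k) : sqn (x - y) = sqn (y - x).
Proof. by rewrite -opprB sqnN. Qed.

Lemma sqn_addK k (x y z : 'rV[R]_k) : sqn (x - z) <= 2 * sqn (x - y) + 2 * sqn (y - z).
Proof.
rewrite /sqn !mulr_sumr -big_split/=; apply: ler_sum => i _; rewrite !mxE.
set a := x _ _; set b := y _ _; set c := z _ _.
by have := sqr_ge0 (a - b - (b - c)); nra.
Qed.

Lemma sqn_cons k (p : measurableTypeR R * 'rV[R]_k) (x : 'rV[R]_k.+1) :
  sqn (rV_cons p - x) = (p.1 - x ord0 ord0) ^+ 2 + sqn (p.2 - \row_j x ord0 (lift ord0 j)).
Proof.
rewrite /sqn big_ord_recl !mxE unlift_none /=; congr (_ + _).
by apply: eq_bigr => i _; rewrite !mxE liftK.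
Qed.

Lemma measurable_sqn_sub d (T : measurableType d) k (f g : T -> 'rV[R]_k) :
  measurable_fun setT f -> measurable_fun setT g -> measurable_fun setT (fun w => sqn (f w - g w)).
Proof.
move=> mf mg; apply: measurable_sum => i; apply: measurable_funX.
under eq_fun do rewrite !mxE.
by apply: measurable_funB;
  [exact: (measurableT_comp (measurable_rV_coord i) mf)
  |exact: (measurableT_comp (measurable_rV_coord i) mg)].
Qed.

Lemma integral_rV_cons k (f : 'rV[R]_k.+1 -> \bar R) : measurable_fun setT f ->
  (forall x, 0 <= f x)%E ->
  (\int[lebesgue_rV k.+1]_x f x =
   \int[lebesgue_measure]_t \int[lebesgue_rV k]_x f (rV_cons (t, x)))%E.
Proof.
move=> mf f0.
have mc : measurable_fun setT (@rV_cons R k) by exact: measurable_funPT.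
have := ge0_integral_pushforward mc (lebesgue_measure \x @lebesgue_rV R k)%E measurableT mf (fun x _ => f0 x).
rewrite preimage_setT => h; apply: etrans h _.
rewrite fubini_tonelli1//; [exact: measurableT_comp|by move=> p; exact: f0].
Qed.

Lemma integral_gauss_rV k (a : R) (x : 'rV[R]_k) : 0 < a ->
  (\int[lebesgue_rV k]_y (expR (- (a * sqn (y - x))))%:E = (Num.sqrt (pi / a) ^+ k)%:E)%E.
Proof.
move=> a0; elim: k x => [|k IH] x.
  rewrite expr0 (_ : (fun y => _) = fun=> 1%E); last first.
    by apply/funext => y; rewrite /sqn big_ord0 mulr0 oppr0 expR0.
  by rewrite integral_cst//= diracT mul1e.
have me j (z : 'rV[R]_j) : measurable_fun setT (fun y : 'rV[R]_j => (expR (- (a * sqn (y - z))))%:E).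
  apply/measurable_EFinP; apply: measurableT_comp => //; apply: measurableT_comp => //.
  by apply: measurable_funM => //; apply: measurable_sqn_sub.
rewrite integral_rV_cons//.
have h t : (\int[lebesgue_rV k]_y (expR (- (a * sqn (rV_cons (t, y) - x))))%:E =
    (expR (- (a * (t - x ord0 ord0) ^+ 2)))%:E * (Num.sqrt (pi / a) ^+ k)%:E)%E.
  under eq_integral => y _ do rewrite sqn_cons/= mulrDr opprD expRD EFinM.
  rewrite ge0_integralZl//; [by rewrite IH|exact: me].
under eq_integral => t _ do rewrite h.
rewrite ge0_integralZr//; first by rewrite integral_gauss// -EFinM -exprS.
apply/measurable_EFinP; apply: measurableT_comp => //; apply: measurableT_comp => //.
by apply: measurable_funM => //; apply: measurable_funX; exact: measurable_funB.
Qed.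

End row_vectors.

Section dominated_by_series.
Context {R : realType}.
Local Notation mu := (@lebesgue_measure R).

(** This replaces antiderivatives in the one-dimensional integrals whose order of magnitude alone
    matters: it is enough to bound f by constants on intervals covering the domain. *)
Lemma integral_le_series (D : set (measurableTypeR R)) (f : R -> R) (a b c : nat -> R) (C : R) :
  measurable D -> measurable_fun D f -> (forall r, D r -> 0 <= f r) ->
  (forall n, a n <= b n) -> (forall n, 0 <= c n) ->
  (forall r, D r -> exists n, a n <= r <= b n /\ f r <= c n) ->
  (forall n, \sum_(0 <= i < n) c i * (b i - a i) <= C) ->
  (\int[mu]_(r in D) (f r)%:E <= C%:E)%E.
Proof.
move=> mD mf f0 ab c0 cov hC.
pose g n (r : measurableTypeR R) : \bar R := ((c n)%:E * (\1_(`[a n, b n]%classic : set (measurableTypeR R)) r)%:E)%E.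
have mI n : measurable (`[a n, b n]%classic : set (measurableTypeR R)) by exact: measurable_itv.
have g0 n r : (0 <= g n r)%E by rewrite /g -EFinM lee_fin mulr_ge0// indicE ler0n.
have mg n : measurable_fun D (g n).
  apply: measurable_funTS; apply: emeasurable_funM => //.
  by apply/measurable_EFinP; exact: measurable_indic.
apply: (@le_trans _ _ (\int[mu]_(r in D) \sum_(n <oo) g n r)%E).
  apply: ge0_le_integral => //.
  - exact/measurable_EFinP.
  - by apply: ge0_emeasurable_sum => // n r _ _; exact: g0.
  - move=> r Dr; have [n [rn fn]] := cov r Dr.
    apply: (@le_trans _ _ (g n r)).
      by rewrite /g indicE mem_set /= ?in_itv//= mule1 lee_fin.
    apply: (@le_trans _ _ (\sum_(0 <= i < n.+1) g i r)%E).
      by rewrite big_nat_recr//= leeDr// sume_ge0.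
    exact: nneseries_lim_ge.
rewrite integral_nneseries//.
apply: lime_le; first by apply: is_cvg_nneseries => n _ _; exact: integral_ge0.
apply: nearW => n; apply: (@le_trans _ _ (\sum_(0 <= i < n) c i * (b i - a i))%:E); last by rewrite lee_fin.
rewrite -sumEFin; apply: lee_sum => i _.
apply: (@le_trans _ _ (\int[mu]_r g i r)%E).
  apply: ge0_subset_integral => //; apply: emeasurable_funM => //.
  by apply/measurable_EFinP; exact: measurable_indic.
rewrite /g ge0_integralZl//; last by rewrite lee_fin.
  rewrite integral_indic// setIT EFinM; apply: lee_wpmul2l; first by rewrite lee_fin.
  apply: (@le_trans _ _ (mu [set` `[a i, b i]])); first exact: lexx.
  rewrite lebesgue_measure_itv/= lte_fin; case: ifP => // _.
  by rewrite lee_fin subr_ge0.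
by apply/measurable_EFinP; exact: measurable_indic.
Qed.

Lemma geometric_sum_lt (x : R) n : 0 <= x < 1 -> \sum_(0 <= i < n) x ^+ i <= (1 - x)^-1.
Proof.
move=> /andP[x0 x1]; have x1' : 0 < 1 - x by rewrite subr_gt0.
rewrite -[leRHS]mul1r ler_pdivlMr// mulrC.
have -> : (1 - x) * (\sum_(0 <= i < n) x ^+ i) = 1 - x ^+ n.
  elim: n => [|n IH]; first by rewrite big_geq// mulr0 expr0 subrr.
  by rewrite big_nat_recr//= mulrDr IH exprS; ring.
by rewrite gerBl exprn_ge0.
Qed.

Lemma expR_lt1 (x : R) : x < 0 -> 0 <= expR x < 1.
Proof. by move=> x0; rewrite expR_ge0 -expR0 ltr_expR. Qed.

Lemma integral_exp_abs (b : R) : 0 < b ->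
  (\int[mu]_r (expR (- (b * `|r|)))%:E <= (2 / (1 - expR (- b)))%:E)%E.
Proof.
move=> b0.
(* Even indices give the unit intervals of the positive half-line, odd ones their mirror images. *)
pose a n : R := if odd n then - (n./2%:R + 1) else n./2%:R.
apply: (@integral_le_series setT _ a (fun n => a n + 1) (fun n => expR (- b) ^+ n./2)) => //.
- by apply: measurableT_comp => //; apply: measurableT_comp => //; apply: measurable_funM => //; exact: measurableT_comp.
- by move=> n; rewrite lerDl.
- move=> r _; pose m := `|Num.floor `|r| |%N.
  have mE : (m%:R : R) = (Num.floor `|r|)%:~R.
    by rewrite -[in RHS](gez0_abs (_ : 0 <= Num.floor `|r|)) ?floor_ge0.
  have m1 : m%:R <= `|r| by rewrite mE floor_le.
  have m2 : `|r| <= m%:R + 1 by rewrite mE -[1]/(1%:~R) -intrD ltW// floorD1_gt.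
  exists (m.*2 + (r < 0)%R)%N; rewrite /a; have [r0|r0] := ltP r 0.
    rewrite addn1 /= odd_double /= uphalf_double; split.
      by move: m1 m2; rewrite ltr0_norm// => ? ?; apply/andP; split; lra.
    by rewrite -expRM_natl ler_expR mulrN lerN2 [leLHS]mulrC ler_wpM2l// ltW.
  rewrite addn0 odd_double /= doubleK; split.
    by move: m1 m2; rewrite ger0_norm// => ? ?; apply/andP; split; lra.
  by rewrite -expRM_natl ler_expR mulrN lerN2 [leLHS]mulrC ler_wpM2l// ltW.
- move=> n; under eq_bigr do rewrite addrC addKr mulr1.
  have hx := expR_lt1 (_ : - b < 0).
  apply: (@le_trans _ _ (\sum_(0 <= i < n.*2) expR (- b) ^+ i./2)).
    rewrite -addnn [leRHS](big_cat_nat (n := n))//= ?leq_addr//.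
    by rewrite lerDl; apply: sumr_ge0 => i _; apply: exprn_ge0; exact: expR_ge0.
  have -> : \sum_(0 <= i < n.*2) expR (- b) ^+ i./2 = 2 * \sum_(0 <= i < n) expR (- b) ^+ i.
    elim: n => [|n IH]; first by rewrite !big_geq// mulr0.
    by rewrite doubleS !big_nat_recr//= IH uphalf_double doubleK; ring.
  by rewrite ler_wpM2l// geometric_sum_lt// hx// oppr_lt0.
Qed.

End dominated_by_series.

(** * Powers and the Riesz kernel as mixtures of Gaussians *)

Section subordination.
Context {R : realType}.
Local Notation mu := (@lebesgue_measure R).

Lemma integral_shift (G : R -> R) (m : R) : continuous G -> (forall x, 0 <= G x) ->
  (\int[mu]_x (G x)%:E = \int[mu]_x (G (x + m))%:E)%E.
Proof.
move=> cG G0; pose F := (fun x : R => x + m) : R -> R.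
have dF (x : R) : is_derive x 1 F 1.
  by apply: is_derive_eq; rewrite addr0.
have F' : derive1 F = cst 1.
  by apply/funext => x; rewrite derive1E derive_val.
rewrite (@increasing_ge0_integration_by_substitutionT _ F G) //.
- by apply: eq_integral => x _; congr EFin; rewrite F' /= !fctE /cst /F mulr1.
- by move=> x y xy; rewrite /F ltrD2r.
- by rewrite F' => x; exact: cst_continuous.
- by rewrite F'; exact: is_cvg_cst.
- by rewrite F'; exact: is_cvg_cst.
- by apply: cvg_addrr_Ny; exact: cvg_id.
- by apply: cvg_addrr; exact: cvg_id.
Qed.

Lemma continuous_expR_lin (f : R -> R) : continuous f -> continuous (fun x => expR (f x)).
Proof. by move=> cf x; apply: continuous_comp; [exact: cf|exact: continuous_expR]. Qed.

(** This is Gamma(b) after the substitution [s = expR u], which moves the integral to the whole line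
    and turns dilations into translations. *)
Definition sub_cst (b : R) : R := fine (\int[mu]_u (expR (b * u - expR u))%:E)%E.

Let csub (b m : R) : continuous (fun u : R => expR (b * u - expR u * m)).
Proof.
apply: continuous_expR_lin => x; apply: cvgB; first by apply: cvgM; [exact: cvg_cst|exact: cvg_id].
by apply: cvgM; [exact: continuous_expR|exact: cvg_cst].
Qed.

Let csub1 (b : R) : continuous (fun u : R => expR (b * u - expR u)).
Proof.
rewrite (_ : (fun u : R => _) = (fun u : R => expR (b * u - expR u * 1))); first exact: csub.
by apply/funext => u; rewrite mulr1.
Qed.

(** On the left the factor [expR (b * u)] decays. On the right [expR (- expR u)] is at most four
    times the exponential of [- 2 u], which suffices because [b - 2 <= - b]. *)
Lemma sub_fin (b : R) : 0 < b <= 1 -> (\int[mu]_u (expR (b * u - expR u))%:E < +oo)%E.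
Proof.
move=> /andP[b0 b1].
apply: (@le_lt_trans _ _ (\int[mu]_u (4%:E * (expR (- (b * `|u|)))%:E))%E).
  apply: ge0_le_integral => //.
  - by apply/measurable_EFinP; exact: (continuous_measurable_fun (@csub1 b)).
  - apply/measurable_EFinP; apply: measurable_funM => //; apply: measurableT_comp => //.
    by apply: measurableT_comp => //; apply: measurable_funM => //; exact: measurableT_comp.
  move=> u _; rewrite -EFinM lee_fin.
  have [u0|u0] := leP 0 u; last first.
    rewrite ltr0_norm// mulrN opprK -[leLHS]mul1r; apply: ler_pM; rewrite ?expR_ge0//.
      by rewrite ler1n.
    by rewrite ler_expR gerBl expR_ge0.
  rewrite ger0_norm//.
  have h2 : expR u * expR u / 4 <= expR (expR u).
    have h3 : expR u / 2 <= expR (expR u / 2).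
      by apply: le_trans (expR_ge1Dx _); rewrite lerDr.
    have h0 : 0 <= expR u / 2 by rewrite divr_ge0 ?expR_ge0.
    have -> : expR (expR u) = expR (expR u / 2) * expR (expR u / 2) by rewrite -expRD; congr expR; field.
    apply: le_trans (ler_pM h0 h0 h3 h3).
    by rewrite le_eqVlt; apply/orP; left; apply/eqP; field.
  have h4 : expR (- expR u) <= 4 * expR (- (2 * u)).
    rewrite expRN -[leLHS]mul1r ler_pdivrMr ?expR_gt0//.
    rewrite -mulrA; apply: le_trans (_ : 4 * (expR (- (2 * u)) * (expR u * expR u / 4)) <= _).
      rewrite -expRD (_ : u + u = 2 * u); last by ring.
      have -> : 4 * (expR (- (2 * u)) * (expR (2 * u) / 4)) = expR (- (2 * u)) * expR (2 * u) by field.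
      by rewrite -expRD addNr expR0.
    by rewrite ler_wpM2l// ler_wpM2l ?expR_ge0.
  rewrite expRD; apply: (@le_trans _ _ (expR (b * u) * (4 * expR (- (2 * u))))).
    by rewrite ler_wpM2l ?expR_ge0.
  rewrite mulrCA ler_wpM2l// -expRD ler_expR.
  have := ler_wpM2r u0 b1; lra.
rewrite ge0_integralZl//.
  apply: lte_mul_pinfty => //.
  by apply: le_lt_trans (integral_exp_abs b0) _; rewrite ltry.
apply/measurable_EFinP; apply: measurableT_comp => //.
by apply: measurableT_comp => //; apply: measurable_funM => //; exact: measurableT_comp.
Qed.

Lemma sub_cst_gt0 (b : R) : 0 < b <= 1 -> 0 < sub_cst b.
Proof.
move=> hb; have hf := sub_fin hb; have /andP[b0 b1] := hb.
rewrite fine_gt0// hf andbT.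
pose I : set (measurableTypeR R) := `[0 : R, 1]%classic.
have mI : measurable I by exact: measurable_itv.
apply: (@lt_le_trans _ _ (\int[mu]_u ((expR (- expR 1))%:E * (\1_I u)%:E))%E).
  rewrite ge0_integralZl//; last by apply/measurable_EFinP; exact: measurable_indic.
  rewrite integral_indic// setIT.
  have h : mu I = 1%:E by rewrite /I lebesgue_measure_itv/= lte_fin ltr01 oppr0 adde0.
  apply: mule_gt0; first by rewrite lte_fin expR_gt0.
  by apply: (@lt_le_trans _ _ 1%:E); [rewrite lte_fin|rewrite -h; exact: lexx].
apply: ge0_le_integral => //.
- apply: emeasurable_funM => //; apply/measurable_EFinP; exact: measurable_indic.
- by apply/measurable_EFinP; exact: (continuous_measurable_fun (@csub1 b)).
move=> u _; rewrite indicE; case: (boolP (u \in I)) => [|_]; last by rewrite mule0 lee_fin expR_ge0.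
rewrite inE /I /= in_itv/= => /andP[u0 u1]; rewrite mule1 lee_fin ler_expR.
have h1 := mulr_ge0 (ltW b0) u0; have h2 : expR u <= expR 1 by rewrite ler_expR.
lra.
Qed.

(** Translation by [ln m] in the Gamma integral. With m the squared distance of two points, this
    exhibits the Riesz kernel as a mixture of Gaussian kernels. *)
Lemma subordination (b m : R) : 0 < b <= 1 -> 0 < m ->
  (\int[mu]_u (expR (b * u - expR u * m))%:E = (sub_cst b * m `^ (- b))%:E)%E.
Proof.
move=> hb m0; rewrite (integral_shift (- ln m) (@csub b m)).
rewrite /sub_cst EFinM fineK; last by rewrite ge0_fin_numE ?sub_fin// integral_ge0// => u _; rewrite lee_fin expR_ge0.
rewrite muleC -ge0_integralZl//.
- apply: eq_integral => u _; rewrite -EFinM; congr EFin.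
  rewrite /powR gt_eqF// -expRD expRD [expR (- ln m)]expRN lnK ?posrE// mulfVK ?gt_eqF//.
  by congr expR; ring.
- by apply/measurable_EFinP; exact: (continuous_measurable_fun (@csub1 b)).
- by rewrite lee_fin powR_ge0.
- by move=> x; exact: expR_ge0.
Qed.

End subordination.

Section gaussian_domination.
Context {R : realType} {k : nat}.
Implicit Types (phi psi : 'rV[R]_k -> R) (a : R) (x y : 'rV[R]_k).

Definition gauss a x y : R := expR (- (a * sqn (y - x))).

Lemma gauss_gt0 a x y : 0 < gauss a x y.
Proof. exact: expR_gt0. Qed.

Lemma gauss_le1 a x y : 0 <= a -> gauss a x y <= 1.
Proof. by move=> a0; rewrite -expR0 ler_expR oppr_le0 mulr_ge0// sqn_ge0. Qed.

Lemma measurable_gauss d (T : measurableType d) a (f g : T -> 'rV[R]_k) :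
  measurable_fun setT f -> measurable_fun setT g -> measurable_fun setT (fun w => gauss a (f w) (g w)).
Proof.
move=> mf mg; apply: measurableT_comp => //; apply: measurableT_comp => //.
by apply: measurable_funM => //; exact: measurable_sqn_sub.
Qed.

(** Time slices of test functions and of mild kernels are both of this kind. Domination by a centred
    Gaussian is stable under linear combinations and makes every spatial form below finite, hence
    bilinear. *)
Definition gdom phi : Prop := measurable_fun setT phi /\
  exists a c, [/\ 0 < a, 0 <= c & forall y, `|phi y| <= c * gauss a 0 y].

Lemma gdom_le phi psi c : gdom psi -> measurable_fun setT phi -> 0 <= c ->
  (forall y, `|phi y| <= c * `|psi y|) -> gdom phi.
Proof.
move=> [mp [a [c' [a0 c'0 h]]]] mf c0 hc; split => //; exists a, (c * c'); split => //.
  exact: mulr_ge0.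
by move=> y; apply: le_trans (hc y) _; rewrite -mulrA ler_wpM2l.
Qed.

Lemma gdomZ (c : R) phi : gdom phi -> gdom (fun y => c * phi y).
Proof.
move=> gp; apply: (gdom_le (c := `|c|) gp) => //; last by move=> y; rewrite normrM.
by apply: measurable_funM => //; case: gp.
Qed.

Lemma gdomD phi psi : gdom phi -> gdom psi -> gdom (fun y => phi y + psi y).
Proof.
move=> [mp [a [c [a0 c0 h]]]] [mq [a' [c' [a'0 c'0 h']]]]; split; first exact: measurable_funD.
exists (Num.min a a'), (c + c'); split; [by rewrite lt_min a0|exact: addr_ge0|].
move=> y; apply: le_trans (ler_normD _ _) _; rewrite mulrDl; apply: lerD.
  apply: le_trans (h y) _; rewrite ler_wpM2l// ler_expR lerN2 ler_wpM2r ?sqn_ge0//.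
  by rewrite ge_min lexx.
apply: le_trans (h' y) _; rewrite ler_wpM2l// ler_expR lerN2 ler_wpM2r ?sqn_ge0//.
by rewrite ge_min lexx orbT.
Qed.

Lemma gdom_gauss a x : 0 < a -> gdom (gauss a x).
Proof.
move=> a0; split; first exact: measurable_gauss.
exists (a / 2), (expR (a * sqn x)); split; [by rewrite divr_gt0|exact: expR_ge0|].
move=> y; rewrite ger0_norm ?expR_ge0// -expRD ler_expR subr0.
have := sqn_addK y x 0; rewrite !subr0 => h.
have := ler_wpM2l (ltW a0) h; nra.
Qed.

End gaussian_domination.

Section pair_form.
Context {R : realType} {k : nat} dZ (Z : measurableType dZ)
  (M : {sigma_finite_measure set Z -> \bar R}) (p1 p2 : Z -> 'rV[R]_k) (K : Z -> R).
Hypothesis mp1 : measurable_fun setT p1.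
Hypothesis mp2 : measurable_fun setT p2.
Hypothesis mK : measurable_fun setT K.
Hypothesis K0 : forall z, 0 <= K z.

(** The abstract space Z serves both noises: pairs of points with the Riesz kernel, or single points
    with [p1 = p2 = id] and kernel 1. *)
Definition pker (phi psi : 'rV[R]_k -> R) (z : Z) : R := phi (p1 z) * K z * psi (p2 z).

Definition pform phi psi : R := \int[M]_z pker phi psi z.

Hypothesis finK : forall a : R, 0 < a ->
  (\int[M]_z (pker (gauss a 0) (gauss a 0) z)%:E < +oo)%E.

Implicit Types phi psi chi : 'rV[R]_k -> R.

Lemma pker_measurable phi psi : measurable_fun setT phi -> measurable_fun setT psi ->
  measurable_fun setT (pker phi psi).
Proof.
move=> mp mq; apply: measurable_funM; last exact: measurableT_comp.
by apply: measurable_funM => //; exact: measurableT_comp.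
Qed.

Lemma pker_integrable phi psi : gdom phi -> gdom psi -> M.-integrable setT (EFin \o pker phi psi).
Proof.
move=> [mp [a [c [a0 c0 h]]]] [mq [a' [c' [a'0 c'0 h']]]].
pose b := Num.min a a'; have b0 : 0 < b by rewrite lt_min a0.
have mb : measurable_fun setT (pker (gauss b 0) (gauss b 0)) by apply: pker_measurable; exact: measurable_gauss.
have g0 z : 0 <= pker (gauss b 0) (gauss b 0) z.
  by apply: mulr_ge0; [apply: mulr_ge0 => //|]; exact: ltW (gauss_gt0 _ _ _).
have i0 : M.-integrable setT (EFin \o pker (gauss b 0) (gauss b 0)).
  apply/integrableP; split; first exact/measurable_EFinP.
  rewrite (eq_integral (EFin \o pker (gauss b 0) (gauss b 0))); first exact: finK.
  by move=> z _ /=; rewrite ger0_norm.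
have ib := integrableZl measurableT (c * c') i0.
apply: le_integrable ib => //; first by apply/measurable_EFinP; exact: pker_measurable.
move=> z _ /=; rewrite lee_fin /pker !normrM (ger0_norm (K0 z)) (ger0_norm c0) (ger0_norm c'0).
rewrite (ger0_norm (ltW (gauss_gt0 b 0 _))) (ger0_norm (ltW (gauss_gt0 b 0 _))).
have le1 y : `|phi y| <= c * gauss b 0 y.
  apply: le_trans (h y) _; rewrite ler_wpM2l// ler_expR lerN2 ler_wpM2r ?sqn_ge0//.
  by rewrite ge_min lexx.
have le2 y : `|psi y| <= c' * gauss b 0 y.
  apply: le_trans (h' y) _; rewrite ler_wpM2l// ler_expR lerN2 ler_wpM2r ?sqn_ge0//.
  by rewrite ge_min lexx orbT.
have -> : c * c' * (gauss b 0 (p1 z) * K z * gauss b 0 (p2 z)) =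
  c * gauss b 0 (p1 z) * K z * (c' * gauss b 0 (p2 z)) by ring.
by apply: ler_pM; rewrite ?mulr_ge0// ler_wpM2r.
Qed.

Lemma pformDl phi psi chi : gdom phi -> gdom psi -> gdom chi ->
  pform (fun y => phi y + psi y) chi = pform phi chi + pform psi chi.
Proof.
move=> h1 h2 h3; rewrite /pform -RintegralD//; [|exact: pker_integrable|exact: pker_integrable].
by apply: eq_Rintegral => z _; rewrite /pker; ring.
Qed.

Lemma pformDr phi psi chi : gdom phi -> gdom psi -> gdom chi ->
  pform chi (fun y => phi y + psi y) = pform chi phi + pform chi psi.
Proof.
move=> h1 h2 h3; rewrite /pform -RintegralD//; [|exact: pker_integrable|exact: pker_integrable].
by apply: eq_Rintegral => z _; rewrite /pker; ring.
Qed.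

Lemma pformZl c phi psi : gdom phi -> gdom psi -> pform (fun y => c * phi y) psi = c * pform phi psi.
Proof.
move=> h1 h2; rewrite /pform -RintegralZl//; last exact: pker_integrable.
by apply: eq_Rintegral => z _; rewrite /pker; ring.
Qed.

Lemma pformZr c phi psi : gdom phi -> gdom psi -> pform phi (fun y => c * psi y) = c * pform phi psi.
Proof.
move=> h1 h2; rewrite /pform -RintegralZl//; last exact: pker_integrable.
by apply: eq_Rintegral => z _; rewrite /pker; ring.
Qed.

Lemma pform_le phi psi phi' psi' : gdom phi -> gdom psi -> gdom phi' -> gdom psi' ->
  (forall y y', phi y * psi y' <= phi' y * psi' y') -> pform phi psi <= pform phi' psi'.
Proof.
move=> h1 h2 h3 h4 h; apply: le_Rintegral => //; [exact: pker_integrable|exact: pker_integrable|].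
by move=> z _; rewrite /pker mulrAC [leRHS]mulrAC ler_wpM2r.
Qed.

Lemma pform_measurable d (T : measurableType d) (F G : T * 'rV[R]_k -> R) :
  measurable_fun setT F -> measurable_fun setT G ->
  measurable_fun setT (fun t => pform (fun y => F (t, y)) (fun y => G (t, y))).
Proof.
move=> mF mG; apply: measurableT_comp => //.
pose f (p : T * Z) : \bar R := (F (p.1, p1 p.2) * K p.2 * G (p.1, p2 p.2))%:E.
have mf : measurable_fun setT f.
  apply/measurable_EFinP; apply: measurable_funM.
    apply: measurable_funM; last exact: measurableT_comp.
    apply: measurableT_comp => //; apply: measurable_fun_pair => //.
    exact: measurableT_comp.
  apply: measurableT_comp => //; apply: measurable_fun_pair => //.
  exact: measurableT_comp.
rewrite (_ : (fun t => _) = (fun t => (\int[M]_z (f^\+ (t, z)) - \int[M]_z (f^\- (t, z)))%E)).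
  by apply: emeasurable_funB; apply: measurable_fun_fubini_tonelli_F => //;
    [exact: measurable_funepos|exact: measurable_funeneg].
by apply/funext => t; rewrite integralE; congr (_ - _)%E; apply: eq_integral => z _; rewrite ?funeposE ?funenegE.
Qed.

End pair_form.

Section riesz_kernel.
Context {R : realType} {k : nat}.
Local Notation mu := (@lebesgue_measure R).
Local Notation lam := (@lebesgue_rV R k).
Variable beta : R.
Hypothesis beta0 : 0 < beta.
Hypothesis betak : beta < k%:R.
Hypothesis beta2 : beta < 2.

Local Notation b := (beta / 2).

Let b01 : 0 < b <= 1.
Proof. by move: beta0 beta2 => ? ?; apply/andP; split; lra. Qed.

Let b0 : 0 < b. Proof. by case/andP: b01. Qed.

Definition riesz (z : 'rV[R]_k * 'rV[R]_k) : R := enorm (z.1 - z.2) `^ (- beta).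

Lemma riesz_ge0 z : 0 <= riesz z.
Proof. exact: powR_ge0. Qed.

Lemma measurable_riesz : measurable_fun setT riesz.
Proof.
apply: (measurableT_comp (measurable_powR _)).
apply: (measurableT_comp (f := @Num.sqrt R)); first exact: (continuous_measurable_fun (@sqrt_continuous R)).
by apply: (measurable_sqn_sub measurable_fst measurable_snd).
Qed.

Lemma riesz_sqn z : riesz z = if sqn (z.1 - z.2) == 0 then 0 else sqn (z.1 - z.2) `^ (- b).
Proof.
rewrite /riesz (_ : enorm (z.1 - z.2) = Num.sqrt (sqn (z.1 - z.2)))//.
have [->|n0] := eqVneq (sqn _) 0.
  by rewrite sqrtr0 /powR eqxx oppr_eq0 (gt_eqF beta0).
rewrite -powR12_sqrt ?sqn_ge0// -powRrM; congr powR.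
by rewrite mulrN mulrC.
Qed.

Definition mixed (z : 'rV[R]_k * 'rV[R]_k) (u : R) : R := expR (b * u) * expR (- (expR u * sqn (z.1 - z.2))).

Lemma mixed_ge0 z u : 0 <= mixed z u.
Proof. by rewrite mulr_ge0 ?expR_ge0. Qed.

Lemma measurable_mixed d (T : measurableType d) (f : T -> 'rV[R]_k * 'rV[R]_k) (g : T -> R) :
  measurable_fun setT f -> measurable_fun setT g -> measurable_fun setT (fun t => mixed (f t) (g t)).
Proof.
move=> mf mg; apply: measurable_funM; apply: measurableT_comp => //.
  exact: measurable_funM.
apply: measurableT_comp => //; apply: measurable_funM; first exact: measurableT_comp.
by apply: measurable_sqn_sub; [exact: measurableT_comp measurable_fst mf|exact: measurableT_comp measurable_snd mf].
Qed.

Lemma mixed_integral z : sqn (z.1 - z.2) != 0 ->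
  (\int[mu]_u (mixed z u)%:E = (sub_cst b * riesz z)%:E)%E.
Proof.
move=> n0; rewrite riesz_sqn (negbTE n0) -(subordination b01); last by rewrite lt_neqAle eq_sym n0 sqn_ge0.
by apply: eq_integral => u _; rewrite /mixed -expRD.
Qed.

Lemma riesz_le_mixed z : ((riesz z)%:E <= (sub_cst b)^-1%:E * \int[mu]_u (mixed z u)%:E)%E.
Proof.
have c0 := sub_cst_gt0 b01.
have [e0|n0] := eqVneq (sqn (z.1 - z.2)) 0.
  rewrite riesz_sqn e0 eqxx mule_ge0 ?lee_fin ?invr_ge0 ?(ltW c0)//.
  by apply: integral_ge0 => u _; rewrite lee_fin mixed_ge0.
by rewrite mixed_integral// -EFinM mulKf ?gt_eqF.
Qed.

(** Integrated against a Gaussian of rate [expR l], the mixture over u decays at rate b to the left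
    of [u = l] and at rate [k / 2 - b] to the right. Both rates are positive because
    [0 < beta < k]. *)
Definition rho_min : R := Num.min b (k%:R / 2 - b).

Let rho_min0 : 0 < rho_min.
Proof. by move: betak => ?; rewrite lt_min b0 subr_gt0; lra. Qed.

Definition gauss_mix_cst : R := Num.sqrt pi ^+ k * (2 / (1 - expR (- rho_min))).

Let sqrt_pi_exp (l : R) : Num.sqrt (pi / expR l) ^+ k = Num.sqrt pi ^+ k * expR (- (k%:R / 2 * l)).
Proof.
have -> : Num.sqrt (pi / expR l) = Num.sqrt pi * expR (- (l / 2)).
  rewrite sqrtrM ?pi_ge0// -expRN; congr (_ * _).
  rewrite (_ : - l = - (l / 2) + - (l / 2)); last by field.
  by rewrite expRD -expr2 sqrtr_sqr ger0_norm ?expR_ge0.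
by rewrite exprMn -expRM_natl; congr (_ * expR _); field.
Qed.

Lemma mixed_gauss_integral (l : R) (x y : 'rV[R]_k) :
  (\int[lam]_z \int[mu]_u (mixed (y, z) u * gauss (expR l) x z)%:E <=
   (gauss_mix_cst * expR ((b - k%:R / 2) * l))%:E)%E.
Proof.
have mg : measurable_fun setT (fun p : 'rV[R]_k * measurableTypeR R => (mixed (y, p.1) p.2 * gauss (expR l) x p.1)%:E).
  apply/measurable_EFinP; apply: measurable_funM.
    by apply: measurable_mixed => //; exact: measurable_fun_pair.
  exact: measurable_gauss.
have g0 p : (0 <= (mixed (y, p.1) p.2 * gauss (expR l) x p.1)%:E)%E.
  by rewrite lee_fin mulr_ge0 ?mixed_ge0// ltW// gauss_gt0.
have mS u : measurable_fun setT (fun z : 'rV[R]_k => (expR (- (expR u * sqn (z - y))))%:E).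
  by apply/measurable_EFinP; exact: measurable_gauss.
have mG : measurable_fun setT (fun z : 'rV[R]_k => (gauss (expR l) x z)%:E).
  by apply/measurable_EFinP; exact: measurable_gauss.
rewrite (fubini_tonelli (fun p : 'rV[R]_k * measurableTypeR R => (mixed (y, p.1) p.2 * gauss (expR l) x p.1)%:E) mg g0) /=.
apply: (@le_trans _ _ (\int[mu]_u ((Num.sqrt pi ^+ k * expR ((b - k%:R / 2) * l))%:E * (expR (- (rho_min * `|u - l|)))%:E))%E).
  apply: ge0_le_integral => //.
  - by move=> u _; apply: integral_ge0 => z _; exact: (g0 (z, u)).
  - exact: (measurable_fun_fubini_tonelli_G _ mg g0).
  - apply/measurable_EFinP; apply: measurable_funM => //; apply: measurableT_comp => //.
    apply: measurableT_comp => //; apply: measurable_funM => //; apply: measurableT_comp => //.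
    exact: measurable_funB.
  (* The wider of the two Gaussians is bounded by 1: for [u <= l] this is the one of the mixture,
     for [u > l] it is [gauss (expR l) x]. *)
  move=> u _; have [ul|lu] := leP u l.
  - apply: (@le_trans _ _ (\int[lam]_z ((expR (b * u))%:E * (gauss (expR l) x z)%:E))%E).
      apply: ge0_le_integral => //.
      + by move=> z _; exact: (g0 (z, u)).
      + exact: (measurable_fun_pair1 u mg).
      + exact: emeasurable_funM.
      move=> z _; rewrite -EFinM lee_fin; apply: ler_wpM2r; first exact: ltW (gauss_gt0 _ _ _).
      by rewrite /mixed ler_piMr ?expR_ge0// -expR0 ler_expR oppr_le0 mulr_ge0 ?expR_ge0// sqn_ge0.
    rewrite ge0_integralZl//; last by move=> z _; rewrite lee_fin ltW// gauss_gt0.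
    rewrite integral_gauss_rV ?expR_gt0// sqrt_pi_exp -!EFinM lee_fin mulrCA -!mulrA.
    rewrite ler_wpM2l ?exprn_ge0 ?sqrtr_ge0// -!expRD ler_expR ler0_norm ?subr_le0//.
    have h : rho_min * (l - u) <= b * (l - u) by rewrite ler_wpM2r ?subr_ge0// ge_min lexx.
    by lra.
  - apply: (@le_trans _ _ (\int[lam]_z ((expR (b * u))%:E * (expR (- (expR u * sqn (z - y))))%:E))%E).
      apply: ge0_le_integral => //.
      + by move=> z _; exact: (g0 (z, u)).
      + exact: (measurable_fun_pair1 u mg).
      + exact: emeasurable_funM.
      move=> z _; rewrite -EFinM lee_fin /mixed /= sqnB ler_piMr ?gauss_le1 ?expR_ge0//.
    rewrite ge0_integralZl//.
    rewrite integral_gauss_rV ?expR_gt0// sqrt_pi_exp -!EFinM lee_fin mulrCA -!mulrA.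
    rewrite ler_wpM2l ?exprn_ge0 ?sqrtr_ge0// -!expRD ler_expR gtr0_norm ?subr_gt0//.
    have h : rho_min * (u - l) <= (k%:R / 2 - b) * (u - l).
      by rewrite ler_wpM2r ?subr_ge0 ?(ltW lu)// ge_min lexx orbT.
    by lra.
have c0 : 0 <= Num.sqrt pi ^+ k * expR ((b - k%:R / 2) * l) by rewrite mulr_ge0 ?exprn_ge0 ?sqrtr_ge0 ?expR_ge0.
rewrite ge0_integralZl//; last first.
  apply/measurable_EFinP; apply: measurableT_comp => //.
  apply: measurableT_comp => //; apply: measurable_funM => //; apply: measurableT_comp => //.
  exact: measurable_funB.
rewrite -(@integral_shift _ (fun u => expR (- (rho_min * `|u|))) (- l)).
- rewrite /gauss_mix_cst mulrAC [X in (_ <= X)%E]EFinM lee_wpmul2l ?lee_fin//.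
  exact: integral_exp_abs.
- apply: continuous_expR_lin => u; apply: cvgN; apply: cvgM; first exact: cvg_cst.
  exact: norm_continuous.
- by move=> u; exact: expR_ge0.
Qed.

Local Notation lam2 := (lam \x lam)%E.

Lemma mixed_gauss_pair (a : R) (x : 'rV[R]_k) : 0 < a ->
  (\int[lam2]_p \int[mu]_u (gauss a x p.1 * mixed p u * gauss a x p.2)%:E <=
   (gauss_mix_cst * Num.sqrt pi ^+ k * a `^ (b - k%:R))%:E)%E.
Proof.
move=> a0; pose l := ln a; have aE : a = expR l by rewrite lnK// posrE.
have mF : measurable_fun setT (fun q : ('rV[R]_k * 'rV[R]_k) * measurableTypeR R =>
    (gauss a x q.1.1 * mixed q.1 q.2 * gauss a x q.1.2)%:E).
  apply/measurable_EFinP; apply: measurable_funM; first apply: measurable_funM.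
  - by apply: measurable_gauss => //; exact: measurableT_comp measurable_fst measurable_fst.
  - exact: measurable_mixed.
  - by apply: measurable_gauss => //; exact: measurableT_comp measurable_snd measurable_fst.
have F0 q : (0 <= (gauss a x q.1.1 * mixed q.1 q.2 * gauss a x q.1.2)%:E)%E.
  by rewrite lee_fin !mulr_ge0 ?mixed_ge0// ltW// gauss_gt0.
rewrite fubini_tonelli1/=; last 2 first.
- exact: (measurable_fun_fubini_tonelli_F _ mF F0).
- by move=> p; apply: integral_ge0 => u _; exact: (F0 (p, u)).
have mG y : measurable_fun setT (fun q : 'rV[R]_k * measurableTypeR R =>
    (mixed (y, q.1) q.2 * gauss a x q.1)%:E).
  apply/measurable_EFinP; apply: measurable_funM; last exact: measurable_gauss.
  by apply: measurable_mixed => //; exact: measurable_fun_pair.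
have G0 y q : (0 <= (mixed (y, q.1) q.2 * gauss a x q.1)%:E)%E.
  by rewrite lee_fin mulr_ge0 ?mixed_ge0// ltW// gauss_gt0.
have mg : measurable_fun setT (fun z : 'rV[R]_k => (gauss a x z)%:E).
  by apply/measurable_EFinP; exact: measurable_gauss.
apply: (@le_trans _ _ (\int[lam]_y ((gauss a x y)%:E * (gauss_mix_cst * expR ((b - k%:R / 2) * l))%:E))%E).
  apply: ge0_le_integral => //.
  - by move=> y _; apply: integral_ge0 => z _; apply: integral_ge0 => u _; exact: (F0 ((y, z), u)).
  - apply: (measurable_fun_fubini_tonelli_F (fun p : 'rV[R]_k * 'rV[R]_k => (\int[mu]_u (gauss a x p.1 * mixed p u * gauss a x p.2)%:E)%E)).
      exact: (measurable_fun_fubini_tonelli_F _ mF F0).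
    by move=> p; apply: integral_ge0 => u _; exact: (F0 (p, u)).
  - exact: emeasurable_funM.
  move=> y _; rewrite /fubini_F /=.
  have -> : (\int[lam]_z \int[mu]_u (gauss a x y * mixed (y, z) u * gauss a x z)%:E =
      (gauss a x y)%:E * \int[lam]_z \int[mu]_u (mixed (y, z) u * gauss a x z)%:E)%E.
    rewrite -ge0_integralZl//; first last.
    - by rewrite lee_fin ltW// gauss_gt0.
    - by move=> z _; apply: integral_ge0 => u _; exact: (G0 y (z, u)).
    - exact: (measurable_fun_fubini_tonelli_F _ (mG y) (G0 y)).
    apply: eq_integral => z _; rewrite -ge0_integralZl//.
    - by apply: eq_integral => u _; rewrite -EFinM; congr EFin; rewrite -mulrA.
    - exact: (measurable_fun_pair2 z (mG y)).
    - by move=> u _; exact: (G0 y (z, u)).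
    - by rewrite lee_fin ltW// gauss_gt0.
  apply: lee_wpmul2l; first by rewrite lee_fin ltW// gauss_gt0.
  by rewrite aE; exact: mixed_gauss_integral.
rewrite ge0_integralZr//; last 2 first.
- by move=> y _; rewrite lee_fin ltW// gauss_gt0.
- rewrite lee_fin mulr_ge0 ?expR_ge0// mulr_ge0 ?exprn_ge0 ?sqrtr_ge0//.
  by rewrite divr_ge0// subr_ge0 -[leRHS]expR0 ler_expR oppr_le0 ltW.
rewrite integral_gauss_rV// [in Num.sqrt (pi / a)]aE sqrt_pi_exp -EFinM lee_fin.
rewrite /powR gt_eqF// -/l le_eqVlt; apply/orP; left; apply/eqP.
have -> : (b - k%:R) * l = - (k%:R / 2 * l) + (b - k%:R / 2) * l by field.
by rewrite expRD; ring.
Qed.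

Definition riesz_gauss_cst : R := (sub_cst b)^-1 * (gauss_mix_cst * Num.sqrt pi ^+ k).

Lemma riesz_gauss (a : R) (x : 'rV[R]_k) : 0 < a ->
  (\int[lam2]_p (pker fst snd riesz (gauss a x) (gauss a x) p)%:E <= (riesz_gauss_cst * a `^ (b - k%:R))%:E)%E.
Proof.
move=> a0; have c0 := sub_cst_gt0 b01.
have mF : measurable_fun setT (fun q : ('rV[R]_k * 'rV[R]_k) * measurableTypeR R =>
    (gauss a x q.1.1 * mixed q.1 q.2 * gauss a x q.1.2)%:E).
  apply/measurable_EFinP; apply: measurable_funM; first apply: measurable_funM.
  - by apply: measurable_gauss => //; exact: measurableT_comp measurable_fst measurable_fst.
  - exact: measurable_mixed.
  - by apply: measurable_gauss => //; exact: measurableT_comp measurable_snd measurable_fst.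
have F0 q : (0 <= (gauss a x q.1.1 * mixed q.1 q.2 * gauss a x q.1.2)%:E)%E.
  by rewrite lee_fin !mulr_ge0 ?mixed_ge0// ltW// gauss_gt0.
have mI := measurable_fun_fubini_tonelli_F (m2 := mu) _ mF F0.
apply: (@le_trans _ _ (\int[lam2]_p ((sub_cst b)^-1%:E * \int[mu]_u (gauss a x p.1 * mixed p u * gauss a x p.2)%:E))%E).
  apply: ge0_le_integral => //.
  - by move=> p _; rewrite lee_fin !mulr_ge0 ?riesz_ge0// ltW// gauss_gt0.
  - apply/measurable_EFinP; apply: pker_measurable => //; [exact: measurable_riesz| |]; exact: measurable_gauss.
  - exact: emeasurable_funM.
  move=> p _.
  have -> : (\int[mu]_u (gauss a x p.1 * mixed p u * gauss a x p.2)%:E =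
     (gauss a x p.1 * gauss a x p.2)%:E * \int[mu]_u (mixed p u)%:E)%E.
    rewrite -ge0_integralZl//.
    - by apply: eq_integral => u _; rewrite -EFinM mulrAC.
    - by apply/measurable_EFinP; exact: measurable_mixed.
    - by move=> u _; rewrite lee_fin mixed_ge0.
    - by rewrite lee_fin mulr_ge0// ltW// gauss_gt0.
  rewrite muleCA /pker mulrAC EFinM; apply: lee_wpmul2l; last exact: riesz_le_mixed.
  by rewrite lee_fin mulr_ge0// ltW// gauss_gt0.
rewrite ge0_integralZl//; last 2 first.
- by move=> p _; apply: integral_ge0 => u _; exact: (F0 (p, u)).
- by rewrite lee_fin invr_ge0 ltW.
rewrite /riesz_gauss_cst -mulrA [X in (_ <= X)%E]EFinM; apply: lee_wpmul2l; first by rewrite lee_fin invr_ge0 ltW.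
exact: mixed_gauss_pair.
Qed.

End riesz_kernel.

Section product_sigma_finite.
Context d1 d2 (T1 : measurableType d1) (T2 : measurableType d2) {R : realType}
  (m1 : {sigma_finite_measure set T1 -> \bar R}) (m2 : {sigma_finite_measure set T2 -> \bar R}).

Lemma product_sigma_finite : sigma_finite setT (m1 \x m2)%E.
Proof.
have /sigma_finiteP[F [FT ndF Foo]] := sigma_finiteT m1.
have /sigma_finiteP[G [GT ndG Goo]] := sigma_finiteT m2.
exists (fun n => F n `*` G n).
  apply/seteqP; split=> // -[x y] _.
  have : [set: T1] x by [].
  have : [set: T2] y by [].
  rewrite GT FT => -[n _ Gny] [l _ Flx]; exists (maxn n l) => //; split.
  - by move: x Flx; exact/subsetPset/ndF/leq_maxr.
  - by move: y Gny; exact/subsetPset/ndG/leq_maxl.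
move=> n; have [mF Fn] := Foo n; have [mG Gn] := Goo n; split; first exact: measurableX.
by rewrite product_measure1E// lte_mul_pinfty// ge0_fin_numE.
Qed.

Definition sigma_finite_product : {sigma_finite_measure set (T1 * T2)%type -> \bar R} :=
  HB.pack (m1 \x m2)%E (Measure_isSigmaFinite.Build _ _ _ (m1 \x m2)%E product_sigma_finite).

End product_sigma_finite.

Definition lebesgue_rV2 {R : realType} k :
  {sigma_finite_measure set ('rV[R]_k * 'rV[R]_k)%type -> \bar R} :=
  sigma_finite_product (@lebesgue_rV R k) (@lebesgue_rV R k).

Section gaussian_positivity.
Context {R : realType} {k : nat}.
Local Notation lam := (@lebesgue_rV R k).
Local Notation lam2 := (@lebesgue_rV2 R k).

Lemma gdom_integrable (phi : 'rV[R]_k -> R) : gdom phi -> lam.-integrable setT (EFin \o phi).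
Proof.
move=> [mp [a [c [a0 c0 h]]]].
have i0 : lam.-integrable setT (EFin \o gauss a 0).
  apply/integrableP; split; first by apply/measurable_EFinP; exact: measurable_gauss.
  rewrite (eq_integral (EFin \o gauss a 0)); last by move=> z _ /=; rewrite gtr0_norm ?gauss_gt0.
  by rewrite integral_gauss_rV// ltry.
apply: le_integrable (integrableZl measurableT c i0) => //; first exact/measurable_EFinP.
move=> y _ /=; rewrite lee_fin normrM (ger0_norm c0) (gtr0_norm (gauss_gt0 _ _ _)).
exact: h.
Qed.

Lemma tensor_integrable (f g : 'rV[R]_k -> R) : lam.-integrable setT (EFin \o f) ->
  lam.-integrable setT (EFin \o g) -> lam2.-integrable setT (EFin \o (fun p => f p.1 * g p.2)).
Proof.
move=> /integrableP[mf fi] /integrableP[mg gi].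
have mf' : measurable_fun setT f by exact/measurable_EFinP.
have mg' : measurable_fun setT g by exact/measurable_EFinP.
have mfg : measurable_fun setT (EFin \o (fun p : 'rV[R]_k * 'rV[R]_k => f p.1 * g p.2)).
  by apply/measurable_EFinP; apply: measurable_funM; exact: measurableT_comp.
apply/integrable12ltyP => //=.
rewrite (eq_integral (fun y => (`|f y|)%:E * \int[lam]_z `|(EFin \o g) z|)%E); last first.
  move=> y _; rewrite -ge0_integralZl//; last exact: measurableT_comp.
  by apply: eq_integral => z _ /=; rewrite normrM EFinM.
have gf : (\int[lam]_z `|(EFin \o g) z|)%E \is a fin_num.
  by rewrite ge0_fin_numE// integral_ge0.
rewrite -(fineK gf) ge0_integralZr//; first (rewrite muleC; apply: lte_mul_pinfty => //; by rewrite lee_fin fine_ge0// integral_ge0).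
- by apply/measurable_EFinP; exact: measurableT_comp.
- by rewrite lee_fin fine_ge0// integral_ge0.
Qed.

(** Completing the square at the midpoint of y and z: a Gaussian kernel is a superposition over w of
    products of a function of y with the same function of z. *)
Lemma gauss_mix_identity (s : R) (y z : 'rV[R]_k) : 0 < s ->
  (\int[lam]_w (expR (- (2 * s * sqn (w - y))) * expR (- (2 * s * sqn (w - z))))%:E =
   (Num.sqrt (pi / (4 * s)) ^+ k * expR (- (s * sqn (y - z))))%:E)%E.
Proof.
move=> s0; pose m := 2^-1 *: (y + z).
rewrite (eq_integral (fun w : 'rV[R]_k => (expR (- (s * sqn (y - z))))%:E * (expR (- (4 * s * sqn (w - m))))%:E)%E).
  rewrite ge0_integralZl//; last by apply/measurable_EFinP; exact: (@measurable_gauss _ k _ _ (4 * s)).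
  by rewrite integral_gauss_rV ?mulr_gt0// -EFinM mulrC.
move=> w _; rewrite -EFinM -!expRD; congr (expR _)%:E.
rewrite -!opprD; congr (- _).
rewrite /sqn !mulr_sumr -!big_split/=; apply: eq_bigr => i _; rewrite !mxE.
by field.
Qed.

(** By [gauss_mix_identity] and Fubini, the form is a positive multiple of the integral over w of
    the square of the integral of [phi y * e y w] in y. *)
Lemma gaussian_kernel_pos (phi : 'rV[R]_k -> R) (s : R) : gdom phi -> 0 < s ->
  (0 <= \int[lam2]_p (phi p.1 * expR (- (s * sqn (p.1 - p.2))) * phi p.2)%:E)%E.
Proof.
move=> gp s0; have ip := gdom_integrable gp; have [mp _] := gp.
pose c := Num.sqrt (pi / (4 * s)) ^+ k.
have c0 : 0 < c by rewrite exprn_gt0// sqrtr_gt0 divr_gt0 ?pi_gt0 ?mulr_gt0.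
pose e (y w : 'rV[R]_k) := expR (- (2 * s * sqn (w - y))).
pose H (q : ('rV[R]_k * 'rV[R]_k) * 'rV[R]_k) := (phi q.1.1 * phi q.1.2) * (e q.1.1 q.2 * e q.1.2 q.2).
have mH : measurable_fun setT (EFin \o H).
  apply/measurable_EFinP; apply: measurable_funM; apply: measurable_funM.
  - by apply: measurableT_comp => //; exact: measurableT_comp measurable_fst measurable_fst.
  - by apply: measurableT_comp => //; exact: measurableT_comp measurable_snd measurable_fst.
  - by apply: (@measurable_gauss _ k _ _ (2 * s)) => //; exact: measurableT_comp measurable_fst measurable_fst.
  - by apply: (@measurable_gauss _ k _ _ (2 * s)) => //; exact: measurableT_comp measurable_snd measurable_fst.
have iphi := tensor_integrable ip ip.
have me y : measurable_fun setT (e y) by exact: (@measurable_gauss _ k _ _ (2 * s)).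
have inner (p : 'rV[R]_k * 'rV[R]_k) : (\int[lam]_w (H (p, w))%:E =
    (c * (phi p.1 * expR (- (s * sqn (p.1 - p.2))) * phi p.2))%:E)%E.
  rewrite /H /= (eq_integral (fun w => (phi p.1 * phi p.2)%:E * (e p.1 w * e p.2 w)%:E)%E); last first.
    by move=> w _; rewrite -EFinM.
  rewrite integralZl//.
    by rewrite gauss_mix_identity// -EFinM; congr EFin; rewrite -/c; ring.
  apply/integrableP; split; first by apply/measurable_EFinP; exact: measurable_funM.
  rewrite (eq_integral (fun w => (e p.1 w * e p.2 w)%:E)) => [|w _]; last first.
    by rewrite /= ger0_norm// mulr_ge0 ?expR_ge0.
  by rewrite gauss_mix_identity// ltry.
have iH : (lam2 \x lam)%E.-integrable setT (EFin \o H).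
  apply: (iffRL (integrable12ltyP lam2 lam mH)).
  have /integrableP[_ hh] := iphi.
  apply: le_lt_trans (_ : \int[lam2]_p (c%:E * `|(EFin \o (fun p => (phi p.1 * phi p.2)%R)) p|) < +oo)%E.
    apply: ge0_le_integral => //.
    - by move=> p _; exact: integral_ge0.
    - have mHn : measurable_fun setT (fun q => `|(EFin \o H) q|%E) by exact: measurableT_comp.
      exact: (measurable_fun_fubini_tonelli_F (m2 := lam) _ mHn (fun q => abse_ge0 _)).
    - by apply: emeasurable_funM => //; apply: measurableT_comp => //; case/integrableP: iphi.
    move=> p _ /=.
    rewrite (eq_integral (fun w => (`|phi p.1 * phi p.2|)%:E * (e p.1 w * e p.2 w)%:E)%E); last first.
      by move=> w _; rewrite -EFinM /H /= [X in X%:E]normrM [`|e _ _ * _|]ger0_norm// mulr_ge0 ?expR_ge0.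
    rewrite ge0_integralZl//; last 2 first.
    - by apply/measurable_EFinP; exact: measurable_funM.
    - by move=> w _; rewrite lee_fin mulr_ge0 ?expR_ge0.
    rewrite gauss_mix_identity// -/c muleC; apply: lee_wpmul2r => //.
    by rewrite lee_fin ler_piMr ?(ltW c0)// -expR0 ler_expR oppr_le0 mulr_ge0 ?sqn_ge0 ?(ltW s0).
  rewrite ge0_integralZl//; last 2 first.
  - by apply: measurableT_comp => //; case/integrableP: iphi.
  - by rewrite lee_fin ltW.
  by apply: lte_mul_pinfty; rewrite ?lee_fin ?(ltW c0).
have <- : (\int[lam2]_p (c^-1%:E * \int[lam]_w (H (p, w))%:E) =
    \int[lam2]_p (phi p.1 * expR (- (s * sqn (p.1 - p.2))) * phi p.2)%:E)%E.
  by apply: eq_integral => p _; rewrite inner -EFinM mulKf ?gt_eqF.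
rewrite integralZl//; last exact: (integrable_fubini_F iH).
apply: mule_ge0; first by rewrite lee_fin invr_ge0 ltW.
have := Fubini iH => /= ->.
apply: integral_ge0 => w _.
have gpe : gdom (fun y => phi y * e y w).
  apply: (gdom_le (c := 1) gp) => //.
    by apply: measurable_funM => //; exact: (@measurable_gauss _ k _ _ (2 * s)).
  move=> y; rewrite mul1r normrM ler_piMr// ger0_norm ?expR_ge0//.
  by rewrite -expR0 ler_expR oppr_le0 !mulr_ge0 ?sqn_ge0 ?(ltW s0).
have ipe := gdom_integrable gpe.
have it := tensor_integrable ipe ipe.
rewrite (eq_integral (EFin \o (fun p => (phi p.1 * e p.1 w) * (phi p.2 * e p.2 w)))); last first.
  by move=> p _; rewrite /H /= mulrACA.
rewrite -(integral12_prod_meas1 it) /fubini_F /=.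
rewrite (eq_integral (fun y => (phi y * e y w)%:E * \int[lam]_z (phi z * e z w)%:E)%E); last first.
  move=> y _; rewrite -integralZl//; exact: eq_integral.
have fI : (\int[lam]_z (phi z * e z w)%:E)%E \is a fin_num by exact: integrable_fin_num ipe.
by rewrite -(fineK fI) integralZr// -{1}(fineK fI) -EFinM lee_fin -expr2 sqr_ge0.
Qed.

End gaussian_positivity.

Section riesz_positivity.
Context {R : realType} {k : nat}.
Local Notation mu := (@lebesgue_measure R).
Local Notation lam := (@lebesgue_rV R k).
Local Notation lam2 := (@lebesgue_rV2 R k).

(** The indicator of the set lies below every Gaussian centred at y, whose integral tends to 0 as
    the rate grows. Positivity of k enters when a k-th power is bounded by its base. *)
Lemma lebesgue_rV_point (y : 'rV[R]_k) : (0 < k)%N -> lam [set z | sqn (y - z) = 0] = 0%E.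
Proof.
move=> k0; set A := [set z | _].
have mA : measurable A.
  rewrite (_ : A = [set z | sqn (y - z) <= 0]).
    by apply: measurable_le_cst; exact: measurable_sqn_sub.
  apply/seteqP; split => z /=; first by rewrite /A /= => ->.
  by move=> h; apply/eqP; rewrite eq_le h sqn_ge0.
have h (a : R) : 0 < a -> (lam A <= (Num.sqrt (pi / a) ^+ k)%:E)%E.
  move=> a0; rewrite -(integral_gauss_rV y a0) -[lam A]mul1e -integral_cst//.
  rewrite integral_mkcond; apply: ge0_le_integral => //.
  - by move=> z _; rewrite patchE; case: ifP.
  - by apply/(measurable_restrictT _ mA).
  - by apply/measurable_EFinP; exact: (@measurable_gauss _ k _ _ a).
  - move=> z _; rewrite patchE; case: ifPn => [|_]; last by rewrite lee_fin expR_ge0.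
    by rewrite inE /A /= sqnB => ->; rewrite mulr0 oppr0 expR0.
apply/eqP; rewrite eq_le measure_ge0 andbT; apply/lee_addgt0Pr => e e0; rewrite add0e.
pose m := Num.min 1 e; have m0 : 0 < m by rewrite lt_min ltr01.
apply: le_trans (h (pi / m ^+ 2) _) _; first by rewrite divr_gt0 ?pi_gt0// exprn_gt0.
rewrite lee_fin (_ : pi / (pi / m ^+ 2) = m ^+ 2); last by rewrite invf_div mulrC divfK ?gt_eqF ?pi_gt0.
rewrite sqrtr_sqr gtr0_norm//; apply: (@le_trans _ _ (m ^+ 1)); last by rewrite expr1 ge_min lexx orbT.
by apply: ler_wiXn2l => //; [exact: ltW|rewrite ge_min lexx].
Qed.

Variable beta : R.
Hypothesis beta0 : 0 < beta.
Hypothesis betak : beta < k%:R.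
Hypothesis beta2 : beta < 2.
Local Notation b := (beta / 2).

Let b01 : 0 < b <= 1.
Proof. by move: beta0 beta2 => ? ?; apply/andP; split; lra. Qed.

Let k0 : (0 < k)%N.
Proof. by rewrite -(ltr0n R); apply: lt_trans betak. Qed.

Lemma diagonal_null : {ae lam2, forall p, sqn (p.1 - p.2) != 0}.
Proof.
exists [set p | sqn (p.1 - p.2) = 0]; split => /=.
- rewrite (_ : [set p | _] = [set p : 'rV[R]_k * 'rV[R]_k | sqn (p.1 - p.2) <= 0]).
    by apply: measurable_le_cst; exact: measurable_sqn_sub.
  apply/seteqP; split => z /=; first by move=> ->.
  by move=> h; apply/eqP; rewrite eq_le h sqn_ge0.
- rewrite /lebesgue_rV2 /= /product_measure1; apply: integral0_eq => y _ /=.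
  rewrite (_ : xsection _ y = [set z | sqn (y - z) = 0]); first exact: lebesgue_rV_point.
  by apply/seteqP; split => z /=; [move/xsectionP|move=> h; apply/xsectionP].
- by move=> p /= /negP; rewrite negbK => /eqP.
Qed.

Lemma riesz_fin (a : R) : 0 < a ->
  (\int[lam2]_p (pker fst snd (@riesz R k beta) (gauss a 0) (gauss a 0) p)%:E < +oo)%E.
Proof.
move=> a0; apply: le_lt_trans (riesz_gauss beta0 betak beta2 0 a0) _; exact: ltry.
Qed.

(** Off the diagonal, a null set, the kernel is a mixture of Gaussian kernels with positive weights.
    Gaussian domination of [phi] gives the integrability that allows the mixture to be integrated
    last. *)
Lemma riesz_pos (phi : 'rV[R]_k -> R) : gdom phi -> 0 <= pform lam2 fst snd (@riesz R k beta) phi phi.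
Proof.
move=> gp; have [mp [a [c [a0 c0 hphi]]]] := gp.
have cst0 := sub_cst_gt0 b01.
pose F (q : ('rV[R]_k * 'rV[R]_k) * measurableTypeR R) := phi q.1.1 * mixed beta q.1 q.2 * phi q.1.2.
pose G (q : ('rV[R]_k * 'rV[R]_k) * measurableTypeR R) := gauss a 0 q.1.1 * mixed beta q.1 q.2 * gauss a 0 q.1.2.
have m1 : measurable_fun setT (fun q : ('rV[R]_k * 'rV[R]_k) * measurableTypeR R => q.1.1).
  exact: measurableT_comp measurable_fst measurable_fst.
have m2 : measurable_fun setT (fun q : ('rV[R]_k * 'rV[R]_k) * measurableTypeR R => q.1.2).
  exact: measurableT_comp measurable_snd measurable_fst.
have mF : measurable_fun setT (EFin \o F).
  apply/measurable_EFinP; apply: measurable_funM; first apply: measurable_funM.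
  - exact: measurableT_comp mp m1.
  - exact: measurable_mixed.
  - exact: measurableT_comp mp m2.
have mFn : measurable_fun setT (fun q => `|(EFin \o F) q|%E) by exact: measurableT_comp.
have mG : measurable_fun setT (fun q => (G q)%:E).
  apply/measurable_EFinP; apply: measurable_funM; first apply: measurable_funM.
  - exact: measurable_gauss.
  - exact: measurable_mixed.
  - exact: measurable_gauss.
have G0 q : (0 <= (G q)%:E)%E by rewrite lee_fin !mulr_ge0 ?mixed_ge0// ltW// gauss_gt0.
have iF : (lam2 \x mu)%E.-integrable setT (EFin \o F).
  apply: (iffRL (integrable12ltyP lam2 mu mF)).
  apply: (@le_lt_trans _ _ (\int[lam2]_p ((c ^+ 2)%:E * \int[mu]_u (G (p, u))%:E))%E).
    apply: ge0_le_integral => //.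
    - by move=> p _; exact: integral_ge0.
    - exact: (measurable_fun_fubini_tonelli_F (m2 := mu) _ mFn (fun q => abse_ge0 _)).
    - by apply: emeasurable_funM => //; exact: (measurable_fun_fubini_tonelli_F (m2 := mu) _ mG G0).
    move=> p _; rewrite -ge0_integralZl//.
    - apply: ge0_le_integral => //.
      + exact: (measurable_fun_pair2 p mFn).
      + by apply: emeasurable_funM => //; exact: (measurable_fun_pair2 p mG).
      move=> u _; rewrite /F /G /= lee_fin normrM normrM (ger0_norm (mixed_ge0 beta p u)).
      rewrite (_ : c ^+ 2 * _ = c * gauss a 0 p.1 * mixed beta p u * (c * gauss a 0 p.2)); last by ring.
      apply: ler_pM => //; first by rewrite mulr_ge0// mixed_ge0.
      by apply: ler_wpM2r => //; exact: mixed_ge0.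
    - exact: (measurable_fun_pair2 p mG).
    - by rewrite lee_fin sqr_ge0.
  rewrite ge0_integralZl//; last 3 first.
  - exact: (measurable_fun_fubini_tonelli_F (m2 := mu) _ mG G0).
  - by move=> p _; apply: integral_ge0 => u _; exact: (G0 (p, u)).
  - by rewrite lee_fin sqr_ge0.
  apply: lte_mul_pinfty; rewrite ?lee_fin ?sqr_ge0//.
  by apply: le_lt_trans (mixed_gauss_pair beta0 betak beta2 0 a0) _; exact: ltry.
have pos : (0 <= \int[lam2]_p \int[mu]_u (EFin \o F) (p, u))%E.
  rewrite (Fubini iF); apply: integral_ge0 => u _.
  pose h := expR (b * u / 2).
  have := gaussian_kernel_pos (gdomZ h gp) (expR_gt0 u).
  congr (_ <= _)%E; apply: eq_integral => p _ /=; congr EFin.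
  have hh : expR (b * u) = h * h by rewrite /h -expRD; congr expR; field.
  by rewrite /F /mixed /= hh; ring.
rewrite /pform /Rintegral fine_ge0//.
rewrite (ae_eq_integral (fun p => ((sub_cst b)^-1%:E * \int[mu]_u (EFin \o F) (p, u))%E))//.
- rewrite integralZl//; last exact: (integrable_fubini_F iF).
  by apply: mule_ge0 => //; rewrite lee_fin invr_ge0 ltW.
- apply/measurable_EFinP; apply: pker_measurable => //; exact: measurable_riesz.
- apply: emeasurable_funM => //.
  by have /integrableP[] := integrable_fubini_F iF.
apply: filterS diagonal_null => p p0 _; rewrite /pker /F /=.
have fm := mixed_integral beta0 beta2 p0.
have mm : measurable_fun setT (fun u : measurableTypeR R => (mixed beta p u)%:E).
  by apply/measurable_EFinP; exact: measurable_mixed.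
have im : mu.-integrable setT (fun u => (mixed beta p u)%:E).
  apply/integrableP; split => //.
  rewrite (_ : (fun u => _) = (fun u => (mixed beta p u)%:E)); first by rewrite fm ltry.
  by apply/funext => u; rewrite /= ger0_norm ?mixed_ge0.
have -> : (\int[mu]_u (phi p.1 * mixed beta p u * phi p.2)%:E =
    (phi p.1 * phi p.2)%:E * \int[mu]_u (mixed beta p u)%:E)%E.
  rewrite -integralZl//; apply: eq_integral => u _; rewrite -EFinM; congr EFin.
  by rewrite mulrAC.
rewrite fm -!EFinM; congr EFin; field.
by rewrite gt_eqF.
Qed.

Lemma riesz_iterated (phi psi : 'rV[R]_k -> R) : gdom phi -> gdom psi ->
  (\int[lam]_y \int[lam]_z (phi y * enorm (y - z) `^ (- beta) * psi z)%:E =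
   (pform lam2 fst snd (@riesz R k beta) phi psi)%:E)%E.
Proof.
move=> g1 g2.
have i := pker_integrable (M := lam2) (p1 := fst) (p2 := snd) measurable_fst measurable_snd
  (@measurable_riesz R k beta) (@riesz_ge0 R k beta) riesz_fin g1 g2.
rewrite /pform /Rintegral fineK; last exact: integrable_fin_num i.
exact: (integral12_prod_meas1 i).
Qed.

End riesz_positivity.

(** * The noise energy *)

Section spatial_form.
Context {R : realType} {k : nat}.
Local Notation mu := (@lebesgue_measure R).
Local Notation lam := (@lebesgue_rV R k).
Local Notation lam2 := (@lebesgue_rV2 R k).
Variable beta : R.

Definition sform (phi psi : 'rV[R]_k -> R) : R :=
  if (k == 1%N) && (beta == 1) then pform lam id id (fun=> 1) phi psi
  else pform lam2 fst snd (@riesz R k beta) phi psi.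

Hypothesis hbeta : 0 < beta < Num.min k%:R 2 \/ k = 1%N /\ beta = 1.

Let not_white : (k == 1%N) && (beta == 1) = false -> [/\ 0 < beta, beta < k%:R & beta < 2].
Proof.
case: hbeta => [|[-> ->]]; last by rewrite !eqxx.
by rewrite lt_min => /andP[? /andP[? ?]] _; split.
Qed.

Let white_k : (k == 1%N) && (beta == 1) -> k = 1%N /\ beta = 1.
Proof. by move=> /andP[/eqP ? /eqP ?]. Qed.

Let white_fin (a : R) (x : 'rV[R]_k) : 0 < a ->
  (\int[lam]_z (pker id id (fun=> 1) (gauss a x) (gauss a x) z)%:E = (Num.sqrt (pi / (2 * a)) ^+ k)%:E)%E.
Proof.
move=> a0; rewrite -(integral_gauss_rV x (_ : 0 < 2 * a)) ?mulr_gt0//.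
apply: eq_integral => y _; rewrite /pker mulr1 -expRD; congr (expR _)%:E; ring.
Qed.

(** The existential hides which noise is meant, so that bilinearity, monotonicity and measurability
    transfer uniformly from [pform]. The exponent [beta / 2 - k] is the scaling exponent of the
    form; for white noise on the line it is -1/2. *)
Lemma sform_pair : exists dZ (Z : measurableType dZ) (M : {sigma_finite_measure set Z -> \bar R})
  (p1 p2 : Z -> 'rV[R]_k) (K : Z -> R),
  [/\ [/\ measurable_fun setT p1, measurable_fun setT p2, measurable_fun setT K & forall z, 0 <= K z],
      forall a : R, 0 < a -> (\int[M]_z (pker p1 p2 K (gauss a 0) (gauss a 0) z)%:E < +oo)%E,
      forall phi psi, sform phi psi = pform M p1 p2 K phi psi,
      exists C, forall a x, 0 < a -> pform M p1 p2 K (gauss a x) (gauss a x) <= C * a `^ (beta / 2 - k%:R) &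
      forall phi, gdom phi -> 0 <= sform phi phi].
Proof.
have [w|nw] := boolP ((k == 1%N) && (beta == 1)).
  have [k1 b1] := white_k w.
  exists _, _, lam, id, id, (fun=> 1); split => //.
  - by move=> a a0; rewrite white_fin// ltry.
  - by move=> phi psi; rewrite /sform w.
  - exists (Num.sqrt (pi / 2)) => a x a0; rewrite /pform /Rintegral white_fin//=.
    rewrite k1 expr1 b1 (_ : 1 / 2 - 1%:R = - 2^-1); last by field.
    rewrite powRN powR12_sqrt ?(ltW a0)// -sqrtrV ?(ltW a0)// -sqrtrM ?divr_ge0 ?pi_ge0//.
    by rewrite invfM mulrA.
  - move=> phi [mp _]; rewrite /sform w; apply: Rintegral_ge0 => z _.
    by rewrite /pker mulr1 -expr2 sqr_ge0.
have [b0 bk b2] := not_white (negbTE nw).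
exists _, _, lam2, fst, snd, (@riesz R k beta); split.
- by split => //; [exact: measurable_riesz|exact: riesz_ge0].
- exact: riesz_fin.
- by move=> phi psi; rewrite /sform (negbTE nw).
- exists (@riesz_gauss_cst R k beta) => a x a0; rewrite /pform /Rintegral.
  have h := riesz_gauss b0 bk b2 x a0.
  have h0 : (0 <= \int[lam2]_p (pker fst snd (@riesz R k beta) (gauss a x) (gauss a x) p)%:E)%E.
    by apply: integral_ge0 => p _; rewrite lee_fin /pker !mulr_ge0 ?riesz_ge0// ltW// gauss_gt0.
  rewrite -lee_fin fineK//; rewrite ge0_fin_numE//.
  by apply: le_lt_trans h _; exact: ltry.
- by move=> phi gp; rewrite /sform (negbTE nw); exact: riesz_pos.
Qed.

Implicit Types phi psi chi : 'rV[R]_k -> R.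

Lemma sformDl phi psi chi : gdom phi -> gdom psi -> gdom chi ->
  sform (fun y => phi y + psi y) chi = sform phi chi + sform psi chi.
Proof.
have [dZ [Z [M [p1 [p2 [K [[m1 m2 mK K0] fK E _ _]]]]]]] := sform_pair.
by move=> *; rewrite !E pformDl.
Qed.

Lemma sformDr phi psi chi : gdom phi -> gdom psi -> gdom chi ->
  sform chi (fun y => phi y + psi y) = sform chi phi + sform chi psi.
Proof.
have [dZ [Z [M [p1 [p2 [K [[m1 m2 mK K0] fK E _ _]]]]]]] := sform_pair.
by move=> *; rewrite !E pformDr.
Qed.

Lemma sformZl c phi psi : gdom phi -> gdom psi -> sform (fun y => c * phi y) psi = c * sform phi psi.
Proof.
have [dZ [Z [M [p1 [p2 [K [[m1 m2 mK K0] fK E _ _]]]]]]] := sform_pair.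
by move=> *; rewrite !E pformZl.
Qed.

Lemma sformZr c phi psi : gdom phi -> gdom psi -> sform phi (fun y => c * psi y) = c * sform phi psi.
Proof.
have [dZ [Z [M [p1 [p2 [K [[m1 m2 mK K0] fK E _ _]]]]]]] := sform_pair.
by move=> *; rewrite !E pformZr.
Qed.

Lemma sform_le phi psi phi' psi' : gdom phi -> gdom psi -> gdom phi' -> gdom psi' ->
  (forall y y', phi y * psi y' <= phi' y * psi' y') -> sform phi psi <= sform phi' psi'.
Proof.
have [dZ [Z [M [p1 [p2 [K [[m1 m2 mK K0] fK E _ _]]]]]]] := sform_pair.
by move=> *; rewrite !E; exact: pform_le.
Qed.

Lemma sform_measurable d (T : measurableType d) (F G : T * 'rV[R]_k -> R) :
  measurable_fun setT F -> measurable_fun setT G ->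
  measurable_fun setT (fun t => sform (fun y => F (t, y)) (fun y => G (t, y))).
Proof.
have [dZ [Z [M [p1 [p2 [K [[m1 m2 mK K0] fK E _ _]]]]]]] := sform_pair.
by move=> mF mG; under eq_fun do rewrite E; exact: pform_measurable.
Qed.

Lemma sform_ge0 phi : gdom phi -> 0 <= sform phi phi.
Proof. by have [dZ [Z [M [p1 [p2 [K [_ _ _ _]]]]]]] := sform_pair; exact. Qed.

Lemma sform_gauss : exists2 C, 0 <= C & forall a x, 0 < a -> sform (gauss a x) (gauss a x) <= C * a `^ (beta / 2 - k%:R).
Proof.
have [dZ [Z [M [p1 [p2 [K [_ _ E [C hC] _]]]]]]] := sform_pair.
exists (Num.max 0 C); first by rewrite le_max lexx.
move=> a x a0; rewrite E; apply: le_trans (hC a x a0) _.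
by rewrite ler_wpM2r ?powR_ge0// le_max lexx orbT.
Qed.

Lemma sform_dominated phi psi c : gdom phi -> gdom psi -> 0 <= c -> (forall y, 0 <= psi y) ->
  (forall y, `|phi y| <= c * psi y) -> sform phi phi <= c ^+ 2 * sform psi psi.
Proof.
move=> g1 g2 c0 psi0 h.
rewrite (_ : c ^+ 2 * _ = sform (fun y => c * psi y) (fun y => c * psi y)).
  have g3 := gdomZ c g2.
  apply: sform_le => // y y'; apply: le_trans (ler_norm _) _; rewrite normrM.
  by apply: ler_pM.
by rewrite sformZl ?sformZr//; [ring|exact: gdomZ].
Qed.

Lemma noise_inner_sform (f g : R * 'rV[R]_k -> R) :
  (forall r, gdom (fun y => f (r, y))) -> (forall r, gdom (fun y => g (r, y))) ->
  noise_inner beta f g =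
  (\int[mu]_(r in `[0%R, +oo[) (sform (fun y => f (r, y)) (fun y => g (r, y)))%:E)%E.
Proof.
move=> hf hg; rewrite /noise_inner /sform; case: ifPn => [w|nw].
  apply: eq_integral => r _; rewrite /pform /Rintegral fineK; last first.
    apply: integrable_fin_num => //; apply: pker_integrable => // a a0.
    by rewrite white_fin// ltry.
  by apply: eq_integral => y _; rewrite /pker mulr1.
have [b0 bk b2] := not_white (negbTE nw).
by apply: eq_integral => r _; exact: riesz_iterated.
Qed.

End spatial_form.

Section energy.
Context {R : realType} {k : nat}.
Local Notation mu := (@lebesgue_measure R).
Local Notation V := (R * 'rV[R]_k)%type.
Variable beta : R.
Hypothesis hbeta : 0 < beta < Num.min k%:R 2 \/ k = 1%N /\ beta = 1.

Definition slices (F : V -> R) : Prop :=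
  measurable_fun setT (F : measurableTypeR R * 'rV[R]_k -> R) /\ forall r, gdom (fun y => F (r, y)).

(** Whiteness in time makes the squared noise norm the integral of this density over [r >= 0], so
    that kernels can be estimated for fixed r. *)
Definition energy (F : V -> R) (r : R) : R := sform beta (fun y => F (r, y)) (fun y => F (r, y)).

Implicit Types F G : V -> R.

Lemma energy_ge0 F r : slices F -> 0 <= energy F r.
Proof. by move=> [_ h]; exact: sform_ge0. Qed.

Lemma energy_measurable F : slices F -> measurable_fun setT (energy F : measurableTypeR R -> R).
Proof. by move=> [mF _]; exact: (sform_measurable hbeta mF mF). Qed.

Lemma slicesD F G : slices F -> slices G -> slices (fun p => F p + G p).
Proof. by move=> [m1 h1] [m2 h2]; split=> [|r]; [exact: measurable_funD|exact: gdomD]. Qed.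

Lemma slicesM (c : R -> R) F : measurable_fun setT (c : measurableTypeR R -> R) -> slices F ->
  slices (fun p => c p.1 * F p).
Proof.
move=> mc [m1 h1]; split=> [|r]; last exact: (gdomZ (c r) (h1 r)).
by apply: measurable_funM => //; exact: measurableT_comp mc measurable_fst.
Qed.

Lemma slicesZ (c : R) F : slices F -> slices (fun p => c * F p).
Proof. by move=> h; apply: (slicesM (c := fun=> c)). Qed.

Lemma slicesB F G : slices F -> slices G -> slices (fun p => F p - G p).
Proof.
move=> h1 h2; have := slicesD h1 (slicesZ (-1) h2).
by rewrite (_ : (fun p => F p + -1 * G p) = (fun p => F p - G p))//; apply/funext => p; rewrite mulN1r.
Qed.

Lemma energyM (c : R -> R) F r : slices F -> energy (fun p => c p.1 * F p) r = c r ^+ 2 * energy F r.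
Proof.
move=> [_ h]; rewrite /energy /= sformZl ?sformZr//; [ring|exact: gdomZ].
Qed.

Lemma energyZ (c : R) F r : slices F -> energy (fun p => c * F p) r = c ^+ 2 * energy F r.
Proof. exact: (energyM (fun=> c)). Qed.

Let cross F G r := sform beta (fun y => F (r, y)) (fun y => G (r, y)) +
  sform beta (fun y => G (r, y)) (fun y => F (r, y)).

Let energyD_cross F G r : slices F -> slices G ->
  energy (fun p => F p + G p) r = energy F r + energy G r + cross F G r.
Proof.
move=> [_ h1] [_ h2]; rewrite /energy /cross sformDl ?sformDr//; [ring|exact: gdomD].
Qed.

Let crossZ a b F G r : slices F -> slices G ->
  cross (fun p => a * F p) (fun p => b * G p) r = a * b * cross F G r.
Proof.
move=> [_ h1] [_ h2]; rewrite /cross !sformZl ?sformZr//; [ring| |]; exact: gdomZ.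
Qed.

(** Young's inequality, from the nonnegativity of the energy of [t F - G]. *)
Lemma energyD_le (t : R) F G r : 0 < t -> slices F -> slices G ->
  energy (fun p => F p + G p) r <= (1 + t) * energy F r + (1 + t^-1) * energy G r.
Proof.
move=> t0 h1 h2; rewrite energyD_cross//.
have := energy_ge0 r (slicesD (slicesZ t h1) (slicesZ (-1) h2)).
rewrite energyD_cross; [|exact: slicesZ|exact: slicesZ]; rewrite !energyZ// crossZ// => h.
have : 0 <= t * energy F r + t^-1 * energy G r - cross F G r.
  rewrite (_ : _ - _ = t^-1 * (t ^+ 2 * energy F r + (-1) ^+ 2 * energy G r + t * -1 * cross F G r)).
    by rewrite mulr_ge0// invr_ge0 ltW.
  by field; rewrite gt_eqF.
lra.
Qed.

Lemma energyB_le F G r : slices F -> slices G ->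
  energy (fun p => F p - G p) r <= 2 * energy F r + 2 * energy G r.
Proof.
move=> h1 h2; have := energyD_le r ltr01 h1 (slicesZ (-1) h2).
rewrite energyZ// sqrrN expr1n mul1r invr1.
by under [X in energy X]eq_fun do rewrite mulN1r.
Qed.

(** The two energies differ by twice the cross term, and a nonnegative spatial kernel preserves the
    pointwise comparison [c G <= F]. A lower bound of one kernel by another thus becomes a positive
    covariance. *)
Lemma energy_polar (c : R) F G r : slices F -> slices G -> 0 <= c ->
  (forall y, 0 <= G (r, y)) -> (forall y, c * G (r, y) <= F (r, y)) ->
  energy (fun p => F p - G p) r + 4 * c * energy G r <= energy (fun p => F p + G p) r.
Proof.
move=> h1 h2 c0 G0 cG; rewrite (energyD_cross r h1 h2).
have -> : (fun p => F p - G p) = (fun p => F p + -1 * G p).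
  by apply/funext => p; rewrite mulN1r.
rewrite (energyD_cross r h1 (slicesZ (-1) h2)) energyZ// (_ : cross F (fun p => -1 * G p) r = - cross F G r); last first.
  have := crossZ 1 (-1) r h1 h2; rewrite mul1r mulN1r => <-.
  by congr cross; apply/funext => p; rewrite mul1r.
have [_ g1] := h1; have [_ g2] := h2.
have l1 : c * energy G r <= sform beta (fun y => F (r, y)) (fun y => G (r, y)).
  rewrite /energy -sformZl//; apply: sform_le => //; first exact: gdomZ.
  by move=> y y'; apply: ler_wpM2r.
have l2 : c * energy G r <= sform beta (fun y => G (r, y)) (fun y => F (r, y)).
  rewrite /energy -sformZr//; apply: sform_le => //; first exact: gdomZ.
  by move=> y y'; apply: ler_wpM2l.
rewrite sqrrN expr1n mul1r /cross; lra.
Qed.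

Lemma noise_energy F : slices F ->
  noise_inner beta F F = (\int[mu]_(r in `[0%R, +oo[) (energy F r)%:E)%E.
Proof. by move=> [_ h]; exact: noise_inner_sform. Qed.

Let mh : measurable (`[0%R, +oo[%classic : set (measurableTypeR R)).
Proof. exact: measurable_itv. Qed.

Let mE F : slices F -> measurable_fun (`[0%R, +oo[%classic : set (measurableTypeR R)) (fun r => (energy F r)%:E).
Proof. by move=> h; apply/measurable_EFinP; apply: measurable_funTS; exact: energy_measurable. Qed.

Lemma noise_energy_ge0 F : slices F -> (0 <= noise_inner beta F F)%E.
Proof.
by move=> h; rewrite noise_energy//; apply: integral_ge0 => r _; rewrite lee_fin energy_ge0.
Qed.

Lemma noise_energy_le F G : slices F -> slices G -> (forall r, energy F r <= energy G r) ->
  (noise_inner beta F F <= noise_inner beta G G)%E.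
Proof.
move=> h1 h2 h; rewrite !noise_energy//; apply: ge0_le_integral => //; [|exact: mE|exact: mE|].
  by move=> r _; rewrite lee_fin energy_ge0.
by move=> r _; rewrite lee_fin.
Qed.

Lemma noise_energyD_le (t : R) F G : 0 < t -> slices F -> slices G ->
  (noise_inner beta (fun p => F p + G p)%R (fun p => F p + G p)%R <=
   (1 + t)%:E * noise_inner beta F F + (1 + t^-1)%:E * noise_inner beta G G)%E.
Proof.
move=> t0 h1 h2; have h3 := slicesD h1 h2; rewrite !noise_energy//.
have t1 : 0 <= 1 + t by rewrite addr_ge0// ltW.
have t2 : 0 <= 1 + t^-1 by rewrite addr_ge0// invr_ge0 ltW.
rewrite -!ge0_integralZl//; try exact: mE; try by move=> r _; rewrite lee_fin energy_ge0.
rewrite -ge0_integralD//; first last.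
- by apply: emeasurable_funM => //; exact: mE.
- by move=> r _; rewrite mule_ge0// lee_fin// energy_ge0.
- by apply: emeasurable_funM => //; exact: mE.
- by move=> r _; rewrite mule_ge0// lee_fin// energy_ge0.
apply: ge0_le_integral => //.
- by move=> r _; rewrite lee_fin energy_ge0.
- exact: mE.
- by apply: emeasurable_funD; apply: emeasurable_funM => //; exact: mE.
- by move=> r _; rewrite -!EFinM -EFinD lee_fin; exact: energyD_le.
Qed.

Lemma noise_energyB_le F G : slices F -> slices G ->
  (noise_inner beta (fun p => F p - G p)%R (fun p => F p - G p)%R <=
   2%:E * noise_inner beta F F + 2%:E * noise_inner beta G G)%E.
Proof.
move=> h1 h2; have := noise_energyD_le ltr01 h1 (slicesZ (-1) h2).
rewrite invr1 (_ : (fun p => F p + -1 * G p) = (fun p => F p - G p)); last first.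
  by apply/funext => p; rewrite mulN1r.
have -> // : noise_inner beta (fun p => -1 * G p) (fun p => -1 * G p) = noise_inner beta G G.
rewrite (noise_energy (slicesZ (-1) h2)) (noise_energy h2).
by apply: eq_integral => r _; rewrite energyZ// sqrrN expr1n mul1r.
Qed.

Lemma noise_energyM_le (c : R -> R) F : measurable_fun setT (c : measurableTypeR R -> R) ->
  (forall r, `|c r| <= 1) -> slices F ->
  (noise_inner beta (fun p => c p.1 * F p)%R (fun p => c p.1 * F p)%R <= noise_inner beta F F)%E.
Proof.
move=> mc c1 h; apply: noise_energy_le => //; first exact: slicesM.
move=> r; rewrite energyM// ler_piMl ?energy_ge0//.
by rewrite -real_normK ?num_real// exprn_ile1.
Qed.

End energy.

(** * Heat kernel estimates *)

Section continuous_measurable_spacetime.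
Context {R : realType} {k : nat}.

Let grid (n : nat) (z : int * {ffun 'I_k -> int}) : R * 'rV[R]_k :=
  (z.1%:~R / n.+1%:R, \row_i ((z.2 i)%:~R / n.+1%:R)).

Let cell (n : nat) (p : R * 'rV[R]_k) : int * {ffun 'I_k -> int} :=
  (Num.floor (p.1 * n.+1%:R), [ffun i => Num.floor (p.2 ord0 i * n.+1%:R)]).

Let dist_floor (n : nat) (a : R) : `|a - (Num.floor (a * n.+1%:R))%:~R / n.+1%:R| <= n.+1%:R^-1.
Proof.
have n0 : 0 < n.+1%:R :> R by rewrite ltr0n.
have /andP[h1 h2] := floor_itv (a * n.+1%:R).
have -> : a - (Num.floor (a * n.+1%:R))%:~R / n.+1%:R = (a * n.+1%:R - (Num.floor (a * n.+1%:R))%:~R) / n.+1%:R.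
  by rewrite mulrBl mulfK ?gt_eqF.
rewrite ger0_norm; last by apply: divr_ge0; [rewrite subr_ge0|exact: ltW].
rewrite -[leRHS]mul1r ler_pM2r ?invr_gt0// lerBlDl.
by apply: ltW; move: h2; rewrite intrD addrC.
Qed.

Let measurable_floor_eq d (T : measurableType d) (h : T -> R) (m : int) : measurable_fun setT h ->
  measurable [set t | Num.floor (h t) = m].
Proof.
move=> mh; rewrite (_ : [set t | _] = [set t | - h t <= - m%:~R] `&` [set t | h t < (m + 1)%:~R]).
  by apply: measurableI; [apply: measurable_le_cst; exact: measurableT_comp|exact: measurable_lt_cst].
apply/seteqP; split => t /=; rewrite lerN2; first by move=> <-; split; [exact: floor_le|exact: floorD1_gt].
by move=> [h1 h2]; apply/floor_def; rewrite h1.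
Qed.

(** The sigma-algebra is generated by coordinates, not by open sets. Hence f is approximated by its
    values at grid points obtained by rounding the coordinates down, functions that take countably
    many values on measurable cells. *)
Lemma continuous_measurable_spacetime (f : R * 'rV[R]_k -> R) : continuous f ->
  measurable_fun setT (f : measurableTypeR R * 'rV[R]_k -> R).
Proof.
move=> cf.
pose g n (p : measurableTypeR R * 'rV[R]_k) := f (grid n (cell n p)).
apply: (@measurable_fun_cvg _ _ _ setT g f) => //; last first.
  move=> p _; apply: (@cvg_comp _ _ _ (fun n => grid n (cell n p)) f _ (nbhs (p : R * 'rV[R]_k)) _ _); last exact: cf.
  apply/cvgrPdist_le => e e0.
  have hN := near_infty_natSinv_lt (PosNum e0).
  near=> n.
  have ne : n.+1%:R^-1 <= e by apply: ltW; near: n; exact: hN.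
  rewrite prod_normE ge_max; apply/andP; split.
    by apply: le_trans ne; exact: dist_floor.
  rewrite /Num.norm /= mx_normrE; apply: bigmax_le; first exact: ltW.
  by move=> [i j] _; rewrite /= !mxE !ord1 ffunE; apply: le_trans ne; exact: dist_floor.
move=> n _ B mB; rewrite setTI.
pose S z : set (measurableTypeR R * 'rV[R]_k) := [set p | B (f (grid n z)) /\ cell n p = z].
have mS z : measurable (S z).
  have [Bz|nB] := pselect (B (f (grid n z))); last first.
    by rewrite (_ : S z = set0)//; apply/seteqP; split => p // -[].
  rewrite (_ : S z = [set p : measurableTypeR R * 'rV[R]_k | Num.floor (p.1 * n.+1%:R) = z.1] `&`
      [set p : measurableTypeR R * 'rV[R]_k | forall i, Num.floor (p.2 ord0 i * n.+1%:R) = z.2 i]).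
    apply: measurableI.
      by apply: measurable_floor_eq; apply: measurable_funM.
    apply: measurable_forall => i; apply: measurable_floor_eq; apply: measurable_funM => //.
    exact: measurableT_comp (measurable_rV_coord i) measurable_snd.
  apply/seteqP; split => p /=.
    by move=> [_ <-]; split => // i; rewrite ffunE.
  move=> [h1 h2]; split => //; rewrite [RHS]surjective_pairing; congr pair => //.
  by apply/ffunP => i; rewrite ffunE.
rewrite (_ : _ @^-1` _ = [set p | exists z, S z p]); first exact: measurable_exists.
apply/seteqP; split => p /=; first by move=> h; exists (cell n p).
by move=> [z [h zE]]; rewrite /g zE.
Unshelve. all: by end_near. Qed.

End continuous_measurable_spacetime.

Section heat_kernel_estimates.
Context {R : realType} {k : nat}.
Local Notation heat := (@heat_kernel R k).

Definition heat_amp (t : R) : R := (4 * pi) `^ (- (k%:R / 2)) * t `^ (- (k%:R / 2)).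

Lemma heat_kernelE (t : R) (x : 'rV[R]_k) : 0 < t ->
  heat t x = heat_amp t * expR (- (sqn x / (4 * t))).
Proof.
move=> t0; rewrite /heat_kernel enorm_sqr /heat_amp powRM//; last exact: ltW.
by rewrite mulr_ge0 ?pi_ge0.
Qed.

Lemma expRN_lip (x y : R) : `|expR (- x) - expR (- y)| <= `|x - y| * (expR (- x) + expR (- y)).
Proof.
wlog xy : x y / x <= y.
  move=> h; have [|/ltW] := leP x y; first exact: h.
  by move=> /h; rewrite distrC [`|y - x|]distrC [expR (- y) + _]addrC.
rewrite distrC [`|x - y|]distrC ler0_norm; last by rewrite subr_le0 ler_expR lerN2.
rewrite ger0_norm ?subr_ge0// opprB.
have h : 1 - expR (- (y - x)) <= y - x by have := expR_ge1Dx (- (y - x)); lra.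
have -> : expR (- x) - expR (- y) = expR (- x) * (1 - expR (- (y - x))).
  by rewrite mulrBr mulr1 -expRD; congr (_ - expR _); ring.
apply: (@le_trans _ _ (expR (- x) * (y - x))); first by rewrite ler_wpM2l ?expR_ge0.
by rewrite mulrC ler_wpM2l ?subr_ge0// lerDl expR_ge0.
Qed.

(** The power k/2 of [t / s <= 1] is at least its power k, to which Bernoulli's inequality
    applies. *)
Let powR_ratio (t s rho : R) : 0 < t -> t <= s -> s <= t + rho ^+ 2 ->
  t `^ (- (k%:R / 2)) * (1 - k%:R * (rho ^+ 2 / t)) <= s `^ (- (k%:R / 2)) <= t `^ (- (k%:R / 2)).
Proof.
move=> t0 ts st; have s0 : 0 < s by exact: lt_le_trans ts.
have k20 : 0 <= k%:R / 2 :> R by rewrite divr_ge0.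
have ts1 : t / s <= 1 by rewrite ler_pdivrMr// mul1r.
have ts0 : 0 <= t / s by rewrite divr_ge0// ltW.
rewrite !powRN.
have pt : 0 < t `^ (k%:R / 2) by exact: powR_gt0.
have ps : 0 < s `^ (k%:R / 2) by exact: powR_gt0.
apply/andP; split; last by rewrite lef_pV2 ?posrE// ge0_ler_powR ?nnegrE// ltW.
have h1 : (s `^ (k%:R / 2))^-1 = (t `^ (k%:R / 2))^-1 * (t / s) `^ (k%:R / 2).
  rewrite powRM ?invr_ge0 ?(ltW t0) ?(ltW s0)// mulKf ?gt_eqF//.
  by rewrite -(powR_inv1 (ltW s0)) -powRrM mulN1r powRN.
rewrite h1 ler_wpM2l ?invr_ge0 ?(ltW pt)//.
apply: (@le_trans _ _ ((t / s) ^+ k)).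
  have -> : t / s = 1 - (1 - t / s) by ring.
  apply: le_trans (expr_onem_ge _ _); last by apply/andP; split; lra.
  rewrite lerB// ler_wpM2l// lerBlDr.
  have -> : 1 = t / t by rewrite divff ?gt_eqF.
  rewrite -lerBlDr -mulrBr.
  have -> : t * (t^-1 - s^-1) = (s - t) / s by field; rewrite !gt_eqF.
  apply: (@le_trans _ _ (rho ^+ 2 / s)).
    by rewrite ler_wpM2r ?invr_ge0 ?(ltW s0)//; lra.
  by rewrite ler_wpM2l ?sqr_ge0// lef_pV2 ?posrE.
rewrite -powR_mulrn//.
have [e0|n0] := eqVneq (t / s) 0.
  by move: e0; move/eqP; rewrite mulf_eq0 invr_eq0 !gt_eqF.
rewrite /powR (negbTE n0) ler_expR; apply: ler_wnM2r.
  by apply: ln_le0.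
by rewrite ler_pdivrMr// ler_peMr// ler1n.
Qed.

Definition heat_diff_cst : R :=
  (4 * pi) `^ (- (k%:R / 2)) * (k%:R + 2 * expR k%:R * (k%:R + 20)).

(** In terms of [e = rho / sqrt t], which is at most 1/2, and of [D], the ratio of [sqn x1] to t,
    both Gaussian exponents are at least [D / 10 - k] and differ by at most [e (k + D)]. Half of the
    decay absorbs the factor [k + D]; the other half is the Gaussian of the conclusion, whence the
    rate 1/20. *)
Lemma heat_kernel_diff (rho t t1 t2 : R) (x1 x2 : 'rV[R]_k) : 0 < rho -> 4 * rho ^+ 2 <= t ->
  t <= t1 <= t + rho ^+ 2 -> t <= t2 <= t + rho ^+ 2 -> sqn (x1 - x2) <= k%:R * rho ^+ 2 ->
  `|heat t1 x1 - heat t2 x2| <=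
  heat_diff_cst * (rho / Num.sqrt t) * t `^ (- (k%:R / 2)) * expR (- (20^-1 / t * sqn x1)).
Proof.
move=> rho0 rt /andP[t11 t12] /andP[t21 t22] hx.
have r2 : 0 < rho ^+ 2 by rewrite exprn_gt0.
have t0 : 0 < t by lra.
have t10 : 0 < t1 by lra.
have t20 : 0 < t2 by lra.
rewrite !heat_kernelE// /heat_amp.
have [e eE] : exists e, e = rho / Num.sqrt t by eexists.
have st0 : 0 < Num.sqrt t by rewrite sqrtr_gt0.
have e0 : 0 < e by rewrite eE divr_gt0.
have ee : rho ^+ 2 = e ^+ 2 * t by rewrite eE expr_div_n sqr_sqrtr ?(ltW t0)// divfK ?gt_eqF.
have e12 : e ^+ 2 <= 1 / 4 by move: rt; rewrite ee mulrA -[leRHS]mul1r ler_pM2r//; lra.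
have e1 : e <= 1 / 2 by rewrite -(@ler_pXn2r _ 2)// ?nnegrE ?(ltW e0)//; lra.
rewrite -eE.
have [K KE] : exists K : R, K = k%:R by eexists.
have K0 : 0 <= K by rewrite KE.
have [a aE] : exists a, a = t `^ (- (k%:R / 2)) by eexists.
have a0 : 0 < a by rewrite aE powR_gt0.
have /andP[l1 u1] := powR_ratio t0 t11 t12; have /andP[l2 u2] := powR_ratio t0 t21 t22.
move: l1 u1 l2 u2; rewrite -aE ee mulfK ?gt_eqF// -KE.
move: (powR_ge0 t2 (- (K / 2))).
move: (t1 `^ _) (t2 `^ _) => a1 a2 a20 l1 u1 l2 u2.
have [B [B0 BE]] : exists B : R, 0 <= B /\ B = (4 * pi) `^ (- (K / 2)).
  by exists ((4 * pi) `^ (- (K / 2))); split; first exact: powR_ge0.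
rewrite /heat_diff_cst -KE -BE.
have [X1 X1E] : exists X, X = sqn x1 by eexists.
have [X2 X2E] : exists X, X = sqn x2 by eexists.
have [D [D0 DE]] : exists D, 0 <= D /\ X1 = D * t.
  by exists (X1 / t); rewrite divfK ?gt_eqF// divr_ge0 ?(ltW t0)// X1E sqn_ge0.
have X20 : 0 <= X2 by rewrite X2E sqn_ge0.
have dX : `|X1 - X2| <= e * X1 + (1 + e^-1) * (K * (e ^+ 2 * t)).
  have h (y1 y2 : R) : `|y1 ^+ 2 - y2 ^+ 2| <= e * y1 ^+ 2 + (1 + e^-1) * (y1 - y2) ^+ 2.
    have h1 : 2 * `|y1| * `|y1 - y2| <= e * y1 ^+ 2 + e^-1 * (y1 - y2) ^+ 2.
      rewrite -[y1 ^+ 2]real_normK ?num_real// -[(y1 - y2) ^+ 2]real_normK ?num_real//.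
      move: `|y1| `|y1 - y2| => u w.
      have := sqr_ge0 (e * u - w) => hh.
      rewrite -(ler_pM2l e0) mulrDr [e * (e^-1 * _)]mulrA divff ?gt_eqF// mul1r; nra.
    have -> : y1 ^+ 2 - y2 ^+ 2 = (y1 - y2) * (2 * y1 - (y1 - y2)) by ring.
    rewrite normrM; apply: le_trans (_ : `|y1 - y2| * (2 * `|y1| + `|y1 - y2|) <= _).
      apply: ler_wpM2l => //; apply: le_trans (ler_normB _ _) _.
      by rewrite normrM ger0_norm.
    have -> : `|y1 - y2| * (2 * `|y1| + `|y1 - y2|) = 2 * `|y1| * `|y1 - y2| + (y1 - y2) ^+ 2.
      by rewrite -[(y1 - y2) ^+ 2]real_normK ?num_real//; ring.
    by lra.
  have -> : X1 - X2 = \sum_i (x1 ord0 i ^+ 2 - x2 ord0 i ^+ 2) by rewrite X1E X2E /sqn sumrB.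
  apply: le_trans (ler_norm_sum _ _ _) _.
  apply: (@le_trans _ _ (\sum_i (e * x1 ord0 i ^+ 2 + (1 + e^-1) * (x1 ord0 i - x2 ord0 i) ^+ 2))).
    by apply: ler_sum => i _; exact: h.
  rewrite big_split/= -!mulr_sumr -/(sqn x1) -X1E lerD2l; apply: ler_wpM2l.
    by rewrite addr_ge0// invr_ge0 ltW.
  by move: hx; rewrite ee -KE /sqn; under eq_bigr do rewrite !mxE.
have X2le : X2 <= 2 * X1 + 2 * (K * (e ^+ 2 * t)).
  have := sqn_addK x2 x1 0; rewrite !subr0 -X1E -X2E sqnB => h; apply: le_trans h _.
  by move: hx; rewrite ee -KE => ?; lra.
have X1le : X1 <= 2 * X2 + 2 * (K * (e ^+ 2 * t)).
  have := sqn_addK x1 x2 0; rewrite !subr0 -X1E -X2E => h; apply: le_trans h _.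
  by move: hx; rewrite ee -KE => ?; lra.
rewrite -X1E -X2E.
have [E1 E1E] : exists E, E = X1 / (4 * t1) by eexists.
have [E2 E2E] : exists E, E = X2 / (4 * t2) by eexists.
rewrite -E1E -E2E.
have E1D : D / 5 <= E1.
  rewrite E1E ler_pdivlMr ?mulr_gt0// DE.
  have : D * t1 <= D * (5 / 4 * t) by apply: ler_wpM2l => //; move: rt t12; rewrite ee; lra.
  lra.
have E2D : D / 10 - K <= E2.
  rewrite E2E ler_pdivlMr ?mulr_gt0//.
  have h1 : 0 <= K * t by rewrite mulr_ge0// ltW.
  have h2 : K * (e ^+ 2 * t) <= K * t / 4.
    by have := ler_wpM2r h1 e12; nra.
  have h3 : D * t2 <= D * (5 / 4 * t) by apply: ler_wpM2l => //; move: rt t22; rewrite ee; lra.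
  have h4 : K * t <= K * t2 by apply: ler_wpM2l.
  by move: X1le; rewrite DE => ?; lra.
have dE : `|E1 - E2| <= e * (K + D).
  have -> : E1 - E2 = (X1 - X2) / (4 * t1) + X2 * ((t2 - t1) / (4 * (t1 * t2))).
    by rewrite E1E E2E; field; rewrite !gt_eqF.
  apply: le_trans (ler_normD _ _) _.
  have b1 : `|(X1 - X2) / (4 * t1)| <= (e * D + (e ^+ 2 + e) * K) / 4.
    rewrite normrM normfV [`|4 * t1|]gtr0_norm ?mulr_gt0// ler_pdivrMr ?mulr_gt0//.
    apply: le_trans dX _.
    have -> : e * X1 + (1 + e^-1) * (K * (e ^+ 2 * t)) = (e * D + (e ^+ 2 + e) * K) * t.
      by rewrite DE; field; rewrite gt_eqF.
    have h0 : 0 <= e * D + (e ^+ 2 + e) * K.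
      by rewrite addr_ge0 ?mulr_ge0 ?addr_ge0 ?sqr_ge0 ?(ltW e0).
    by have := ler_wpM2l h0 t11; lra.
  have b2 : `|X2 * ((t2 - t1) / (4 * (t1 * t2)))| <= (2 * D + 2 * K) * e ^+ 2 / 4.
    rewrite normrM (ger0_norm X20) normrM normfV [`|4 * _|]gtr0_norm ?mulr_gt0//.
    have d12 : `|t2 - t1| <= e ^+ 2 * t by rewrite -ee ler_norml; apply/andP; split; lra.
    have tt : t * t <= t1 * t2 by apply: ler_pM => //; exact: ltW.
    have XD : X2 <= (2 * D + 2 * K) * t.
      have h1 : 0 <= K * t by rewrite mulr_ge0// ltW.
      by move: X2le; rewrite DE => ?; have := ler_wpM2r h1 e12; nra.
    rewrite mulrA ler_pdivrMr ?mulr_gt0//.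
    apply: (@le_trans _ _ ((2 * D + 2 * K) * t * (e ^+ 2 * t))); first exact: ler_pM.
    have h0 : 0 <= (2 * D + 2 * K) * e ^+ 2 by rewrite mulr_ge0 ?sqr_ge0// addr_ge0 ?mulr_ge0.
    by have := ler_wpM2l h0 tt; lra.
  apply: (le_trans (lerD b1 b2)).
  have ee1 : e ^+ 2 <= e / 2 by rewrite expr2; have := ler_wpM2l (ltW e0) e1; lra.
  have c1 := ler_wpM2r D0 ee1; have c2 := ler_wpM2r K0 ee1.
  have c3 : 0 <= e * D by rewrite mulr_ge0// ltW.
  have c4 : 0 <= e * K by rewrite mulr_ge0// ltW.
  by lra.
have [g gE] : exists g, g = expR (- (D / 20)) by eexists.
have g0 : 0 < g by rewrite gE expR_gt0.
have -> : expR (- (20^-1 / t * X1)) = g.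
  by rewrite gE DE; congr expR; field; rewrite gt_eqF.
have gE1 : expR (- E1) <= g by rewrite gE ler_expR; lra.
have gsq : expR (- (D / 10)) = g * g by rewrite gE -expRD; congr expR; field.
have sumE : expR (- E1) + expR (- E2) <= 2 * expR K * (g * g).
  have s1 : expR (- E1) <= expR K * (g * g).
    by rewrite -gsq -expRD ler_expR; lra.
  have s2 : expR (- E2) <= expR K * (g * g).
    by rewrite -gsq -expRD ler_expR; lra.
  by lra.
have KDg : (K + D) * g <= K + 20.
  have h1 : D * g <= 20.
    have : D / 20 <= expR (D / 20) by apply: le_trans (expR_ge1Dx _); rewrite lerDr.
    rewrite gE expRN => h; rewrite ler_pdivrMr ?expR_gt0//; lra.
  have h2 : g <= 1 by rewrite gE -expR0 ler_expR oppr_le0 divr_ge0.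
  by rewrite mulrDl; have := ler_wpM2l K0 h2; lra.
have KK : 0 <= e * K by rewrite mulr_ge0// ltW.
have -> : B * a1 * expR (- E1) - B * a2 * expR (- E2) =
  B * ((a1 - a2) * expR (- E1) + a2 * (expR (- E1) - expR (- E2))) by ring.
rewrite normrM (ger0_norm B0) -!mulrA; apply: ler_wpM2l => //.
apply: le_trans (ler_normD _ _) _; rewrite !normrM.
have p1 : `|a1 - a2| * `|expR (- E1)| <= a * (K * e) * g.
  apply: ler_pM => //; last by rewrite ger0_norm ?expR_ge0.
  have : a * (K * e ^+ 2) <= a * (K * e).
    by apply: ler_wpM2l; [exact: ltW|apply: ler_wpM2l => //; nra].
  by rewrite ler_norml => ?; apply/andP; split; lra.
have p2 : `|a2| * `|expR (- E1) - expR (- E2)| <= a * (e * ((K + 20) * (2 * expR K)) * g).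
  rewrite (ger0_norm a20); apply: ler_pM => //.
  apply: le_trans (expRN_lip _ _) _.
  apply: (@le_trans _ _ (e * (K + D) * (2 * expR K * (g * g)))).
    by apply: ler_pM => //; rewrite addr_ge0 ?expR_ge0.
  have -> : e * (K + D) * (2 * expR K * (g * g)) = e * (2 * expR K) * g * ((K + D) * g) by ring.
  have -> : e * ((K + 20) * (2 * expR K)) * g = e * (2 * expR K) * g * (K + 20) by ring.
  by apply: ler_wpM2l => //; rewrite !mulr_ge0 ?expR_ge0 ?(ltW e0) ?(ltW g0).
by apply: le_trans (lerD p1 p2) _; rewrite le_eqVlt; apply/orP; left; apply/eqP; ring.
Qed.

End heat_kernel_estimates.

Section time_integrals.
Context {R : realType}.
Local Notation mu := (@lebesgue_measure R).

Lemma dyadic_scale (x : R) : 1 <= x -> exists n, 2 ^+ n <= x <= 2 ^+ n.+1.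
Proof.
move=> x1; have ex : exists n, x < 2 ^+ n.
  exists (Num.bound x); apply: lt_le_trans (_ : (Num.bound x)%:R <= _).
    by apply: archi_boundP; exact: le_trans x1.
  by rewrite -natrX ler_nat ltnW// ltn_expl.
case: (ex_minnP ex) => -[|n] h1 h2; first by move: h1; rewrite expr0 ltNge x1.
exists n; rewrite (ltW h1) andbT leNgt; apply/negP => h; have := h2 n h.
by rewrite ltnn.
Qed.

Let measurable_pow (m c : R) (D : set (measurableTypeR R)) : measurable_fun D (fun r : R => (m - r) `^ c).
Proof.
apply: measurable_funTS; apply: (measurableT_comp (measurable_powR _)).
exact: measurable_funB.
Qed.

Let powR2_gt1 (c : R) : 0 < c -> 1 < (2 : R) `^ c.
Proof.
move=> c0; have h : 0 < c * ln (2 : R) by rewrite mulr_gt0// ln_gt0// ltr1n.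
by rewrite /powR pnatr_eq0/=; move: h; rewrite -ltr_expR expR0.
Qed.

(** Dyadic blocks in the distance to m give a geometric series. *)
Lemma far_integral (b m A : R) : 0 < b -> 0 < A ->
  (\int[mu]_(r in `]-oo, (m - A)%R]) ((m - r) `^ (- (1 + b)))%:E <=
   ((1 - 2 `^ (- b))^-1 * A `^ (- b))%:E)%E.
Proof.
move=> b0 A0.
have y01 : 0 <= (2 : R) `^ (- b) < 1.
  by rewrite powR_ge0 powRN invf_lt1 ?powR_gt0//= powR2_gt1.
apply: (@integral_le_series _ _ _ (fun n => m - 2 ^+ n.+1 * A) (fun n => m - 2 ^+ n * A)
  (fun n => (2 ^+ n * A) `^ (- (1 + b)))) => //.
- by move=> r _; exact: powR_ge0.
- by move=> n; rewrite lerD2l lerN2 ler_wpM2r ?(ltW A0)// ler_weXn2l// ler1n.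
- by move=> n; exact: powR_ge0.
- move=> r /=; rewrite in_itv/= => rA.
  have [|n /andP[h1 h2]] := @dyadic_scale ((m - r) / A); first by rewrite ler_pdivlMr// mul1r; lra.
  move: h1 h2; rewrite ler_pdivlMr// ler_pdivrMr// => h1 h2; exists n; split.
    by apply/andP; split; lra.
  have p0 : 0 < 2 ^+ n * A by rewrite mulr_gt0// exprn_gt0.
  rewrite !powRN lef_pV2 ?posrE ?powR_gt0//; last exact: lt_le_trans h1.
  have q0 : 0 <= m - r by exact: le_trans (ltW p0) h1.
  apply: ge0_ler_powR => //; rewrite ?nnegrE; [by rewrite addr_ge0// ltW|exact: ltW].
- move=> n; apply: (@le_trans _ _ (\sum_(0 <= i < n) (2 `^ (- b)) ^+ i * A `^ (- b))).
    apply: ler_sum => i _.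
    have p0 : 0 < 2 ^+ i * A by rewrite mulr_gt0// exprn_gt0.
    have -> : m - 2 ^+ i * A - (m - 2 ^+ i.+1 * A) = 2 ^+ i * A by rewrite exprS; ring.
    rewrite -{2}(powRr1 (ltW p0)) -powRD; last by apply/implyP => _; rewrite gt_eqF.
    rewrite (_ : - (1 + b) + 1 = - b); last by ring.
    rewrite powRM ?exprn_ge0 ?(ltW A0)//.
    by rewrite -[2 ^+ i]powR_mulrn// -powRrM mulrC [i%:R * _]mulrC powRrM powR_mulrn ?powR_ge0// mulrC.
  by rewrite -mulr_suml ler_wpM2r ?powR_ge0// geometric_sum_lt.
Qed.

Lemma near_integral (b t l : R) : 0 < b < 1 -> 0 <= l ->
  (\int[mu]_(r in `](t - l)%R, t[) ((t - r) `^ (- b))%:E <=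
   ((1 - 2 `^ (- (1 - b)))^-1 * l `^ (1 - b))%:E)%E.
Proof.
move=> /andP[b0 b1]; rewrite le_eqVlt => /predU1P[<-|l0].
  rewrite subr0 set_itvoo0 integral_set0 lee_fin mulr_ge0 ?powR_ge0// invr_ge0 subr_ge0.
  rewrite powRN invf_le1 ?powR_gt0//.
  by rewrite ltW// powR2_gt1// subr_gt0.
have c0 : 0 < 1 - b by rewrite subr_gt0.
have y01 : 0 <= (2 : R) `^ (- (1 - b)) < 1.
  by rewrite powR_ge0 powRN invf_lt1 ?powR_gt0//= powR2_gt1.
have /andP[y0 y1] := y01.
have d0 n : 0 < l / 2 ^+ n by rewrite divr_gt0// exprn_gt0.
have dS n : l / 2 ^+ n = 2 * (l / 2 ^+ n.+1).
  by rewrite exprS; field; rewrite expf_neq0.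
apply: (@integral_le_series _ _ _ (fun n => t - l / 2 ^+ n) (fun n => t - l / 2 ^+ n.+1)
  (fun n => (l / 2 ^+ n.+1) `^ (- b))) => //.
- by move=> r _; exact: powR_ge0.
- by move=> n; have := d0 n.+1; rewrite (dS n); lra.
- by move=> n; exact: powR_ge0.
- move=> r /=; rewrite in_itv/= => /andP[h1 h2].
  have tr : 0 < t - r by rewrite subr_gt0.
  have [|n /andP[h3 h4]] := @dyadic_scale (l / (t - r)); first by rewrite ler_pdivlMr// mul1r; lra.
  move: h3 h4; rewrite ler_pdivlMr// ler_pdivrMr// => h3 h4; exists n.
  have e1 : l / 2 ^+ n.+1 <= t - r by rewrite ler_pdivrMr ?exprn_gt0// mulrC.
  have e2 : t - r <= l / 2 ^+ n by rewrite ler_pdivlMr ?exprn_gt0// mulrC.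
  split; first by apply/andP; split; lra.
  rewrite !powRN lef_pV2 ?posrE ?powR_gt0//.
  by apply: ge0_ler_powR => //; rewrite ?nnegrE ?(ltW b0) ?(ltW (d0 _)) ?(ltW tr).
- move=> n; apply: (@le_trans _ _ (\sum_(0 <= i < n) (2 `^ (- (1 - b))) ^+ i * l `^ (1 - b))).
    apply: ler_sum => i _.
    have -> : t - l / 2 ^+ i.+1 - (t - l / 2 ^+ i) = l / 2 ^+ i.+1 by rewrite (dS i); ring.
    rewrite -{2}(powRr1 (ltW (d0 i.+1))) -powRD; last by apply/implyP => _; rewrite gt_eqF.
    rewrite (_ : - b + 1 = 1 - b); last by ring.
    rewrite powRM ?(ltW l0) ?invr_ge0 ?exprn_ge0// mulrC ler_wpM2r ?powR_ge0//.
    rewrite -[2 ^+ i.+1]powR_mulrn// -powRN -powRrM mulNr mulrC -mulNr powRrM powR_mulrn ?powR_ge0//.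
    by apply: ler_wiXn2l => //; exact: ltW.
  by rewrite -mulr_suml ler_wpM2r ?powR_ge0// geometric_sum_lt.
Qed.

End time_integrals.

Section mild_energy.
Context {R : realType} {k : nat}.
Local Notation mu := (@lebesgue_measure R).
Local Notation V := (R * 'rV[R]_k)%type.
Variable beta : R.
Hypothesis hbeta : 0 < beta < Num.min k%:R 2 \/ k = 1%N /\ beta = 1.
Variables (sigma : V -> R) (S T : R).
Hypothesis csigma : continuous sigma.
Hypothesis S0 : 0 <= S.
Hypothesis bsigma : forall t x, 0 <= t <= T -> `|sigma (t, x)| <= S.

Local Notation b := (beta / 2).
Local Notation h := (mild_kernel sigma).

Lemma beta_half : 0 < b < 1.
Proof.
case: hbeta => [|[_ ->]]; last by apply/andP; split; lra.
by rewrite lt_min => /andP[b0 /andP[_ b2]]; apply/andP; split; lra.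
Qed.

Let b0 : 0 < b. Proof. by case/andP: beta_half. Qed.
Let b1 : b < 1. Proof. by case/andP: beta_half. Qed.

Lemma mild_kernelE t x r y : 0 <= r < t -> h t x (r, y) = heat_kernel (t - r) (x - y) * sigma (r, y).
Proof. by rewrite /mild_kernel /= => ->. Qed.

Lemma mild_kernel0 t x r y : ~~ (0 <= r < t) -> h t x (r, y) = 0.
Proof. by rewrite /mild_kernel /= => /negbTE ->. Qed.

Lemma mild_kernel_le t x r y : t <= T -> 0 <= r < t ->
  `|h t x (r, y)| <= @heat_amp R k (t - r) * S * gauss ((4 * (t - r))^-1) x y.
Proof.
move=> tT rt; have /andP[r0 r1] := rt; rewrite mild_kernelE// heat_kernelE ?subr_gt0//.
rewrite normrM ger0_norm; last by rewrite !mulr_ge0 ?powR_ge0 ?expR_ge0.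
rewrite -[leRHS]mulrA [S * _]mulrC mulrA /gauss sqnB [sqn _ / _]mulrC; apply: ler_wpM2l.
  by rewrite !mulr_ge0 ?powR_ge0 ?expR_ge0.
by apply: bsigma; rewrite r0 ltW// (lt_le_trans r1).
Qed.

Lemma slices_mild_kernel t x : t <= T -> slices (h t x).
Proof.
move=> tT.
have ms := continuous_measurable_spacetime csigma.
have mh : measurable_fun setT (h t x : measurableTypeR R * 'rV[R]_k -> R).
  rewrite (_ : h t x = fun p => if 0 <= p.1 < t then
      (4 * pi * (t - p.1)) `^ (- (k%:R / 2)) *
      expR (- (sqn (x - p.2) * (4 * (t - p.1)) `^ (-1))) * sigma p else 0); last first.
    apply/funext => p; rewrite /mild_kernel; case: ifPn => // /andP[p0 pt].
    by rewrite /heat_kernel enorm_sqr powR_inv1// mulr_ge0// subr_ge0 ltW.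
  have mt : measurable_fun setT (fun p : measurableTypeR R * 'rV[R]_k => t - p.1).
    exact: measurable_funB.
  apply: measurable_fun_ifT => //.
    by apply: measurable_and; [exact: measurable_fun_ler|exact: measurable_fun_ltr].
  apply: measurable_funM => //; apply: measurable_funM.
    by apply: (measurableT_comp (measurable_powR _)); exact: measurable_funM.
  apply: measurableT_comp => //; apply: measurableT_comp => //; apply: measurable_funM.
    exact: measurable_sqn_sub.
  by apply: (measurableT_comp (measurable_powR _)); exact: measurable_funM.
split => // r.
have mr : measurable_fun setT (fun y : 'rV[R]_k => h t x (r, y)).
  exact: (measurable_fun_pair2 r mh).
have [rt|nrt] := boolP (0 <= r < t).
  have /andP[r0 r1] := rt.
  have a0 : 0 < (4 * (t - r))^-1 by rewrite invr_gt0 mulr_gt0// subr_gt0.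
  apply: (gdom_le (c := @heat_amp R k (t - r) * S) (gdom_gauss x a0)) => //.
    by rewrite !mulr_ge0 ?powR_ge0.
  by move=> y; rewrite [`|gauss _ _ _|]gtr0_norm ?gauss_gt0//; exact: mild_kernel_le.
apply: (gdom_le (c := 0) (gdom_gauss x ltr01)) => // y.
by rewrite mild_kernel0// normr0 mul0r.
Qed.

Let cG := cid2 (sform_gauss hbeta).

Definition mild_near_cst : R :=
  (S * (4 * pi) `^ (- (k%:R / 2))) ^+ 2 * (s2val cG * 4 `^ (- (b - k%:R))).

Lemma mild_near_cst_ge0 : 0 <= mild_near_cst.
Proof. by rewrite mulr_ge0 ?sqr_ge0// mulr_ge0 ?powR_ge0// (s2valP cG). Qed.

Lemma powR_collect (t : R) : 0 < t ->
  (t `^ (- (k%:R / 2))) ^+ 2 * t `^ (- (b - k%:R)) = t `^ (- b).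
Proof.
move=> t0; have n0 : t != 0 by rewrite gt_eqF.
rewrite expr2 -!powRD ?n0 ?implybT//; congr (_ `^ _).
by field.
Qed.

Lemma powR_inv_arg (c t e : R) : 0 < c -> 0 < t -> (c * t)^-1 `^ e = c `^ (- e) * t `^ (- e).
Proof.
move=> c0 t0; rewrite -powRM ?(ltW c0) ?(ltW t0)//.
by rewrite -(powR_inv1 (_ : 0 <= c * t)) ?mulr_ge0 ?(ltW c0) ?(ltW t0)// -powRrM mulN1r.
Qed.

(** The squared amplitude of the heat kernel is of order [(t - r)^-k], and the form of a Gaussian of
    width [sqrt (t - r)] is of order [(t - r)^(k - b)]. Their product is integrable up to [r = t]
    because [b < 1]. *)
Lemma mild_energy_le t x r : t <= T ->
  energy beta (h t x) r <= if 0 <= r < t then mild_near_cst * (t - r) `^ (- b) else 0.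
Proof.
move=> tT; have [_ sl] := slices_mild_kernel x tT.
case: ifPn => rt; last first.
  have g1 := gdom_gauss (0 : 'rV[R]_k) ltr01.
  have := sform_dominated hbeta (sl r) g1 (lexx 0) (fun y => ltW (gauss_gt0 _ _ _)).
  rewrite expr0n/= mul0r; apply => y.
  by rewrite mild_kernel0// normr0 mul0r.
have /andP[r0 r1] := rt; have tr : 0 < t - r by rewrite subr_gt0.
have a0 : 0 < (4 * (t - r))^-1 by rewrite invr_gt0 mulr_gt0.
have c0 : 0 <= @heat_amp R k (t - r) * S by rewrite !mulr_ge0 ?powR_ge0.
have := sform_dominated hbeta (sl r) (gdom_gauss x a0) c0 (fun y => ltW (gauss_gt0 _ _ _))
  (fun y => mild_kernel_le x y tT rt).
move=> hh; apply: le_trans hh _.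
apply: le_trans (_ : (@heat_amp R k (t - r) * S) ^+ 2 * (s2val cG * (4 * (t - r))^-1 `^ (b - k%:R)) <= _).
  by apply: ler_wpM2l; [exact: sqr_ge0|exact: (s2valP' cG)].
rewrite powR_inv_arg// /heat_amp /mild_near_cst -(powR_collect tr).
by rewrite le_eqVlt; apply/orP; left; apply/eqP; ring.
Qed.

Definition mild_far_cst : R :=
  (S * @heat_diff_cst R k) ^+ 2 * (s2val cG * 20 `^ (- (b - k%:R))).

Lemma mild_far_cst_ge0 : 0 <= mild_far_cst.
Proof. by rewrite mulr_ge0 ?sqr_ge0// mulr_ge0 ?powR_ge0// (s2valP cG). Qed.

(** The bound of [mild_energy_le] gains the square of the relative error of the heat kernel, that is
    [rho ^+ 2] divided by the time elapsed since r. *)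
Lemma mild_energy_diff_le t s x y r rho : 0 < rho -> t <= T -> s <= T -> `|t - s| <= rho ^+ 2 ->
  sqn (x - y) <= k%:R * rho ^+ 2 -> 0 <= r -> 4 * rho ^+ 2 <= Num.min t s - r ->
  energy beta (fun p => h t x p - h s y p) r <=
  mild_far_cst * rho ^+ 2 * (Num.min t s - r) `^ (- (1 + b)).
Proof.
move=> rho0 tT sT ts hxy r0 hr.
have r2 : 0 < rho ^+ 2 by rewrite exprn_gt0.
have [m mE] : exists m, m = Num.min t s by eexists.
have [mt ms] : m <= t /\ m <= s by rewrite mE !ge_min !lexx orbT.
have [tm sm] : t <= m + rho ^+ 2 /\ s <= m + rho ^+ 2.
  by move: ts; rewrite mE ler_norml => /andP[? ?]; case: (leP t s) => ?; split; lra.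
rewrite -mE in hr *.
have [u uE] : exists u, u = m - r by eexists.
rewrite -uE in hr *; have u0 : 0 < u by lra.
have rt : 0 <= r < t by apply/andP; split; lra.
have rs : 0 <= r < s by apply/andP; split; lra.
have [_ sl] := slicesB (slices_mild_kernel x tT) (slices_mild_kernel y sT).
have a0 : 0 < 20^-1 / u by rewrite divr_gt0.
pose c := S * (@heat_diff_cst R k * (rho / Num.sqrt u) * u `^ (- (k%:R / 2))).
have c0 : 0 <= c.
  rewrite /c !mulr_ge0 ?powR_ge0 ?invr_ge0 ?sqrtr_ge0 ?expR_ge0 ?addr_ge0 ?(ltW rho0)//.
have dom z : `|h t x (r, z) - h s y (r, z)| <= c * gauss (20^-1 / u) x z.
  rewrite !mild_kernelE// -mulrBl normrM mulrC /c -mulrA; apply: ler_pM => //.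
    by apply: bsigma; rewrite r0 /=; lra.
  rewrite /gauss sqnB; apply: heat_kernel_diff => //.
  - by apply/andP; split; lra.
  - by apply/andP; split; lra.
  - by rewrite (_ : x - z - (y - z) = x - y)//; rewrite opprB addrA subrK.
have := sform_dominated hbeta (sl r) (gdom_gauss x a0) c0 (fun y => ltW (gauss_gt0 _ _ _)) dom.
move=> hh; apply: le_trans hh _.
apply: le_trans (_ : c ^+ 2 * (s2val cG * (20^-1 / u) `^ (b - k%:R)) <= _).
  by apply: ler_wpM2l; [exact: sqr_ge0|exact: (s2valP' cG)].
have -> : 20^-1 / u = (20 * u)^-1 by rewrite invfM.
rewrite powR_inv_arg// /c /mild_far_cst.
have -> : u `^ (- (1 + b)) = u^-1 * u `^ (- b).
  rewrite opprD powRD ?(gt_eqF u0) ?implybT// powR_inv1//; exact: ltW.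
rewrite -(powR_collect u0).
have -> : u^-1 = (Num.sqrt u)^-1 ^+ 2 by rewrite exprVn sqr_sqrtr// ltW.
by rewrite le_eqVlt; apply/orP; left; apply/eqP; ring.
Qed.

Definition noise_cut_cst : R :=
  mild_far_cst * (1 - 2 `^ (- b))^-1 + 4 * mild_near_cst * (2 + (1 - 2 `^ (- (1 - b)))^-1).

Let pow2_lt1 (c : R) : 0 < c -> 0 <= (1 - (2 : R) `^ (- c))^-1.
Proof.
move=> c0; rewrite invr_ge0 subr_ge0 powRN invf_le1 ?powR_gt0//.
have h : 0 < c * ln (2 : R) by rewrite mulr_gt0// ln_gt0// ltr1n.
by rewrite /powR pnatr_eq0/=; move: h; rewrite -ltr_expR expR0; exact: ltW.
Qed.

Lemma noise_cut_cst_ge0 : 0 <= noise_cut_cst.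
Proof.
have c0 : 0 < 1 - b by rewrite subr_gt0.
apply: addr_ge0; apply: mulr_ge0.
- exact: mild_far_cst_ge0.
- exact: pow2_lt1.
- by rewrite mulr_ge0// mild_near_cst_ge0.
- by rewrite addr_ge0// pow2_lt1.
Qed.

(** The later increment estimates are instances with different cutoffs. At times at least A before
    both points the difference of the kernels is small, and integrates to order [rho^2 A^-b]. In the
    window of half-width l each kernel is bounded separately with its integrable singularity, which
    gives order [l^(1 - b)]. Elsewhere the cutoff or both kernels vanish. *)
Lemma noise_cut (eta : R -> R) t s x y (rho A c l : R) :
  measurable_fun setT (eta : measurableTypeR R -> R) -> (forall r, `|eta r| <= 1) ->
  0 < rho -> t <= T -> s <= T -> `|t - s| <= rho ^+ 2 -> sqn (x - y) <= k%:R * rho ^+ 2 ->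
  4 * rho ^+ 2 <= A -> 0 <= l ->
  (forall r, 0 <= r -> [\/ eta r = 0, r <= Num.min t s - A, c - l < r < c + l | Num.max t s <= r]) ->
  (noise_inner beta (fun p => eta p.1 * (h t x p - h s y p))%R (fun p => eta p.1 * (h t x p - h s y p))%R <=
   (noise_cut_cst * (rho ^+ 2 * A `^ (- b) + l `^ (1 - b)))%:E)%E.
Proof.
move=> meta eta1 rho0 tT sT ts hxy hA l0 heta.
have A0 : 0 < A by have := exprn_gt0 2 rho0; lra.
have [m mE] : exists m, m = Num.min t s by eexists.
have slt := slices_mild_kernel x tT; have sls := slices_mild_kernel y sT.
have sd := slicesB slt sls.
have se := slicesM meta sd.
rewrite (noise_energy hbeta se).
have nc0 := mild_near_cst_ge0; have fc0 := mild_far_cst_ge0.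
pose D1 : set (measurableTypeR R) := `]-oo, (m - A)%R]%classic.
pose D2 : set (measurableTypeR R) := `[(c - l)%R, (c + l)%R]%classic.
pose D3 (u : R) : set (measurableTypeR R) := `](u - l)%R, u[%classic.
have mD1 : measurable D1 by exact: measurable_itv.
have mD2 : measurable D2 by exact: measurable_itv.
have mD3 u : measurable (D3 u) by exact: measurable_itv.
pose g1 r : R := mild_far_cst * rho ^+ 2 * (m - r) `^ (- (1 + b)).
pose g2 (r : R) : R := 4 * mild_near_cst * l `^ (- b).
pose g3 u r : R := 2 * mild_near_cst * (u - r) `^ (- b).
have mpow (u e : R) (D : set (measurableTypeR R)) : measurable_fun D (fun r : R => (u - r) `^ e).
  by apply: measurable_funTS; apply: (measurableT_comp (measurable_powR _)); exact: measurable_funB.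
have m1 D : measurable_fun D (g1 : measurableTypeR R -> R) by apply: measurable_funM.
have m2 D : measurable_fun D (g2 : measurableTypeR R -> R) by exact: measurable_cst.
have m3 u D : measurable_fun D (g3 u : measurableTypeR R -> R) by apply: measurable_funM.
have p1 r : 0 <= g1 r by exact: mulr_ge0 (mulr_ge0 fc0 (sqr_ge0 _)) (powR_ge0 _ _).
have p2 r : 0 <= g2 r by apply: mulr_ge0 (mulr_ge0 _ nc0) (powR_ge0 _ _).
have p3 u r : 0 <= g3 u r by apply: mulr_ge0 (mulr_ge0 _ nc0) (powR_ge0 _ _).
pose pt (D : set (measurableTypeR R)) (g : R -> R) (r : measurableTypeR R) : \bar R := ((EFin \o g) \_ D) r.
have pt0 D g r : (forall r, 0 <= g r) -> (0 <= pt D g r)%E.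
  by move=> g0; rewrite /pt patchE; case: ifP => //= _; rewrite lee_fin.
have mpt D g : measurable D -> measurable_fun setT (g : measurableTypeR R -> R) -> measurable_fun setT (pt D g).
  move=> mD mg; apply/(measurable_restrictT _ mD); apply/measurable_EFinP.
  exact: measurable_funS mg.
have ptE (D : set (measurableTypeR R)) g r : D r -> pt D g r = (g r)%:E.
  by move=> Dr; rewrite /pt patchE mem_set.
apply: (@le_trans _ _ (\int[mu]_r (pt D1 g1 r + (pt D2 g2 r + (pt (D3 t) (g3 t) r + pt (D3 s) (g3 s) r))))%E).
  have mS : measurable_fun setT (fun r => pt D1 g1 r + (pt D2 g2 r + (pt (D3 t) (g3 t) r + pt (D3 s) (g3 s) r)))%E.
    by do !apply: emeasurable_funD; apply: mpt => //.
  have S0' r : (0 <= pt D1 g1 r + (pt D2 g2 r + (pt (D3 t) (g3 t) r + pt (D3 s) (g3 s) r)))%E.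
    by rewrite !adde_ge0// pt0.
  apply: (@le_trans _ _ (\int[mu]_(r in `[0%R, +oo[) (pt D1 g1 r + (pt D2 g2 r + (pt (D3 t) (g3 t) r + pt (D3 s) (g3 s) r))))%E); last first.
    by apply: ge0_subset_integral => //; exact: measurable_itv.
  have mI : measurable (`[0%R, +oo[%classic : set (measurableTypeR R)) by exact: measurable_itv.
  apply: ge0_le_integral => //.
  - by move=> r _; rewrite lee_fin (energy_ge0 hbeta).
  - by apply/measurable_EFinP; apply: measurable_funTS; exact: (energy_measurable hbeta).
  - exact: measurable_funS mS.
  move=> r /=; rewrite in_itv/= andbT => r0.
  rewrite (energyM hbeta eta r sd).
  have en0 := energy_ge0 hbeta r sd.
  have [er|ner] := eqVneq (eta r) 0; first by rewrite er expr0n/= mul0r.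
  have le1 : (eta r ^+ 2 * energy beta (fun p => h t x p - h s y p) r <= energy beta (fun p => h t x p - h s y p) r)%R.
    by rewrite ler_piMl// -real_normK ?num_real// exprn_ile1.
  (* In the window, either r is within l of u and the singular bound is kept, or the singular factor
     is at most its value at distance l. *)
  have near_le u : u <= T -> c - l < r < c + l -> forall z,
      ((2 * energy beta (h u z) r)%:E <= (2^-1 * g2 r)%:E + pt (D3 u) (g3 u) r)%E.
    move=> uT rc z; have /andP[rc1 rc2] := rc.
    have lpos : 0 < l by lra.
    apply: (@le_trans _ _ (2 * (if 0 <= r < u then mild_near_cst * (u - r) `^ (- b) else 0))%:E).
      by rewrite lee_fin ler_wpM2l// mild_energy_le.
    case: ifPn => [/andP[_ ru]|_]; last by rewrite mulr0 adde_ge0 ?pt0// lee_fin mulr_ge0// p2.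
    have [ul|lu] := ltP (u - l) r.
      rewrite ptE; last by rewrite /D3 /= in_itv/= ul.
      rewrite -EFinD lee_fin /g3 /g2; have := p2 r; rewrite /g2 => ?; lra.
    apply: (@le_trans _ _ (2^-1 * g2 r)%:E); last by rewrite leeDl// pt0.
    rewrite lee_fin /g2.
    have : (u - r) `^ (- b) <= l `^ (- b).
      rewrite !powRN lef_pV2 ?posrE ?powR_gt0 ?subr_gt0//.
      by apply: ge0_ler_powR; rewrite ?nnegrE ?subr_ge0 ?(ltW b0) ?(ltW lpos) ?(ltW ru)//; lra.
    by move=> hh; have := ler_wpM2l nc0 hh; lra.
  have [e0|rA|rc|rmax] := heta r r0.
  - by rewrite e0 eqxx in ner.
  - apply: (@le_trans _ _ (pt D1 g1 r)); last by rewrite leeDl// !adde_ge0 ?pt0.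
    rewrite ptE; last by rewrite /D1 /= in_itv/= mE.
    rewrite lee_fin; apply: le_trans le1 _; rewrite /g1 mE; apply: mild_energy_diff_le => //; lra.
  - apply: (@le_trans _ _ (pt D2 g2 r + (pt (D3 t) (g3 t) r + pt (D3 s) (g3 s) r))%E); last first.
      by rewrite leeDr// pt0.
    have -> : pt D2 g2 r = ((2^-1 * g2 r)%:E + (2^-1 * g2 r)%:E)%E.
      rewrite ptE -?EFinD; last first.
        by rewrite /D2 /= in_itv/=; case/andP: rc => *; apply/andP; split; exact: ltW.
      by congr EFin; field.
    rewrite addeACA; apply: (@le_trans _ _ ((2 * energy beta (h t x) r)%:E + (2 * energy beta (h s y) r)%:E)%E).
      rewrite -EFinD lee_fin; apply: le_trans le1 _.
      exact: (energyB_le hbeta).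
    by apply: leeD; exact: near_le.
  - apply: (@le_trans _ _ 0%E); last exact: S0'.
    rewrite lee_fin; apply: le_trans le1 _.
    apply: le_trans (energyB_le hbeta r slt sls) _.
    move: rmax; rewrite ge_max => /andP[tr sr].
    have := mild_energy_le x r tT; rewrite [_ < t]ltNge tr andbF.
    have := mild_energy_le y r sT; rewrite [_ < s]ltNge sr andbF => e1 e2.
    by rewrite -mulrDr pmulr_rle0//; apply: le_trans (lerD e2 e1) _; rewrite addr0.
rewrite !ge0_integralD//; try (by move=> *; rewrite ?adde_ge0 ?pt0//); try (by do ?apply: emeasurable_funD; apply: mpt).
have intE D g : (\int[mu]_r pt D g r = \int[mu]_(r in D) (g r)%:E)%E.
  by rewrite [RHS]integral_mkcond.
rewrite !intE.
have i1 : (\int[mu]_(r in D1) (g1 r)%:E <= (mild_far_cst * (1 - 2 `^ (- b))^-1 * (rho ^+ 2 * A `^ (- b)))%:E)%E.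
  rewrite (eq_integral (fun r : measurableTypeR R => (mild_far_cst * rho ^+ 2)%:E * ((m - r) `^ (- (1 + b)))%:E)%E) => [|r _]; last by rewrite -EFinM.
  rewrite ge0_integralZl//; last 3 first.
  - by apply/measurable_EFinP; exact: mpow.
  - by move=> r _; rewrite lee_fin powR_ge0.
  - by rewrite lee_fin mulr_ge0// sqr_ge0.
  apply: (@le_trans _ _ ((mild_far_cst * rho ^+ 2)%:E * ((1 - 2 `^ (- b))^-1 * A `^ (- b))%:E)%E).
    by apply: lee_wpmul2l; [rewrite lee_fin mulr_ge0// sqr_ge0|exact: far_integral].
  by rewrite -EFinM lee_fin le_eqVlt; apply/orP; left; apply/eqP; ring.
have i2 : (\int[mu]_(r in D2) (g2 r)%:E <= (8 * mild_near_cst * l `^ (1 - b))%:E)%E.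
  rewrite (_ : (\int[mu]_(r in D2) (g2 r)%:E = (4 * mild_near_cst * l `^ (- b))%:E * mu D2)%E); last exact: (integral_cst mu mD2 (4 * mild_near_cst * l `^ (- b))%:E).
  apply: (@le_trans _ _ ((4 * mild_near_cst * l `^ (- b))%:E * (2 * l)%:E)%E).
    apply: lee_wpmul2l; first by rewrite lee_fin; exact: (p2 0).
    apply: (@le_trans _ _ (mu [set` `[(c - l)%R, (c + l)%R]])); first exact: lexx.
    rewrite lebesgue_measure_itv/= lte_fin; case: ifP => _; rewrite ?lee_fin ?mulr_ge0//.
    by rewrite le_eqVlt; apply/orP; left; apply/eqP; ring.
  rewrite -EFinM lee_fin.
  have [->|ln0] := eqVneq l 0; first by rewrite !mulr0; apply: mulr_ge0 (mulr_ge0 _ nc0) (powR_ge0 _ _).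
  have -> : l `^ (1 - b) = l * l `^ (- b) by rewrite powRD ?ln0 ?implybT// powRr1.
  by rewrite le_eqVlt; apply/orP; left; apply/eqP; ring.
have i3 u : (\int[mu]_(r in D3 u) (g3 u r)%:E <= (2 * mild_near_cst * (1 - 2 `^ (- (1 - b)))^-1 * l `^ (1 - b))%:E)%E.
  rewrite (eq_integral (fun r : measurableTypeR R => (2 * mild_near_cst)%:E * ((u - r) `^ (- b))%:E)%E) => [|r _]; last by rewrite -EFinM.
  rewrite ge0_integralZl//; last 3 first.
  - by apply/measurable_EFinP; exact: mpow.
  - by move=> r _; rewrite lee_fin powR_ge0.
  - by rewrite lee_fin mulr_ge0.
  apply: (@le_trans _ _ ((2 * mild_near_cst)%:E * ((1 - 2 `^ (- (1 - b)))^-1 * l `^ (1 - b))%:E)%E).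
    apply: lee_wpmul2l; first by rewrite lee_fin mulr_ge0.
    by apply: near_integral => //; exact: beta_half.
  by rewrite -EFinM lee_fin mulrA.
apply: le_trans (leeD i1 (leeD i2 (leeD (i3 t) (i3 s)))) _.
rewrite -!EFinD lee_fin /noise_cut_cst mulrDr.
have c0 : 0 < 1 - b by rewrite subr_gt0.
have q1 := pow2_lt1 b0; have q2 := pow2_lt1 c0.
have a1 : 0 <= mild_far_cst * (1 - 2 `^ (- b))^-1 * l `^ (1 - b) by exact: mulr_ge0 (mulr_ge0 fc0 q1) (powR_ge0 _ _).
have a2 : 0 <= 4 * mild_near_cst * (2 + (1 - 2 `^ (- (1 - b)))^-1) * (rho ^+ 2 * A `^ (- b)).
  apply: mulr_ge0; last by apply: mulr_ge0; [exact: sqr_ge0|exact: powR_ge0].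
  by apply: mulr_ge0; [exact: mulr_ge0|exact: addr_ge0].
move: a1 a2; move: (_^-1) (_^-1) (l `^ _) (A `^ _) => v1 v2 v3 v4 ? ?; lra.
Qed.

End mild_energy.

(** * Smooth cutoffs *)

Section bump_functions.
Context {R : realType}.

(** The family is closed under derivation: the derivative of [flat n] combines [flat n.+1] and
    [flat n.+2]. At 0 this holds because each member is at most quadratic there. *)
Definition flat n (x : R) : R := if 0 < x then x^-1 ^+ n * expR (- x^-1) else 0.

Lemma flat_le0 n x : x <= 0 -> flat n x = 0.
Proof. by move=> x0; rewrite /flat ltNge x0. Qed.

Lemma flat_ge0 n x : 0 <= flat n x.
Proof.
by rewrite /flat; case: ifPn => // x0; rewrite mulr_ge0 ?expR_ge0// exprn_ge0// invr_ge0 ltW.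
Qed.

Lemma flat0_gt0 x : 0 < x -> 0 < flat 0 x.
Proof. by move=> x0; rewrite /flat x0 expr0 mul1r expR_gt0. Qed.

Lemma flat_le_sqr n x : `|flat n x| <= n.+2%:R ^+ n.+2 * x ^+ 2.
Proof.
rewrite ger0_norm ?flat_ge0//; have [x0|x0] := leP x 0.
  by rewrite flat_le0// mulr_ge0 ?sqr_ge0// exprn_ge0.
rewrite /flat x0; have xn : x != 0 by rewrite gt_eqF.
have [y yE] : exists y, y = x^-1 by eexists.
have y0 : 0 < y by rewrite yE invr_gt0.
have -> : x = y^-1 by rewrite yE invrK.
rewrite invrK.
have h : (y / n.+2%:R) ^+ n.+2 <= expR y.
  have -> : expR y = expR (y / n.+2%:R) ^+ n.+2.
    by rewrite -expRM_natl mulrC divfK// pnatr_eq0.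
  rewrite lerXn2r ?nnegrE ?expR_ge0// ?divr_ge0 ?(ltW y0)//.
  by apply: le_trans (expR_ge1Dx _); rewrite lerDr.
rewrite expRN -/(_ / _) ler_pdivrMr ?expR_gt0//.
have -> : y ^+ n = n.+2%:R ^+ n.+2 * y^-1 ^+ 2 * (y / n.+2%:R) ^+ n.+2.
  rewrite expr_div_n (_ : y ^+ n.+2 = y ^+ n * y ^+ 2); last by rewrite -exprD addn2.
  have : n.+2%:R ^+ n.+2 != 0 :> R by rewrite expf_neq0// pnatr_eq0.
  by move: (_%:R ^+ _) => c c0; field; rewrite c0 gt_eqF.
by rewrite ler_wpM2l// mulr_ge0 ?exprn_ge0// invr_ge0 ltW.
Qed.

Lemma is_derive_small (f : R -> R) C : (forall x, `|f x| <= C * x ^+ 2) -> is_derive (0 : R) 1 f 0.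
Proof.
move=> hf; have f0 : f 0 = 0.
  by apply/eqP; rewrite -normr_le0; have := hf 0; rewrite expr0n/= mulr0.
have C0 : 0 <= C by have := le_trans (normr_ge0 _) (hf 1); rewrite expr1n mulr1.
have h : (fun h : R => h^-1 *: (f (h *: (1 : R) + 0) - f 0)) @ 0^' --> (0 : R).
  apply/cvgrPdist_le => e e0.
  exists (e / (C + 1)) => /=; first by rewrite divr_gt0// ltr_wpDl.
  move=> x /=; rewrite sub0r normrN => xe xn.
  rewrite sub0r normrN f0 subr0 addr0 /GRing.scale/= mulr1 normrM normfV.
  rewrite mulrC ler_pdivrMr ?normr_gt0//; apply: le_trans (hf x) _.
  rewrite -real_normK ?num_real// expr2 mulrA ler_wpM2r//.
  apply: le_trans (_ : C * (e / (C + 1)) <= _); first by rewrite ler_wpM2l// ltW.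
  by rewrite mulrCA ger_pMr// ler_pdivrMr ?ltr_wpDl// mul1r lerDl.
apply: DeriveDef; first by apply: cvgP h.
exact: cvg_lim h.
Qed.

Lemma is_derive_flat n (x : R) : is_derive x 1 (flat n) (- n%:R * flat n.+1 x + flat n.+2 x).
Proof.
have [x0|x0|->] := ltgtP x 0; last first.
- by rewrite !flat_le0// mulr0 addr0; apply: is_derive_small; exact: flat_le_sqr.
- pose g (y : R) : R := y^-1 ^+ n * expR (- y^-1).
  have xn : x != 0 by rewrite gt_eqF.
  have near_g : \near x, g x = flat n x.
    by near=> y; rewrite /flat ifT//; near: y; exact: lt_nbhsr.
  have dV : is_derive x 1 (fun y : R => y^-1) (- x ^- 2 *: 1) by exact: is_deriveV.
  have dg : is_derive x 1 g (- n%:R * flat n.+1 x + flat n.+2 x).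
    have dE : is_derive x 1 (fun y : R => expR (- y^-1)) (expR (- x^-1) * - (- x ^- 2 *: 1)).
      exact: (is_derive1_comp (is_derive_expR _) (is_deriveN dV)).
    have dX : is_derive x 1 (fun y : R => y^-1 ^+ n) ((n%:R * x^-1 ^+ n.-1) *: (- x ^- 2 *: 1)).
      rewrite (_ : (fun y : R => y^-1 ^+ n) = GRing.inv ^+ n); first exact: is_deriveX.
      by apply/funext => y; rewrite fctE.
    have dm : is_derive x 1 g _ := is_deriveM dX dE.
    apply: (is_derive_eq dm); rewrite /flat x0 /GRing.scale/= mulr1.
    case: n {g near_g dX dm} => [|n]; rewrite ?exprS; field => //.
  exact: near_eq_is_derive near_g dg.
- have near0 : \near x, (cst 0 : R -> R) x = flat n x.
    by near=> y; rewrite flat_le0// ltW//; near: y; exact: lt_nbhsl.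
  rewrite !flat_le0 ?ltW// mulr0 addr0.
  exact: near_eq_is_derive near0 (is_derive_cst 0 x 1).
Unshelve. all: by end_near. Qed.

Lemma flat_sum_gt0 (z : R) : 0 < flat 0 z + flat 0 (1 - z).
Proof.
have [z0|z0] := leP z 0; first by rewrite ltr_wpDl ?flat_ge0// flat0_gt0//; lra.
by rewrite ltr_pwDl ?flat_ge0// flat0_gt0.
Qed.

(** An algebra of functions stable under derivation that contains [annulus]. Quadratic arguments
    avoid the absolute value, and the only quotients have the denominator of [step], which never
    vanishes. *)
Inductive bump_alg : (R -> R) -> Prop :=
| bump_cst c : bump_alg (fun=> c)
| bump_id : bump_alg (fun x => x)
| bump_flat n a c b : bump_alg (fun x => flat n (a * (x - c) ^+ 2 + b))
| bump_inv a c b : bump_alg (fun x => (flat 0 (a * (x - c) ^+ 2 + b) + flat 0 (1 - (a * (x - c) ^+ 2 + b)))^-1)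
| bump_add f g : bump_alg f -> bump_alg g -> bump_alg (fun x => f x + g x)
| bump_mul f g : bump_alg f -> bump_alg g -> bump_alg (fun x => f x * g x).

Let bump_compl n a c b : bump_alg (fun x => flat n (1 - (a * (x - c) ^+ 2 + b))).
Proof.
have := bump_flat n (- a) c (1 - b); congr bump_alg; apply/funext => x; congr flat; ring.
Qed.

Let is_derive_quad (a c b x : R) :
  is_derive x 1 (fun x : R => a * (x - c) ^+ 2 + b) (2 * a * (x - c)).
Proof.
have d1 : is_derive x 1 (fun x : R => x - c) (1 - 0).
  exact: (is_deriveB (is_derive_id x 1) (is_derive_cst c x 1)).
have d2 := is_deriveD (is_deriveM (is_derive_cst a x 1) (is_deriveX 2 d1)) (is_derive_cst b x 1).
by apply: (is_derive_eq d2); rewrite /GRing.scale/=; ring.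
Qed.

Lemma bump_alg_derive f : bump_alg f -> exists2 g, bump_alg g & forall x : R, is_derive x 1 f (g x).
Proof.
have quad a c : bump_alg (fun x => 2 * a * (x - c)).
  apply: bump_mul; first exact: bump_cst.
  by apply: bump_add; [exact: bump_id|exact: bump_cst].
have dflat n (a c b x : R) : is_derive x 1 (fun x => flat n (a * (x - c) ^+ 2 + b))
   ((- n%:R * flat n.+1 (a * (x - c) ^+ 2 + b) + flat n.+2 (a * (x - c) ^+ 2 + b)) * (2 * a * (x - c))).
  exact: (is_derive1_comp (is_derive_flat n _) (is_derive_quad a c b x)).
elim => {f} [c||n a c b|a c b|f g _ [f' bf df] _ [g' bg dg]|f g Bf [f' bf df] Bg [g' bg dg]].
- by exists (fun=> 0); [exact: bump_cst|move=> x; exact: is_derive_cst].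
- by exists (fun=> 1); [exact: bump_cst|move=> x; exact: is_derive_id].
- exists (fun x => (- n%:R * flat n.+1 (a * (x - c) ^+ 2 + b) + flat n.+2 (a * (x - c) ^+ 2 + b)) * (2 * a * (x - c))) => //.
  apply: bump_mul => //; apply: bump_add; last exact: bump_flat.
  by apply: bump_mul; [exact: bump_cst|exact: bump_flat].
- pose F x := flat 0 (a * (x - c) ^+ 2 + b) + flat 0 (1 - (a * (x - c) ^+ 2 + b)).
  pose F' x := flat 2 (a * (x - c) ^+ 2 + b) * (2 * a * (x - c)) -
    flat 2 (1 - (a * (x - c) ^+ 2 + b)) * (2 * a * (x - c)).
  exists (fun x => -1 * ((F x)^-1 * (F x)^-1) * F' x).
    apply: bump_mul.
      by apply: bump_mul; [exact: bump_cst|apply: bump_mul; exact: bump_inv].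
    apply: bump_add; first by apply: bump_mul => //; exact: bump_flat.
    rewrite (_ : (fun x => - _) = fun x => -1 * (flat 2 (1 - (a * (x - c) ^+ 2 + b)) * (2 * a * (x - c)))); last first.
      by apply/funext => x; rewrite mulN1r.
    by apply: bump_mul; [exact: bump_cst|apply: bump_mul].
  move=> x; have F0 : F x != 0 by rewrite gt_eqF// flat_sum_gt0.
  have dF : is_derive x 1 F (F' x).
    have d2 : is_derive x 1 (fun x => flat 0 (1 - (a * (x - c) ^+ 2 + b)))
       ((- 0%:R * flat 1 (- a * (x - c) ^+ 2 + (1 - b)) + flat 2 (- a * (x - c) ^+ 2 + (1 - b))) * (2 * - a * (x - c))).
      rewrite (_ : (fun x => flat 0 _) = (fun x => flat 0 (- a * (x - c) ^+ 2 + (1 - b)))) //.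
      by apply/funext => y; congr flat; ring.
    apply: (is_derive_eq (is_deriveD (dflat 0 a c b x) d2)).
    rewrite /F' (_ : - a * (x - c) ^+ 2 + (1 - b) = 1 - (a * (x - c) ^+ 2 + b)); last by ring.
    by ring.
  apply: (is_derive_eq (is_deriveV F0 dF)).
  by rewrite /GRing.scale/= expr2 invfM; ring.
- exists (fun x => f' x + g' x); first exact: bump_add.
  by move=> x; exact: (is_deriveD (df x) (dg x)).
- exists (fun x => f x * g' x + g x * f' x).
    by apply: bump_add; exact: bump_mul.
  by move=> x; exact: (is_deriveM (df x) (dg x)).
Qed.

Definition step (z : R) : R := flat 0 z / (flat 0 z + flat 0 (1 - z)).

Lemma step_itv z : 0 <= step z <= 1.
Proof.
rewrite /step divr_ge0 ?flat_ge0 ?(ltW (flat_sum_gt0 z))//=.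
by rewrite ler_pdivrMr ?flat_sum_gt0// mul1r lerDl flat_ge0.
Qed.

Lemma step0 z : z <= 0 -> step z = 0.
Proof. by move=> z0; rewrite /step flat_le0// mul0r. Qed.

Lemma step1 z : 1 <= z -> step z = 1.
Proof.
move=> z1; rewrite /step [flat 0 (1 - z)]flat_le0; last by rewrite subr_le0.
by rewrite addr0 divff// gt_eqF// flat0_gt0//; exact: lt_le_trans z1.
Qed.

(** As functions of the ratio, the argument of the first step is 0 at 1/2 and 1 at 1, that of the
    second is 1 at 1 and 0 at 2. So the cutoff is 1 at distances from t between l and u, and 0 at
    distances up to [l / 2] or from [2 u] on. *)
Definition annulus (t l u : R) (x : R) : R :=
  step (4 / 3 * ((x - t) / l) ^+ 2 - 1 / 3) * step (4 / 3 - 1 / 3 * ((x - t) / u) ^+ 2).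

Lemma bump_annulus t l u : bump_alg (annulus t l u).
Proof.
rewrite (_ : annulus t l u = fun x =>
  (flat 0 (4 / 3 / l ^+ 2 * (x - t) ^+ 2 + - (1 / 3)) *
   (flat 0 (4 / 3 / l ^+ 2 * (x - t) ^+ 2 + - (1 / 3)) +
    flat 0 (1 - (4 / 3 / l ^+ 2 * (x - t) ^+ 2 + - (1 / 3))))^-1) *
  (flat 0 (- (1 / 3) / u ^+ 2 * (x - t) ^+ 2 + 4 / 3) *
   (flat 0 (- (1 / 3) / u ^+ 2 * (x - t) ^+ 2 + 4 / 3) +
    flat 0 (1 - (- (1 / 3) / u ^+ 2 * (x - t) ^+ 2 + 4 / 3)))^-1)); last first.
  apply/funext => x; rewrite /annulus /step !expr_div_n.
  have -> : 4 / 3 * ((x - t) ^+ 2 / l ^+ 2) - 1 / 3 = 4 / 3 / l ^+ 2 * (x - t) ^+ 2 + - (1 / 3) by ring.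
  by have -> : 4 / 3 - 1 / 3 * ((x - t) ^+ 2 / u ^+ 2) = - (1 / 3) / u ^+ 2 * (x - t) ^+ 2 + 4 / 3 by ring.
by apply: bump_mul; (apply: bump_mul; [exact: bump_flat|exact: bump_inv]).
Qed.

Lemma annulus_itv t l u x : 0 <= annulus t l u x <= 1.
Proof.
have /andP[a0 a1] := step_itv (4 / 3 * ((x - t) / l) ^+ 2 - 1 / 3).
have /andP[b0 b1] := step_itv (4 / 3 - 1 / 3 * ((x - t) / u) ^+ 2).
by rewrite mulr_ge0//= mulr_ile1.
Qed.

Let sqr_ratio (a l : R) : (a / l) ^+ 2 = (`|a| / `|l|) ^+ 2.
Proof. by rewrite !expr_div_n !real_normK ?num_real. Qed.

Lemma annulus1 t l u x : 0 < l -> 0 < u -> l <= `|x - t| <= u -> annulus t l u x = 1.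
Proof.
move=> l0 u0 /andP[h1 h2]; rewrite /annulus (sqr_ratio _ l) (sqr_ratio _ u) (gtr0_norm l0) (gtr0_norm u0).
have a1 : 1 <= `|x - t| / l by rewrite ler_pdivlMr// mul1r.
have a2 : `|x - t| / u <= 1 by rewrite ler_pdivrMr// mul1r.
have a3 : 0 <= `|x - t| / u by rewrite divr_ge0// ltW.
by rewrite !step1 ?mulr1//; nra.
Qed.

Lemma annulus_in t l u x : 0 < l -> `|x - t| <= l / 2 -> annulus t l u x = 0.
Proof.
move=> l0 h; rewrite /annulus [step (_ - _)]step0 ?mul0r// sqr_ratio (gtr0_norm l0).
have a2 : `|x - t| / l <= 1 / 2 by rewrite ler_pdivrMr//; lra.
have a3 : 0 <= `|x - t| / l by rewrite divr_ge0// ltW.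
nra.
Qed.

Lemma annulus_out t l u x : 0 < u -> 2 * u <= `|x - t| -> annulus t l u x = 0.
Proof.
move=> u0 h; rewrite /annulus [step (4 / 3 - _)]step0 ?mulr0// sqr_ratio (gtr0_norm u0).
have a2 : 2 <= `|x - t| / u by rewrite ler_pdivlMr.
nra.
Qed.

End bump_functions.

Section test_functions.
Context {R : realType} {k : nat}.
Local Notation V := (R * 'rV[R]_k)%type.

(** Smoothness without computing iterated derivatives: it is enough to exhibit a class of continuous
    derivable functions stable under all directional derivatives. *)
Lemma smooth_class (K : (V -> R) -> Prop) :
  (forall f, K f -> continuous f /\ forall p v, derivable f p v) ->
  (forall f v, K f -> K ('D_v f)) -> forall f, K f -> smooth f.
Proof.
move=> K1 K2 f Kf vs; have Ki : K (iter_derive vs f).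
  by elim: vs => [//|v vs IH] /=; exact: K2.
by have [] := K1 _ Ki.
Qed.

Lemma is_derive_time (c : R -> R) c' (p v : V) : is_derive p.1 1 c c' ->
  is_derive p v (fun p : V => c p.1) (v.1 * c').
Proof.
move=> dc; have [c1 c2] := dc.
have dC : differentiable c p.1 by apply/derivable1_diffP.
have dv : is_derive p.1 v.1 c (v.1 * c').
  apply: DeriveDef; first exact: diff_derivable.
  rewrite deriveE// -[v.1 in LHS](mulr1 v.1) -[v.1 * 1]/(v.1 *: (1 : R)) linearZ/=.
  by rewrite -deriveE// c2.
by case: dv => a b; apply: DeriveDef; [exact: a|exact: b].
Qed.

(** By the Leibniz rule, derivatives of a cutoff of f remain sums of time functions times iterated
    derivatives of f. *)
Inductive cutoff_class (f : V -> R) : (V -> R) -> Prop :=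
| cutoff_base c us : bump_alg c -> cutoff_class f (fun p => c p.1 * iter_derive us f p)
| cutoff_add g h : cutoff_class f g -> cutoff_class f h -> cutoff_class f (fun p => g p + h p).

Lemma smooth_cutoff (c : R -> R) (f : V -> R) : bump_alg c -> smooth f ->
  smooth (fun p => c p.1 * f p).
Proof.
move=> bc sf; apply: (@smooth_class (cutoff_class f)); last exact: (cutoff_base f [::] bc).
- move=> g; elim=> {g c bc} [c us bc|g h _ [cg dg] _ [ch dh]].
    have [c' bc' dc] := bump_alg_derive bc; have [cf df] := sf us.
    split => [p|p v]; last first.
      by case: (is_derive_time v (dc p.1)) => dt _; exact: (derivableM dt (df p v)).
    apply: cvgM; last exact: cf.
    apply: (@continuous_comp _ _ _ (fst : V -> R) c p); first exact: cvg_fst.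
    by apply: differentiable_continuous; apply/derivable1_diffP; case: (dc p.1).
  split => [p|p v]; first exact: cvgD (cg p) (ch p).
  exact: derivableD (dg p v) (dh p v).
- move=> g v Kg; suff : (forall p, derivable g p v) /\ cutoff_class f ('D_v g) by case.
  elim: Kg => {g c bc} [c us bc|g1 g2 _ [d1 h1] _ [d2 h2]].
    have [c' bc' dc] := bump_alg_derive bc; have [cf df] := sf us.
    have dt p : derivable (fun p : V => c p.1) p v by case: (is_derive_time v (dc p.1)).
    have dtv p : 'D_v (fun p : V => c p.1) p = v.1 * c' p.1 by case: (is_derive_time v (dc p.1)).
    split => [p|]; first exact: (derivableM (dt p) (df p v)).
    have -> : 'D_v (fun p : V => c p.1 * iter_derive us f p) =
        fun p => c p.1 * iter_derive (v :: us) f p + (fun x => v.1 * c' x) p.1 * iter_derive us f p.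
      apply/funext => p; rewrite (deriveM (dt p) (df p v)) dtv.
      by rewrite /GRing.scale/=; congr (_ + _); rewrite mulrC.
    apply: cutoff_add; first exact: cutoff_base.
    by apply: (cutoff_base f us (c := fun x => v.1 * c' x)); apply: bump_mul => //; exact: bump_cst.
  split => [p|]; first exact: derivableD.
  have -> : 'D_v (fun p => g1 p + g2 p) = fun p => 'D_v g1 p + 'D_v g2 p.
    by apply/funext => p; exact: deriveD.
  exact: cutoff_add.
Qed.

Lemma test_function_cutoff (c : R -> R) (f : V -> R) : bump_alg c -> test_function f ->
  test_function (fun p => c p.1 * f p).
Proof.
move=> bc [sf [K cK fK]]; split; first exact: smooth_cutoff.
by exists K => // p /fK ->; rewrite mulr0.
Qed.

Lemma test_function_bounded (f : V -> R) : test_function f ->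
  exists M A, [/\ 0 <= M, 0 <= A & forall r y, `|f (r, y)| <= M * gauss 1 0 y /\ (A < `|r| -> f (r, y) = 0)].
Proof.
move=> [sf [K cK fK]]; have [cf _] := sf [::].
have [A hA] : exists A, forall p, K p -> `|p| <= A.
  have [A [_ hA]] := compact_bounded cK.
  by exists (A + 1) => p Kp; apply: (hA (A + 1)) => //; rewrite ltrDl.
have [M hM] : exists M, forall p, K p -> `|f p| <= M.
  have cfK : compact (f @` K).
    by apply: continuous_compact => //; apply: continuous_subspaceT => p; exact: cf.
  have [M [_ hM]] := compact_bounded cfK.
  by exists (M + 1) => p Kp; apply: (hM (M + 1)); [rewrite ltrDl|exists p].
have [M' [M'0 MM']] : exists M', 0 <= M' /\ M <= M' by exists `|M|; rewrite ler_norm.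
have [A' [A'0 AA']] : exists A', 0 <= A' /\ A <= A' by exists `|A|; rewrite ler_norm.
exists (M' * expR (k%:R * A' ^+ 2)), A'; split => //; first by rewrite mulr_ge0// expR_ge0.
move=> r y; have [Kp|nKp] := pselect (K (r, y)); last first.
  by rewrite fK// normr0 !mulr_ge0 ?expR_ge0 ?(ltW (gauss_gt0 _ _ _)).
have := hA _ Kp; rewrite prod_normE /= ge_max => /andP[rA yA]; split; last first.
  by move=> /lt_le_trans/(_ rA); rewrite ltNge AA'.
rewrite -mulrA -[leLHS]mulr1; apply: ler_pM => //; first by apply: le_trans MM'; exact: hM.
rewrite /gauss mul1r subr0 -expRD -[leLHS]expR0 ler_expR subr_ge0.
rewrite /sqn; apply: le_trans (_ : \sum_(i < k) A' ^+ 2 <= _); last first.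
  by rewrite sumr_const card_ord mulr_natl.
apply: ler_sum => i _; rewrite -real_normK ?num_real// lerXn2r ?nnegrE//.
apply: le_trans AA'; apply: le_trans yA.
by rewrite [`|y|]mx_normrE (le_trans _ (le_bigmax _ _ (ord0, i))).
Qed.

End test_functions.

(** * Wiener integrals *)

Section tame_functions.
Context {R : realType} {k : nat}.
Local Notation mu := (@lebesgue_measure R).
Local Notation V := (R * 'rV[R]_k)%type.
Local Notation half := (`[0%R, +oo[%classic : set (measurableTypeR R)).
Variable beta : R.
Hypothesis hbeta : 0 < beta < Num.min k%:R 2 \/ k = 1%N /\ beta = 1.

Let mhalf : measurable half. Proof. exact: measurable_itv. Qed.

(** Domination uniform in time and a bounded time support make the noise form finite and bilinear.
    The singular mild kernels are reached only as limits of such functions. *)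
Definition tame (f : V -> R) : Prop := slices f /\ exists M A, [/\ 0 <= M, 0 <= A &
  forall r y, `|f (r, y)| <= M * gauss 1 0 y /\ (A < `|r| -> f (r, y) = 0)].

Lemma test_function_tame (f : V -> R) : test_function f -> tame f.
Proof.
move=> tf; have [M [A [M0 A0 h]]] := test_function_bounded tf.
have [sf _] := tf; have [cf _] := sf [::].
have mf := continuous_measurable_spacetime cf.
split; last by exists M, A.
split => // r; apply: (gdom_le (c := M) (gdom_gauss 0 ltr01)) => //.
  exact: (measurable_fun_pair2 r mf).
by move=> y; have [h1 _] := h r y; rewrite [`|gauss _ _ _|]gtr0_norm ?gauss_gt0.
Qed.

Lemma tame_lin (a : R) f g : tame f -> tame g -> tame (fun p => a * f p + g p).
Proof.
move=> [sf [M [A [M0 A0 h]]]] [sg [M' [A' [M'0 A'0 h']]]].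
split; first by apply: slicesD => //; exact: slicesZ.
exists (`|a| * M + M'), (A + A'); split; rewrite ?addr_ge0 ?mulr_ge0// => r y.
have [h1 h2] := h r y; have [h3 h4] := h' r y; split.
  rewrite mulrDl (le_trans (ler_normD _ _))// lerD// normrM -mulrA.
  by rewrite ler_wpM2l.
by move=> rA; rewrite h2 ?h4 ?mulr0 ?addr0//; lra.
Qed.

Definition slice_form (f g : V -> R) (r : measurableTypeR R) : R :=
  sform beta (fun y => f (r, y)) (fun y => g (r, y)).

Lemma slice_form_integrable f g : tame f -> tame g -> mu.-integrable half (EFin \o slice_form f g).
Proof.
move=> [[mf sf] [M [A [M0 A0 h]]]] [[mg sg] [M' [A' [M'0 A'0 h']]]].
have g1 := gdom_gauss (0 : 'rV[R]_k) ltr01.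
pose c := M * M' * sform beta (gauss 1 (0 : 'rV[R]_k)) (gauss 1 0).
have c0 : 0 <= c by rewrite /c mulr_ge0 ?(mulr_ge0 M0 M'0)// (sform_ge0 hbeta).
have cE a : `|a| = 1 -> forall r, a * slice_form f g r <= c.
  move=> a1 r; rewrite /slice_form -(sformZl hbeta)// /c.
  have -> : M * M' * sform beta (gauss 1 (0 : 'rV[R]_k)) (gauss 1 0) =
      sform beta (fun y : 'rV[R]_k => M * gauss 1 0 y) (fun y => M' * gauss 1 0 y).
    by rewrite (sformZl hbeta)//; [rewrite (sformZr hbeta)//; ring|exact: gdomZ].
  apply: (sform_le hbeta) => //; try exact: gdomZ.
  move=> y y'; apply: le_trans (ler_norm _) _; rewrite normrM normrM a1 mul1r.
  by have [? _] := h r y; have [? _] := h' r y'; apply: ler_pM.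
apply: (@le_integrable _ _ _ _ _ mhalf _ (EFin \o (fun r : measurableTypeR R => c * \1_(`[(- A)%R, A]%classic : set (measurableTypeR R)) r))).
- apply/measurable_EFinP; apply: measurable_funTS.
  exact: (sform_measurable hbeta (T := measurableTypeR R)).
- move=> r _ /=; rewrite lee_fin indicE.
  have [rA|Ar] := leP `|r| A.
    rewrite mem_set /= ?in_itv/=; last by rewrite -ler_norml.
    rewrite mulr1 (ger0_norm c0) ler_norml.
    have := cE 1; rewrite normr1 => /(_ erefl r); rewrite mul1r => ->.
    by rewrite andbT lerNl; have := cE (-1); rewrite normrN1 => /(_ erefl r); rewrite mulN1r.
  have -> : slice_form f g r = 0.
    rewrite /slice_form (_ : (fun y => f (r, y)) = fun y => 0 * gauss 1 0 y).
      by rewrite (sformZl hbeta)// mul0r.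
    by apply/funext => y; have [_ ->] := h r y; rewrite ?mul0r.
  by rewrite normr0.
apply: (@integrableS _ _ _ mu setT) => //.
have := integrableZl (@measurableT _ (measurableTypeR R)) c (integrable_indic_itv (- A) A true false).
by congr integrable; apply/funext => r; rewrite /= EFinM.
Qed.

Definition bform f g : R := \int[mu]_(r in half) slice_form f g r.

Lemma bform_linl a f g u : tame f -> tame g -> tame u ->
  bform (fun p => a * f p + g p) u = a * bform f u + bform g u.
Proof.
move=> tf tg tu; have [[_ sf] _] := tf; have [[_ sg] _] := tg; have [[_ su] _] := tu.
rewrite /bform -RintegralZl//; last exact: slice_form_integrable.
rewrite -RintegralD//; last 2 first.
- have := integrableZl mhalf a (slice_form_integrable tf tu).
  by congr integrable; apply/funext => r; rewrite /= EFinM.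
- exact: slice_form_integrable.
apply: eq_Rintegral => r _; rewrite /slice_form (sformDl hbeta)// ?(sformZl hbeta)//.
exact: gdomZ.
Qed.

Lemma bform_linr a f g u : tame f -> tame g -> tame u ->
  bform u (fun p => a * f p + g p) = a * bform u f + bform u g.
Proof.
move=> tf tg tu; have [[_ sf] _] := tf; have [[_ sg] _] := tg; have [[_ su] _] := tu.
rewrite /bform -RintegralZl//; last exact: slice_form_integrable.
rewrite -RintegralD//; last 2 first.
- have := integrableZl mhalf a (slice_form_integrable tu tf).
  by congr integrable; apply/funext => r; rewrite /= EFinM.
- exact: slice_form_integrable.
apply: eq_Rintegral => r _; rewrite /slice_form (sformDr hbeta)// ?(sformZr hbeta)//.
exact: gdomZ.
Qed.

Lemma bform_disjoint f g : slices f -> slices g ->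
  (forall r, (forall y, f (r, y) = 0) \/ (forall y, g (r, y) = 0)) -> bform f g = 0.
Proof.
move=> [_ sf] [_ sg] h; rewrite /bform.
transitivity (\int[mu]_(r in half) (cst (0 : R) r)); last by rewrite Rintegral_cst// mul0r.
apply: eq_Rintegral => r _; rewrite /slice_form /=; have g1 := gdom_gauss (0 : 'rV[R]_k) ltr01.
case: (h r) => [f0|g0].
  by rewrite (_ : (fun y => f (r, y)) = fun y => 0 * gauss 1 0 y) ?(sformZl hbeta)// ?mul0r//; apply/funext => y; rewrite f0 mul0r.
by rewrite (_ : (fun y => g (r, y)) = fun y => 0 * gauss 1 0 y) ?(sformZr hbeta)// ?mul0r//; apply/funext => y; rewrite g0 mul0r.
Qed.

Lemma noise_inner_bform f g : tame f -> tame g -> noise_inner beta f g = (bform f g)%:E.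
Proof.
move=> tf tg; have [[_ sf] _] := tf; have [[_ sg] _] := tg.
rewrite (noise_inner_sform hbeta)// /bform /Rintegral fineK//.
by apply: integrable_fin_num => //; exact: slice_form_integrable.
Qed.

Lemma noise_energyZ (c : R) (F : V -> R) : slices F ->
  noise_inner beta (fun p => c * F p)%R (fun p => c * F p)%R = ((c ^+ 2)%:E * noise_inner beta F F)%E.
Proof.
move=> sF; rewrite !(noise_energy hbeta)//; last exact: slicesZ.
rewrite -ge0_integralZl//.
- by apply: eq_integral => r _; rewrite (energyZ hbeta)// EFinM.
- by apply/measurable_EFinP; apply: measurable_funTS; exact: (energy_measurable hbeta).
- by move=> r _; rewrite lee_fin (energy_ge0 hbeta).
- by rewrite lee_fin sqr_ge0.
Qed.

End tame_functions.

Lemma ip_sqrD_scaled d (T : measurableType d) (R : realType) (P : probability T R) (t : R) (f g : T -> R) :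
  0 < t -> L2 P f -> L2 P g ->
  ip P (fun x => f x + g x) (fun x => f x + g x) <= (1 + t) * ip P f f + (1 + t^-1) * ip P g g.
Proof.
move=> t0 Lf Lg; have := ip_ge0 P (fun x => t * f x - g x).
rewrite (ip_sqrB (L2Z t Lf) Lg) (ip_sqrD Lf Lg) ip_sqrZ// ipZl// => h.
have : 0 <= t^-1 * (t ^+ 2 * ip P f f - 2 * (t * ip P f g) + ip P g g).
  by rewrite mulr_ge0// invr_ge0 ltW.
have -> : t^-1 * (t ^+ 2 * ip P f f - 2 * (t * ip P f g) + ip P g g) =
   t * ip P f f - 2 * ip P f g + t^-1 * ip P g g by field; rewrite gt_eqF.
lra.
Qed.

(** The limit [e -> 0] followed by [t -> 0], performed by one choice in which the error is a small
    multiple of t, so that it survives multiplication by [t^-1]. *)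
Lemma ler_scaled_error {R : realFieldType} (a x : R) : 0 <= x ->
  (forall t e, 0 < t -> 0 < e -> a <= (1 + t) * ((1 + t) * x + (1 + t^-1) * e) + (1 + t^-1) * e) ->
  a <= x.
Proof.
move=> x0 h; apply/ler_addgt0Pr => e e0.
pose t := Num.min 1 (e / (6 * (x + 1))).
have x6 : 0 < 6 * (x + 1) by lra.
have t0 : 0 < t by rewrite lt_min ltr01 divr_gt0.
have t1 : t <= 1 by rewrite ge_min lexx.
have tx : t * (6 * (x + 1)) <= e by rewrite -ler_pdivlMr// ge_min lexx orbT.
have d0 : 0 < e * t / 12 by rewrite !mulr_gt0// invr_gt0.
have := h t (e * t / 12) t0 d0.
have -> : (1 + t) * ((1 + t) * x + (1 + t^-1) * (e * t / 12)) + (1 + t^-1) * (e * t / 12) =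
  (1 + t) * ((1 + t) * x + (t + 1) * e / 12) + (t + 1) * e / 12.
  by field; rewrite gt_eqF.
rewrite -subr_ge0 => h1; rewrite -subr_ge0; apply: le_trans h1 _.
have h2 : 0 <= t * (1 - t) * x by rewrite !mulr_ge0 ?subr_ge0// ltW.
have h3 : t * (1 - t) * e >= 0 by rewrite !mulr_ge0 ?subr_ge0// ltW.
have h4 : 0 <= (1 - t) * e by rewrite !mulr_ge0 ?subr_ge0// ltW.
have h5 : 0 <= t * x by rewrite mulr_ge0// ltW.
clearbody t; clear -h2 h3 h4 h5 tx t0 e0; lra.
Qed.

Section wiener.
Context {R : realType} {k : nat}.
Local Notation V := (R * 'rV[R]_k)%type.
Variable beta : R.
Hypothesis hbeta : 0 < beta < Num.min k%:R 2 \/ k = 1%N /\ beta = 1.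
Context disp (Omega : measurableType disp) (P : probability Omega R) (d : nat).
Variable W : 'I_d -> (V -> R) -> Omega -> R.
Hypothesis hW : gaussian_noise P beta W.

Inductive noise_span : (Omega -> R) -> Prop :=
| noise_span0 : noise_span (fun=> 0)
| noise_span_cons a j f Y : test_function f -> noise_span Y ->
    noise_span (fun w => a * W j f w + Y w).

Lemma noise_span_gaussian Y : noise_span Y -> centered_gaussian P Y.
Proof.
move=> sY; suff [n [c [l [f [tf ->]]]]] : exists n (c : 'I_n -> R) (l : 'I_n -> 'I_d) (f : 'I_n -> V -> R),
   (forall i, test_function (f i)) /\ Y = fun w => \sum_i c i * W (l i) (f i) w.
  by have [h _] := hW; exact: h.
elim: sY => {Y} [|a j f Y tf _ [n [c [l [g [tg ->]]]]]].
  have e (T : Type) : 'I_0 -> T by case.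
  by exists 0%N, (@e _), (@e _), (@e _); split; [case|apply/funext => w; rewrite big_ord0].
exists n.+1, (fun i => oapp c a (unlift ord0 i)), (fun i => oapp l j (unlift ord0 i)),
  (fun i => oapp g f (unlift ord0 i)); split.
  by move=> i; case: (unlift ord0 i) => [i'|] /=.
apply/funext => w; rewrite big_ord_recl unlift_none/=; congr (_ + _).
by apply: eq_bigr => i _; rewrite liftK.
Qed.

Lemma noise_spanD Y Z : noise_span Y -> noise_span Z -> noise_span (fun w => Y w + Z w).
Proof.
elim=> [|a j f Y' tf _ IH] sZ; first by under eq_fun do rewrite add0r.
by under eq_fun do rewrite -addrA; apply: noise_span_cons => //; exact: IH.
Qed.

Lemma noise_spanZ a Y : noise_span Y -> noise_span (fun w => a * Y w).
Proof.
elim=> [|b j f Y' tf _ IH]; first by under eq_fun do rewrite mulr0; exact: noise_span0.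
by under eq_fun do rewrite mulrDr mulrA; apply: noise_span_cons.
Qed.

Lemma noise_span_L2 Y : noise_span Y -> L2 P Y.
Proof. by move=> /noise_span_gaussian /centered_gaussian_props[]. Qed.

(** The noise is not given as a linear map, so a combination of test functions is remembered
    together with the same combination of the variables [W j f]. *)
Inductive noise_test (j : 'I_d) : (V -> R) -> (Omega -> R) -> Prop :=
| noise_test1 f : test_function f -> noise_test j f (W j f)
| noise_test_lin a f Y g Z : noise_test j f Y -> noise_test j g Z ->
    noise_test j (fun p => a * f p + g p) (fun w => a * Y w + Z w).

(** The cutoff acts on each test function of the combination, and the new variable evaluates the
    noise on the cut functions. *)
Lemma noise_test_cutoff j f Y (c : R -> R) : bump_alg c -> noise_test j f Y ->
  exists Y', noise_test j (fun p => c p.1 * f p) Y'.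
Proof.
move=> bc; elim=> {f Y} [f tf|a f Y g Z _ [Y' nY'] _ [Z' nZ']].
  by exists (W j (fun p => c p.1 * f p)); apply: noise_test1; exact: test_function_cutoff.
exists (fun w => a * Y' w + Z' w).
rewrite (_ : (fun p => _) = fun p => a * (c p.1 * f p) + c p.1 * g p); first exact: noise_test_lin.
by apply/funext => p; ring.
Qed.

Lemma noise_test_tame j f Y : noise_test j f Y -> tame f /\ noise_span Y.
Proof.
elim=> {f Y} [f tf|a f Y g Z _ [tf sY] _ [tg sZ]].
  split; first exact: test_function_tame.
  have := noise_span_cons 1 j tf noise_span0.
  by under eq_fun do rewrite addr0 mul1r.
split; first exact: tame_lin.
by apply: noise_spanD => //; exact: noise_spanZ.
Qed.

Lemma noise_test_ip j f Y j' f' Y' : noise_test j f Y -> noise_test j' f' Y' ->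
  ip P Y Y' = if j == j' then bform beta f f' else 0.
Proof.
move=> nY nY'; have [t' s'] := noise_test_tame nY'; have L' := noise_span_L2 s'.
elim: nY => {f Y} [f tf|a f Y g Z nY IHY nZ IHZ]; last first.
  have [tf /noise_span_L2 LY] := noise_test_tame nY; have [tg /noise_span_L2 LZ] := noise_test_tame nZ.
  rewrite (ipDl (L2Z a LY) LZ L') (ipZl a LY L') IHY IHZ; case: eqP => _; last by rewrite mulr0 addr0.
  by rewrite (bform_linl hbeta).
have [t1 /noise_span_L2 L1] := noise_test_tame (noise_test1 j tf).
elim: nY' => {f' Y' t' s' L'} [f' tf'|a f' Y g Z nY IHY nZ IHZ]; last first.
  have [t2 /noise_span_L2 LY] := noise_test_tame nY; have [tg /noise_span_L2 LZ] := noise_test_tame nZ.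
  rewrite ipC (ipDl (L2Z a LY) LZ L1) (ipZl a LY L1) ipC IHY ipC IHZ; case: eqP => _; last by rewrite mulr0 addr0.
  by rewrite (bform_linr hbeta).
have [_ h] := hW; have := h j j' f f' tf tf'.
have t2 := test_function_tame tf'.
rewrite unlock (noise_inner_bform hbeta)// => e.
by rewrite /ip /Rintegral e; case: ifP.
Qed.

(** Approximation to any accuracy by combinations, instead of a sequence of test functions, is
    stable under linear combinations. The [slices] condition makes the noise norm an integral of
    energies. *)
Definition wiener (j : 'I_d) (h : V -> R) (X : Omega -> R) : Prop :=
  [/\ slices h, measurable_fun setT X & forall e, 0 < e -> exists g Y,
    [/\ noise_test j g Y, (noise_inner beta (fun p => h p - g p)%R (fun p => h p - g p)%R <= e%:E)%E,
        L2 P (fun w => X w - Y w) & ip P (fun w => X w - Y w) (fun w => X w - Y w) <= e]].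

Lemma wiener_L2 j h X : wiener j h X -> L2 P X.
Proof.
move=> [_ _ /(_ 1 ltr01)[g [Y [/noise_test_tame[_ /noise_span_L2 LY] _ L1 _]]]].
have := L2D L1 LY; by under eq_fun do rewrite subrK.
Qed.

Lemma wiener_test j f Y : noise_test j f Y -> wiener j f Y.
Proof.
move=> nY; have [[sf _] /noise_span_L2 LY] := noise_test_tame nY.
split => //; first exact: L2_measurable LY.
move=> e e0; exists f, Y; split => //.
- under eq_fun do rewrite subrr.
  rewrite (_ : (fun=> 0) = fun p => 0 * f p); last by apply/funext => p; rewrite mul0r.
  rewrite noise_energyZ// expr0n/= mul0e lee_fin; exact: ltW.
- by under eq_fun do rewrite subrr; exact: L20.
- by under eq_fun do rewrite subrr; rewrite /ip mul0r Rintegral_cst1 ltW.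
Qed.

Lemma wiener_lin a j f X g Z : wiener j f X -> wiener j g Z ->
  wiener j (fun p => a * f p + g p) (fun w => a * X w + Z w).
Proof.
move=> [sf mX hX] [sg mZ hZ]; split.
- by apply: slicesD => //; exact: slicesZ.
- by apply: measurable_funD => //; exact: measurable_funM.
move=> e e0; pose e' := e / (2 * (1 + a ^+ 2)).
have a2 := sqr_ge0 a.
have a1 : 0 < 1 + a ^+ 2 by rewrite ltr_pwDl.
have e'0 : 0 < e' by rewrite divr_gt0// mulr_gt0.
have [f' [X' [nX' qf LX iX]]] := hX e' e'0; have [g' [Z' [nZ' qg LZ iZ]]] := hZ e' e'0.
have [[sf' _] _] := noise_test_tame nX'; have [[sg' _] _] := noise_test_tame nZ'.
have ee : (1 + 1) * (a ^+ 2 * e') + (1 + 1) * e' = e by rewrite /e'; field; rewrite gt_eqF.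
exists (fun p => a * f' p + g' p), (fun w => a * X' w + Z' w); split.
- exact: noise_test_lin.
- have -> : (fun p => a * f p + g p - (a * f' p + g' p)) =
      (fun p => a * (f p - f' p) + (g p - g' p)) by apply/funext => p; ring.
  have s1 := slicesB sf sf'; have s2 := slicesB sg sg'.
  apply: le_trans (noise_energyD_le hbeta ltr01 (slicesZ a s1) s2) _.
  rewrite (noise_energyZ hbeta)// invr1 -ee [in leRHS]EFinD [in leRHS]EFinM [X in (_ <= _ + X)%E]EFinM [in leRHS]EFinM.
  apply: leeD; apply: lee_wpmul2l => //.
  by apply: lee_wpmul2l; [rewrite lee_fin|exact: qf].
- have -> : (fun w => a * X w + Z w - (a * X' w + Z' w)) =
      (fun w => a * (X w - X' w) + (Z w - Z' w)) by apply/funext => p; ring.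
  by apply: L2D => //; exact: L2Z.
have -> : (fun w => a * X w + Z w - (a * X' w + Z' w)) =
    (fun w => a * (X w - X' w) + (Z w - Z' w)) by apply/funext => p; ring.
apply: le_trans (ip_sqrD_le (L2Z a LX) LZ) _.
by rewrite ip_sqrZ// -ee lerD// ler_wpM2l// ler_wpM2l.
Qed.

Lemma wienerZ a j f X : wiener j f X -> wiener j (fun p => a * f p) (fun w => a * X w).
Proof.
move=> wX; have := wiener_lin (a - 1) wX wX.
have -> : (fun p => (a - 1) * f p + f p) = (fun p => a * f p) by apply/funext => p; ring.
by have -> : (fun p => (a - 1) * X p + X p) = (fun p => a * X p) by apply/funext => p; ring.
Qed.

Lemma wienerD j f X g Z : wiener j f X -> wiener j g Z ->
  wiener j (fun p => f p + g p) (fun w => X w + Z w).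
Proof.
move=> wX wZ; have := wiener_lin 1 wX wZ.
by under eq_fun do rewrite mul1r; under [X in wiener _ _ X]eq_fun do rewrite mul1r.
Qed.

Lemma wienerB j f X g Z : wiener j f X -> wiener j g Z ->
  wiener j (fun p => f p - g p) (fun w => X w - Z w).
Proof.
move=> wX wZ; have := wiener_lin (-1) wZ wX.
have -> : (fun p => -1 * g p + f p) = (fun p => f p - g p) by apply/funext => p; ring.
by have -> : (fun p => -1 * Z p + X p) = (fun p => X p - Z p) by apply/funext => p; ring.
Qed.

(** The norm of h is not known to be finite beforehand, and the form is bilinear on the approximants
    only. Both inequalities therefore come from Young's inequality with parameter t, the
    approximation error tending to 0 before t does. *)
Lemma wiener_isometry j h X : wiener j h X -> noise_inner beta h h = (ip P X X)%:E.
Proof.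
move=> wX; have LX := wiener_L2 wX; have [sh _ hX] := wX.
have q0 := noise_energy_ge0 hbeta sh.
have qle t e : 0 < t -> 0 < e -> (noise_inner beta h h <=
    ((1 + t) * ((1 + t) * ip P X X + (1 + t^-1) * e) + (1 + t^-1) * e)%:E)%E.
  move=> t0 e0; have [g [Y [nY qg L1 i1]]] := hX e e0.
  have [[sg _] /noise_span_L2 LY] := noise_test_tame nY; have [tg _] := noise_test_tame nY.
  have t1 : 0 <= 1 + t by rewrite addr_ge0// ltW.
  have t2 : 0 <= 1 + t^-1 by rewrite addr_ge0// invr_ge0 ltW.
  have := noise_energyD_le hbeta t0 sg (slicesB sh sg).
  have -> : (fun p => g p + (h p - g p)) = h by apply/funext => p; rewrite addrC subrK.
  move=> hh; apply: le_trans hh _.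
  rewrite [in leRHS]EFinD; apply: leeD; last first.
    by rewrite EFinM; apply: lee_wpmul2l; rewrite ?lee_fin.
  rewrite [in leRHS]EFinM; apply: lee_wpmul2l; first by rewrite lee_fin.
  rewrite noise_inner_bform// lee_fin -[bform _ _ _]/(if true then _ else 0) -(eqxx j) -(noise_test_ip nY nY).
  have -> : Y = (fun w => X w + -1 * (X w - Y w)) by apply/funext => w; ring.
  apply: le_trans (ip_sqrD_scaled t0 LX (L2Z (-1) L1)) _.
  by rewrite ip_sqrZ// sqrrN expr1n mul1r lerD2l ler_wpM2l.
have qfin : noise_inner beta h h \is a fin_num.
  by rewrite ge0_fin_numE//; apply: le_lt_trans (qle 1 1 ltr01 ltr01) _; rewrite ltry.
have [q qE] : exists q, noise_inner beta h h = q%:E by exists (fine (noise_inner beta h h)); rewrite fineK.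
move: q0 qle; rewrite qE lee_fin => q0 qle.
congr EFin; apply/eqP; rewrite eq_le; apply/andP; split.
  by apply: ler_scaled_error => [|t e t0 e0]; [exact: ip_ge0|rewrite -lee_fin; exact: qle].
apply: ler_scaled_error => // t e t0 e0.
have [g [Y [nY qg L1 i1]]] := hX e e0.
have [tg sY] := noise_test_tame nY; have LY := noise_span_L2 sY; have [sg _] := tg.
have t1 : 0 <= 1 + t by rewrite addr_ge0// ltW.
have t2 : 0 <= 1 + t^-1 by rewrite addr_ge0// invr_ge0 ltW.
have := ip_sqrD_scaled t0 LY L1.
have -> : (fun w => Y w + (X w - Y w)) = X by apply/funext => p; rewrite addrC subrK.
move=> hh; apply: le_trans hh _; apply: lerD; last exact: ler_wpM2l.
apply: ler_wpM2l => //; rewrite (noise_test_ip nY nY) eqxx -lee_fin -noise_inner_bform//.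
have := noise_energyD_le hbeta t0 sh (slicesZ (-1) (slicesB sh sg)).
have -> : (fun p => h p + -1 * (h p - g p)) = g by apply/funext => p; ring.
rewrite (noise_energyZ hbeta (-1) (slicesB sh sg)) sqrrN expr1n mul1e => h2; apply: le_trans h2 _.
rewrite [in leRHS]EFinD; apply: leeD; rewrite EFinM; apply: lee_wpmul2l; rewrite ?lee_fin ?qE//.
Qed.

Lemma ip_approx0 (X Z : Omega -> R) : L2 P X -> L2 P Z ->
  (forall e, 0 < e -> exists Y, [/\ L2 P Y, ip P (fun w => X w - Y w) (fun w => X w - Y w) <= e &
    ip P Y Z = 0]) -> ip P X Z = 0.
Proof.
move=> LX LZ h; apply/eqP; rewrite -sqrf_eq0 eq_le sqr_ge0 andbT.
apply/ler_addgt0Pr => e e0; rewrite add0r.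
have z0 := ip_ge0 P Z; have z1 : 0 < ip P Z Z + 1 by rewrite ltr_wpDl.
have [Y [LY hY YZ]] := h (e / (ip P Z Z + 1)) (divr_gt0 e0 z1).
have -> : ip P X Z = ip P (fun w => X w - Y w) Z by rewrite ipBl// YZ subr0.
apply: le_trans (ip_CauchySchwarz (L2B LX LY) LZ) _.
apply: le_trans (ler_wpM2r z0 hY) _.
by rewrite mulrAC ler_pdivrMr// ler_wpM2l// ?lerDl// ltW.
Qed.

Lemma wiener_independent j h X j' h' X' : j != j' -> wiener j h X -> wiener j' h' X' -> ip P X X' = 0.
Proof.
move=> jj wX wX'; have LX := wiener_L2 wX; have LX' := wiener_L2 wX'.
have [_ _ hX] := wX; have [_ _ hX'] := wX'.
apply: ip_approx0 => // e e0; have [g [Y [nY _ _ iY]]] := hX e e0.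
have [_ sY] := noise_test_tame nY; have LY := noise_span_L2 sY.
exists Y; split => //; rewrite ipC; apply: ip_approx0 => // e' e'0.
have [g' [Y' [nY' _ _ iY']]] := hX' e' e'0.
have [_ sY'] := noise_test_tame nY'; have LY' := noise_span_L2 sY'.
by exists Y'; split => //; rewrite (noise_test_ip nY' nY) eq_sym (negbTE jj).
Qed.

(** Unlike [wiener], this mixes the components j and forgets the kernel; joint Gaussianity of the
    whole field requires nothing else. *)
Definition noise_limit (X : Omega -> R) : Prop := measurable_fun setT X /\
  forall e, 0 < e -> exists Y, [/\ noise_span Y, L2 P (fun w => X w - Y w) &
    ip P (fun w => X w - Y w) (fun w => X w - Y w) <= e].

Lemma wiener_limit j h X : wiener j h X -> noise_limit X.
Proof.
move=> [_ mX hX]; split => // e e0; have [g [Y [nY _ L1 i1]]] := hX e e0.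
by exists Y; split => //; have [_] := noise_test_tame nY.
Qed.

Lemma noise_limit_near X : noise_limit X -> near_gauss P X.
Proof.
move=> [mX hX]; split => // e e0; have [Y [sY L1 i1]] := hX e e0.
by exists Y; split => //; exact: noise_span_gaussian.
Qed.

Lemma noise_limit_lin a X Z : noise_limit X -> noise_limit Z -> noise_limit (fun w => a * X w + Z w).
Proof.
move=> [mX hX] [mZ hZ]; split.
  by apply: measurable_funD => //; exact: measurable_funM.
move=> e e0; pose e' := e / (2 * (1 + a ^+ 2)).
have a2 := sqr_ge0 a.
have a1 : 0 < 1 + a ^+ 2 by rewrite ltr_pwDl.
have e'0 : 0 < e' by rewrite divr_gt0// mulr_gt0.
have [X' [nX' LX iX]] := hX e' e'0; have [Z' [nZ' LZ iZ]] := hZ e' e'0.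
have ee : 2 * (a ^+ 2 * e') + 2 * e' = e by rewrite /e'; field; rewrite gt_eqF.
have E : (fun w => a * X w + Z w - (a * X' w + Z' w)) =
    (fun w => a * (X w - X' w) + (Z w - Z' w)) by apply/funext => p; ring.
exists (fun w => a * X' w + Z' w); rewrite E; split.
- by apply: noise_spanD => //; exact: noise_spanZ.
- by apply: L2D => //; exact: L2Z.
apply: le_trans (ip_sqrD_le (L2Z a LX) LZ) _.
by rewrite ip_sqrZ// -ee lerD// ler_wpM2l// ler_wpM2l.
Qed.

Lemma noise_limit_family (I : Type) (X : I -> Omega -> R) : (forall i, noise_limit (X i)) ->
  gauss_family P X.
Proof.
move=> hX s; apply: noise_limit_near; elim: s => [|[a i] s IH].
  rewrite (_ : (fun w => _) = fun=> 0); last by apply/funext => w; rewrite /comb big_nil.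
  split => // e e0; exists (fun=> 0); rewrite (_ : (fun _ : Omega => 0 - 0 : R) = fun=> 0) ?subrr//.
  split; [exact: noise_span0|exact: L20|by rewrite /ip mul0r Rintegral_cst1 ltW].
rewrite (_ : (fun w => _) = fun w => a * X i w + comb s (X ^~ w)).
  exact: noise_limit_lin.
by apply/funext => w; rewrite /comb big_cons.
Qed.

End wiener.

(** * Covariance of the mild solution *)

Section kernel_estimates.
Context {R : realType} {k : nat}.
Local Notation mu := (@lebesgue_measure R).
Local Notation lam := (@lebesgue_rV R k).
Local Notation lam2 := (@lebesgue_rV2 R k).
Local Notation V := (R * 'rV[R]_k)%type.
Local Notation half := (`[0%R, +oo[%classic : set (measurableTypeR R)).
Variable beta : R.
Hypothesis hbeta : 0 < beta < Num.min k%:R 2 \/ k = 1%N /\ beta = 1.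
Hypothesis k0 : (0 < k)%N.
Local Notation b := (beta / 2).

Let b0 : 0 < b. Proof. by case/andP: (beta_half hbeta). Qed.
Let b1 : b < 1. Proof. by case/andP: (beta_half hbeta). Qed.

Let pair_gauss (a c : R) (x : 'rV[R]_k) : 0 < a -> 0 < c ->
  (\int[lam2]_p (gauss a x p.1 * gauss c p.1 p.2)%:E =
   (Num.sqrt (pi / c) ^+ k * Num.sqrt (pi / a) ^+ k)%:E)%E.
Proof.
move=> a0 c0.
have mF : measurable_fun setT (fun p : 'rV[R]_k * 'rV[R]_k => (gauss a x p.1 * gauss c p.1 p.2)%:E).
  apply/measurable_EFinP; apply: measurable_funM; first exact: measurable_gauss.
  exact: measurable_gauss.
rewrite (fubini_tonelli1 (m1 := lam) (m2 := lam) (fun p : 'rV[R]_k * 'rV[R]_k => (gauss a x p.1 * gauss c p.1 p.2)%:E))//; last first.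
  by move=> p; rewrite lee_fin mulr_ge0// ltW// gauss_gt0.
rewrite /fubini_F /=.
have e y : (\int[lam]_z (gauss a x y * gauss c y z)%:E = (Num.sqrt (pi / c) ^+ k)%:E * (gauss a x y)%:E)%E.
  under eq_integral do rewrite EFinM.
  rewrite ge0_integralZl//.
  - by rewrite integral_gauss_rV// muleC.
  - by apply/measurable_EFinP; exact: measurable_gauss.
  - by move=> z _; rewrite lee_fin ltW// gauss_gt0.
  - by rewrite lee_fin ltW// gauss_gt0.
under eq_integral do rewrite e.
rewrite ge0_integralZl//.
- by rewrite integral_gauss_rV.
- by apply/measurable_EFinP; exact: measurable_gauss.
- by move=> z _; rewrite lee_fin ltW// gauss_gt0.
Qed.

Let sqn_triangle (x y z : 'rV[R]_k) : sqn (z - x) <= 2 * sqn (z - y) + 2 * sqn (y - x).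
Proof.
rewrite /sqn !mulr_sumr -big_split/=; apply: ler_sum => i _; rewrite !mxE.
by have := sqr_ge0 ((z ord0 i - y ord0 i) - (y ord0 i - x ord0 i)); lra.
Qed.

(* With g_s(y, z) = exp(- s |y - z|^2), one has g_3a - g_4a <= C |y - z|^-beta pointwise,
   also on the diagonal, where both sides vanish. *)
Lemma sform_gauss_gt0 (a : R) (x : 'rV[R]_k) : 0 < a -> 0 < sform beta (gauss a x) (gauss a x).
Proof.
move=> a0; rewrite /sform; case: ifPn => [w|nw].
  rewrite /pform /pker /Rintegral.
  rewrite (_ : (\int[lam]_z _)%E = (Num.sqrt (pi / (2 * a)) ^+ k)%:E) /=.
    by rewrite exprn_gt0// sqrtr_gt0 divr_gt0 ?pi_gt0// mulr_gt0.
  rewrite -(integral_gauss_rV x (_ : 0 < 2 * a)) ?mulr_gt0//.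
  apply: eq_integral => y _; rewrite mulr1 -expRD; congr (expR _)%:E; ring.
have [bp bk b2] : [/\ 0 < beta, beta < k%:R & beta < 2].
  case: hbeta => [|[k1 be]]; first by rewrite lt_min => /andP[? /andP[? ?]].
  by move: nw; rewrite k1 be !eqxx.
have ker0 p : 0 <= pker fst snd (@riesz R k beta) (gauss a x) (gauss a x) p.
  by rewrite /pker mulr_ge0 ?(ltW (gauss_gt0 _ _ _))// mulr_ge0 ?riesz_ge0// ltW// gauss_gt0.
rewrite lt_neqAle Rintegral_ge0 ?andbT; last by move=> p _; exact: ker0.
apply/negP => /eqP e0.
have mK : measurable_fun setT (pker fst snd (@riesz R k beta) (gauss a x) (gauss a x)).
  apply: measurable_funM; last exact: measurable_gauss.
  by apply: measurable_funM; [exact: measurable_gauss|exact: measurable_riesz].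
have i0 : (\int[lam2]_p (pker fst snd (@riesz R k beta) (gauss a x) (gauss a x) p)%:E = 0)%E.
  move: e0; rewrite /pform /Rintegral => e0.
  have h0 : (0 <= \int[lam2]_p (pker fst snd (@riesz R k beta) (gauss a x) (gauss a x) p)%:E)%E.
    by apply: integral_ge0 => p _; rewrite lee_fin.
  rewrite -[LHS]fineK -?e0// ge0_fin_numE//.
  by apply: le_lt_trans (riesz_gauss bp bk b2 x a0) _; exact: ltry.
pose C := 1 + a^-1.
have C0 : 0 < C by rewrite addr_gt0// invr_gt0.
have dom p : gauss (3 * a) x p.1 * gauss (3 * a) p.1 p.2 <=
    gauss (3 * a) x p.1 * gauss (4 * a) p.1 p.2 +
    C * pker fst snd (@riesz R k beta) (gauss a x) (gauss a x) p.
  case: p => y z; rewrite /pker /=.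
  have g1 := gauss_gt0 (3 * a) x y; have g2 := gauss_gt0 (4 * a) y z.
  have [e|n0] := eqVneq (sqn (y - z)) 0.
    have e' : sqn (z - y) = 0 by rewrite sqnB.
    have := ker0 (y, z); rewrite /pker/= => ge.
    rewrite {2 4}/gauss e' !mulr0 oppr0 expR0 lerDl; exact: mulr_ge0 (ltW C0) ge.
  have s0 : 0 < sqn (y - z) by rewrite lt_neqAle eq_sym n0 sqn_ge0.
  have c1 : 1 <= C * expR (a * sqn (y - z)) * @riesz R k beta (y, z).
    rewrite riesz_sqn// (negbTE n0) /= powRN -ler_pdivrMr ?invr_gt0 ?powR_gt0// invrK mul1r.
    apply: (@le_trans _ _ (1 + sqn (y - z))).
      have [l1|l1] := leP (sqn (y - z)) 1.
        apply: (@le_trans _ _ 1); last by rewrite lerDl sqn_ge0.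
        have e1 : (1 : R) `^ b = 1 by rewrite powR1.
        rewrite -[leRHS]e1; apply: ge0_ler_powR => //; rewrite ?nnegrE ?sqn_ge0//; exact: ltW.
      apply: (@le_trans _ _ (sqn (y - z))); last by rewrite lerDr.
      rewrite -[leRHS]powRr1 ?sqn_ge0//; apply: ler_powR; [exact: ltW|exact: ltW].
    apply: (@le_trans _ _ (C * (1 + a * sqn (y - z)))); last first.
      by apply: ler_wpM2l; [exact: ltW|exact: expR_ge1Dx].
    rewrite /C mulrDl mul1r [a^-1 * _]mulrDr mulr1 mulKf ?gt_eqF//.
    have : 0 <= a * sqn (y - z) by rewrite mulr_ge0 ?sqn_ge0// ltW.
    have : 0 <= a^-1 by rewrite invr_ge0 ltW.
    lra.
  apply: (@le_trans _ _ (C * (gauss a x y * @riesz R k beta (y, z) * gauss a x z))); last by rewrite lerDr mulr_ge0// ltW.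
  have gg : gauss (3 * a) x y * gauss (3 * a) y z * expR (a * sqn (y - z)) <= gauss a x y * gauss a x z.
    rewrite /gauss -!expRD ler_expR [sqn (z - y)]sqnB.
    by have := ler_wpM2l (ltW a0) (sqn_triangle x y z); rewrite [sqn (z - y)]sqnB; lra.
  have r0 := @riesz_ge0 R k beta (y, z).
  have p0 : 0 <= gauss (3 * a) x y * gauss (3 * a) y z by rewrite mulr_ge0// ltW// gauss_gt0.
  apply: le_trans (ler_peMr p0 c1) _.
  have := ler_wpM2l (mulr_ge0 (ltW C0) r0) gg.
  by move=> hh; apply: le_trans (_ : _ <= C * @riesz R k beta (y, z) * (gauss a x y * gauss a x z)) _; [apply: le_trans hh; rewrite le_eqVlt|rewrite le_eqVlt]; apply/orP; left; apply/eqP; ring.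
have a3 : 0 < 3 * a by rewrite mulr_gt0.
have a4 : 0 < 4 * a by rewrite mulr_gt0.
have mg (c : R) : measurable_fun setT (fun p : 'rV[R]_k * 'rV[R]_k => gauss (3 * a) x p.1 * gauss c p.1 p.2).
  by apply: measurable_funM; exact: measurable_gauss.
have : (\int[lam2]_p (gauss (3 * a) x p.1 * gauss (3 * a) p.1 p.2)%:E <=
    \int[lam2]_p ((gauss (3 * a) x p.1 * gauss (4 * a) p.1 p.2)%:E +
     (C * pker fst snd (@riesz R k beta) (gauss a x) (gauss a x) p)%:E))%E.
  apply: ge0_le_integral => //.
  - by move=> p _; rewrite lee_fin mulr_ge0// ltW// gauss_gt0.
  - exact/measurable_EFinP.
  - by apply: emeasurable_funD; apply/measurable_EFinP => //; exact: measurable_funM.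
  - by move=> p _; rewrite -EFinD lee_fin.
rewrite ge0_integralD//; last 4 first.
- by move=> p _; rewrite lee_fin mulr_ge0// ltW// gauss_gt0.
- exact/measurable_EFinP.
- by move=> p _; rewrite lee_fin mulr_ge0// ltW.
- by apply/measurable_EFinP; exact: measurable_funM.
under [X in (_ <= _ + X)%E]eq_integral do rewrite EFinM.
rewrite ge0_integralZl//; last 3 first.
- exact/measurable_EFinP.
- by move=> p _; rewrite lee_fin.
- by rewrite lee_fin ltW.
rewrite i0 mule0 adde0 !pair_gauss// lee_fin ler_pM2r; last by rewrite exprn_gt0// sqrtr_gt0 divr_gt0 ?pi_gt0.
apply/negP; rewrite -ltNge ltr_pXn2r ?nnegrE ?sqrtr_ge0// ltr_sqrt ?divr_gt0 ?pi_gt0//.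
by rewrite ltr_pM2l ?pi_gt0// ltf_pV2 ?posrE// ltr_pM2r// ltr_nat.
Qed.

Let mhalf : measurable half. Proof. exact: measurable_itv. Qed.

Lemma noise_energy_sum (F G H : V -> R) (a c : R) : 0 <= a -> 0 <= c ->
  slices F -> slices G -> slices H ->
  (\int[mu]_(r in half) (energy beta F r + (a * energy beta G r + c * energy beta H r))%:E =
   noise_inner beta F F + (a%:E * noise_inner beta G G + c%:E * noise_inner beta H H))%E.
Proof.
move=> a0 c0 sF sG sH; rewrite !(noise_energy hbeta)//.
have m (E : V -> R) : slices E -> measurable_fun half (fun r => (energy beta E r)%:E).
  by move=> sE; apply/measurable_EFinP; apply: measurable_funTS; exact: (energy_measurable hbeta).
have e0 (E : V -> R) r : slices E -> (0 <= (energy beta E r)%:E)%E.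
  by move=> sE; rewrite lee_fin (energy_ge0 hbeta).
under eq_integral do rewrite EFinD EFinD !EFinM.
rewrite ge0_integralD//; last 4 first.
- by move=> r _; exact: e0.
- exact: m.
- by move=> r _; rewrite adde_ge0// mule_ge0// ?lee_fin// (energy_ge0 hbeta).
- by apply: emeasurable_funD; apply: emeasurable_funM => //; exact: m.
rewrite ge0_integralD//; last 4 first.
- by move=> r _; rewrite mule_ge0// ?lee_fin// (energy_ge0 hbeta).
- by apply: emeasurable_funM => //; exact: m.
- by move=> r _; rewrite mule_ge0// ?lee_fin// (energy_ge0 hbeta).
- by apply: emeasurable_funM => //; exact: m.
rewrite !ge0_integralZl//; try exact: m; move=> *; exact: e0.
Qed.

Lemma noise_energy_le_sum (E F G H : V -> R) (a c : R) : 0 <= a -> 0 <= c ->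
  slices E -> slices F -> slices G -> slices H ->
  (forall r, 0 <= r -> energy beta E r <= energy beta F r + (a * energy beta G r + c * energy beta H r)) ->
  (noise_inner beta E E <=
   noise_inner beta F F + (a%:E * noise_inner beta G G + c%:E * noise_inner beta H H))%E.
Proof.
move=> a0 c0 sE sF sG sH h; rewrite -noise_energy_sum// (noise_energy hbeta)//.
apply: ge0_le_integral => //.
- by move=> r _; rewrite lee_fin (energy_ge0 hbeta).
- by apply/measurable_EFinP; apply: measurable_funTS; exact: (energy_measurable hbeta).
- apply/measurable_EFinP; apply: measurable_funTS.
  by do ?[apply: measurable_funD|apply: measurable_funM] => //; exact: (energy_measurable hbeta).
- by move=> r /=; rewrite in_itv/= andbT => r0; rewrite lee_fin; exact: h.
Qed.

Lemma noise_energy_sum_le (E F G : V -> R) (a : R) : 0 <= a ->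
  slices E -> slices F -> slices G ->
  (forall r, 0 <= r -> energy beta F r + a * energy beta G r <= energy beta E r) ->
  (noise_inner beta F F + a%:E * noise_inner beta G G <= noise_inner beta E E)%E.
Proof.
move=> a0 sE sF sG h.
rewrite -[leLHS]adde0 -(mul0e (noise_inner beta G G)) -addeA -noise_energy_sum// (noise_energy hbeta sE).
apply: ge0_le_integral => //.
- by move=> r _; rewrite lee_fin mul0r addr0 addr_ge0 ?mulr_ge0 ?(energy_ge0 hbeta).
- apply/measurable_EFinP; apply: measurable_funTS.
  by do ?[apply: measurable_funD|apply: measurable_funM] => //; exact: (energy_measurable hbeta).
- by apply/measurable_EFinP; apply: measurable_funTS; exact: (energy_measurable hbeta).
- by move=> r /=; rewrite in_itv/= andbT => r0; rewrite lee_fin mul0r addr0; exact: h.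
Qed.

End kernel_estimates.

Lemma powR_small {R : realType} (a e : R) : 0 < a -> 0 < e -> exists2 K, 8 <= K & K `^ (- a) <= e.
Proof.
move=> a0 e0; have e1 : 0 < e^-1 by rewrite invr_gt0.
exists (8 + e^-1 `^ a^-1); first by rewrite lerDl powR_ge0.
have p8 : 0 < 8 + e^-1 `^ a^-1 by rewrite ltr_pwDl// powR_ge0.
have e2 : e^-1 = (e^-1 `^ a^-1) `^ a by rewrite -powRrM mulVf ?gt_eqF// powRr1// ltW.
have h : e^-1 <= (8 + e^-1 `^ a^-1) `^ a.
  rewrite {1}e2; apply: ge0_ler_powR; rewrite ?nnegrE ?powR_ge0 ?(ltW p8) ?(ltW a0)//.
  by rewrite lerDr.
by rewrite powRN -[leRHS]invrK lef_pV2 ?posrE// powR_gt0.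
Qed.

Lemma measurable_past {R : realType} (tau : R) :
  measurable_fun setT (fun r : measurableTypeR R => (r < tau)%R%:R : R).
Proof.
rewrite (_ : (fun _ => _) = fun r : measurableTypeR R => if (r < tau)%R then 1 else 0).
  by apply: measurable_fun_ifT => //; exact: measurable_fun_ltr.
by apply/funext => r; case: ifP.
Qed.

Section mild_increments.
Context {R : realType} {k : nat}.
Local Notation V := (R * 'rV[R]_k)%type.
Variable beta : R.
Hypothesis hbeta : 0 < beta < Num.min k%:R 2 \/ k = 1%N /\ beta = 1.
Hypothesis k0 : (0 < k)%N.
Variables (J : Type) (sigma : J -> V -> R) (S T : R).
Hypothesis csigma : forall j, continuous (sigma j).
Hypothesis S0 : 0 <= S.
Hypothesis bsigma : forall j t x, 0 <= t <= T -> `|sigma j (t, x)| <= S.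
Local Notation b := (beta / 2).
Local Notation h j := (mild_kernel (sigma j)).
Local Notation C0 := (noise_cut_cst hbeta S).

Let b0 : 0 < b. Proof. by case/andP: (beta_half hbeta). Qed.
Let b1 : b < 1. Proof. by case/andP: (beta_half hbeta). Qed.
Let cb : 0 < 1 - b. Proof. by rewrite subr_gt0. Qed.

Let powR_split (x : R) : 0 < x -> x * x `^ (- b) = x `^ (1 - b).
Proof. by move=> x0; rewrite powRD ?(gt_eqF x0) ?implybT// powRr1// ltW. Qed.

Let noise_cut1 j t s x y (rho A c l : R) : 0 < rho -> t <= T -> s <= T -> `|t - s| <= rho ^+ 2 ->
  sqn (x - y) <= k%:R * rho ^+ 2 -> 4 * rho ^+ 2 <= A -> 0 <= l ->
  (forall r, 0 <= r -> [\/ r <= Num.min t s - A, c - l < r < c + l | Num.max t s <= r]) ->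
  (noise_inner beta (fun p => h j t x p - h j s y p)%R (fun p => h j t x p - h j s y p)%R <=
   (C0 * (rho ^+ 2 * A `^ (- b) + l `^ (1 - b)))%:E)%E.
Proof.
move=> rho0 tT sT ts xy hA l0 hr.
have := @noise_cut R k beta hbeta (sigma j) S T (@csigma j) S0 (@bsigma j) (fun=> 1) t s x y rho A c l.
under [X in noise_inner beta X]eq_fun do rewrite mul1r.
under [X in noise_inner beta _ X]eq_fun do rewrite mul1r.
apply=> //; first by move=> r; rewrite normr1.
by move=> r /hr[]; [exact: Or42|exact: Or43|exact: Or44].
Qed.

Lemma mild_increment : exists2 C, 0 <= C & forall j t s x y (rho : R), 0 < rho -> t <= T -> s <= T ->
  `|t - s| <= rho ^+ 2 -> sqn (x - y) <= k%:R * rho ^+ 2 ->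
  (noise_inner beta (fun p => h j t x p - h j s y p)%R (fun p => h j t x p - h j s y p)%R <=
   (C * (rho ^+ 2) `^ (1 - b))%:E)%E.
Proof.
have c0 := noise_cut_cst_ge0 hbeta S.
exists (C0 * (4 `^ (- b) + 5 `^ (1 - b))).
  by rewrite mulr_ge0// addr_ge0 ?powR_ge0.
move=> j t s x y rho rho0 tT sT ts xy.
have r2 : 0 < rho ^+ 2 by rewrite exprn_gt0.
(* [4 * rho ^+ 2] is the least distance at which the kernel difference is controlled; all later
   times up to the larger endpoint lie in the window around the smaller one. *)
apply: le_trans (@noise_cut1 j t s x y rho (4 * rho ^+ 2) (Num.min t s) (5 * rho ^+ 2) rho0 tT sT ts xy _ _ _) _ => //.
- by rewrite mulr_ge0// ltW.
- move=> r r0; have [m mE] : exists m, m = Num.min t s by eexists.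
  have tm : Num.max t s <= m + rho ^+ 2.
    by move: ts; rewrite mE ler_norml ge_max => /andP[? ?]; case: (leP t s) => ?; apply/andP; split; lra.
  rewrite -mE; have [h1|h1] := leP r (m - 4 * rho ^+ 2); first exact: Or31.
  have [h2|h2] := leP (m + rho ^+ 2) r; first by apply: Or33; exact: le_trans tm h2.
  by apply: Or32; apply/andP; split; lra.
rewrite lee_fin -[leRHS]mulrA ler_wpM2l//.
move: (rho ^+ 2) r2 => u u0; rewrite !powRM ?(ltW u0)//.
by rewrite mulrCA powR_split// mulrDl.
Qed.

(** Removing the annulus leaves a window of width of order [rho^2 / K] around the centre, with
    relative cost [K^-(1 - b)], and the times before [tc - K rho^2], with relative cost [K^-b].
    After [tc + K rho^2] both kernels vanish, since t and s lie within [rho^2] of the centre. *)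
Lemma mild_increment_annulus (e : R) : 0 < e -> exists2 K, 8 <= K &
  forall j t s x y (rho tc : R), 0 < rho -> t <= T -> s <= T ->
  `|t - s| <= rho ^+ 2 -> `|t - tc| <= rho ^+ 2 -> `|s - tc| <= rho ^+ 2 ->
  sqn (x - y) <= k%:R * rho ^+ 2 ->
  (noise_inner beta
     (fun p => (1 - annulus tc (rho ^+ 2 / K) (K * rho ^+ 2) p.1) * (h j t x p - h j s y p))%R
     (fun p => (1 - annulus tc (rho ^+ 2 / K) (K * rho ^+ 2) p.1) * (h j t x p - h j s y p))%R <= (e * (rho ^+ 2) `^ (1 - b))%:E)%E.
Proof.
move=> e0; have c0 := noise_cut_cst_ge0 hbeta S.
have c1 : 0 < 4 * (C0 + 1) by rewrite mulr_gt0// ltr_wpDl.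
have e1 : 0 < e / (4 * (C0 + 1)) by rewrite divr_gt0.
have [K1 K18 hK1] := powR_small b0 e1.
have [K2 K28 hK2] := powR_small cb e1.
pose K := Num.max K1 K2; have K8 : 8 <= K by rewrite le_max K18.
have Kpos : 0 < K by apply: lt_le_trans K8.
have hmon a K' : 0 < a -> 0 < K' -> K' <= K -> K `^ (- a) <= K' `^ (- a).
  move=> a0 K'0 hK; rewrite !powRN lef_pV2 ?posrE ?powR_gt0//.
  by apply: ge0_ler_powR => //; rewrite ?nnegrE; exact: ltW.
have hb : K `^ (- b) <= e / (4 * (C0 + 1)).
  by apply: le_trans (hmon _ _ b0 _ _) hK1; [exact: lt_le_trans K18|rewrite le_max lexx].
have hcb : K `^ (- (1 - b)) <= e / (4 * (C0 + 1)).
  by apply: le_trans (hmon _ _ cb _ _) hK2; [exact: lt_le_trans K28|rewrite le_max lexx orbT].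
exists K; first exact: K8.
move=> j t s x y rho tc rho0 tT sT ts ttc stc xy.
pose chi := annulus tc (rho ^+ 2 / K) (K * rho ^+ 2).
have r2 : 0 < rho ^+ 2 by rewrite exprn_gt0.
have l0 : 0 < rho ^+ 2 / K by rewrite divr_gt0.
have u0 : 0 < K * rho ^+ 2 by rewrite mulr_gt0.
have mchi : measurable_fun setT (chi : measurableTypeR R -> R).
  apply: continuous_measurable_fun => r; have [g _ dg] := bump_alg_derive (bump_annulus tc (rho ^+ 2 / K) (K * rho ^+ 2)).
  by apply: differentiable_continuous; apply/derivable1_diffP; case: (dg r).
have lK : rho ^+ 2 / K <= rho ^+ 2 by rewrite ler_pdivrMr// ler_peMr// ?ltW//; lra.
have K8r : 8 * rho ^+ 2 <= K * rho ^+ 2 by rewrite ler_wpM2r// ltW.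
have := @noise_cut R k beta hbeta (sigma j) S T (@csigma j) S0 (@bsigma j) (fun r => 1 - chi r) t s x y rho (K * rho ^+ 2 / 2) tc (rho ^+ 2 / K).
move=> hh; apply: le_trans (hh _ _ rho0 tT sT ts xy _ _ _) _ => {hh}.
- exact: measurable_funB.
- by move=> r; have /andP[] := annulus_itv tc (rho ^+ 2 / K) (K * rho ^+ 2) r; rewrite -/chi ler_norml => ? ?; apply/andP; split; lra.
- by move: K8r; lra.
- exact: ltW.
- move=> r r0; have [hin|hin] := ltP `|r - tc| (rho ^+ 2 / K).
    by apply: Or43; move: hin; rewrite ltr_norml => /andP[? ?]; apply/andP; split; lra.
  have [hout|hout] := leP `|r - tc| (K * rho ^+ 2).
    by apply: Or41; rewrite /chi annulus1 ?subrr// hin.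
  move: ttc stc; rewrite !ler_norml => /andP[t1 t2] /andP[s1 s2].
  move: hout; rewrite ltr_normr => /orP[hr|hr].
    by apply: Or44; rewrite ge_max; apply/andP; split; lra.
  by apply: Or42; rewrite lerBrDr le_min; apply/andP; split; lra.
rewrite lee_fin; move: (rho ^+ 2) r2 => u r2.
rewrite (_ : K * u / 2 = K / 2 * u); last by field.
rewrite (_ : u / K = K^-1 * u); last by rewrite mulrC.
rewrite !powRM ?(ltW r2) ?invr_ge0 ?(ltW Kpos) ?divr_ge0 ?(ltW Kpos)//.
rewrite mulrCA powR_split// -mulrDl mulrA ler_wpM2r ?powR_ge0//.
have hV : K^-1 `^ (1 - b) = K `^ (- (1 - b)).
  by rewrite -(powR_inv1 (ltW Kpos)) -powRrM mulN1r.
have h2b : 2^-1 `^ (- b) <= (2 : R).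
  move: b0 b1; move: (beta / 2) => c' c'0 c'1.
  rewrite -(powR_inv1 (_ : 0 <= 2))// -powRrM mulN1r opprK -[leRHS]powRr1//.
  by apply: ler_powR; [rewrite ler1n|exact: ltW].
have h3 : 2^-1 `^ (- b) * K `^ (- b) <= 2 * (e / (4 * (C0 + 1))).
  by apply: ler_pM => //; exact: powR_ge0.
rewrite hV [K `^ _ * _]mulrC.
apply: (@le_trans _ _ (C0 * (2 * (e / (4 * (C0 + 1))) + e / (4 * (C0 + 1))))).
  by rewrite ler_wpM2l// lerD.
rewrite (_ : _ * _ = (C0 / (C0 + 1)) * (3 / 4 * e)); last first.
  by field; rewrite gt_eqF// ltr_wpDl.
have h4 : C0 / (C0 + 1) <= 1 by rewrite ler_pdivrMr ?ltr_wpDl// mul1r lerDl.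
have h5 : 0 <= 3 / 4 * e by rewrite mulr_ge0 ?(ltW e0).
by apply: le_trans (ler_wpM2r h5 h4) _; lra.
Qed.

(** Noise before [tau] stays at distance [delta] from the singularity of the kernels, so the energy
    of an increment is of order [rho^2] instead of [rho^(2 (1 - b))]. This is why the covariance
    with an earlier value is smoother than the field. *)
Lemma mild_increment_past (tau delta : R) : 0 < delta -> exists2 C, 0 <= C &
  forall j t s x y (rho : R), 0 < rho <= 1 -> t <= T -> s <= T -> `|t - s| <= rho ^+ 2 ->
  sqn (x - y) <= k%:R * rho ^+ 2 -> tau + delta <= t -> tau + delta <= s ->
  (noise_inner beta (fun p => (p.1 < tau)%R%:R * (h j t x p - h j s y p))%R
     (fun p => (p.1 < tau)%R%:R * (h j t x p - h j s y p))%R <= (C * rho ^+ 2)%:E)%E.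
Proof.
move=> d0; have c0 := noise_cut_cst_ge0 hbeta S; have [C1 C10 hC1] := mild_increment.
have meta : measurable_fun setT (fun r : measurableTypeR R => (r < tau)%R%:R : R).
  exact: measurable_past.
exists (C0 * delta `^ (- b) + 4 * C1 / delta).
  by rewrite addr_ge0 ?mulr_ge0 ?invr_ge0 ?powR_ge0 ?(ltW d0).
move=> j t s x y rho /andP[rho0 rho1] tT sT ts xy ht hs.
have eta1 r : `|(r < tau)%R%:R : R| <= 1 by case: (r < tau); rewrite ?normr1// normr0.
have r2 : 0 < rho ^+ 2 by rewrite exprn_gt0.
(* When rho is not small against [delta], the general increment bound is enough, multiplied by the
   factor [4 rho^2 / delta], which exceeds 1. *)
have [h4|h4] := leP (4 * rho ^+ 2) delta.
  have := @noise_cut R k beta hbeta (sigma j) S T (@csigma j) S0 (@bsigma j) (fun r => (r < tau)%R%:R) t s x y rho delta 0 0.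
  move=> hh; apply: le_trans (hh meta eta1 rho0 tT sT ts xy h4 (lexx 0) _) _.
    move=> r r0; have [rt|rt] := ltP r tau; last by apply: Or41.
    by apply: Or42; rewrite lerBrDr le_min; apply/andP; split; lra.
  rewrite lee_fin powR0 ?gt_eqF// addr0 [rho ^+ 2 * _]mulrC mulrA ler_wpM2r ?(ltW r2)// lerDl.
  by rewrite mulr_ge0 ?invr_ge0 ?mulr_ge0 ?(ltW d0).
have sd := slicesB (slices_mild_kernel (@csigma j) S0 (@bsigma j) x tT) (slices_mild_kernel (@csigma j) S0 (@bsigma j) y sT).
apply: le_trans (noise_energyM_le hbeta meta eta1 sd) _.
apply: le_trans (hC1 j t s x y rho rho0 tT sT ts xy) _; rewrite lee_fin.
have p1 : (rho ^+ 2) `^ (1 - b) <= 1.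
  have e1 : (1 : R) `^ (1 - b) = 1 by rewrite powR1.
  rewrite -[leRHS]e1; apply: ge0_ler_powR; rewrite ?nnegrE ?(ltW cb) ?(ltW r2)//.
  by rewrite expr_le1// ltW.
apply: (@le_trans _ _ C1); first by rewrite ler_piMr.
rewrite mulrDl; apply: (@le_trans _ _ (4 * C1 / delta * rho ^+ 2)); last first.
  by rewrite lerDr mulr_ge0 ?(ltW r2)// mulr_ge0 ?powR_ge0.
rewrite (_ : 4 * C1 / delta * rho ^+ 2 = C1 * (4 * rho ^+ 2 / delta)); last by ring.
by rewrite ler_peMr// ler_pdivlMr// mul1r ltW.
Qed.

End mild_increments.

Section mild_overlap.
Context {R : realType} {k : nat}.
Local Notation V := (R * 'rV[R]_k)%type.
Variable beta : R.
Hypothesis hbeta : 0 < beta < Num.min k%:R 2 \/ k = 1%N /\ beta = 1.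
Hypothesis k0 : (0 < k)%N.
Variables (J : Type) (sigma : J -> V -> R) (S T : R).
Hypothesis csigma : forall j, continuous (sigma j).
Hypothesis S0 : 0 <= S.
Hypothesis bsigma : forall j t x, 0 <= t <= T -> `|sigma j (t, x)| <= S.
Local Notation b := (beta / 2).
Local Notation h j := (mild_kernel (sigma j)).

Let b0 : 0 < b. Proof. by case/andP: (beta_half hbeta). Qed.
Let b1 : b < 1. Proof. by case/andP: (beta_half hbeta). Qed.

(** Both kernels are nonnegative, and before time [t0 / 4] the one of [(t, x)] is at least a
    constant times the one of [(t0 / 2, x0)]. By [energy_polar] this gives a uniform gap between the
    norms of sum and difference, that is a positive covariance. *)
Lemma mild_overlap (t0 : R) (x0 : 'rV[R]_k) : 0 < t0 -> t0 + 1 <= T ->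
  (exists2 c, 0 < c & forall j t x, 0 <= t <= T -> c <= sigma j (t, x)) ->
  exists2 c, 0 < c & forall j t x, t0 <= t <= t0 + 1 -> sqn (x - x0) <= k%:R ->
  (noise_inner beta (fun p => h j t x p - h j (t0 / 2) x0 p)%R (fun p => h j t x p - h j (t0 / 2) x0 p)%R + c%:E <=
   noise_inner beta (fun p => h j t x p + h j (t0 / 2) x0 p)%R (fun p => h j t x p + h j (t0 / 2) x0 p)%R)%E.
Proof.
move=> t00 tT [s0 s00 hs].
pose tau := t0 / 2; have tau0 : 0 < tau by rewrite divr_gt0.
have tauE : t0 = 2 * tau by rewrite /tau; field.
have tauT : tau <= T by lra.
pose eta (r : R) : R := (r < tau / 2)%R%:R.
have meta : measurable_fun setT (eta : measurableTypeR R -> R).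
  exact: measurable_past.
have sg j := slices_mild_kernel (@csigma j) S0 (@bsigma j) x0 tauT.
have sg' j := slicesM meta (sg j).
have sig0 j r y : 0 <= r <= T -> 0 <= sigma j (r, y) by move=> /(hs j)-/(_ y); apply: le_trans; exact: ltW.
pose amp (u : R) : R := (4 * pi) `^ (- (k%:R / 2)) * u `^ (- (k%:R / 2)).
have amp_gt0 u : 0 < u -> 0 < amp u by move=> u0; rewrite mulr_gt0 ?powR_gt0// mulr_gt0// pi_gt0.
have amp_mon u v : 0 < u -> u <= v -> amp v <= amp u.
  move=> u0 uv; rewrite ler_wpM2l ?powR_ge0// !powRN lef_pV2 ?posrE ?powR_gt0//; last exact: lt_le_trans uv.
  by apply: ge0_ler_powR; rewrite ?nnegrE ?divr_ge0 ?(ltW u0) ?(le_trans (ltW u0) uv).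
pose a := (2 * tau)^-1; have a0 : 0 < a by rewrite invr_gt0 mulr_gt0.
pose c1 := amp tau * s0; have c10 : 0 < c1 by rewrite mulr_gt0// amp_gt0.
have kap0 := sform_gauss_gt0 hbeta k0 x0 a0.
pose kap := c1 ^+ 2 * sform beta (gauss a x0) (gauss a x0).
have kap_gt0 : 0 < kap by rewrite mulr_gt0// exprn_gt0.
have hker j t x r y : 0 <= r < t -> t <= T ->
    h j t x (r, y) = amp (t - r) * gauss (4 * (t - r))^-1 x y * sigma j (r, y).
  move=> rt tT'; have /andP[r0 r1] := rt; rewrite mild_kernelE// heat_kernelE ?subr_gt0//.
  by rewrite /gauss /amp /heat_amp sqnB [sqn _ / _]mulrC.
have en_low j r : 0 <= r < tau / 2 -> kap <= energy beta (fun p => eta p.1 * h j tau x0 p) r.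
  move=> /andP[r0 rt]; rewrite (energyM hbeta eta r (sg j)) /eta rt expr1n mul1r /kap.
  have g1 := gdom_gauss x0 a0; have [_ sl] := sg j.
  have -> : c1 ^+ 2 * sform beta (gauss a x0) (gauss a x0) =
      sform beta (fun y => c1 * gauss a x0 y) (fun y => c1 * gauss a x0 y).
    by rewrite (sformZl hbeta)//; [rewrite (sformZr hbeta)//; ring|exact: gdomZ].
  have low y : c1 * gauss a x0 y <= h j tau x0 (r, y).
    rewrite hker//; last by apply/andP; split=> //; lra.
    rewrite /c1 -mulrA [s0 * _]mulrC mulrA; apply: ler_pM.
    - by rewrite mulr_ge0 ?(ltW (gauss_gt0 _ _ _)) ?(ltW (amp_gt0 _ tau0)).
    - exact: ltW.
    - apply: ler_pM; rewrite ?(ltW (gauss_gt0 _ _ _)) ?(ltW (amp_gt0 _ tau0))//.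
        by apply: amp_mon; lra.
      rewrite /gauss ler_expR lerN2 ler_wpM2r ?sqn_ge0// /a lef_pV2 ?posrE; lra.
    - by apply: hs; apply/andP; split => //; lra.
  apply: (sform_le hbeta) => //; try exact: gdomZ.
  by move=> y y'; apply: ler_pM => //; rewrite mulr_ge0 ?(ltW c10)// ltW// gauss_gt0.
have q_low j : ((kap * (tau / 2))%:E <= noise_inner beta (fun p => eta p.1 * h j tau x0 p)%R (fun p => eta p.1 * h j tau x0 p)%R)%E.
  rewrite (noise_energy hbeta (sg' j)).
  have mD : measurable (`[0%R, (tau / 2)%R[%classic : set (measurableTypeR R)) by exact: measurable_itv.
  have mH : measurable (`[0%R, +oo[%classic : set (measurableTypeR R)) by exact: measurable_itv.
  have mE D : measurable_fun D (fun r : measurableTypeR R => (energy beta (fun p => eta p.1 * h j tau x0 p) r)%:E).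
    by apply/measurable_EFinP; apply: measurable_funTS; exact: (energy_measurable hbeta).
  apply: (@le_trans _ _ (\int[@lebesgue_measure R]_(r in `[0%R, (tau / 2)%R[) (energy beta (fun p => eta p.1 * h j tau x0 p)%R r)%:E)%E); last first.
    apply: ge0_subset_integral => //.
      by move=> r _; rewrite lee_fin (energy_ge0 hbeta).
    by move=> r /=; rewrite !in_itv/= => /andP[-> _].
  apply: (@le_trans _ _ (\int[@lebesgue_measure R]_(r in `[0%R, (tau / 2)%R[) (cst kap%:E r))%E); last first.
    apply: ge0_le_integral => //; first by move=> r _; rewrite lee_fin ltW.
    by move=> r /=; rewrite in_itv/= => hr; rewrite lee_fin en_low.
  rewrite integral_cst// EFinM; apply: lee_wpmul2l; first by rewrite lee_fin ltW.
  apply: (@le_trans _ _ (@lebesgue_measure R [set` `[0%R, (tau / 2)%R[])); last exact: lexx.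
  by rewrite lebesgue_measure_itv/= lte_fin divr_gt0// oppr0 addr0.
(* A ratio of extreme amplitudes times the cost of moving the centre from x to [x0]. The squared
   distance of y to x is at most twice that to [x0] plus twice that of x to [x0]: the first part is
   absorbed by [t - r >= 2 (tau - r)], the second costs at most [k / (2 tau)] in the exponent. *)
pose c2 := amp (t0 + 1) / amp (tau / 2) * expR (- (k%:R / (2 * tau))).
have c20 : 0 < c2.
  by rewrite mulr_gt0 ?expR_gt0// divr_gt0 ?amp_gt0//; lra.
exists (4 * c2 * (kap * (tau / 2))).
  by apply: (mulr_gt0 (mulr_gt0 _ c20) (mulr_gt0 kap_gt0 (divr_gt0 tau0 _))).
move=> j t x /andP[tt0 tt1] hx; have tT' : t <= T by lra.
have sh := slices_mild_kernel (@csigma j) S0 (@bsigma j) x tT'.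
have h0 t' x' r y : t' <= T -> 0 <= h j t' x' (r, y).
  move=> t'T; have [rt|rt] := boolP (0 <= r < t'); last by rewrite mild_kernel0.
  rewrite hker// mulr_ge0//; last by apply: sig0; case/andP: rt => -> rt /=; lra.
  by rewrite mulr_ge0 ?(ltW (gauss_gt0 _ _ _))// ltW// amp_gt0// subr_gt0; case/andP: rt.
rewrite EFinM; apply: (@le_trans _ _ (noise_inner beta (fun p => h j t x p - h j tau x0 p)%R (fun p => h j t x p - h j tau x0 p)%R +
   (4 * c2)%:E * noise_inner beta (fun p => eta p.1 * h j tau x0 p)%R (fun p => eta p.1 * h j tau x0 p)%R)%E).
  by apply: leeD2l; apply: lee_wpmul2l => //; rewrite lee_fin mulr_ge0// ltW.
apply: (noise_energy_sum_le hbeta) => //; first by rewrite mulr_ge0// ltW.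
- exact: slicesD.
- exact: slicesB.
move=> r r0; rewrite (energyM hbeta eta r (sg j)) /eta.
have [rt|rt] := ltP r (tau / 2); last first.
  rewrite expr0n/= mul0r mulr0 addr0.
  have := energy_polar hbeta (r := r) sh (sg j) (lexx 0).
  rewrite mulr0 mul0r addr0; apply => y; [exact: h0|by rewrite mul0r h0].
rewrite expr1n mul1r; apply: (energy_polar hbeta) => //; first exact: ltW.
  by move=> y; exact: h0.
move=> y; rewrite !hker//; try by apply/andP; split=> //; lra.
rewrite mulrA ler_wpM2r//; first by apply: sig0; apply/andP; split => //; lra.
have At : amp (t0 + 1) <= amp (t - r) by apply: amp_mon; lra.
have Atau : amp (tau - r) <= amp (tau / 2) by apply: amp_mon; lra.
have Ah : 0 < amp (tau / 2) by apply: amp_gt0; rewrite divr_gt0.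
have gle : expR (- (k%:R / (2 * tau))) * gauss (4 * (tau - r))^-1 x0 y <= gauss (4 * (t - r))^-1 x y.
  rewrite /gauss -expRD ler_expR -opprD lerN2.
  have tri : sqn (y - x) <= 2 * sqn (y - x0) + 2 * sqn (x - x0).
    rewrite [sqn (x - x0)]sqnB /sqn !mulr_sumr -big_split/=; apply: ler_sum => i _; rewrite !mxE.
    by have := sqr_ge0 ((y ord0 i - x0 ord0 i) - (x0 ord0 i - x ord0 i)); lra.
  have u0 : 0 < 4 * (t - r) by lra.
  have i1 : (4 * (t - r))^-1 <= (8 * (tau - r))^-1 by rewrite lef_pV2 ?posrE; lra.
  have i2 : (4 * (t - r))^-1 <= (4 * tau)^-1 by rewrite lef_pV2 ?posrE; lra.
  have iv : 0 <= (4 * (t - r))^-1 by rewrite invr_ge0 ltW.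
  apply: le_trans (ler_wpM2l iv tri) _; rewrite mulrDr addrC; apply: lerD.
    apply: (@le_trans _ _ ((4 * tau)^-1 * (2 * k%:R))).
      by apply: ler_pM => //; rewrite ?mulr_ge0 ?sqn_ge0// ler_wpM2l.
    by rewrite le_eqVlt; apply/orP; left; apply/eqP; field; rewrite gt_eqF.
  apply: (@le_trans _ _ ((8 * (tau - r))^-1 * (2 * sqn (y - x0)))).
    by rewrite ler_wpM2r// mulr_ge0 ?sqn_ge0.
  by rewrite le_eqVlt; apply/orP; left; apply/eqP; field; rewrite gt_eqF//; lra.
have fin (A B E p g P G : R) : 0 < B -> 0 <= A -> 0 <= p -> p <= B -> A <= P -> 0 <= E * g ->
    E * g <= G -> A / B * E * (p * g) <= P * G.
  move=> B0 A0 p0 pB AP Eg0 EgG; rewrite (_ : _ * _ = A * (p / B) * (E * g)); last by ring.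
  have pB0 : 0 <= p / B by rewrite divr_ge0// ltW.
  apply: ler_pM => //; first exact: mulr_ge0.
  by apply: le_trans AP; rewrite ler_piMr// ler_pdivrMr// mul1r.
apply: fin => //.
- by apply/ltW/amp_gt0; lra.
- by apply/ltW/amp_gt0; lra.
- by rewrite mulr_ge0 ?expR_ge0// ltW// gauss_gt0.
Qed.

End mild_overlap.

(** * Dyadic words *)

Section words.
Context {R : realType} {k : nat}.

(* A letter picks one of the 4 time quarters and one of the 2^k spatial halves of a box. *)
Definition letter : finType := ('I_4 * {ffun 'I_k -> bool})%type.

Fixpoint tpos (u : seq letter) : R :=
  if u is a :: u' then ((val a.1)%:R + tpos u') / 4 else 0.

Fixpoint xpos (u : seq letter) : 'rV[R]_k :=
  if u is a :: u' then \row_i (((a.2 i)%:R + xpos u' ord0 i) / 2) else 0.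

Lemma card_letter : #|letter| = (4 * 2 ^ k)%N.
Proof. by rewrite card_prod card_ord card_ffun card_bool card_ord. Qed.

Lemma tpos_itv u : 0 <= tpos u <= 1.
Proof.
elim: u => [|[a c] u /andP[h0 h1]] /=; first by rewrite lexx ler01.
have a0 : 0 <= (val a)%:R :> R by exact: ler0n.
have a3 : (val a)%:R <= 3 :> R by rewrite ler_nat -ltnS ltn_ord.
by apply/andP; split; lra.
Qed.

Lemma xpos_itv u i : 0 <= xpos u ord0 i <= 1.
Proof.
elim: u => [|[a c] u /andP[h0 h1]] /=; first by rewrite mxE lexx ler01.
by rewrite mxE /=; case: (c i) => /=; apply/andP; split; lra.
Qed.

Lemma tpos_cat u v : tpos (u ++ v) = tpos u + tpos v * (2^-1 ^+ size u) ^+ 2.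
Proof.
elim: u => [|a u IH] /=; first by rewrite add0r expr0 expr1n mulr1.
by rewrite IH [2^-1 ^+ _.+1]exprS; field.
Qed.

Lemma xpos_cat u v i : xpos (u ++ v) ord0 i = xpos u ord0 i + xpos v ord0 i * 2^-1 ^+ size u.
Proof.
elim: u => [|a u IH] /=; first by rewrite mxE add0r expr0 mulr1.
by rewrite !mxE IH exprS; field.
Qed.

Lemma tpos_close u v w : `|tpos (u ++ v) - tpos (u ++ w)| <= (2^-1 ^+ size u) ^+ 2.
Proof.
rewrite !tpos_cat (_ : _ - _ = (tpos v - tpos w) * (2^-1 ^+ size u) ^+ 2); last by ring.
rewrite normrM [`|_ ^+ 2|]ger0_norm ?sqr_ge0// ler_piMl ?sqr_ge0//.
by have /andP[? ?] := tpos_itv v; have /andP[? ?] := tpos_itv w; rewrite ler_norml; apply/andP; split; lra.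
Qed.

Lemma xpos_close u v w : sqn (xpos (u ++ v) - xpos (u ++ w)) <= k%:R * (2^-1 ^+ size u) ^+ 2.
Proof.
rewrite /sqn; apply: le_trans (_ : \sum_(i < k) (2^-1 ^+ size u) ^+ 2 <= _); last first.
  by rewrite sumr_const card_ord mulr_natl.
apply: ler_sum => i _; rewrite !mxE !xpos_cat.
rewrite (_ : _ - _ = (xpos v ord0 i - xpos w ord0 i) * 2^-1 ^+ size u); last by ring.
rewrite exprMn ler_piMl ?sqr_ge0// -real_normK ?num_real// expr_le1//.
by have /andP[? ?] := xpos_itv v i; have /andP[? ?] := xpos_itv w i; rewrite ler_norml; apply/andP; split; lra.
Qed.

Lemma word_dense L (t : R) (x : 'rV[R]_k) : 0 <= t <= 1 -> (forall i, 0 <= x ord0 i <= 1) ->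
  exists u, [/\ size u = L, `|t - tpos u| <= 2^-1 ^+ L & forall i, `|x ord0 i - xpos u ord0 i| <= 2^-1 ^+ L].
Proof.
elim: L t x => [|L IH] t x t01 x01.
  exists [::]; split => //= [|i]; rewrite ?mxE expr0 subr0 ger0_norm//.
  - by case/andP: t01.
  - by case/andP: t01.
  - by case/andP: (x01 i).
  - by case/andP: (x01 i).
have [a ha] : exists a : 'I_4, 0 <= 4 * t - (val a)%:R <= 1.
  move: t01 => /andP[t0 t1].
  have [h1|h1] := leP (4 * t) 1; first by exists ord0; rewrite subr0 h1 andbT mulr_ge0.
  have [h2|h2] := leP (4 * t) 2.
    by exists (Ordinal (isT : (1 < 4)%N)) => /=; apply/andP; split; lra.
  have [h3|h3] := leP (4 * t) 3.
    by exists (Ordinal (isT : (2 < 4)%N)) => /=; apply/andP; split; lra.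
  by exists (Ordinal (isT : (3 < 4)%N)) => /=; apply/andP; split; lra.
pose c := [ffun i : 'I_k => 1 < 2 * x ord0 i].
have [i|u [su ht hx]] := IH (4 * t - (val a)%:R) (\row_i (2 * x ord0 i - (c i)%:R)) ha.
  rewrite mxE ffunE; have /andP[? ?] := x01 i.
  by have [?|?] := ltP 1 (2 * x ord0 i); rewrite /=; apply/andP; split; lra.
have e : 2^-1 ^+ L.+1 = 2^-1 ^+ L / 2 :> R by rewrite exprSr.
have e0 : 0 <= 2^-1 ^+ L :> R by rewrite exprn_ge0.
exists ((a, c) :: u); split => /=; first by rewrite su.
  by move: ht; rewrite !ler_norml e => /andP[? ?]; apply/andP; split; lra.
by move=> i; have := hx i; rewrite !mxE /= !ler_norml e => /andP[? ?]; apply/andP; split; lra.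
Qed.

End words.
Arguments letter : clear implicits.

(** The sum of nonnegative constants serves as a common upper bound. *)
Lemma exists_uniform {R : realType} d (Q : 'I_d -> R -> Prop) :
  (forall j c c', c <= c' -> Q j c -> Q j c') -> (forall j, exists2 c, 0 <= c & Q j c) ->
  exists2 c, 0 <= c & forall j, Q j c.
Proof.
move=> mon h; have /choice[c hc] : forall j, exists c, 0 <= c /\ Q j c.
  by move=> j; have [c c0 qc] := h j; exists c.
exists (\sum_j c j); first by apply: sumr_ge0 => j _; case: (hc j).
move=> j; have [c0 qc] := hc j; apply: mon qc; rewrite (bigD1 j)//= lerDl.
by apply: sumr_ge0 => i _; case: (hc i).
Qed.

(** * Density bound for the reference value *)

Section gaussian_density.
Context d (T : measurableType d) (R : realType) (P : probability T R).
Local Notation mu := (@lebesgue_measure R).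
Local Notation c := ((Num.sqrt (pi *+ 2))^-1 : R).

Let c0 : 0 < c. Proof. by rewrite invr_gt0 sqrtr_gt0 mulrn_wgt0 ?pi_gt0. Qed.

Let gauss_cst : R := expR 1 * (c * (Num.sqrt pi * (2 * Num.sqrt (gmoment R 1)))).

Let gauss_cst_ge0 : 0 <= gauss_cst.
Proof. by rewrite !mulr_ge0 ?expR_ge0 ?sqrtr_ge0 ?(ltW c0). Qed.

(** The indicator of the interval is at most e times a Gaussian of width r around a, whose mean
    under a normal law is at most of order r divided by the deviation, uniformly in a. *)
Let gaussian_density (Y : T -> R) (a r : R) : centered_gaussian P Y -> 4^-1 <= ip P Y Y -> 0 < r ->
  (P [set w | (`|Y w - a| <= r)%R] <= (gauss_cst * r)%:E)%E.
Proof.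
move=> cY hY r0; have [mY _] := cY; have [LY _ _ _] := centered_gaussian_props cY.
have [s s0 Ys] := centered_gaussian_integral cY.
have g1 := gmoment1_gt0 R.
have ipE : ip P Y Y = s ^+ 2 * gmoment R 1.
  apply: EFin_inj; rewrite -(ip_sqrE LY) (Ys (fun x => x ^+ 2)); last 2 first.
  - exact: exprn_continuous.
  - by move=> x; exact: sqr_ge0.
  transitivity (\int[mu]_x ((c * s ^+ 2)%:E * (x ^+ 2 * gauss0 x)%:E))%E.
    by apply: eq_integral => x _; rewrite -EFinM; congr EFin; ring.
  rewrite integralZl//; last exact: (@integrable_pow_gauss0 R 2).
  have ig := integrable_fin_num measurableT (@integrable_pow_gauss0 R 2).
  rewrite /gmoment [s ^+ 2 * _]mulrA [s ^+ 2 * c]mulrC [in RHS]EFinM /Rintegral fineK//.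
have sg : 2^-1 <= s * Num.sqrt (gmoment R 1).
  rewrite -(@ler_pXn2r _ 2) ?nnegrE ?mulr_ge0 ?sqrtr_ge0 ?invr_ge0//.
  rewrite exprMn sqr_sqrtr ?(ltW g1)// -ipE; apply: le_trans hY.
  by rewrite le_eqVlt; apply/orP; left; apply/eqP; field.
have sp : 0 < s.
  rewrite lt_neqAle s0 andbT eq_sym; apply/eqP => s00.
  by move: sg; rewrite s00 mul0r leNgt invr_gt0 ltr0n.
have sinv : s^-1 <= 2 * Num.sqrt (gmoment R 1).
  by rewrite -[leLHS]mulr1 mulrC -ler_pdivlMr ?invr_gt0// invrK; lra.
pose f (y : R) : R := expR (- ((y - a) / r) ^+ 2).
have cf : continuous f.
  move=> y; apply: continuous_comp; last exact: continuous_expR.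
  apply: cvgN; apply: (@continuous_comp _ _ _ (fun y => (y - a) / r) (fun z => z ^+ 2)); last exact: exprn_continuous.
  by apply: cvgM; [apply: cvgB; [exact: cvg_id|exact: cvg_cst]|exact: cvg_cst].
have f0 y : 0 <= f y by exact: expR_ge0.
have mfY : measurable_fun setT (fun w => f (Y w)).
  by apply: measurableT_comp => //; exact: continuous_measurable_fun.
have iE : (\int[P]_w (f (Y w))%:E <= (c * (Num.sqrt pi * (r / s)))%:E)%E.
  rewrite (Ys f cf f0).
  apply: (@le_trans _ _ (\int[mu]_x (c%:E * (expR (- ((s / r) ^+ 2 * (x - a / s) ^+ 2)))%:E))%E).
    apply: ge0_le_integral => //.
    - by move=> x _; rewrite lee_fin; exact: (mulr_ge0 (ltW c0) (mulr_ge0 (f0 _) (expR_ge0 _))).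
    - apply/measurable_EFinP; apply: measurable_funM => //; apply: measurable_funM; last exact: measurable_gauss0.
      by apply: measurableT_comp; [exact: continuous_measurable_fun|exact: measurable_funM].
    - apply: emeasurable_funM => //; apply/measurable_EFinP; apply: measurableT_comp => //.
      apply: measurableT_comp => //; apply: measurable_funM => //; apply: measurable_funX.
      exact: measurable_funB.
    move=> x _; rewrite -EFinM lee_fin; apply: (ler_wpM2l (ltW c0)).
    apply: (@le_trans _ _ (f (s * x))).
      by rewrite ler_piMr// /gauss0 -[leRHS]expR0 ler_expR oppr_le0 mulr_ge0 ?sqr_ge0// invr_ge0.
    rewrite /f -exprMn (_ : s / r * (x - a / s) = (s * x - a) / r)//.
    by field; rewrite !gt_eqF.
  rewrite ge0_integralZl//.
  - rewrite integral_gauss; last by rewrite exprn_gt0// divr_gt0.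
    rewrite -EFinM lee_fin; apply: (ler_wpM2l (ltW c0)).
    by rewrite sqrtrM ?pi_ge0// -exprVn sqrtr_sqr invf_div ger0_norm// divr_ge0// ltW.
  - apply/measurable_EFinP; apply: measurableT_comp => //.
    apply: measurableT_comp => //; apply: measurable_funM => //; apply: measurable_funX.
    exact: measurable_funB.
have mS : measurable [set w | (`|Y w - a| <= r)%R].
  rewrite (_ : [set w | _] = (fun w => `|Y w - a|) @^-1` `]-oo, r]%classic).
    rewrite -[X in measurable X]setTI; apply: (_ : measurable_fun setT (fun w => `|Y w - a|)) => //.
    by apply: measurableT_comp => //; exact: measurable_funB.
  by apply/seteqP; split => w /=; rewrite in_itv.
apply: (@le_trans _ _ (\int[P]_w ((expR 1)%:E * (f (Y w))%:E))%E).
  rewrite -[leLHS]mul1e -(integral_cst P mS 1%E).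
  apply: (@le_trans _ _ (\int[P]_(w in [set w | (`|Y w - a| <= r)%R]) ((expR 1)%:E * (f (Y w))%:E))%E).
    apply: ge0_le_integral => //.
      apply: measurable_funTS; apply: emeasurable_funM => //; exact/measurable_EFinP.
    move=> w /= hw; rewrite -EFinM lee_fin /f -expRD -[leLHS]expR0 ler_expR subr_ge0.
    rewrite -real_normK ?num_real// expr_le1// normrM normfV (gtr0_norm r0).
    by rewrite ler_pdivrMr// mul1r.
  have mg : measurable_fun setT (fun w => (expR 1)%:E * (f (Y w))%:E)%E.
    by apply: emeasurable_funM => //; exact/measurable_EFinP.
  by apply: ge0_subset_integral => // w _; rewrite -EFinM lee_fin mulr_ge0// expR_ge0.
rewrite ge0_integralZl//.
- apply: le_trans (lee_wpmul2l _ iE) _; first by rewrite lee_fin expR_ge0.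
  rewrite -EFinM lee_fin /gauss_cst -[leRHS]mulrA; apply: (ler_wpM2l (expR_ge0 _)).
  rewrite -[leRHS]mulrA; apply: (ler_wpM2l (ltW c0)).
  rewrite -[leRHS]mulrA; apply: (ler_wpM2l (sqrtr_ge0 _)).
  by rewrite mulrC ler_wpM2r// ltW.
- exact/measurable_EFinP.
- by move=> w _; rewrite lee_fin.
Qed.

Lemma near_gauss_density : exists2 C, 0 <= C & forall (X : T -> R) (a r : R),
  near_gauss P X -> ip P X X = 1 -> 0 <= r ->
  (P [set w | (`|X w - a| <= r)%R] <= (C * r)%:E)%E.
Proof.
exists (2 * gauss_cst + 1); first by rewrite addr_ge0// mulr_ge0.
move=> X a r nX X1 r0; have [LX _ _ _] := near_gauss_props nX; have [mX hX] := nX.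
have mS (Z : T -> R) (b t : R) : measurable_fun setT Z -> measurable [set w | (`|Z w - b| <= t)%R].
  move=> mZ; rewrite (_ : [set w | _] = (fun w => `|Z w - b|) @^-1` `]-oo, t]%classic).
    rewrite -[X in measurable X]setTI; apply: (_ : measurable_fun setT (fun w => `|Z w - b|)) => //.
    by apply: measurableT_comp => //; exact: measurable_funB.
  by apply/seteqP; split => w /=; rewrite in_itv.
suff pos t : 0 < t -> (P [set w | (`|X w - a| <= t)%R] <= ((2 * gauss_cst + 1) * t)%:E)%E.
  have C0 : 0 < 2 * gauss_cst + 1 by rewrite ltr_wpDl// mulr_ge0.
  apply/lee_addgt0Pr => e e0.
  have t0 : 0 < r + e / (2 * gauss_cst + 1) by rewrite ltr_wpDl// divr_gt0.
  apply: (@le_trans _ _ (P [set w | (`|X w - a| <= r + e / (2 * gauss_cst + 1))%R])).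
    apply: le_measure; rewrite ?inE; try exact: mS.
    by move=> w /= h; apply: le_trans h _; rewrite lerDl divr_ge0// ltW.
  apply: le_trans (pos _ t0) _; rewrite -EFinD lee_fin mulrDr lerD2l mulrC divfK// gt_eqF//.
(* With squared error [t ^+ 3], Chebyshev's inequality at level t costs only t; the cap 1/4 keeps
   the variance of the approximating Gaussian at least 1/4. *)
move=> t0; pose e := Num.min 4^-1 (t ^+ 3).
have e0 : 0 < e by rewrite lt_min invr_gt0 exprn_gt0// andbT.
have [Y [cY LD iD]] := hX e e0.
have [LY _ _ _] := centered_gaussian_props cY; have [mY _] := cY.
have hY : 4^-1 <= ip P Y Y.
  have := ip_sqrD_le LY LD.
  rewrite (_ : (fun w => Y w + (X w - Y w)) = X); last by apply/funext => w; rewrite addrC subrK.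
  rewrite X1; have e4 : e <= 4^-1 by rewrite ge_min lexx.
  by clearbody e; lra.
apply: (@le_trans _ _ (P ([set w | (`|Y w - a| <= 2 * t)%R] `|` [set w | (t <= `|X w - Y w|)%R]))).
  have mD : measurable [set w | (t <= `|X w - Y w|)%R].
    rewrite (_ : [set w | _] = (fun w => `|X w - Y w|) @^-1` `[t, +oo[%classic).
      rewrite -[X in measurable X]setTI; apply: (_ : measurable_fun setT (fun w => `|X w - Y w|)) => //.
      by apply: measurableT_comp => //; exact: measurable_funB.
    by apply/seteqP; split => w /=; rewrite in_itv/= andbT.
  apply: le_measure; rewrite ?inE; [exact: mS|by apply: measurableU => //; exact: mS|].
  move=> w /= h; have [h1|h1] := leP t `|X w - Y w|; [by right|left].
  rewrite (_ : Y w - a = (X w - a) - (X w - Y w)); last by ring.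
  by apply: le_trans (ler_normB _ _) _; lra.
have mD : measurable [set w | (t <= `|X w - Y w|)%R].
  rewrite (_ : [set w | _] = (fun w => `|X w - Y w|) @^-1` `[t, +oo[%classic).
    rewrite -[X in measurable X]setTI; apply: (_ : measurable_fun setT (fun w => `|X w - Y w|)) => //.
    by apply: measurableT_comp => //; exact: measurable_funB.
  by apply/seteqP; split => w /=; rewrite in_itv/= andbT.
apply: le_trans (measureU2 _ (mS _ _ _ mY) mD) _.
have -> : (2 * gauss_cst + 1) * t = 2 * gauss_cst * t + t by ring.
rewrite [X in (_ <= X)%E]EFinD; apply: leeD.
  have t20 : 0 < 2 * t by rewrite mulr_gt0.
  apply: le_trans (gaussian_density a cY hY t20) _.
  by rewrite lee_fin le_eqVlt; apply/orP; left; apply/eqP; ring.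
apply: le_trans (chebyshev_L2 LD t0) _; rewrite lee_fin ler_pdivrMr ?exprn_gt0//.
by apply: le_trans iD _; rewrite -exprS ge_min lexx orbT.
Qed.

End gaussian_density.

(** * The solution on a box *)

Lemma half_powR {R : realType} (c : R) : 0 < c < 1 -> 2^-1 < 2^-1 `^ c < 1.
Proof.
move=> /andP[c0 c1]; have l2 : 0 < ln (2 : R) by rewrite ln_gt0// ltr1n.
have -> : 2^-1 `^ c = expR (- (c * ln 2)) :> R.
  by rewrite /powR invr_eq0 pnatr_eq0/= lnV ?posrE// mulrN.
have {1}-> : 2^-1 = expR (- ln 2) :> R by rewrite expRN lnK ?posrE.
rewrite ltr_expR -[X in _ && (_ < X)]expR0 ltr_expR.
by apply/andP; split; nra.
Qed.

Lemma powR_scale {R : realType} (x c : R) n : 0 <= x ->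
  ((x ^+ n) ^+ 2) `^ c = (x `^ c) ^+ n ^+ 2.
Proof.
move=> x0; have e (y : R) : y ^+ n ^+ 2 = y ^+ (n * 2) by rewrite -exprM.
rewrite !e -(powR_mulrn _ x0) -(powR_mulrn _ (powR_ge0 x c)).
by rewrite -powRrM mulrC powRrM.
Qed.

Section box.
Context (R : realType) (disp : measure_display) (Omega : measurableType disp)
  (P : probability Omega R) (k d : nat) (beta : R).
Local Notation V := (R * 'rV[R]_k)%type.
Variables (W : 'I_d -> (V -> R) -> Omega -> R) (sigma : 'I_d -> V -> R)
  (v : R -> 'rV[R]_k -> Omega -> 'rV[R]_d).
Hypotheses (hk : (1 <= k)%N)
  (hbeta : 0 < beta < Num.min k%:R 2 \/ k = 1%N /\ beta = 1)
  (hsigma : forall j, continuous (sigma j))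
  (hbound : forall j (S : R), 0 <= S -> exists c C : R,
     [/\ 0 < c, c < C & forall t x, 0 <= t <= S -> c <= sigma j (t, x) <= C])
  (hW : gaussian_noise P beta W)
  (hv : mild_solution P beta W sigma v)
  (hd : d%:R = (4 + 2 * k%:R) / (2 - beta)).
Variables (t0 : R) (x0 : 'rV[R]_k).
Hypothesis t00 : 0 < t0.

Local Notation b := (beta / 2).
Local Notation h j := (mild_kernel (sigma j)).
Local Notation Q F := (noise_inner beta F%R F%R).

Let b0 : 0 < b. Proof. by case/andP: (beta_half hbeta). Qed.
Let b1 : b < 1. Proof. by case/andP: (beta_half hbeta). Qed.

Definition box_time (u : seq (letter k)) : R := t0 + tpos u.
Definition box_place (u : seq (letter k)) : 'rV[R]_k := x0 + xpos u.
Definition box_kernel (j : 'I_d) u : V -> R := h j (box_time u) (box_place u).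
Definition box_field (j : 'I_d) u (w : Omega) : R := v (box_time u) (box_place u) w ord0 j.

Let q : R := 2^-1 `^ (1 - b).

Let q_half : 2^-1 < q < 1.
Proof. by apply: half_powR; rewrite subr_gt0 b1 ltrBlDr ltrDl b0. Qed.

Let q01 : 0 < q < 1.
Proof. by have /andP[h0 ->] := q_half; rewrite andbT (lt_trans _ h0)// invr_gt0. Qed.

Let q0 : 0 < q. Proof. by case/andP: q01. Qed.

Let pow_scale n : ((2^-1 ^+ n) ^+ 2) `^ (1 - b) = q ^+ n ^+ 2.
Proof. exact: powR_scale. Qed.

Lemma box_critical : #|letter k|%:R * q ^+ d = 1.
Proof.
rewrite card_letter /q -powR_mulrn ?powR_ge0// -powRrM hd.
have -> : (1 - b) * ((4 + 2 * k%:R) / (2 - beta)) = (2 + k)%:R.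
  by rewrite natrD; field; move: b1; rewrite subr_eq0; lra.
rewrite powR_mulrn ?invr_ge0// exprD natrM natrX exprVn exprVn.
by field; rewrite expf_neq0.
Qed.

Lemma box_dim_gt0 : (0 < d)%N.
Proof.
rewrite -(ltr_nat R) hd divr_gt0//; last by move: b1; lra.
Qed.

Let box_bounds : exists S s0, [/\ 0 <= S, 0 < s0,
  forall j t x, 0 <= t <= t0 + 1 -> `|sigma j (t, x)| <= S &
  forall j t x, 0 <= t <= t0 + 1 -> s0 <= sigma j (t, x)].
Proof.
have T0 : 0 <= t0 + 1 by rewrite addr_ge0// ltW.
have [S S0 hS] : exists2 S, 0 <= S & forall j t x, 0 <= t <= t0 + 1 -> `|sigma j (t, x)| <= S.
  apply: (@exists_uniform _ _ (fun j S => forall t x, 0 <= t <= t0 + 1 -> `|sigma j (t, x)| <= S)).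
    by move=> j c c' cc hc t x /(hc _ x) /le_trans; apply.
  move=> j; have [c [C [c0 cC hC]]] := hbound j T0.
  exists C; first by apply/ltW/(lt_trans c0).
  move=> t x /(hC _ x) /andP[h1 h2]; rewrite ger0_norm//.
  by apply: le_trans h1; exact: ltW.
(* The lower bound is carried as the inverse of s, because [exists_uniform] handles conditions that
   persist when the constant grows. *)
have [s s0 hs] : exists2 s, 0 <= s & forall j, 0 < s /\ forall t x, 0 <= t <= t0 + 1 -> s^-1 <= sigma j (t, x).
  apply: (@exists_uniform _ _ (fun j s => 0 < s /\ forall t x, 0 <= t <= t0 + 1 -> s^-1 <= sigma j (t, x))).
    move=> j c c' cc [c0 hc]; have c'0 : 0 < c' by exact: lt_le_trans cc.
    by split => // t x /(hc _ x); apply: le_trans; rewrite lef_pV2 ?posrE.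
  move=> j; have [c [C [c0 cC hC]]] := hbound j T0.
  exists c^-1; first by rewrite invr_ge0 ltW.
  split; first by rewrite invr_gt0.
  by move=> t x /(hC _ x) /andP[h1 h2]; rewrite invrK.
have s1 : 0 < s by have [] := hs (Ordinal box_dim_gt0).
exists S, s^-1; split => //; first by rewrite invr_gt0.
by move=> j; have [] := hs j.
Qed.

Let mild_wiener j t x : 0 <= t -> t <= t0 + 1 ->
  wiener beta P W j (h j t x) (fun w => v t x w ord0 j).
Proof.
move=> t_ge0 tT; have [S [s0 [S0 _ bS _]]] := box_bounds.
have [mX [f [tf cf cX]]] := hv j x t_ge0.
split => //; first exact: (slices_mild_kernel (@hsigma j) S0 (@bS j) x tT).
move=> e e0.
have nb : nbhs (0%:E : \bar R) [set y : \bar R | (y < e%:E)%E] by exact: (@nbhs_open_ereal_lt R 0 (fun=> e) e0).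
have [N1 _ /(_ (maxn N1 _) (leq_maxl _ _)) h1] := cf _ nb.
have [N2 _ /(_ (maxn N1 N2) (leq_maxr _ _)) /= h2] := cX _ nb.
move: (h1 N2) => /= {}h1; set n := maxn N1 N2 in h1 h2.
have nt := noise_test1 W j (tf n).
have [_ sW] := noise_test_tame nt; have LW := noise_span_L2 hW sW.
have LD : L2 P (fun w => v t x w ord0 j - W j (f n) w).
  split; first by apply: measurable_funB => //; exact: L2_measurable LW.
  by move: h2; rewrite unlock => /lt_trans; apply; exact: ltry.
exists (f n), (W j (f n)); split => //; first exact: ltW.
by rewrite -lee_fin -(ip_sqrE LD); move: h2; rewrite unlock => /ltW.
Qed.

Lemma box_time_itv u : t0 <= box_time u <= t0 + 1.
Proof. by rewrite /box_time; have /andP[? ?] := @tpos_itv R k u; apply/andP; split; lra. Qed.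

Lemma box_wiener j u : wiener beta P W j (box_kernel j u) (box_field j u).
Proof.
have /andP[h1 h2] := box_time_itv u.
by apply: mild_wiener => //; apply: le_trans h1; exact: ltW.
Qed.

Let box_close u u1 u2 : `|box_time (u ++ u1) - box_time (u ++ u2)| <= (2^-1 ^+ size u) ^+ 2 /\
  sqn (box_place (u ++ u1) - box_place (u ++ u2)) <= k%:R * (2^-1 ^+ size u) ^+ 2.
Proof.
have -> : box_time (u ++ u1) - box_time (u ++ u2) = tpos (u ++ u1) - tpos (u ++ u2).
  by rewrite /box_time; ring.
have -> : box_place (u ++ u1) - box_place (u ++ u2) = xpos (u ++ u1) - xpos (u ++ u2).
  by apply/rowP => i; rewrite !mxE; ring.
by split; [exact: tpos_close|exact: xpos_close].
Qed.

Let half_pow_gt0 n : 0 < 2^-1 ^+ n :> R. Proof. by rewrite exprn_gt0// invr_gt0. Qed.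

Let box_increment : exists2 A, 0 <= A & forall j u u1 u2,
  (Q (fun p => box_kernel j (u ++ u1) p - box_kernel j (u ++ u2) p) <= (A * q ^+ size u ^+ 2)%:E)%E.
Proof.
have [S [s0 [S0 _ bS _]]] := box_bounds.
have [A A0 hA] := mild_increment hbeta hsigma S0 bS.
exists A => // j u u1 u2; rewrite -pow_scale.
have [c1 c2] := box_close u u1 u2.
by apply: hA => //; have /andP[] := box_time_itv (u ++ u1); have /andP[] := box_time_itv (u ++ u2).
Qed.

Let noise_energyB_bound (F G : V -> R) (x y : R) : slices F -> slices G ->
  (Q F <= x%:E)%E -> (Q G <= y%:E)%E -> (Q (fun p => F p - G p) <= (2 * x + 2 * y)%:E)%E.
Proof.
move=> sF sG hF hG; apply: le_trans (noise_energyB_le hbeta sF sG) _.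
by rewrite [in leRHS]EFinD ![in leRHS]EFinM; apply: leeD; apply: lee_wpmul2l.
Qed.

(** The kernels F are replaced by approximants G before cutting, since cutoffs are available for
    combinations of test functions. The cut increment inherits the size x of the full one, the
    remainder the size y of what the cutoff misses; the replacement adds [8 e]. *)
Let cut_increment (c : R -> R) (F F' G G' : V -> R) (x y e : R) :
  measurable_fun setT (c : measurableTypeR R -> R) -> (forall r, `|c r| <= 1) ->
  slices F -> slices F' -> slices G -> slices G' ->
  (Q (fun p => F p - G p) <= e%:E)%E -> (Q (fun p => F' p - G' p) <= e%:E)%E ->
  (Q (fun p => F' p - F p) <= x%:E)%E ->
  (Q (fun p => (1 - c p.1) * (F' p - F p)) <= y%:E)%E ->
  (Q (fun p => c p.1 * (G' p - G p)) <= (2 * x + 8 * e)%:E)%E /\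
  (Q (fun p => (F' p - F p) - c p.1 * (G' p - G p)) <= (2 * y + 8 * e)%:E)%E.
Proof.
move=> mc c1 sF sF' sG sG' h h' hx hy.
have d1 := slicesB sF sG; have d2 := slicesB sF' sG'.
have hE := noise_energyB_bound d2 d1 h' h.
have sE := slicesB d2 d1; have sD := slicesB sF' sF; have sH := slicesB sG' sG.
split.
  apply: le_trans (noise_energyM_le hbeta mc c1 sH) _.
  have -> : (fun p => G' p - G p) = (fun p => F' p - F p - (F' p - G' p - (F p - G p))).
    by apply/funext => p; ring.
  apply: le_trans (noise_energyB_bound sD sE hx hE) _.
  by rewrite lee_fin; lra.
have m1c : measurable_fun setT ((fun r => 1 - c r) : measurableTypeR R -> R) by exact: measurable_funB.
have -> : (fun p => F' p - F p - c p.1 * (G' p - G p)) =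
    (fun p => (1 - c p.1) * (F' p - F p) - (- c p.1) * (F' p - G' p - (F p - G p))).
  by apply/funext => p; ring.
have mNc : measurable_fun setT ((fun r => - c r) : measurableTypeR R -> R) by exact: measurableT_comp.
have s1 := slicesM m1c sD; have s2 := slicesM mNc sE.
apply: le_trans (noise_energyB_bound s1 s2 hy _) _.
  by apply: le_trans (noise_energyM_le hbeta mNc _ sE) hE => r; rewrite normrN.
by rewrite lee_fin; lra.
Qed.

(** [bad_scales] is applied along the ancestors of w at levels [n1 + i s]: divided by [q ^+ n i],
    the field below each of them has increments with the same bounds, so the M scales become M
    comparable blocks. *)
Lemma box_bad_words e eta n1 : 0 < e -> 0 < eta ->
  exists M s n0, (n1 <= n0)%N /\ forall L w, size w = (n0 + M * s)%N ->
  (P [set z | bad_word q (fun j u => box_field j u z) L M s n0 e w] <= eta%:E)%E.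
Proof.
move=> e0 eta0; have [A A0 hA] := box_increment.
have [S [s0 [S0 _ bS _]]] := box_bounds.
have A80 : 0 <= 2 * A + 8 by rewrite addr_ge0// mulr_ge0.
have [M [delta delta0 hM]] := bad_scales q01 box_critical A80 e0 eta0.
have d4 : 0 < delta / 4 by rewrite divr_gt0.
(* The tolerated remainder [delta] determines K, and K the spacing s: [4 K^2 <= 4^s] separates the
   supports of consecutive annuli, which extend from [rho^2 / (2 K)] to [2 K rho^2] for their
   respective rho. *)
have [K K8 hK] := mild_increment_annulus hbeta hsigma S0 bS d4.
have K0 : 0 < K by apply: lt_le_trans K8.
have [s hs] : exists s, 4 * K ^+ 2 <= 4 ^+ s.
  exists (Num.bound (4 * K ^+ 2)); apply: (@le_trans _ _ (Num.bound (4 * K ^+ 2))%:R).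
    by apply/ltW/archi_boundP; rewrite mulr_ge0// sqr_ge0.
  by rewrite -natrX ler_nat ltnW// ltn_expl.
exists M, s, n1; split => // L w sw.
pose n i := (n1 + i * s)%N.
pose wd i := take (n i) w.
have size_wd i : (i < M)%N -> size (wd i) = n i.
  by move=> iM; rewrite /wd size_takel// sw leq_add2l leq_mul2r ltnW// orbT.
pose rho i : R := 2^-1 ^+ n i.
pose r i : R := q ^+ n i.
have r0 i : 0 < r i by rewrite /r exprn_gt0.
have rho0 i : 0 < rho i by exact: half_pow_gt0.
(* All the annuli are centred at the time of the leaf w, which makes them disjoint. *)
pose tc := box_time w.
pose chi i : R -> R := annulus tc (rho i ^+ 2 / K) (K * rho i ^+ 2).
have chi1 i x : `|chi i x| <= 1.
  have /andP[h0 h1] := annulus_itv tc (rho i ^+ 2 / K) (K * rho i ^+ 2) x.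
  by rewrite ler_norml h1 andbT (le_trans _ h0)// lerN10.
have mchi i : measurable_fun setT (chi i : measurableTypeR R -> R).
  apply: continuous_measurable_fun => x.
  have [g _ dg] := bump_alg_derive (bump_annulus tc (rho i ^+ 2 / K) (K * rho i ^+ 2)).
  by apply: differentiable_continuous; apply/derivable1_diffP; case: (dg x).
pose c0 := Num.min 1 (delta / 16).
have c00 : 0 < c0 by rewrite lt_min ltr01 divr_gt0.
have c01 : c0 <= 1 by rewrite ge_min lexx.
have c0d : c0 <= delta / 16 by rewrite ge_min lexx orbT.
clearbody c0.
(* At most [c0] times the squared scale of every word that occurs, so that the approximation of the
   kernels preserves the increment bounds at all levels. *)
pose err := c0 * (q ^+ (size w + L)) ^+ 2.
have err0 : 0 < err by rewrite mulr_gt0// !exprn_gt0.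
have /choice[F hF] (p : 'I_d * seq (letter k)) : exists f, exists2 Y,
    noise_test W p.1 f Y & (Q (fun x => box_kernel p.1 p.2 x - f x) <= err%:E)%E.
  have [_ _ /(_ err err0)[g [Y [nY qY _ _]]]] := box_wiener p.1 p.2.
  by exists g, Y.
have /choice[G hG] (p : nat * ('I_d * seq (letter k))) : exists Y,
    noise_test W p.2.1 (fun x => chi p.1 x.1 * F p.2 x) Y.
  have [Y nY _] := hF p.2; apply: (noise_test_cutoff _ nY); exact: bump_annulus.
(* Y is the noise on cut test functions, which makes covariances between different scales exactly
   zero. Z is defined as the difference, so that Y + Z is the rescaled field itself. *)
pose Y i j u z : R := (r i)^-1 * G (i, (j, wd i ++ u)) z.
pose Z i j u z : R := (r i)^-1 * box_field j (wd i ++ u) z - Y i j u z.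
have wG i j u : wiener beta P W j (fun x => chi i x.1 * F (j, u) x) (G (i, (j, u))).
  by apply: wiener_test => //; exact: (hG (i, (j, u))).
have wY i j u : wiener beta P W j (fun x => (r i)^-1 * (chi i x.1 * F (j, wd i ++ u) x)) (Y i j u).
  by apply: wienerZ => //; exact: wG.
have wZ i j u : wiener beta P W j (fun x => (r i)^-1 * box_kernel j (wd i ++ u) x -
    (r i)^-1 * (chi i x.1 * F (j, wd i ++ u) x)) (Z i j u).
  by apply: wienerB => //; apply: wienerZ => //; exact: box_wiener.
have sF p : slices (F p).
  by have [Y' nY' _] := hF p; have [[]] := noise_test_tame nY'.
have sB j u : slices (box_kernel j u) by have [] := box_wiener j u.
have key i j u a : (i < M)%N -> (size u < L)%N ->
    ip P (fun z => Y i j (rcons u a) z - Y i j u z) (fun z => Y i j (rcons u a) z - Y i j u z) <=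
      (2 * A + 8 * c0) * q ^+ size u ^+ 2 /\
    ip P (fun z => Z i j (rcons u a) z - Z i j u z) (fun z => Z i j (rcons u a) z - Z i j u z) <=
      Num.min ((2 * A + 8 * c0) * q ^+ size u ^+ 2) (delta / 2 + 8 * c0).
  move=> iM uL; pose U := wd i ++ u; pose U' := wd i ++ rcons u a.
  have UU : U' = U ++ [:: a] by rewrite /U' /U -catA cats1.
  have sU : size U = (n i + size u)%N by rewrite size_cat size_wd.
  have qU : q ^+ size U ^+ 2 = r i ^+ 2 * q ^+ size u ^+ 2 by rewrite sU exprD exprMn.
  have hx : (Q (fun p => box_kernel j U' p - box_kernel j U p) <= (A * (r i ^+ 2 * q ^+ size u ^+ 2))%:E)%E.
    by have := hA j U [:: a] [::]; rewrite -UU cats0 qU.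
  have m1c : measurable_fun setT ((fun x => 1 - chi i x) : measurableTypeR R -> R) by exact: measurable_funB.
  have c1c x : `|1 - chi i x| <= 1.
    have /andP[h0 h1] := annulus_itv tc (rho i ^+ 2 / K) (K * rho i ^+ 2) x.
    by rewrite ger0_norm ?subr_ge0// gerBl.
  have hy1 := le_trans (noise_energyM_le hbeta m1c c1c (slicesB (sB j U') (sB j U))) hx.
  have wE : w = wd i ++ drop (n i) w by rewrite cat_take_drop.
  have hy2 : (Q (fun p => (1 - chi i p.1) * (box_kernel j U' p - box_kernel j U p)) <= (delta / 4 * r i ^+ 2)%:E)%E.
    rewrite /r -pow_scale -/(rho i).
    have /andP[_ t1] := box_time_itv U'; have /andP[_ t2] := box_time_itv U.
    have [c1 c2] := box_close (wd i) (rcons u a) u.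
    have [c3 _] := box_close (wd i) (rcons u a) (drop (n i) w).
    have [c4 _] := box_close (wd i) u (drop (n i) w).
    move: c1 c2 c3 c4; rewrite -wE size_wd// => c1 c2 c3 c4.
    exact: hK.
  have [Y1 _ e1] := hF (j, U); have [Y2 _ e2] := hF (j, U').
  have errle : err <= c0 * (r i ^+ 2 * q ^+ size u ^+ 2).
    rewrite /err ler_wpM2l ?(ltW c00)// -qU lerXn2r ?nnegrE ?exprn_ge0 ?(ltW q0)//.
    apply: ler_wiXn2l; [exact: ltW|by case/andP: q01 => _ /ltW|].
    by rewrite sU leq_add// ?(ltnW uL)// sw leq_add2l leq_mul2r (ltnW iM) orbT.
  have [b1' b2] := cut_increment (mchi i) (chi1 i) (sB j U) (sB j U') (sF (j, U)) (sF (j, U')) e1 e2 hx hy1.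
  have [_ b3] := cut_increment (mchi i) (chi1 i) (sB j U) (sB j U') (sF (j, U)) (sF (j, U')) e1 e2 hx hy2.
  have sH := slicesB (sF (j, U')) (sF (j, U)).
  have sD := slicesB (sB j U') (sB j U).
  have sC := slicesM (mchi i) sH.
  have scale (X : Omega -> R) (H : V -> R) (y z : R) : slices H ->
      wiener beta P W j (fun p => (r i)^-1 * H p) X -> (Q (fun p => H p) <= y%:E)%E ->
      y <= r i ^+ 2 * z -> ip P X X <= z.
    move=> sH' wX hy yz; rewrite -lee_fin -(wiener_isometry hbeta hW wX) (noise_energyZ hbeta)//.
    apply: (@le_trans _ _ ((r i)^-1 ^+ 2 * (r i ^+ 2 * z))%:E).
      rewrite [in leRHS]EFinM; apply: lee_wpmul2l; first by rewrite lee_fin sqr_ge0.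
      by apply: le_trans hy _; rewrite lee_fin.
    by rewrite mulrA -exprMn mulVf ?gt_eqF// expr1n mul1r.
  have w1 : wiener beta P W j (fun p => (r i)^-1 * (chi i p.1 * (F (j, U') p - F (j, U) p)))
      (fun z => Y i j (rcons u a) z - Y i j u z).
    have := wienerB hbeta (wY i j (rcons u a)) (wY i j u).
    by rewrite -/U -/U'; congr wiener; apply/funext => p; ring.
  have w2 : wiener beta P W j (fun p => (r i)^-1 * (box_kernel j U' p - box_kernel j U p - chi i p.1 * (F (j, U') p - F (j, U) p)))
      (fun z => Z i j (rcons u a) z - Z i j u z).
    have := wienerB hbeta (wZ i j (rcons u a)) (wZ i j u).
    by rewrite -/U -/U'; congr wiener; apply/funext => p; ring.
  have q2 : q ^+ size u ^+ 2 <= 1 by rewrite exprn_ile1 ?exprn_ile1 ?exprn_ge0 ?(ltW q0)//; case/andP: q01 => _ /ltW.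
  have r2 : 0 <= r i ^+ 2 by exact: sqr_ge0.
  split.
    apply: (scale _ _ _ _ sC w1 b1'); move: errle; move: (r i ^+ 2) (q ^+ _ ^+ 2) => x1 x2 hh.
    by rewrite [leRHS](_ : _ = 2 * (A * (x1 * x2)) + 8 * (c0 * (x1 * x2))); [rewrite lerD2l ler_wpM2l|ring].
  rewrite le_min; apply/andP; split.
    apply: (scale _ _ _ _ (slicesB sD sC) w2 b2); move: errle; move: (r i ^+ 2) (q ^+ _ ^+ 2) => x1 x2 hh.
    by rewrite [leRHS](_ : _ = 2 * (A * (x1 * x2)) + 8 * (c0 * (x1 * x2))); [rewrite lerD2l ler_wpM2l|ring].
  apply: (scale _ _ _ _ (slicesB sD sC) w2 b3).
  have h8 : c0 * (r i ^+ 2 * q ^+ size u ^+ 2) <= c0 * r i ^+ 2.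
    by rewrite ler_wpM2l ?(ltW c00)// ler_piMr.
  move: (le_trans errle h8); move: (r i ^+ 2) => x1 hh.
  by rewrite [leRHS](_ : _ = 2 * (delta / 4 * x1) + 8 * (c0 * x1)); [rewrite lerD2l ler_wpM2l|field].
have -> : [set z | bad_word q (fun j u => box_field j u z) L M s n1 e w] =
    [set z | forall i, (i < M)%N -> ~ osc_le L e (fun j u => Y i j u z + Z i j u z)].
  have YZ i j u z : Y i j u z + Z i j u z = (r i)^-1 * box_field j (wd i ++ u) z by rewrite /Z addrC subrK.
  have eqv z i : (i < M)%N -> osc_le L e (fun j u => Y i j u z + Z i j u z) <->
      osc_le L (e * q ^+ size (wd i)) (fun j u => box_field j (wd i ++ u) z).
    move=> iM; rewrite size_wd// -/(r i); split => h j u uL; have := h j u uL; rewrite !YZ -mulrBr normrM normfV (gtr0_norm (r0 i)).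
      by rewrite mulrC ler_pdivrMr.
    by rewrite [_^-1 * _]mulrC ler_pdivrMr.
  apply/seteqP; split => z /= hz i iM.
    by move=> /(eqv z i iM); exact: hz.
  by move=> h; apply: (hz i iM); apply/(eqv z i iM).
apply: (hM _ Omega P Y Z L).
- apply: (noise_limit_family hW) => -[i [j u]] /=; exact: (wiener_limit (wY i j u)).
- move=> i i' j j' u u' ii'.
  suff G0 : ip P (G (i, (j, wd i ++ u))) (G (i', (j', wd i' ++ u'))) = 0.
    have L1 := wiener_L2 hW (wG i j (wd i ++ u)); have L2' := wiener_L2 hW (wG i' j' (wd i' ++ u')).
    by rewrite /Y (ipZl _ L1 (L2Z _ L2')) ipC (ipZl _ L2' L1) ipC G0 !mulr0.
  rewrite (noise_test_ip hbeta hW (hG (i, (j, wd i ++ u))) (hG (i', (j', wd i' ++ u')))) /=.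
  case: eqP => // _; apply: (bform_disjoint hbeta); try exact: slicesM.
  have sep (m m' : nat) x : (m < m')%N -> chi m x = 0 \/ chi m' x = 0.
    move=> mm; have [hl|hl] := leP `|x - tc| (rho m ^+ 2 / K / 2).
      by left; apply: annulus_in => //; rewrite divr_gt0// exprn_gt0.
    right; apply: annulus_out; first by rewrite mulr_gt0// exprn_gt0.
    apply: le_trans (ltW hl).
    have n4 : rho m' ^+ 2 * 4 ^+ s <= rho m ^+ 2.
      rewrite /rho -!exprM ![(_ * 2)%N]mulnC !exprM.
      have -> : 2^-1 ^+ 2 = 4^-1 :> R by field.
      rewrite !exprVn ler_pdivrMl ?exprn_gt0// ler_pdivlMr ?exprn_gt0//.
      rewrite -exprD; apply: ler_weXn2l; first by rewrite ler1n.
      by rewrite /n addnCA leq_add2l -mulSn leq_mul2r mm orbT.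
    have r2' := sqr_ge0 (rho m').
    have := le_trans (ler_wpM2l r2' hs) n4 => h4.
    rewrite ler_pdivlMr// ler_pdivlMr//; move: h4; lra.
  move=> x; have [lt|lt|e'] := ltngtP i i'; last by rewrite e' eqxx in ii'.
    by case: (sep i i' x lt) => c'; [left|right] => y; rewrite c' mul0r.
  by case: (sep i' i x lt) => c'; [right|left] => y; rewrite c' mul0r.
- move=> i iM j u a uL; have [h1 _] := key i j u a iM uL.
  have q2 : q ^+ size u ^+ 2 <= 1 by rewrite exprn_ile1 ?exprn_ile1 ?exprn_ge0 ?(ltW q0)//; case/andP: q01 => _ /ltW.
  have h2 : (2 * A + 8 * c0) * q ^+ size u ^+ 2 <= (2 * A + 8) * q ^+ size u ^+ 2.
    by rewrite ler_wpM2r ?sqr_ge0//; lra.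
  by rewrite le_min (le_trans h1 h2) (le_trans h1 (le_trans h2 _))// ler_piMr.
- by move=> i j u; have [] := wZ i j u.
- move=> i j u a; apply: (noise_limit_near hW).
  exact: (wiener_limit (wienerB hbeta (wZ i j (rcons u a)) (wZ i j u))).
- move=> i iM j u a uL; have [_ h1] := key i j u a iM uL.
  have h2 : (2 * A + 8 * c0) * q ^+ size u ^+ 2 <= (2 * A + 8) * q ^+ size u ^+ 2.
    by rewrite ler_wpM2r ?sqr_ge0//; lra.
  move: h1; rewrite !le_min => /andP[h3 h4]; rewrite (le_trans h3 h2)/=.
  by apply: le_trans h4 _; lra.
Qed.

Let ref_time : 0 <= t0 / 2 /\ t0 / 2 <= t0 + 1.
Proof. by move: t00 => ?; split; lra. Qed.

Let ref_field (j : 'I_d) (w : Omega) : R := v (t0 / 2) x0 w ord0 j.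

Let ref_wiener j : wiener beta P W j (h j (t0 / 2) x0) (ref_field j).
Proof. by have [h1 h2] := ref_time; exact: mild_wiener. Qed.

Let field_L2 j u : L2 P (box_field j u). Proof. exact: (wiener_L2 hW (box_wiener j u)). Qed.
Let ref_L2 j : L2 P (ref_field j). Proof. exact: (wiener_L2 hW (ref_wiener j)). Qed.

(** By the isometry, the gap of [mild_overlap] between the squared norms of sum and difference is
    four times the covariance. *)
Let ref_overlap : exists2 c, 0 < c & forall j u, c <= ip P (box_field j u) (ref_field j).
Proof.
have [S [s0 [S0 s00 bS lS]]] := box_bounds.
have [|c c0 hc] := mild_overlap hbeta hk hsigma S0 bS x0 t00 (lexx _); first by exists s0.
exists (c / 4); first by rewrite divr_gt0.
move=> j u; have := hc j (box_time u) (box_place u) (box_time_itv u).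
have -> : box_place u - x0 = xpos u - xpos [::].
  by apply/rowP => i; rewrite !mxE; ring.
have := @xpos_close R k [::] u [::]; rewrite expr0 expr1n mulr1 /= => hx /(_ hx).
rewrite (wiener_isometry hbeta hW (wienerB hbeta (box_wiener j u) (ref_wiener j))).
rewrite (wiener_isometry hbeta hW (wienerD hbeta (box_wiener j u) (ref_wiener j))).
rewrite -EFinD lee_fin (ip_sqrB (field_L2 j u) (ref_L2 j)) (ip_sqrD (field_L2 j u) (ref_L2 j)).
by move: (ip P _ _) (ip P _ _) (ip P _ _) => y1 y2 y3; lra.
Qed.

Let ref_norm j : R := Num.sqrt (ip P (ref_field j) (ref_field j)).

Let ref_norm_gt0 j : 0 < ref_norm j.
Proof.
have [c c0 hc] := ref_overlap; rewrite sqrtr_gt0 lt_neqAle ip_ge0 andbT; apply/eqP => m0.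
have := ip_CauchySchwarz (field_L2 j [::]) (ref_L2 j).
rewrite -m0 mulr0 leNgt exprn_gt0//; exact: lt_le_trans (hc _ _).
Qed.

Let ref_norm_sqr j : ref_norm j ^+ 2 = ip P (ref_field j) (ref_field j).
Proof. by rewrite sqr_sqrtr// ip_ge0. Qed.

(** The kernel of the reference value vanishes after [t0 / 2], so only the past part of the
    increment matters, and its norm is of order rho. Polarising with [s = rho] and [s = - rho]
    balances the two terms and gives a covariance of order [2 ^- size u], smaller than the size
    [q ^+ size u] of the increment. *)
Let ref_increment : exists2 C, 0 <= C & forall j u u',
  `|ip P (fun w => box_field j (u ++ u') w - box_field j u w) (ref_field j)| <=
  (C + ref_norm j ^+ 2) * 2^-1 ^+ size u.
Proof.
have [S [s0 [S0 s00 bS _]]] := box_bounds.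
have t20 : 0 < t0 / 2 by rewrite divr_gt0.
have [C C0 hC] := mild_increment_past hbeta hsigma S0 bS (t0 / 2) t20.
exists C => // j u u'.
have [rho rhoE] : exists rho, rho = 2^-1 ^+ size u :> R by eexists.
have rho0 : 0 < rho by rewrite rhoE half_pow_gt0.
have rho1 : rho <= 1 by rewrite rhoE exprn_ile1// invf_le1// ler1n.
have [c1 c2] := box_close u u' [::]; rewrite cats0 -rhoE in c1 c2.
have /andP[l1 r1] := box_time_itv (u ++ u'); have /andP[l2 r2] := box_time_itv u.
have rho01 : 0 < rho <= 1 by rewrite rho0.
have tt : t0 / 2 + t0 / 2 = t0 by field.
have := hC j (box_time (u ++ u')) (box_time u) (box_place (u ++ u')) (box_place u) rho rho01 r1 r2 c1 c2.
rewrite tt => /(_ l1 l2) hQ.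
have wD := wienerB hbeta (box_wiener j (u ++ u')) (box_wiener j u).
have LD := wiener_L2 hW wD; have LZ := ref_L2 j; have wZ := ref_wiener j.
have [sD _ _] := wD; have [sZ _ _] := wZ.
have sH := slicesM (@measurable_past R (t0 / 2)) sD.
have step s : s ^+ 2 = rho ^+ 2 -> 4 * (s * ip P (fun w => box_field j (u ++ u') w - box_field j u w) (ref_field j)) <=
    2 * (C * rho ^+ 2) + 2 * rho ^+ 2 * ref_norm j ^+ 2.
  move=> s2.
  have wA := wienerD hbeta wD (wienerZ hbeta s wZ).
  have wB := wienerB hbeta wD (wienerZ hbeta s wZ).
  have [sA _ _] := wA; have [sB _ _] := wB.
  have r20 : 0 <= 2 * rho ^+ 2 by rewrite mulr_ge0// sqr_ge0.
  have := @noise_energy_le_sum R k beta hbeta _ _ _ _ 2 (2 * rho ^+ 2) (ler0n R 2) r20 sA sB sH sZ.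
  move=> hh.
  have : (Q (fun p => box_kernel j (u ++ u') p - box_kernel j u p + s * h j (t0 / 2) x0 p) <=
    Q (fun p => box_kernel j (u ++ u') p - box_kernel j u p - s * h j (t0 / 2) x0 p) +
    (2%:E * Q (fun p => (p.1 < t0 / 2)%R%:R * (box_kernel j (u ++ u') p - box_kernel j u p)) +
     (2 * rho ^+ 2)%:E * Q (fun p => h j (t0 / 2) x0 p)))%E.
    apply: hh => r r0.
    have eZ : energy beta (fun p => s * h j (t0 / 2) x0 p) r = rho ^+ 2 * energy beta (h j (t0 / 2) x0) r.
      by rewrite (energyZ hbeta s r sZ) s2.
    have ge1 := energy_ge0 hbeta r sB.
    have ge2 := energy_ge0 hbeta r sZ.
    have [rt|rt] := ltP r (t0 / 2).
      have := energyD_le hbeta r ltr01 sD (slicesZ s sZ).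
      rewrite eZ invr1 (energyM hbeta (fun r : R => (r < t0 / 2)%R%:R) r sD) rt expr1n mul1r => h3.
      apply: le_trans h3 _; rewrite -[leLHS]add0r; apply: lerD => //.
      by rewrite le_eqVlt; apply/orP; left; apply/eqP; ring.
    have z0 y : h j (t0 / 2) x0 (r, y) = 0 by rewrite mild_kernel0// negb_and -leNgt rt orbT.
    have -> : energy beta (fun p => box_kernel j (u ++ u') p - box_kernel j u p + s * h j (t0 / 2) x0 p) r =
        energy beta (fun p => box_kernel j (u ++ u') p - box_kernel j u p - s * h j (t0 / 2) x0 p) r.
      by rewrite /energy; congr sform; apply/funext => y; rewrite z0 mulr0 addr0 subr0.
    rewrite lerDl; apply: addr_ge0; apply: mulr_ge0 => //; exact: (energy_ge0 hbeta).
  rewrite (wiener_isometry hbeta hW wA) (wiener_isometry hbeta hW wB) (wiener_isometry hbeta hW wZ).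
  move=> h4; have : ((ip P (fun w => box_field j (u ++ u') w - box_field j u w + s * ref_field j w)
      (fun w => box_field j (u ++ u') w - box_field j u w + s * ref_field j w))%:E <=
     (ip P (fun w => box_field j (u ++ u') w - box_field j u w - s * ref_field j w)
      (fun w => box_field j (u ++ u') w - box_field j u w - s * ref_field j w) +
      (2 * (C * rho ^+ 2) + 2 * rho ^+ 2 * ip P (ref_field j) (ref_field j)))%:E)%E.
    apply: le_trans h4 _; rewrite [in leRHS]EFinD; apply: leeD => //.
    rewrite [in leRHS]EFinD [X in (_ <= X + _)%E]EFinM; apply: leeD; last by rewrite EFinM.
    by apply: lee_wpmul2l => //; exact: hQ.
  rewrite lee_fin (ip_sqrD LD (L2Z s LZ)) (ip_sqrB LD (L2Z s LZ)) ref_norm_sqr.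
  rewrite [ip P _ (fun x => s * ref_field j x)]ipC (ipZl s LZ LD) [ip P (ref_field j) (fun x => _ - _)]ipC.
  by move: (ip P _ _) (ip P _ _) (ip P _ _) (ip P _ _) => y1 y2 y3 y4; lra.
have s1 := step rho erefl; have s2 := step (- rho) (sqrrN _).
rewrite -rhoE; move: s1 s2; move: (ip P _ _) (ref_norm j ^+ 2) (sqr_ge0 (ref_norm j)) => y m m0 h1 h2.
have h3 : `|y| * (4 * rho) <= 2 * (C + m) * rho ^+ 2.
  rewrite -[4 * rho]gtr0_norm ?mulr_gt0// -normrM ler_norml; apply/andP; split; lra.
have h4 : 0 <= (C + m) * rho by rewrite mulr_ge0 ?addr_ge0 ?(ltW rho0).
rewrite -(ler_pM2r (_ : 0 < 4 * rho)) ?mulr_gt0//; apply: le_trans h3 _.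
by have := mulr_ge0 h4 (ltW rho0); lra.
Qed.

Lemma box_hitting (z : 'I_d -> R) e : 0 < e -> exists L0 kap, 0 < kap /\
  forall L, (L0 <= L)%N ->
  (P [set w | exists u : L.-tuple (letter k), forall j, (`|box_field j u w - z j| <= kap)%R] <= e%:E)%E.
Proof.
move=> e0.
have [c c0 hc] := ref_overlap; have [C C0 hC] := ref_increment; have [A A0 hA] := box_increment.
have [D D0 hD] := near_gauss_density P.
pose N (j : 'I_d) (w : Omega) : R := (ref_norm j)^-1 * ref_field j w.
have wN j : wiener beta P W j (fun p => (ref_norm j)^-1 * h j (t0 / 2) x0 p) (N j).
  exact: wienerZ.
have LN j : L2 P (N j) by exact: L2Z.
pose gam (j : 'I_d) u := ip P (box_field j u) (N j).
have gamI j u : gam j u = (ref_norm j)^-1 * ip P (box_field j u) (ref_field j).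
  by rewrite /gam ipC /N (ipZl _ (ref_L2 j) (field_L2 j u)) ipC.
(* A common bound for the norms of the reference values turns the covariance bound c into the lower
   bound [c / B] for the normalised slopes. *)
pose B := 1 + \sum_j ref_norm j.
have B0 : 0 < B by rewrite ltr_pwDl// sumr_ge0// => j _; exact: ltW.
have nB j : ref_norm j <= B.
  rewrite /B (bigD1 j)//= addrCA lerDl addr_ge0// sumr_ge0// => i _; exact: ltW.
pose G := \sum_j (ref_norm j)^-1 * (C + ref_norm j ^+ 2).
have Gj j : 0 <= (ref_norm j)^-1 * (C + ref_norm j ^+ 2).
  by rewrite mulr_ge0 ?invr_ge0 ?addr_ge0 ?sqr_ge0// ltW.
have G0 : 0 <= G by rewrite sumr_ge0.
have g0 : 0 < c / B by rewrite divr_gt0.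
have gXN : gauss_family P (sum_family (fun i : 'I_d * seq (letter k) => box_field i.1 i.2) N).
  apply: (noise_limit_family hW) => -[[j u]|j] /=; [exact: wiener_limit (box_wiener j u)|exact: wiener_limit (wN j)].
have q_lt := q_half; have /andP[qh _] := q_lt.
have h2 : 0 < (2^-1 : R) by rewrite invr_gt0.
have rhoq : (0 < (2^-1 : R)) && ((2^-1 : R) < q) := introT andP (conj h2 qh).
have incX j u a : ip P (fun w => box_field j (rcons u a) w - box_field j u w)
    (fun w => box_field j (rcons u a) w - box_field j u w) <= A * q ^+ size u ^+ 2.
  rewrite -lee_fin -(wiener_isometry hbeta hW (wienerB hbeta (box_wiener j (rcons u a)) (box_wiener j u))).
  by have := hA j u [:: a] [::]; rewrite cats0 cats1.
have gam_ge j u : c / B <= `|gam j u|.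
  rewrite gamI ger0_norm; last first.
    by rewrite mulr_ge0 ?invr_ge0 ?(ltW (ref_norm_gt0 j))// (le_trans (ltW c0)).
  rewrite mulrC; apply: ler_pM => //; [by rewrite invr_ge0 ltW|exact: ltW|].
  by rewrite lef_pV2 ?posrE.
have gam_lip j u u' : `|gam j (u ++ u') - gam j u| <= G * 2^-1 ^+ size u.
  rewrite !gamI -mulrBr -(ipBl (field_L2 j (u ++ u')) (field_L2 j u) (ref_L2 j)).
  rewrite normrM ger0_norm ?invr_ge0 ?(ltW (ref_norm_gt0 j))//.
  apply: (@le_trans _ _ ((ref_norm j)^-1 * (C + ref_norm j ^+ 2) * 2^-1 ^+ size u)).
    by rewrite -mulrA ler_wpM2l ?invr_ge0 ?(ltW (ref_norm_gt0 j)).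
  by rewrite ler_wpM2r ?(ltW (half_pow_gt0 _))// /G (bigD1 j)//= lerDl sumr_ge0.
have gamE j u i : ip P (box_field j u) (N i) = if i == j then gam j u else 0.
  case: eqP => [->//|/eqP ij].
  by apply: (wiener_independent hbeta hW _ (box_wiener j u) (wN i)); rewrite eq_sym.
have NN j : ip P (N j) (N j) = 1.
  by rewrite /N ip_sqrZ// -ref_norm_sqr -exprMn mulVf ?expr1n// gt_eqF.
have ipN i j : ip P (N i) (N j) = (i == j)%:R.
  have [<-|ij] := eqVneq i j; first exact: NN.
  exact: (wiener_independent hbeta hW ij (wN i) (wN j)).
have densN j a r : 0 <= r -> (P [set w | (`|N j w - a| <= r)%R] <= (D * r)%:E)%E.
  by move=> r0; apply: hD => //; exact: (noise_limit_near hW (wiener_limit (wN j))).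
exact: (hitting_small q01 box_critical box_dim_gt0 A0 gXN incX box_bad_words g0 G0 D0 rhoq gam_ge gam_lip gamE ipN densN z e0).
Qed.

End box.

(** * Paths and polarity *)

Section box_paths.
Context {R : realType} (k d : nat) (t0 : R) (x0 : 'rV[R]_k).
Local Notation V := (R * 'rV[R]_k)%type.
Hypothesis t00 : 0 < t0.

Definition box : set V := [set p : V | t0 <= p.1 <= t0 + 1 /\
  forall i, x0 ord0 i <= p.2 ord0 i <= x0 ord0 i + 1].

Lemma box_compact : compact box.
Proof.
have -> : box = `[t0, t0 + 1]%classic `*`
    [set x : 'rV[R]_k | forall i, `[x0 ord0 i, x0 ord0 i + 1]%classic (x ord0 i)].
  by apply/seteqP; split => -[t x] /= [h1 h2]; split => //= [|i|i]; try (move: h1; rewrite in_itv); try (move: (h2 i); rewrite in_itv).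
apply: compact_setX; first exact: segment_compact.
by apply: (@rV_compact R k (fun i => `[x0 ord0 i, x0 ord0 i + 1]%classic)) => i; exact: segment_compact.
Qed.

Definition box_point (u : seq (letter k)) : V := (t0 + tpos u, x0 + xpos u).

Lemma box_pointP u : box (box_point u).
Proof.
split=> /= [|i]; first by have /andP[? ?] := @tpos_itv R k u; apply/andP; split; lra.
by rewrite mxE; have /andP[? ?] := @xpos_itv R k u i; apply/andP; split; lra.
Qed.

Variable f : V -> 'rV[R]_d.
Hypothesis cf : {within [set p : V | 0 <= p.1], continuous f}.

Let box_sub : box `<=` [set p : V | 0 <= p.1].
Proof. by move=> p [/andP[h _] _] /=; apply: le_trans h; exact: ltW. Qed.

Lemma box_approx p e : box p -> 0 < e -> exists n, forall L, (n <= L)%N ->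
  exists2 u : seq (letter k), size u = L & forall j, `|f (box_point u) ord0 j - f p ord0 j| <= e.
Proof.
move=> Bp e0.
have := (iffLR (subspace_continuousP _ _)) cf p (box_sub Bp).
move=> /(_ _ (nbhsx_ballx (f p) _ e0)) /nbhs_ballP[r /= r0 hr].
have [n hn] : exists n, 2^-1 ^+ n < r.
  exists (Num.bound r^-1); rewrite exprVn -[ltRHS]invrK ltf_pV2 ?posrE ?exprn_gt0 ?invr_gt0//.
  apply: (@lt_trans _ _ (Num.bound r^-1)%:R); first by apply: archi_boundP; rewrite invr_ge0 ltW.
  by rewrite -natrX ltr_nat ltn_expl.
exists n => L nL.
have Ln : 2^-1 ^+ L < r.
  by apply: le_lt_trans hn; apply: ler_wiXn2l => //; rewrite invf_le1// ler1n.
case: p Bp hr => t x [/= h1 h2] hr.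
have [||u [su ht hx]] := @word_dense R k L (t - t0) (x - x0).
- by move: h1 => /andP[? ?]; apply/andP; split; lra.
- by move=> i; rewrite !mxE; move: (h2 i) => /andP[? ?]; apply/andP; split; lra.
exists u => // j.
have Bu := box_pointP u.
have : ball (f (t, x)) e (f (box_point u)).
  apply: hr; last exact: box_sub Bu.
  split => /=.
    rewrite /ball /= (_ : t - (t0 + tpos u) = t - t0 - tpos u); last by ring.
    exact: le_lt_trans ht Ln.
  split => // i j'; rewrite (ord1 i) /ball /= mxE.
  have := hx j'; rewrite !mxE => hx'.
  rewrite (_ : _ - (_ + _) = x ord0 j' - x0 ord0 j' - xpos u ord0 j'); last by ring.
  exact: le_lt_trans hx' Ln.
move=> [_ /(_ ord0 j)]; rewrite /ball /= => /ltW.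
by rewrite distrC.
Qed.

(** Expressing the hitting event through countably many words gives its measurability. The words are
    dense in the box, and compactness makes the image of the box closed, so approximate hits at all
    precisions yield a true one. *)
Lemma box_hitP z : (exists2 p, box p & f p = z) <->
  (forall m : nat, exists u : seq (letter k), forall j, `|f (box_point u) ord0 j - z ord0 j| <= m.+1%:R^-1).
Proof.
split=> [[p Bp <-] m|h].
  have [|n hn] := @box_approx p m.+1%:R^-1 Bp; first by rewrite invr_gt0.
  by have [u _ hu] := hn n (leqnn n); exists u.
have cB : compact (f @` box).
  by apply: continuous_compact box_compact; exact: continuous_subspaceW cf.
have clB := compact_closed (@norm_hausdorff R 'rV[R]_d) cB.
suff : (f @` box) z by move=> [p Bp fp]; exists p.
rewrite (iffLR (closure_id _) clB) => A /nbhs_ballP[r /= r0 hr].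
have [m hm] : exists m : nat, m.+1%:R^-1 < r.
  exists (Num.bound r^-1); rewrite -[ltRHS]invrK ltf_pV2 ?posrE ?invr_gt0//.
  apply: (@lt_trans _ _ (Num.bound r^-1)%:R); last by rewrite ltr_nat.
  by apply: archi_boundP; rewrite invr_ge0 ltW.
have [u hu] := h m; exists (f (box_point u)); split.
  by exists (box_point u) => //; exact: box_pointP.
apply: hr; split => // i j; rewrite (ord1 i) /ball /= distrC.
exact: le_lt_trans (hu j) hm.
Qed.

End box_paths.

(** The level from which words of length L come close to z depends on the path, so hitting is
    contained only in a lower limit of the events of [box_hitting]. That lower limit is an
    increasing union, which keeps the uniform bound. *)
Lemma measure_liminf_le d (T : measurableType d) (R : realType) (P : probability T R)
    (E : (set T)^nat) (e : R) N : (forall n, measurable (E n)) ->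
  (forall n, (N <= n)%N -> (P (E n) <= e%:E)%E) ->
  (P [set w | exists n, forall L, (n <= L)%N -> E L w] <= e%:E)%E.
Proof.
move=> mE hE; pose G n := [set w | forall L, (n <= L)%N -> E L w].
have mG n : measurable (G n).
  by apply: measurable_forall => L; exact: measurable_implies.
have -> : [set w | exists n, forall L, (n <= L)%N -> E L w] = \bigcup_n G n.
  by apply/seteqP; split => w /= [n]; [exists n|exists n].
have mU : measurable (\bigcup_n G n) by exact: bigcup_measurable.
have ndG : nondecreasing_seq G.
  by move=> m n mn; apply/subsetPset => w h L nL; apply: h; exact: leq_trans nL.
have cv := nondecreasing_cvg_mu mG mU ndG (mu := P).
rewrite -(cvg_lim (@ereal_hausdorff R) cv); apply: lime_le.
  by apply/cvg_ex; eexists; exact: cv.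
apply: nearW => n /=; apply: (@le_trans _ _ (P (E (maxn n N)))).
  apply: le_measure; rewrite ?inE// => w; apply; exact: leq_maxl.
by apply: hE; exact: leq_maxr.
Qed.

Section polar.
Context (R : realType) (disp : measure_display) (Omega : measurableType disp)
  (P : probability Omega R) (k d : nat) (beta : R).
Local Notation V := (R * 'rV[R]_k)%type.
Variables (W : 'I_d -> (V -> R) -> Omega -> R) (sigma : 'I_d -> V -> R)
  (v : R -> 'rV[R]_k -> Omega -> 'rV[R]_d).
Hypotheses (hk : (1 <= k)%N)
  (hbeta : 0 < beta < Num.min k%:R 2 \/ k = 1%N /\ beta = 1)
  (hsigma : forall j, continuous (sigma j))
  (hbound : forall j (S : R), 0 <= S -> exists c C : R,
     [/\ 0 < c, c < C & forall t x, 0 <= t <= S -> c <= sigma j (t, x) <= C])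
  (hW : gaussian_noise P beta W)
  (hv : mild_solution P beta W sigma v)
  (hcont : continuous_paths v)
  (hd : d%:R = (4 + 2 * k%:R) / (2 - beta)).

Definition box_hit (t0 : R) (x0 : 'rV[R]_k) (z : 'rV[R]_d) : set Omega :=
  [set w | exists2 p, box t0 x0 p & v p.1 p.2 w = z].

Lemma box_hit_null (t0 : R) (x0 : 'rV[R]_k) z : 0 < t0 ->
  measurable (box_hit t0 x0 z) /\ P (box_hit t0 x0 z) = 0%E.
Proof.
move=> t00; have mX j u : measurable_fun setT (@box_field R disp Omega k d v t0 x0 j u).
  have [_ m _] := box_wiener hbeta hsigma hbound hW hv hd x0 t00 j u; exact: m.
have mle j u c : measurable [set w | `|@box_field R disp Omega k d v t0 x0 j u w - z ord0 j| <= c].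
  apply: (measurable_le_cst (f := fun w => `|@box_field R disp Omega k d v t0 x0 j u w - z ord0 j|)).
  by apply: measurableT_comp => //; exact: measurable_funB.
have hitE : box_hit t0 x0 z = [set w | forall m : nat, exists u : seq (letter k), forall j : 'I_d,
    `|@box_field R disp Omega k d v t0 x0 j u w - z ord0 j| <= m.+1%:R^-1].
  by apply/seteqP; split => w /=; [move=> /(iffLR (box_hitP x0 t00 (@hcont w) z))|move=> h; apply/(box_hitP x0 t00 (@hcont w) z)].
have mhit : measurable (box_hit t0 x0 z).
  rewrite hitE; apply: measurable_forall => m; apply: measurable_exists => u.
  by apply: measurable_forall => j; exact: mle.
split => //; apply/eqP; rewrite eq_le measure_ge0 andbT.
apply/lee_addgt0Pr => e e0; rewrite add0e.
have [L0 [kap [kap0 hL]]] := box_hitting hk hbeta hsigma hbound hW hv hd x0 t00 (fun j => z ord0 j) e0.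
pose E L := [set w | exists u : L.-tuple (letter k), forall j,
  `|@box_field R disp Omega k d v t0 x0 j u w - z ord0 j| <= kap].
have mE L : measurable (E L).
  by apply: measurable_exists => u; apply: measurable_forall => j; exact: mle.
apply: le_trans (measure_liminf_le mE hL).
apply: le_measure; rewrite ?inE//.
  by apply: measurable_exists => n; apply: measurable_forall => L; exact: measurable_implies.
move=> w [p Bp pz] /=; have [n hn] := box_approx t00 (@hcont w) Bp kap0.
exists n => L nL; have [u su hu] := hn L nL.
have su' : size u == L by apply/eqP.
by exists (Tuple su') => j; rewrite -pz; exact: hu.
Qed.

Lemma hit_null : points_polar P v.
Proof.
move=> z /=.
pose I := (nat * nat * {ffun 'I_k -> int})%type.
(* Unit boxes with integer spatial corners cover space. Adding the inverse of [n.+1] keeps starting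
   times positive while reaching arbitrarily small ones. *)
pose t_ (i : I) : R := i.1.1%:R + i.1.2.+1%:R^-1.
pose x_ (i : I) : 'rV[R]_k := \row_j (i.2 j)%:~R.
have t_gt0 i : 0 < t_ i by rewrite ltr_wpDl// invr_gt0.
have hE : [set w | exists t x, 0 < t /\ v t x w = z] = [set w | exists i : I, box_hit (t_ i) (x_ i) z w].
  apply/seteqP; split => w /=; last first.
    move=> [i [[t x] [/= /andP[h1 _] _] e]]; exists t, x; split => //.
    exact: lt_le_trans (t_gt0 i) h1.
  move=> [t [x [tpos e]]].
  pose n := Num.bound t^-1.
  have hn : n.+1%:R^-1 <= t.
    rewrite -[leRHS]invrK lef_pV2 ?posrE ?invr_gt0//.
    apply/ltW/(@lt_trans _ _ n%:R); last by rewrite ltr_nat.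
    by apply: archi_boundP; rewrite invr_ge0 ltW.
  pose m := Num.truncn (t - n.+1%:R^-1).
  have /andP[m1 m2] : m%:R <= t - n.+1%:R^-1 < m.+1%:R by apply: truncn_itv; rewrite subr_ge0.
  exists (m, n, [ffun j => Num.floor (x ord0 j)]), (t, x) => //; split => /=.
    rewrite /t_ /=; move: m1 m2; rewrite -[m.+1%:R]natr1.
    by move: (m%:R) (n.+1%:R^-1) => y1 y2 ? ?; apply/andP; split; lra.
  move=> j; rewrite mxE ffunE; have /andP[h1 h2] := floor_itv (x ord0 j).
  by rewrite h1 /=; rewrite intrD1 in h2; exact: ltW.
have mI i : measurable (box_hit (t_ i) (x_ i) z) by have [] := box_hit_null (x_ i) z (t_gt0 i).
rewrite hE; split; first exact: measurable_exists.
pose F n := if unpickle n is Some i then box_hit (t_ i) (x_ i) z else set0.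
have -> : [set w | exists i : I, box_hit (t_ i) (x_ i) z w] = \bigcup_n F n.
  apply/seteqP; split => w /=.
    by move=> [i hi]; exists (pickle i) => //; rewrite /F pickleK.
  by move=> [n _]; rewrite /F; case: (unpickle n) => // i hi; exists i.
have mF n : measurable (F n) by rewrite /F; case: (unpickle n).
apply/negligibleP; first exact: bigcup_measurable.
apply: negligible_bigcup => n; apply/negligibleP => //.
rewrite /F; case: (unpickle n) => [i|]; last exact: measure0.
by have [] := box_hit_null (x_ i) z (t_gt0 i).
Qed.

End polar.

Theorem theorem7p2 (R : realType) (disp : measure_display)
  (Omega : measurableType disp) (P : probability Omega R)
  (k d : nat) (beta : R)
  (W : 'I_d -> (R * 'rV[R]_k -> R) -> Omega -> R)
  (sigma : 'I_d -> R * 'rV[R]_k -> R)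
  (v : R -> 'rV[R]_k -> Omega -> 'rV[R]_d)
  (mu : 'I_d -> complex_measure (measurableTypeR R * 'rV[R]_k)%type R)
  (hk : (1 <= k)%N)
  (hbeta : 0 < beta < Num.min k%:R 2 \/ k = 1%N /\ beta = 1)
  (hsigma : forall j, continuous (sigma j))
  (hbound : forall j (S : R), 0 <= S -> exists c C : R,
     [/\ 0 < c, c < C & forall t x, 0 <= t <= S -> c <= sigma j (t, x) <= C])
  (hW : gaussian_noise P beta W)
  (hv : mild_solution P beta W sigma v)
  (hcont : continuous_paths v)
  (hd : d%:R = (4 + 2 * k%:R) / (2 - beta))
  (ha : forall j, is_fourier_transform (sigma j) (mu j) /\
     (complex_variation (mu j) setT < +oo)%E)
  (hb : forall j, exists c : R, \forall a \near +oo,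
     (\int[complex_variation (mu j)]_q
       \int[lebesgue_measure \x lebesgue_rV k]_(p in D1 beta a)
         (enorm p.2 `^ (beta - k%:R) *
          (enorm (p.2 - q.2) ^+ 2 /
           (enorm (p.2 - q.2) ^+ 4 + `|p.1 - q.1| ^+ 2)))%:E
      <= (c * a `^ (2 * gamma2 beta))%:E)%E)
  (hc : forall j, exists c : R, \forall b \near +oo,
     (\int[complex_variation (mu j)]_q
       \int[lebesgue_measure \x lebesgue_rV k]_(p in D2 beta b)
         (enorm p.2 `^ (beta - k%:R) /
          (enorm (p.2 - q.2) ^+ 4 + `|p.1 - q.1| ^+ 2))%:E
      <= (c * b ^- 2)%:E)%E) :
  points_polar P v.
Proof. exact: (hit_null hk hbeta hsigma hbound hW hv hcont hd). Qed.
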